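(* Let $M$ and $A$ be weight sequences satisfying $(M.1)$ and $(M.2)'$, and let $E$ be a TMIB of class $[M]-[A]$ satisfying condition (G). Then, for a given $f \in \mathcal{S}'^{[M]}_{[A]}(\mathbb{R}^d)$, we have $f * \varphi \in E$ for every $\varphi \in \mathcal{S}^{[M]}_{[A]}(\mathbb{R}^d)$ if and only if there exist $f_\alpha \in E$, $\alpha \in \mathbb{N}^d$, such that $f = \sum_{\alpha \in \mathbb{N}^d} f_\alpha^{(\alpha)}$ (convergence in $\mathcal{S}'^{[M]}_{[A]}$) and, for some $\ell>0$ in the Beurling case (for every $\ell>0$ in the Roumieu case), $\sup_{\alpha \in \mathbb{N}^d} \ell^{|\alpha|} M_\alpha \|f_\alpha\|_E < \infty$.
   Context: A weight sequence is a sequence $M=(M_p)_{p\in\mathbb{N}}$ of positive reals with $(M_p/M_0)^{1/p}\to\infty$. Conditions: $(M.1)$ $M_p^2\le M_{p-1}M_{p+1}$ for $p\ge1$; $(M.2)'$ $M_{p+1}\le C_0H^pM_p$ for some $C_0,H\ge1$. For $\alpha\in\mathbb{N}^d$ write $M_\alpha=M_{|\alpha|}$. The associated function is $\omega_M(t)=\sup_{p\in\mathbb{N}}\log(t^pM_0/M_p)$ for $t>0$, $\omega_M(0)=0$, extended radially to $\mathbb{R}^d$ by $\omega_M(x)=\omega_M(|x|)$. For $q,\ell>0$, $\mathcal{S}^{M,\ell}_{A,q}$ is the Banach space of $\varphi\in C^\infty(\mathbb{R}^d)$ with $\sup_{\alpha\in\mathbb{N}^d,x\in\mathbb{R}^d}|\varphi^{(\alpha)}(x)|e^{\omega_A(qx)}/(\ell^{|\alpha|}M_\alpha)<\infty$.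 The Gelfand–Shilov spaces are $\mathcal{S}^{(M)}_{(A)}=\varprojlim_{\ell\to0^+}\mathcal{S}^{M,\ell}_{A,1/\ell}$ (Beurling) and $\mathcal{S}^{\{M\}}_{\{A\}}=\varinjlim_{\ell\to\infty}\mathcal{S}^{M,\ell}_{A,1/\ell}$ (Roumieu); $[M]$, $[A]$ denotes either case, and statements in parentheses refer to the Roumieu case. $\mathcal{S}'^{[M]}_{[A]}$ is the strong dual (tempered ultradistributions). It is assumed $\mathcal{S}^{(M)}_{(A)}\neq\{0\}$. Operators: $T_xf(t)=f(t-x)$, $M_\xi f(t)=e^{2\pi i\xi\cdot t}f(t)$, $\check f(t)=f(-t)$, extended to $\mathcal{S}'^{[M]}_{[A]}$ by duality; for $f\in\mathcal{S}'^{[M]}_{[A]}$, $\psi\in\mathcal{S}^{[M]}_{[A]}$, $\langle f*\psi,\varphi\rangle=\langle f,\varphi*\check\psi\rangle$. A Banach space $E$ is a TMIB (translation-modulation invariant Banach space of ultradistributions) of class $[M]-[A]$ if: (a) $\mathcal{S}^{[M]}_{[A]}\hookrightarrow E\hookrightarrow\mathcal{S}'^{[M]}_{[A]}$ continuously and densely; (b) $T_x(E)\subseteq E$, $M_\xi(E)\subseteq E$ for all $x,\xi$; (c) there exist $q,C_{E,q}>0$ (for every $q>0$ there exists $C_{E,q}>0$) with $\omega_E(x):=\|T_x\|_{L(E)}\le C_{E,q}e^{\omega_A(qx)}$ and $\nu_E(\xi):=\|M_{-\xi}\|_{L(E)}\le C_{E,q}e^{\omega_M(q\xi)}$ for all $x,\xi\in\mathbb{R}^d$.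 Condition (G): for every $q_0>0$ there is $q_1>0$ (for every $q_1>0$ there is $q_0>0$) and $C>0$ such that $\nu_E(\xi)e^{\omega_M(q_0\xi)}\le Ce^{\omega_M(q_1\xi)}$ for all $\xi\in\mathbb{R}^d$. *)

(* Defs.v *)
From HB Require Import structures.
From mathcomp Require Import all_boot all_order all_algebra.
From mathcomp Require Import all_classical all_reals all_analysis.
From mathcomp Require Export complex.
Set Implicit Arguments. Unset Strict Implicit. Unset Printing Implicit Defensive.
Import Order.TTheory GRing.Theory Num.Theory.
Import numFieldNormedType.Exports.
Local Open Scope classical_set_scope.
Local Open Scope ring_scope.

Section GelfandShilov.
Variables (R : realType) (d : nat).

Definition pt := 'rV[R]_d.
Definition testfun := pt -> R[i].
Definition functional := testfun -> R[i].
Definition mindex := {ffun 'I_d -> nat}.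
Definition mabs (a : mindex) : nat := (\sum_(i < d) a i)%N.

Definition cRe (z : R[i]) : R := complex.Re z.
Definition cIm (z : R[i]) : R := complex.Im z.

Definition cnorm (z : R[i]) : R := Num.sqrt (cRe z ^+ 2 + cIm z ^+ 2).

Definition eucl (x : pt) : R := Num.sqrt (\sum_(i < d) x ord0 i ^+ 2).
Definition dotp (x y : pt) : R := \sum_(i < d) x ord0 i * y ord0 i.

Definition weight_seq (M : nat -> R) : Prop :=
  (forall p, 0 < M p) /\
  ((fun p : nat => (M p / M 0%N) `^ (p%:R^-1)) @ \oo --> +oo).
Definition cond_M1 (M : nat -> R) : Prop :=
  forall p : nat, (0 < p)%N -> M p ^+ 2 <= M p.-1 * M p.+1.
Definition cond_M2' (M : nat -> R) : Prop :=
  exists C0 H : R, 1 <= C0 /\ 1 <= H /\ forall p : nat, M p.+1 <= C0 * H ^+ p * M p.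

Definition omega (M : nat -> R) (t : R) : R :=
  if t <= 0 then 0 else
  fine (ereal_sup (range (fun p : nat => (ln (t ^+ p * M 0%N / M p))%:E))).

Definition evec (j : 'I_d) : pt := \row_(k < d) (if k == j then 1 else 0).
Definition pderiv (j : 'I_d) (phi : testfun) : testfun :=
  fun x => (('D_(evec j) (fun y => cRe (phi y)) x) +i* ('D_(evec j) (fun y => cIm (phi y)) x))%C.
Definition dmult (a : mindex) (phi : testfun) : testfun :=
  foldr (fun j psi => iter (a j) (pderiv j) psi) phi (enum 'I_d).
Definition smooth (phi : testfun) : Prop :=
  forall s : seq 'I_d, let psi := foldr pderiv phi s in
    continuous (fun y => cRe (psi y)) /\ continuous (fun y => cIm (psi y)) /\
    forall (j : 'I_d) (x : pt),
      derivable (fun y => cRe (psi y)) x (evec j) /\ derivable (fun y => cIm (psi y)) x (evec j).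

Definition gsnorm (M A : nat -> R) (l q : R) (phi : testfun) : \bar R :=
  ereal_sup [set y | exists (a : mindex) (x : pt),
    y = (cnorm (dmult a phi x) * expR (omega A (q * eucl x))
          / (l ^+ mabs a * M (mabs a)))%:E].
Definition inSl (M A : nat -> R) (l : R) (phi : testfun) : Prop :=
  smooth phi /\ (gsnorm M A l l^-1 phi < +oo)%E.
(* beur = true: Beurling S^{(M)}_{(A)}; beur = false: Roumieu S^{{M}}_{{A}} *)
Definition GS (beur : bool) (M A : nat -> R) (phi : testfun) : Prop :=
  if beur then forall l : R, 0 < l -> inSl M A l phi
  else exists l : R, 0 < l /\ inSl M A l phi.

Section Space.
Variables (beur : bool) (M A : nat -> R).
Local Notation S := (GS beur M A).

(* equality of functionals as elements of the dual (agreement on test functions) *)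
Definition eqS (T1 T2 : functional) : Prop := forall phi, S phi -> T1 phi = T2 phi.

(* tempered ultradistributions: continuous linear functionals on S
   (Frechet space = projective limit in the Beurling case,
    (LB)-space = inductive limit in the Roumieu case) *)
Definition ultradist (T : functional) : Prop :=
  (forall (a : R[i]) phi psi, S phi -> S psi ->
     T (fun x => a * phi x + psi x) = a * T phi + T psi) /\
  (if beur then exists l C : R, 0 < l /\ forall phi, S phi ->
       ((cnorm (T phi))%:E <= C%:E * gsnorm M A l l^-1 phi)%E
   else forall l : R, 0 < l -> exists C : R, forall phi, inSl M A l phi ->
       ((cnorm (T phi))%:E <= C%:E * gsnorm M A l l^-1 phi)%E).

(* absolutely convex 0-neighbourhoods of the locally convex topology of S *)
Definition nbhs0S (U : set testfun) : Prop :=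
  (forall phi, U phi -> S phi) /\
  (forall (a b : R[i]) phi psi, U phi -> U psi -> cnorm a + cnorm b <= 1 ->
     U (fun x => a * phi x + b * psi x)) /\
  (if beur then exists l r : R, 0 < l /\ 0 < r /\
       forall phi, S phi -> (gsnorm M A l l^-1 phi < r%:E)%E -> U phi
   else forall l : R, 0 < l -> exists r : R, 0 < r /\
       forall phi, inSl M A l phi -> (gsnorm M A l l^-1 phi < r%:E)%E -> U phi).

Definition boundedS (B : set testfun) : Prop :=
  (forall phi, B phi -> S phi) /\
  forall U, nbhs0S U -> exists lam : R, 0 < lam /\
     forall phi, B phi -> U (fun x => (lam^-1)%:C%C * phi x).

Definition dderiv (a : mindex) (T : functional) : functional :=
  fun phi => (-1) ^+ mabs a * T (dmult a phi).

(* unconditional convergence of sum_a F a to T in the strong dual topology *)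
Definition sum_cvgS (F : mindex -> functional) (T : functional) : Prop :=
  forall B, boundedS B -> forall eps : R, 0 < eps ->
  exists F0 : seq mindex, forall Fs : seq mindex, uniq Fs -> {subset F0 <= Fs} ->
    forall phi, B phi -> cnorm (\sum_(a <- Fs) F a phi - T phi) <= eps.
End Space.

Definition upd (x : pt) (j : 'I_d) (t : R) : pt :=
  \row_(k < d) (if k == j then t else x ord0 k).
Definition Rint (f : R -> R) : R := Rintegral lebesgue_measure setT f.
Definition int1 (j : 'I_d) (g : testfun) : testfun :=
  fun x => (Rint (fun t => cRe (g (upd x j t))) +i* Rint (fun t => cIm (g (upd x j t))))%C.
Definition integ (g : testfun) : R[i] := foldr int1 g (enum 'I_d) 0.

Definition conv (phi psi : testfun) : testfun := fun x => integ (fun y => phi (x - y) * psi y).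
Definition check (phi : testfun) : testfun := fun t => phi (- t).
Definition transl (x : pt) (phi : testfun) : testfun := fun t => phi (t - x).
Definition expi (th : R) : R[i] := (cos th +i* sin th)%C.
Definition modul (xi : pt) (phi : testfun) : testfun :=
  fun t => expi (2 * pi * dotp xi t) * phi t.

Definition pairing (phi : testfun) : functional := fun psi => integ (fun x => phi x * psi x).
Definition convD (T : functional) (psi : testfun) : functional :=
  fun phi => T (conv phi (check psi)).
Definition translD (x : pt) (T : functional) : functional := fun phi => T (transl (- x) phi).
Definition modD (xi : pt) (T : functional) : functional := fun phi => T (modul xi phi).

Section TMIB.
Variables (beur : bool) (M A : nat -> R).
Variables (E : lmodType R[i]) (nE : E -> R) (iota : E -> functional).
Local Notation S := (GS beur M A).
Local Notation eqS := (eqS beur M A).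

(* operator norm on E of an operator on S' leaving E invariant *)
Definition opnormE (Op : functional -> functional) : \bar R :=
  ereal_sup [set y | exists e e' : E, nE e <= 1 /\ eqS (iota e') (Op (iota e)) /\
                                      y = (nE e')%:E].
Definition omegaE (x : pt) : \bar R := opnormE (translD x).
Definition nuE (xi : pt) : \bar R := opnormE (modD (- xi)).

Definition is_TMIB : Prop :=
  [/\ (forall e, 0 <= nE e), (forall e, nE e = 0 -> e = 0),
      (forall (a : R[i]) e, nE (a *: e) = cnorm a * nE e),
      (forall e1 e2, nE (e1 + e2) <= nE e1 + nE e2) &
      (forall u : nat -> E,
         (forall eps : R, 0 < eps -> exists N, forall m n, (N <= m)%N -> (N <= n)%N ->
            nE (u m - u n) < eps) ->
         exists l, forall eps : R, 0 < eps -> exists N, forall n, (N <= n)%N ->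
            nE (u n - l) < eps)] /\
  (forall (a : R[i]) e1 e2, eqS (iota (a *: e1 + e2)) (fun phi => a * iota e1 phi + iota e2 phi)) /\
  (forall e, ultradist beur M A (iota e)) /\
  (forall e1 e2, eqS (iota e1) (iota e2) -> e1 = e2) /\
  (forall B, boundedS beur M A B -> exists C : R, forall e phi, B phi ->
      cnorm (iota e phi) <= C * nE e) /\
  (forall T, ultradist beur M A T -> forall B, boundedS beur M A B ->
      forall eps : R, 0 < eps -> exists e, forall phi, B phi -> cnorm (T phi - iota e phi) <= eps) /\
  (forall phi, S phi -> exists e, eqS (iota e) (pairing phi)) /\
  (if beur then exists l C : R, 0 < l /\ forall phi e, S phi -> eqS (iota e) (pairing phi) ->
       ((nE e)%:E <= C%:E * gsnorm M A l l^-1 phi)%E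
   else forall l : R, 0 < l -> exists C : R, forall phi e, inSl M A l phi ->
       eqS (iota e) (pairing phi) -> ((nE e)%:E <= C%:E * gsnorm M A l l^-1 phi)%E) /\
  (forall e (eps : R), 0 < eps -> exists phi e', S phi /\ eqS (iota e') (pairing phi) /\
      nE (e - e') < eps) /\
  (forall x e, exists e', eqS (iota e') (translD x (iota e))) /\
  (forall xi e, exists e', eqS (iota e') (modD xi (iota e))) /\
  (if beur then exists q C : R, 0 < q /\ 0 < C /\
       (forall x, (omegaE x <= (C * expR (omega A (q * eucl x)))%:E)%E) /\
       (forall xi, (nuE xi <= (C * expR (omega M (q * eucl xi)))%:E)%E)
   else forall q : R, 0 < q -> exists C : R, 0 < C /\
       (forall x, (omegaE x <= (C * expR (omega A (q * eucl x)))%:E)%E) /\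
       (forall xi, (nuE xi <= (C * expR (omega M (q * eucl xi)))%:E)%E)).

Definition condG : Prop :=
  if beur then forall q0 : R, 0 < q0 -> exists q1 C : R, 0 < q1 /\ 0 < C /\
       forall xi, (nuE xi * (expR (omega M (q0 * eucl xi)))%:E
                   <= (C * expR (omega M (q1 * eucl xi)))%:E)%E
  else forall q1 : R, 0 < q1 -> exists q0 C : R, 0 < q0 /\ 0 < C /\
       forall xi, (nuE xi * (expR (omega M (q0 * eucl xi)))%:E
                   <= (C * expR (omega M (q1 * eucl xi)))%:E)%E.
End TMIB.
End GelfandShilov.

(* Main.v *)
Require Import Defs.
From HB Require Import structures.
From mathcomp Require Import all_boot all_order all_algebra.
From mathcomp Require Import all_classical all_reals all_analysis.
From mathcomp Require Import measurable_realfun complex ring lra zify.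
Set Implicit Arguments. Unset Strict Implicit. Unset Printing Implicit Defensive.
Import Order.TTheory GRing.Theory Num.Theory.
Import numFieldNormedType.Exports.
Local Open Scope classical_set_scope.
Local Open Scope ring_scope.
Local Open Scope complex_scope.

(** Fix a window zeta = chi1 * chi2 in the Beurling space with zeta(0) = 1. As the translations of E
    have norms bounded by exp(omega_A), for a large mesh L the operator P e = sum_z zeta(L z) e(. + L z)
    over z in Z^d is a small perturbation of the identity of E, hence invertible. Poisson
    summation, in a form averaged by Fejer kernels that avoids Fourier transforms, reads
    L^d <P e, phi> = sum_k <e, phi * M_(k/L) zeta>.

    Moving a modulation onto e costs nu_E(k/L), and integrating by parts up to the order at which
    omega_M(q |k|) is attained, condition (G) turns the Poisson formula for e = P e' into
    |<e, phi^(a)>| <= C ell^|a| M_a ||e||, although M is not assumed to satisfy (M.2). So the series of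
    the f_a^(a) converges, and f * phi = sum_a f_a * phi^(a) converges absolutely in E.

    Conversely, if f * phi always lies in E, the closed graph theorem bounds f * M_(k/L) chi in E by
    exp(omega_M(q |k|)). The identity (2 i pi k_j / L)^p M_(k/L) chi = sum of derivatives of M_(k/L) times
    derivatives of chi writes f * M_(k/L) zeta as a finite sum of derivatives of elements of E; p is
    chosen where omega_M is attained. Summing over k gives elements G_a of E, and f_a = L^(-d) P^(-1) G_a
    (up to the sign (-1)^|a|). The sum of the f_a^(a) is f because both have the same image under P after
    convolution with any test function. *)

(** * Complex numbers and one-variable calculus *)

(** Rather than an infinite order differential operator, for which (M.2) would be the natural
    hypothesis, each frequency k/L gets its own finite order p of integration by parts, tied to an
    index at which a supremum defining omega_M is attained. When p is chosen for the coefficients in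
    the Roumieu case, the scale at which omega_M is evaluated tends to 0 slowly as k grows, because
    the estimates at the various scales have unrelated constants.

    The window has to be a convolution: chi1 receives the derivatives, while the fixed chi2 is what
    a vector of E is finally paired with, so that a norm in E controls a number.

    Integrals are handled as limits of finite sums, at rates uniform over classes of functions
    described by one constant. The same sums act on vectors of E, so that no vector-valued integral
    is formed, and smoothness, associativity and Poisson summation all come from identities between
    finite sums.

    Continuity estimates hold for some scale in the Beurling case and for all scales in the Roumieu
    case; membership in S is the other way round. [QQ beur] and [QQ (~~ beur)] express the two, and
    one argument covers both cases. *)

Section Cnorm.
Variable R : realType.
Implicit Types z w : R[i].
Lemma cnE z : cnorm z = Normc.normc z. Proof. by case: z. Qed.
Lemma cn_ge0 z : 0 <= cnorm z. Proof. exact: sqrtr_ge0. Qed.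
Lemma cn0 : cnorm (0 : R[i]) = 0. Proof. by rewrite cnE Normc.normc0. Qed.
Lemma cn1 : cnorm (1 : R[i]) = 1. Proof. by rewrite cnE Normc.normc1. Qed.
Lemma cn_eq0 z : cnorm z = 0 -> z = 0. Proof. by rewrite cnE => /Normc.eq0_normc. Qed.

Lemma cnM z w : cnorm (z * w) = cnorm z * cnorm w.
Proof. by rewrite !cnE Normc.normcM. Qed.

Lemma cnV z : cnorm z^-1 = (cnorm z)^-1.
Proof. by rewrite !cnE Normc.normcV. Qed.

Lemma cnD z w : cnorm (z + w) <= cnorm z + cnorm w.
Proof. by rewrite !cnE; exact: le_normcD. Qed.

Lemma cnN z : cnorm (- z) = cnorm z.
Proof. by case: z => a b; rewrite /cnorm /= !sqrrN. Qed.

Lemma cnB z w : cnorm (z - w) <= cnorm z + cnorm w.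
Proof. by rewrite -(cnN w) cnD. Qed.

Lemma cnBC z w : cnorm (z - w) = cnorm (w - z).
Proof. by rewrite -cnN opprB. Qed.

Lemma cn_tri z u w : cnorm (z - w) <= cnorm (z - u) + cnorm (u - w).
Proof. by rewrite (_ : z - w = (z - u) + (u - w)) ?cnD // addrA subrK. Qed.

Lemma cnX z n : cnorm (z ^+ n) = cnorm z ^+ n.
Proof. by elim: n => [|n IH]; rewrite ?expr0 ?cn1 // !exprS cnM IH. Qed.

Lemma cnR (r : R) : cnorm (r%:C) = `|r|.
Proof. by rewrite /cnorm /= expr0n addr0 sqrtr_sqr. Qed.

Lemma cnRe z : `|cRe z| <= cnorm z.
Proof. by rewrite /cnorm -sqrtr_sqr ler_wsqrtr // lerDl sqr_ge0. Qed.

Lemma cnIm z : `|cIm z| <= cnorm z.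
Proof. by rewrite /cnorm -sqrtr_sqr ler_wsqrtr // lerDr sqr_ge0. Qed.

Lemma cn_le z : cnorm z <= `|cRe z| + `|cIm z|.
Proof.
rewrite /cnorm -[leRHS]ger0_norm ?addr_ge0 // -sqrtr_sqr ler_wsqrtr //.
rewrite sqrrD !real_normK ?num_real // -addrA lerD2l lerDr.
by rewrite mulrn_wge0 // mulr_ge0.
Qed.

Lemma cn_sum (I : Type) (r : seq I) (P : pred I) (F : I -> R[i]) :
  cnorm (\sum_(i <- r | P i) F i) <= \sum_(i <- r | P i) cnorm (F i).
Proof.
elim/big_ind2: _ => [|x a y b ha hb|//]; first by rewrite cn0.
by rewrite (le_trans (cnD _ _)) // lerD.
Qed.

Lemma cReD z w : cRe (z + w) = cRe z + cRe w. Proof. by case: z; case: w. Qed.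
Lemma cImD z w : cIm (z + w) = cIm z + cIm w. Proof. by case: z; case: w. Qed.
Lemma cReB z w : cRe (z - w) = cRe z - cRe w. Proof. by case: z; case: w. Qed.
Lemma cImB z w : cIm (z - w) = cIm z - cIm w. Proof. by case: z; case: w. Qed.

Lemma cReRM (r : R) w : cRe (r%:C * w) = r * cRe w.
Proof. by case: w => a b; rewrite /cRe /= mul0r subr0. Qed.

Lemma cImRM (r : R) w : cIm (r%:C * w) = r * cIm w.
Proof. by case: w => a b; rewrite /cIm /= mul0r addr0. Qed.

Lemma cReImE z : z = (cRe z) +i* (cIm z). Proof. by case: z. Qed.

Lemma cn_arb z : (forall e : R, 0 < e -> cnorm z <= e) -> z = 0.
Proof.
move=> H; apply: cn_eq0; apply/eqP; rewrite eq_le cn_ge0 andbT.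
by apply/ler_addgt0Pr => e e0; rewrite add0r H.
Qed.

End Cnorm.

Section Calculus1.
Variable R : realType.
Implicit Types (F G : R -> R[i]) (t : R) (z : R[i]).

(** Real differentiability of a complex-valued function, with a bound linear in [|h|] instead of a
    difference quotient: there is no puncture at [h = 0], and sums, products and limits need no
    splitting into real and imaginary parts. *)
Definition cder F t z := forall e : R, 0 < e -> exists2 dl : R, 0 < dl &
  forall h : R, `|h| < dl -> cnorm (F (t + h) - F t - h%:C * z) <= e * `|h|.

Definition ccont F t := forall e : R, 0 < e -> exists2 dl : R, 0 < dl &
  forall h : R, `|h| < dl -> cnorm (F (t + h) - F t) <= e.

Lemma cder_cont F t z : cder F t z -> ccont F t.
Proof.
move=> H e e0; have [dl dl0 Hd] := H 1 ltr01.
have K0 : 0 < 1 + cnorm z by rewrite ltr_pwDl ?cn_ge0.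
exists (Num.min dl (e / (1 + cnorm z))); first by rewrite lt_min dl0 divr_gt0.
move=> h; rewrite lt_min => /andP[h1 h2].
have -> : F (t + h) - F t = (F (t + h) - F t - h%:C * z) + h%:C * z by rewrite subrK.
rewrite (le_trans (cnD _ _)) // cnM cnR.
apply: (@le_trans _ _ (`|h| * (1 + cnorm z))).
  by rewrite mulrDr lerD2r (le_trans (Hd _ h1)) // mul1r mulr1.
by rewrite -ler_pdivlMr // ltW.
Qed.

Lemma cder_cst z t : cder (fun=> z) t 0.
Proof.
by move=> e e0; exists 1 => // h _; rewrite mulr0 !subrr cn0 mulr_ge0 // ltW.
Qed.

Lemma cderD F G t z w : cder F t z -> cder G t w -> cder (fun s => F s + G s) t (z + w).
Proof.
move=> HF HG e e0; have e20 : 0 < e / 2 by rewrite divr_gt0.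
have [d1 d10 H1] := HF _ e20; have [d2 d20 H2] := HG _ e20.
exists (Num.min d1 d2); first by rewrite lt_min d10.
move=> h; rewrite lt_min => /andP[h1 h2].
rewrite (_ : _ - _ = (F (t + h) - F t - h%:C * z) + (G (t + h) - G t - h%:C * w)); last by ring.
rewrite (le_trans (cnD _ _)) // (le_trans (lerD (H1 _ h1) (H2 _ h2))) //.
by rewrite -mulrDl -splitr.
Qed.

Lemma cderM F G t z w : cder F t z -> cder G t w ->
  cder (fun s => F s * G s) t (z * G t + F t * w).
Proof.
move=> HF HG e e0.
set K := 1 + cnorm (F t) + cnorm (G t) + cnorm z.
have ge := @cn_ge0 R.
have K0 : 0 < K by rewrite /K -!addrA ltr_pwDl // !addr_ge0.
have K1 : cnorm (F t) <= K by rewrite /K; have := ge (F t); have := ge (G t); have := ge z; lra.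
have K2 : cnorm (G t) + 1 <= K by rewrite /K; have := ge (F t); have := ge (G t); have := ge z; lra.
have K3 : cnorm z <= K by rewrite /K; have := ge (F t); have := ge (G t); have := ge z; lra.
set e' := e / (3 * K).
have e'0 : 0 < e' by rewrite divr_gt0 // mulr_gt0.
have [d1 d10 H1] := HF _ e'0; have [d2 d20 H2] := HG _ e'0.
have [d3 d30 H3] := cder_cont HG e'0.
have [d4 d40 H4] := cder_cont HG ltr01.
exists (Num.min (Num.min d1 d2) (Num.min d3 d4)); first by rewrite !lt_min d10 d20 d30 d40.
move=> h; rewrite !lt_min => /andP[/andP[h1 h2] /andP[h3 h4]].
rewrite (_ : _ - _ = (F (t + h) - F t - h%:C * z) * G (t+h) + F t * (G (t + h) - G t - h%:C * w)
  + h%:C * z * (G (t+h) - G t)); last by ring.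
have hG : cnorm (G (t + h)) <= K.
  rewrite -(subrK (G t) (G (t + h))) (le_trans (cnD _ _)) //.
  by rewrite (le_trans _ K2) // addrC lerD2l H4.
have -> : e * `|h| = e' * `|h| * K + K * (e' * `|h|) + `|h| * K * e'.
  by rewrite /e'; field; rewrite gt_eqF.
rewrite (le_trans (cnD _ _)) // lerD // ?(le_trans (cnD _ _)) ?lerD //.
- by rewrite cnM ler_pM ?H1.
- by rewrite cnM ler_pM ?H2.
- by rewrite !cnM cnR ler_pM ?mulr_ge0 ?H3 // ler_wpM2l.
Qed.

Lemma cderMl F c t z : cder F t z -> cder (fun s => c * F s) t (c * z).
Proof. by move=> /(cderM (cder_cst c t)); rewrite mul0r add0r. Qed.

Lemma derive_epsP (V : normedModType R) (f : V -> R) (x v : V) (l : R) :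
  (derivable f x v /\ 'D_v f x = l) <->
  (forall e : R, 0 < e -> exists2 dl : R, 0 < dl &
    forall h : R, `|h| < dl -> `|f (h *: v + x) - f x - h * l| <= e * `|h|).
Proof.
split=> [[df <-] e e0|H].
  have /cvgrPdist_le/(_ e e0) : h^-1 *: (f (h *: v + x) - f x) @[h --> 0^'] --> 'D_v f x by exact: df.
  rewrite near_withinE => /nbhs_ballP[dl dl0 Hd]; exists dl => // h hd.
  have [->|h0] := eqVneq h 0.
    by rewrite scale0r add0r mul0r !subrr normr0 mulr0.
  have : `|'D_v f x - h^-1 *: (f (h *: v + x) - f x)| <= e.
    by apply: Hd => //; rewrite /ball /= sub0r normrN.
  rewrite -(ler_pM2l (_ : 0 < `|h|)) ?normr_gt0 // -normrM mulrBr [h * (_ *: _)]mulVKf //.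
  by rewrite distrC [_ * e]mulrC.
have cv : h^-1 *: (f (h *: v + x) - f x) @[h --> 0^'] --> l.
  apply/cvgrPdist_le => e e0; have [dl dl0 Hd] := H _ e0.
  rewrite near_withinE; apply/nbhs_ballP; exists dl => // h.
  rewrite /ball /= sub0r normrN => hd h0.
  rewrite -(ler_pM2l (_ : 0 < `|h|)) ?normr_gt0 // -normrM mulrBr mulVKf //.
  by rewrite distrC (le_trans (Hd _ hd)) // mulrC.
split; first by apply/cvg_ex; exists l.
exact: (cvg_lim _ cv).
Qed.

Lemma cder_is_derive F t z : cder F t z ->
  is_derive t 1 (fun s => cRe (F s)) (cRe z) /\ is_derive t 1 (fun s => cIm (F s)) (cIm z).
Proof.
move=> H; split.
  have [] := (derive_epsP (fun s : R => cRe (F s)) t 1 (cRe z)).2.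
    move=> e e0; have [dl dl0 Hd] := H e e0; exists dl => // h hd.
    rewrite -cReRM -!cReB (le_trans (cnRe _)) //.
    by rewrite [h *: _]mulr1 [h + t]addrC Hd.
  by move=> df <-; exact/derivableP.
have [] := (derive_epsP (fun s : R => cIm (F s)) t 1 (cIm z)).2.
  move=> e e0; have [dl dl0 Hd] := H e e0; exists dl => // h hd.
  rewrite -cImRM -!cImB (le_trans (cnIm _)) //.
  by rewrite [h *: _]mulr1 [h + t]addrC Hd.
by move=> df <-; exact/derivableP.
Qed.

(** The mean value theorem fails for complex values, so it is applied to the real and to the
    imaginary part; hence the factor 2, which reappears in [schwarz_step] and [cls_pdr]. *)
Lemma cn_MVT F G (a b C : R) : (forall t, cder F t (G t)) ->
  (forall t, Num.min a b <= t <= Num.max a b -> cnorm (G t) <= C) ->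
  cnorm (F b - F a) <= 2 * C * `|b - a|.
Proof.
wlog ab : a b / a <= b => [hw dF hG|].
  have [ab|/ltW ba] := leP a b; first exact: hw.
  by rewrite cnBC distrC; apply: hw => // t; rewrite minC maxC; exact: hG.
rewrite (min_idPl ab) (max_idPr ab) => dF hG.
rewrite (le_trans (cn_le _)) // -mulrA mulr_natl mulr2n.
have [c1 c1i e1] : exists2 c, c \in `[a, b]%R & cRe (F b) - cRe (F a) = cRe (G c) * (b - a).
  apply: (@MVT_segment R (fun s => cRe (F s)) (fun s => cRe (G s))) => //.
    by move=> x _; have [] := cder_is_derive (dF x).
  apply: derivable_within_continuous => x _.
  by have [[]] := cder_is_derive (dF x).
have [c2 c2i e2] : exists2 c, c \in `[a, b]%R & cIm (F b) - cIm (F a) = cIm (G c) * (b - a).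
  apply: (@MVT_segment R (fun s => cIm (F s)) (fun s => cIm (G s))) => //.
    by move=> x _; have [] := cder_is_derive (dF x).
  apply: derivable_within_continuous => x _.
  by have [_ []] := cder_is_derive (dF x).
rewrite cReB cImB e1 e2 !normrM lerD // ler_wpM2r //.
  by rewrite (le_trans (cnRe _)) // hG //; move: c1i; rewrite in_itv.
by rewrite (le_trans (cnIm _)) // hG //; move: c2i; rewrite in_itv.
Qed.

Lemma cder_lim (Fn Gn : nat -> R -> R[i]) F G t :
  (forall n s, cder (Fn n) s (Gn n s)) ->
  (forall s e, 0 < e -> exists N, forall n, (N <= n)%N -> cnorm (Fn n s - F s) <= e) ->
  (forall e, 0 < e -> exists N, forall n, (N <= n)%N -> forall s, cnorm (Gn n s - G s) <= e) ->
  cder F t (G t).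
Proof.
move=> dF cF cG e e0.
have e60 : 0 < e / 6 by rewrite divr_gt0.
have e30 : 0 < e / 6 by [].
have [N HN] := cG _ e60.
have e80 : 0 < e / 6 / 2 by rewrite divr_gt0.
have diff m s : (N <= m)%N -> cnorm (Gn m s - Gn N s) <= e / 6 + e / 6.
  move=> Nm; rewrite (le_trans (cn_tri _ (G s) _)) // lerD ?HN //.
  by rewrite cnBC HN.
(* The mean value estimate makes [Fn m - Fn N] Lipschitz with a small constant. Letting m grow at
   the two points t and t + h only gives the same for [F - Fn N], with N independent of h. *)
have lip h : cnorm ((F (t + h) - Fn N (t + h)) - (F t - Fn N t)) <= 4 * (e / 6) * `|h|.
  apply/ler_addgt0Pr => d d0.
  have d20 : 0 < d / 2 by rewrite divr_gt0.
  have [N1 H1] := cF (t + h) _ d20; have [N2 H2] := cF t _ d20.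
  set m := maxn N (maxn N1 N2).
  have : cnorm ((Fn m (t + h) - Fn N (t + h)) - (Fn m t - Fn N t)) <= 2 * (e / 6 + e / 6) * `|t + h - t|.
    apply: (@cn_MVT (fun s => Fn m s - Fn N s) (fun s => Gn m s - Gn N s)).
      move=> s; have := cderD (dF m s) (cderMl (-1) (dF N s)).
      by rewrite mulN1r; under eq_fun do rewrite mulN1r.
    by move=> s _; apply: diff; rewrite leq_maxl.
  rewrite [t + h]addrC addrK [h + t]addrC => H3.
  rewrite (_ : _ - _ = - (Fn m (t + h) - F (t + h)) + (Fn m t - F t) +
     ((Fn m (t + h) - Fn N (t + h)) - (Fn m t - Fn N t))); last by ring.
  rewrite addrC (le_trans (cnD _ _)) // [leRHS](_ : _ = 2 * (e / 6 + e / 6) * `|h| + d); last by field.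
  rewrite lerD // (le_trans (cnD _ _)) // cnN [leRHS]splitr lerD //.
    by rewrite H1 // leq_max leq_max leqnn /= orbT.
  by rewrite H2 // leq_max leq_max leqnn /= !orbT.
have [dl dl0 Hd] := dF N t _ e60.
exists dl => // h hd.
rewrite (_ : _ - _ = ((F (t + h) - Fn N (t + h)) - (F t - Fn N t)) + (Fn N (t + h) - Fn N t - h%:C * Gn N t) +
   h%:C * (Gn N t - G t)); last by ring.
rewrite (_ : e * `|h| = 4 * (e / 6) * `|h| + e / 6 * `|h| + `|h| * (e / 6)); last by field.
rewrite (le_trans (cnD _ _)) // lerD // ?(le_trans (cnD _ _)) ?lerD ?lip ?Hd //.
by rewrite cnM cnR ler_wpM2l // HN.
Qed.

Lemma cder_eq F G t z : (forall s, F s = G s) -> cder F t z -> cder G t z.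
Proof. by move=> /funext ->. Qed.

Lemma cder_comp_aff F (a b t : R) z : cder F (a * t + b) z ->
  cder (fun s => F (a * s + b)) t (a%:C * z).
Proof.
move=> H e e0.
have K0 : 0 < 1 + `|a| by rewrite ltr_pwDl.
have [dl dl0 Hd] := H (e / (1 + `|a|)) (divr_gt0 e0 K0).
exists (dl / (1 + `|a|)); first by rewrite divr_gt0.
move=> h; rewrite ltr_pdivlMr // => hd.
have ah : `|a * h| <= `|h| * (1 + `|a|) by rewrite normrM mulrC ler_wpM2l // lerDr.
have := Hd (a * h) (le_lt_trans ah hd).
rewrite (_ : a * (t + h) + b = a * t + b + a * h); last by ring.
rewrite (_ : h%:C * (a%:C * z) = (a * h)%:C * z); last by rewrite rmorphM /=; ring.
move=> /le_trans -> //.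
rewrite mulrAC ler_pdivrMr // -mulrA ler_wpM2l // ltW //.
Qed.

Lemma cder_parts F t (a b : R) : is_derive t 1 (fun s => cRe (F s)) a ->
  is_derive t 1 (fun s => cIm (F s)) b -> cder F t (a +i* b).
Proof.
move=> [d1 e1] [d2 e2] e e0; have e20 : 0 < e / 2 by rewrite divr_gt0.
have [dl1 p1 H1] := (derive_epsP (fun s : R => cRe (F s)) t 1 a).1 (conj d1 e1) _ e20.
have [dl2 p2 H2] := (derive_epsP (fun s : R => cIm (F s)) t 1 b).1 (conj d2 e2) _ e20.
exists (Num.min dl1 dl2); first by rewrite lt_min p1.
move=> h; rewrite lt_min => /andP[h1 h2].
rewrite (le_trans (cn_le _)) // (splitr e) mulrDl lerD //.
  by rewrite !cReB cReRM; move: (H1 _ h1); rewrite [h *: _]mulr1 [h + t]addrC.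
by rewrite !cImB cImRM; move: (H2 _ h2); rewrite [h *: _]mulr1 [h + t]addrC.
Qed.

Lemma cder_expi t (c : R) : cder (fun s => expi (c * s)) t ((0 +i* c) * expi (c * t)).
Proof.
have H s : cder (@expi R) s ((0 +i* 1) * expi s).
  have := @cder_parts (@expi R) s (- sin s) (cos s) (is_derive_cos s) (is_derive_sin s).
  by congr cder; rewrite /expi; apply/eqP; rewrite eq_complex /=; apply/andP; split; apply/eqP; ring.
have := @cder_comp_aff (@expi R) c 0 t _ (H _).
rewrite addr0; under eq_fun do rewrite addr0.
by congr cder; rewrite /expi; apply/eqP; rewrite eq_complex /=; apply/andP; split; apply/eqP; ring.
Qed.

End Calculus1.

(** * Smooth functions *)

Section Smooth.
Variables (R : realType) (d : nat).
Local Notation pt := (pt R d).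
Local Notation testfun := (testfun R d).
Implicit Types (phi psi : testfun) (x y : pt) (j : 'I_d) (s : seq 'I_d).
Local Notation evec := (@evec R d).
Definition pdr phi j x (z : R[i]) := cder (fun h => phi (x + h *: evec j)) 0 z.

Definition pcont phi := forall x (e : R), 0 < e -> exists2 dl : R, 0 < dl &
  forall y, (forall i, `|y ord0 i - x ord0 i| < dl) -> cnorm (phi y - phi x) <= e.

(** Derivatives are indexed by words in the coordinate directions, so that one more derivative is
    one more letter. [DD_perm] shows that only the multi-index [cnt s] matters, and [DD_dmult]
    returns to [dmult]. *)
Definition DD s phi : testfun := foldr (@pderiv R d) phi s.

Lemma pdrP phi j x (z : R[i]) : pdr phi j x z <->
  (derivable (fun y => cRe (phi y)) x (evec j) /\ 'D_(evec j) (fun y => cRe (phi y)) x = cRe z) /\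
  (derivable (fun y => cIm (phi y)) x (evec j) /\ 'D_(evec j) (fun y => cIm (phi y)) x = cIm z).
Proof.
rewrite (derive_epsP (fun y : pt => cRe (phi y))) (derive_epsP (fun y : pt => cIm (phi y))).
split=> [H|[H1 H2] e e0].
  split=> e e0; have [dl dl0 Hd] := H e e0; exists dl => // h hd; have := Hd h hd;
    rewrite scale0r addr0 add0r [h *: _ + x]addrC => /(le_trans _); apply.
    by rewrite -cReRM -!cReB cnRe.
  by rewrite -cImRM -!cImB cnIm.
have e20 : 0 < e / 2 by rewrite divr_gt0.
have [d1 p1 {}H1] := H1 _ e20; have [d2 p2 {}H2] := H2 _ e20.
exists (Num.min d1 d2); first by rewrite lt_min p1.
move=> h; rewrite lt_min => /andP[h1 h2]; rewrite scale0r addr0 add0r.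
rewrite (le_trans (cn_le _)) // (splitr e) mulrDl lerD //.
  by rewrite !cReB cReRM [x + _]addrC H1.
by rewrite !cImB cImRM [x + _]addrC H2.
Qed.

Lemma pdr_pderiv phi j x z : pdr phi j x z -> pderiv j phi x = z.
Proof. by move=> /pdrP[[_ e1] [_ e2]]; rewrite /pderiv e1 e2 -cReImE. Qed.

Lemma cont_epsP (f : 'rV[R]_d -> R) : continuous f <->
  forall x (e : R), 0 < e -> exists2 dl : R, 0 < dl &
  forall y : 'rV[R]_d, (forall i, `|y ord0 i - x ord0 i| < dl) -> `|f y - f x| <= e.
Proof.
split=> [H x e e0|H x].
  have /cvgrPdist_le/(_ _ e0)/nbhs_ballP[dl dl0 Hd] := H x.
  exists dl => // y xy; rewrite distrC; apply: Hd; split => // i k.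
  by rewrite (ord1 i) /ball /= distrC xy.
apply: (@cvgrPdist_le _ _ _ (nbhs x) _ f (f x)).2 => e e0; have [dl dl0 Hd] := H x e e0.
apply/nbhs_ballP; exists dl => // y xy.
by rewrite distrC Hd // => i; rewrite distrC; case: xy => _ /(_ ord0 i).
Qed.

Lemma pcontP phi : pcont phi <->
  (continuous (fun y => cRe (phi y)) /\ continuous (fun y => cIm (phi y))).
Proof.
rewrite !cont_epsP; split=> [H|[H1 H2] x e e0].
  split=> x e e0; have [dl dl0 Hd] := H x e e0; exists dl => // y xy.
    by rewrite -cReB (le_trans (cnRe _)) // Hd.
  by rewrite -cImB (le_trans (cnIm _)) // Hd.
have e20 : 0 < e / 2 by rewrite divr_gt0.
have [d1 p1 {}H1] := H1 x _ e20; have [d2 p2 {}H2] := H2 x _ e20.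
exists (Num.min d1 d2); first by rewrite lt_min p1.
move=> y xy; rewrite (le_trans (cn_le _)) // (splitr e) lerD //.
  by rewrite cReB; apply: H1 => i; have := xy i; rewrite lt_min => /andP[].
by rewrite cImB; apply: H2 => i; have := xy i; rewrite lt_min => /andP[].
Qed.

Lemma smoothP phi : smooth phi <-> forall s, pcont (DD s phi) /\
  forall j x, pdr (DD s phi) j x (pderiv j (DD s phi) x).
Proof.
split=> H s.
  have [c1 [c2 Hd]] := H s; split; first exact/pcontP.
  by move=> j x; apply/pdrP; have [h1 h2] := Hd j x.
have [/pcontP[c1 c2] Hd] := H s; split => //; split => // j x.
by have /pdrP[[h1 _] [h2 _]] := Hd j x.
Qed.

Lemma DD_cat s1 s2 phi : DD (s1 ++ s2) phi = DD s1 (DD s2 phi).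
Proof. by rewrite /DD foldr_cat. Qed.

Lemma smooth_DD s phi : smooth phi -> smooth (DD s phi).
Proof.
by move=> /smoothP H; apply/smoothP => s1; rewrite -DD_cat; exact: H.
Qed.

Lemma smooth_pderiv j phi : smooth phi -> smooth (pderiv j phi).
Proof. exact: (@smooth_DD [:: j]). Qed.

Lemma smooth_pcont phi : smooth phi -> pcont phi.
Proof. by move=> /smoothP/(_ [::])[]. Qed.

Lemma smooth_pdr phi j x : smooth phi -> pdr phi j x (pderiv j phi x).
Proof. by move=> /smoothP/(_ [::])[_]; exact. Qed.

(** Every word of derivatives stays in a class that is stable under each partial derivative, so
    continuity of its members settles all orders at once. The closure properties of smooth functions
    follow by naming a stable class. *)
Lemma smooth_coind (X : testfun -> Prop) :
  (forall phi, X phi -> pcont phi /\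
     forall j, exists2 psi, X psi & forall x, pdr phi j x (psi x)) ->
  forall phi, X phi -> smooth phi.
Proof.
move=> HX phi Xphi; apply/smoothP => s.
have XD : X (DD s phi).
  elim: s => [//|j s IH]; have [_ /(_ j)[psi Xpsi Hd]] := HX _ IH.
  by rewrite /= (_ : pderiv j _ = psi) //; apply: funext => x; apply: pdr_pderiv.
have [c Hd] := HX _ XD; split => // j x.
by have [psi _ H] := Hd j; rewrite (pdr_pderiv (H x)).
Qed.

Lemma smooth_line phi j x t : smooth phi ->
  cder (fun t => phi (x + t *: evec j)) t (pderiv j phi (x + t *: evec j)).
Proof.
move=> /(@smooth_pdr _ j (x + t *: evec j)); rewrite /pdr => H.
have := @cder_comp_aff _ (fun h => phi (x + t *: evec j + h *: evec j)) 1 (- t) t.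
rewrite mul1r subrr => /(_ _ H); rewrite mul1r; apply: cder_eq => u.
by rewrite mul1r scalerBl -addrA subrKC.
Qed.

(** In this identity and the next, a, b, c, e are the values of phi at the corners of a square of
    side h, and u, v are mixed derivatives. *)
Lemma double_diff1 (a b c e h u : R[i]) :
  a - b - h * (h * u) - (c - e) = a - b - c + e - h * h * u.
Proof. ring. Qed.

Lemma double_diff2 (a b c e h u v : R[i]) :
  (a - b - c + e - h * h * v) - (a - c - b + e - h * h * u) = h * h * (u - v).
Proof. ring. Qed.

(** Two mean value estimates, along i for the increment in direction j and then along j for
    [pderiv i phi], each costing a factor 2. The size of h is governed by the continuity of the
    mixed derivative at x. *)
Lemma schwarz_step phi i j x : smooth phi -> forall e : R, 0 < e ->
  exists2 dl : R, 0 < dl & forall h : R, `|h| < dl ->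
  cnorm (phi (x + h *: evec i + h *: evec j) - phi (x + h *: evec i) - phi (x + h *: evec j) + phi x
    - h%:C * h%:C * pderiv j (pderiv i phi) x) <= 4 * e * `|h| * `|h|.
Proof.
move=> sm e e0; set C := pderiv j _ x.
have smi := smooth_pderiv i sm; have smij := smooth_pderiv j smi.
have [dl dl0 Hd] := smooth_pcont smij x e0.
exists (dl / 2); first by rewrite divr_gt0.
move=> h; rewrite ltr_pdivlMr // => hd.
pose g t := phi (x + h *: evec j + t *: evec i) - phi (x + t *: evec i) - t%:C * (h%:C * C).
pose g' t := pderiv i phi (x + h *: evec j + t *: evec i) - pderiv i phi (x + t *: evec i) - (h%:C * C).
have dg t : cder g t (g' t).
  have := cderD (cderD (smooth_line i (x + h *: evec j) t sm) (cderMl (-1) (smooth_line i x t sm))) _.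
  move=> /(_ (fun u : R => - (u%:C * (h%:C * C))) (- (h%:C * C))).
  rewrite /g /g' mulN1r; move=> H; have H1 : cder (fun u : R => - (u%:C * (h%:C * C))) t (- (h%:C * C)).
    move=> e1 e10; exists 1 => // k _; rewrite rmorphD /=.
    rewrite (_ : _ - _ = 0); last by ring.
    by rewrite cn0 mulr_ge0 // ltW.
  by apply: (cder_eq _ (H H1)) => s; rewrite mulN1r.
have bt (t : R) : Num.min 0 h <= t <= Num.max 0 h -> `|t| <= `|h|.
  by case: (leP 0 h) => h0 /andP[t1 t2]; [rewrite !ger0_norm // (le_trans t1) | rewrite !ler0_norm ?lerN2 // ltW].
have bg t : Num.min 0 h <= t <= Num.max 0 h -> cnorm (g' t) <= 2 * e * `|h|.
  move=> /bt ht.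
  pose k (s : R) := pderiv i phi (x + t *: evec i + s *: evec j) - s%:C * C.
  have dk (s : R) : cder k s (pderiv j (pderiv i phi) (x + t *: evec i + s *: evec j) - C).
    apply: cderD; first exact: smooth_line.
    move=> e1 e10; exists 1 => // u _; rewrite rmorphD /=.
    rewrite (_ : _ - _ = 0); last by ring.
    by rewrite cn0 mulr_ge0 // ltW.
  have bk (s : R) : Num.min 0 h <= s <= Num.max 0 h ->
      cnorm (pderiv j (pderiv i phi) (x + t *: evec i + s *: evec j) - C) <= e.
    move=> /bt hs; apply: Hd => m; rewrite !mxE -addrA addrC addrK.
    apply: le_lt_trans hd; rewrite (le_trans (ler_normD _ _)) // mulr_natr mulr2n lerD // normrM.
      by case: (m == i); rewrite ?normr0 ?normr1 ?mulr0 ?mulr1.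
    by case: (m == j); rewrite ?normr0 ?normr1 ?mulr0 ?mulr1.
  have := cn_MVT dk bk; rewrite subr0 /k scale0r addr0 mul0r subr0.
  congr (cnorm _ <= _); rewrite /g' [x + t *: evec i + h *: evec j]addrAC.
  exact: addrAC.
have := cn_MVT dg bg; rewrite subr0 /g !scale0r !addr0 mul0r subr0.
rewrite (_ : 2 * (2 * e * `|h|) * `|h| = 4 * e * `|h| * `|h|); last by ring.
congr (cnorm _ <= _).
rewrite [x + h *: evec i + h *: evec j]addrAC.
exact: double_diff1.
Qed.

(** The second difference over a square is symmetric in i and j, so both mixed derivatives,
    multiplied by h^2, lie within e h^2 / 2 of the same number. *)
Lemma schwarz phi i j : smooth phi -> pderiv i (pderiv j phi) = pderiv j (pderiv i phi).
Proof.
move=> sm; apply: funext => x; apply/eqP; rewrite -subr_eq0; apply/eqP; apply: cn_arb => e e0.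
have e80 : 0 < e / 8 by rewrite divr_gt0.
have [d1 p1 H1] := schwarz_step i j x sm e80.
have [d2 p2 H2] := schwarz_step j i x sm e80.
set h := Num.min d1 d2 / 2.
have m0 : 0 < Num.min d1 d2 by rewrite lt_min p1.
have h0 : 0 < h by rewrite divr_gt0.
have /andP[h1 h2] : (`|h| < d1) && (`|h| < d2).
  by rewrite -lt_min gtr0_norm // /h ltr_pdivrMr // ltr_pMr // ltr1n.
have {}H1 := H1 h h1; have {}H2 := H2 h h2.
rewrite -(ler_pM2l h0) -(ler_pM2l h0).
have -> : h * (h * cnorm (pderiv i (pderiv j phi) x - pderiv j (pderiv i phi) x)) =
  cnorm (h%:C * h%:C * (pderiv i (pderiv j phi) x - pderiv j (pderiv i phi) x)).
  by rewrite !cnM !cnR gtr0_norm // mulrA.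
have -> : h * (h * e) = 4 * (e / 8) * `|h| * `|h| + 4 * (e / 8) * `|h| * `|h|.
  by rewrite gtr0_norm //; field.
move: (lerD H1 H2) => /(le_trans _); apply.
rewrite [x + h *: evec j + h *: evec i]addrAC.
rewrite -(double_diff2 (phi (x + h *: evec i + h *: evec j)) (phi (x + h *: evec i)) (phi (x + h *: evec j)) (phi x)).
exact: cnB.
Qed.

Lemma DD_mid j s1 s2 phi : smooth phi -> DD (s1 ++ j :: s2) phi = DD (j :: s1 ++ s2) phi.
Proof.
move=> sm; elim: s1 => [//|k s1 IH] /=.
rewrite -/(DD (s1 ++ s2) phi) -/(DD (s1 ++ j :: s2) phi) IH /=.
exact/schwarz/smooth_DD.
Qed.

Lemma DD_perm s1 s2 phi : smooth phi -> perm_eq s1 s2 -> DD s1 phi = DD s2 phi.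
Proof.
move=> sm; elim: s1 s2 => [|j s1 IH] s2 p.
  by have /nilP -> : nilp s2 by rewrite /nilp -(perm_size p).
have : j \in s2 by rewrite -(perm_mem p) mem_head.
move=> /splitPr e; case: s2 / e p => s2 s3 p.
have {}p : perm_eq s1 (s2 ++ s3).
  by rewrite -(perm_cons j) (perm_trans p) // -cat1s perm_catCA.
by rewrite DD_mid //= -/(DD s1 phi) (IH _ p).
Qed.

Definition mseq (a : mindex d) : seq 'I_d := flatten [seq nseq (a j) j | j <- enum 'I_d].
Definition cnt s : mindex d := [ffun j => count_mem j s].

Lemma dmult_DD a phi : dmult a phi = DD (mseq a) phi.
Proof.
rewrite /dmult /mseq; elim: (enum 'I_d) => [//|j s IH] /=.
rewrite DD_cat -IH; move: (foldr _ _ _) => psi.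
by elim: (a j) => [//|n IHn]; rewrite iterS IHn.
Qed.

Lemma size_mseq a : size (mseq a) = mabs a.
Proof.
rewrite /mseq size_flatten /shape -map_comp /mabs sumnE big_map big_enum /=.
by apply: eq_bigr => j _; rewrite size_nseq.
Qed.

Lemma count_mseq a j : count_mem j (mseq a) = a j.
Proof.
rewrite /mseq count_flatten -map_comp sumnE big_map big_enum /= (bigD1 j) //=.
rewrite count_nseq /= eqxx mul1n big1 ?addn0 // => k kj.
by rewrite count_nseq /= (negPf kj).
Qed.

Lemma mseq_cnt s : perm_eq (mseq (cnt s)) s.
Proof. by apply/allP => j _; rewrite /= count_mseq ffunE. Qed.

Lemma mabs_cnt s : mabs (cnt s) = size s.
Proof. by rewrite -size_mseq; apply/perm_size/mseq_cnt. Qed.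

Lemma DD_dmult s phi : smooth phi -> DD s phi = dmult (cnt s) phi.
Proof. by move=> sm; rewrite dmult_DD; apply: DD_perm => //; rewrite perm_sym mseq_cnt. Qed.

Lemma pcontD phi psi : pcont phi -> pcont psi -> pcont (fun x => phi x + psi x).
Proof.
move=> H1 H2 x e e0; have e20 : 0 < e / 2 by rewrite divr_gt0.
have [d1 p1 {}H1] := H1 x _ e20; have [d2 p2 {}H2] := H2 x _ e20.
exists (Num.min d1 d2); first by rewrite lt_min p1.
move=> y xy; rewrite opprD addrACA (le_trans (cnD _ _)) // (splitr e) lerD //.
  by apply: H1 => i; have := xy i; rewrite lt_min => /andP[].
by apply: H2 => i; have := xy i; rewrite lt_min => /andP[].
Qed.

Lemma pcontZ c phi : pcont phi -> pcont (fun x => c * phi x).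
Proof.
move=> H x e e0; have c0 : 0 < 1 + cnorm c by rewrite ltr_pwDl ?cn_ge0.
have [dl p {}H] := H x _ (divr_gt0 e0 c0); exists dl => // y /H.
rewrite ler_pdivlMr // -mulrBr cnM => /(le_trans _); apply.
by rewrite mulrC ler_wpM2l ?cn_ge0 // lerDr.
Qed.

Lemma pderivZD (c : R[i]) j phi psi : smooth phi -> smooth psi ->
  pderiv j (fun x => c * phi x + psi x) = (fun x => c * pderiv j phi x + pderiv j psi x).
Proof.
move=> s1 s2; apply: funext => x; apply: pdr_pderiv.
by apply: cderD; [apply: cderMl|]; apply: smooth_pdr.
Qed.

Lemma smoothZD (c : R[i]) phi psi : smooth phi -> smooth psi -> smooth (fun x => c * phi x + psi x).
Proof.
move=> s1 s2; apply: (@smooth_coind (fun u => exists f : testfun * testfun,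
   (smooth f.1 /\ smooth f.2) /\ u = fun x => c * f.1 x + f.2 x)); last first.
  by exists (phi, psi); exact: (conj (conj s1 s2) erefl).
move=> _ {phi psi s1 s2} [[phi psi] [[/= s1 s2] ->]]; split.
  exact: (pcontD (pcontZ c (smooth_pcont s1)) (smooth_pcont s2)).
move=> j; exists (fun x => c * pderiv j phi x + pderiv j psi x).
  by exists (pderiv j phi, pderiv j psi); exact: (conj (conj (smooth_pderiv j s1) (smooth_pderiv j s2)) erefl).
move=> x; exact: (cderD (cderMl c (smooth_pdr j x s1)) (smooth_pdr j x s2)).
Qed.

Lemma DDZD (c : R[i]) s phi psi : smooth phi -> smooth psi ->
  DD s (fun x => c * phi x + psi x) = (fun x => c * DD s phi x + DD s psi x).
Proof.
move=> s1 s2; elim: s => [//|j s IH] /=; rewrite -/(DD s _) IH.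
exact: (pderivZD c j (smooth_DD s s1) (smooth_DD s s2)).
Qed.

Lemma smooth0 : smooth ((fun=> 0) : testfun).
Proof.
apply: (@smooth_coind (fun u => u = fun=> 0)) => // _ ->; split.
  by move=> x e e0; exists 1 => // y _; rewrite subrr cn0 ltW.
by move=> j; exists (fun=> 0) => // x; exact: cder_cst.
Qed.

Lemma DD0 s : DD s (fun=> 0 : R[i]) = (fun=> 0).
Proof.
elim: s => [//|j s IH] /=; rewrite -/(DD s _) IH; apply: funext => x.
by apply: pdr_pderiv; exact: cder_cst.
Qed.

Lemma smoothZ (c : R[i]) phi : smooth phi -> smooth (fun x => c * phi x).
Proof.
move=> sm; rewrite (_ : (fun x => _) = (fun x => c * phi x + 0)); last by apply: funext => x; rewrite addr0.
by apply: smoothZD => //; exact: smooth0.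
Qed.

Lemma DDZ (c : R[i]) s phi : smooth phi -> DD s (fun x => c * phi x) = (fun x => c * DD s phi x).
Proof.
move=> sm; rewrite (_ : (fun x => _) = (fun x => c * phi x + 0)); last by apply: funext => x; rewrite addr0.
rewrite (DDZD _ _ sm smooth0) DD0.
by apply: funext => x; rewrite addr0.
Qed.

Lemma smooth_sum (I : Type) (r : seq I) (c : I -> R[i]) (F : I -> testfun) :
  (forall i, smooth (F i)) -> smooth (fun x => \sum_(i <- r) c i * F i x).
Proof.
move=> sm; elim: r => [|i r IH].
  by move: smooth0; congr smooth; apply: funext => x; rewrite big_nil.
move: (smoothZD (c i) (sm i) IH); congr smooth; apply: funext => x; by rewrite big_cons.
Qed.

Lemma DD_sum (I : Type) (r : seq I) (c : I -> R[i]) (F : I -> testfun) s :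
  (forall i, smooth (F i)) ->
  DD s (fun x => \sum_(i <- r) c i * F i x) = (fun x => \sum_(i <- r) c i * DD s (F i) x).
Proof.
move=> sm; elim: r => [|i r IH].
  under eq_fun do rewrite big_nil; rewrite DD0.
  by apply: funext => x; rewrite big_nil.
under eq_fun do rewrite big_cons; rewrite DDZD //; last exact: smooth_sum.
by apply: funext => x; rewrite big_cons IH.
Qed.

Lemma pcont_transl y phi : pcont phi -> pcont (transl y phi).
Proof.
move=> H x e e0; have [dl p {}H] := H (x - y) _ e0; exists dl => // z xz.
by apply: H => i; rewrite !mxE opprB addrA subrK.
Qed.

Lemma pdr_transl y j phi x z : pdr phi j (x - y) z -> pdr (transl y phi) j x z.
Proof. by move=> H; apply: cder_eq H => h; rewrite /transl addrAC. Qed.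

Lemma pderiv_transl y j phi : smooth phi -> pderiv j (transl y phi) = transl y (pderiv j phi).
Proof. by move=> sm; apply: funext => x; exact: (pdr_pderiv (pdr_transl (smooth_pdr j (x - y) sm))). Qed.

Lemma smooth_transl y phi : smooth phi -> smooth (transl y phi).
Proof.
move=> sm; apply: (@smooth_coind (fun u => exists2 phi, smooth phi & u = transl y phi)); last by exists phi.
move=> _ {phi sm} [phi sm ->]; split; first exact/pcont_transl/smooth_pcont.
move=> j; exists (transl y (pderiv j phi)); first by exists (pderiv j phi) => //; exact: smooth_pderiv.
by move=> x; exact: (pdr_transl (smooth_pdr j (x - y) sm)).
Qed.

Lemma DD_transl y s phi : smooth phi -> DD s (transl y phi) = transl y (DD s phi).
Proof.
by move=> sm; elim: s => [//|j s IH] /=; rewrite -/(DD s _) IH pderiv_transl //; exact: smooth_DD.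
Qed.

Lemma pdr_check j phi x z : pdr phi j (- x) z -> pdr (check phi) j x (- z).
Proof.
rewrite /pdr => H.
have := @cder_comp_aff _ (fun h => phi (- x + h *: evec j)) (-1) 0 0 z.
rewrite mulr0 addr0 => /(_ H); rewrite rmorphN /= mulN1r; apply: cder_eq => h.
by rewrite mulN1r addr0 /check opprD scaleNr.
Qed.

Lemma pcont_check phi : pcont phi -> pcont (check phi).
Proof.
move=> H x e e0; have [dl p {}H] := H (- x) _ e0; exists dl => // z xz.
by apply: H => i; rewrite !mxE -opprD normrN xz.
Qed.

Lemma smooth_check phi : smooth phi -> smooth (check phi).
Proof.
move=> sm; apply: (@smooth_coind (fun u => exists2 phi, smooth phi & u = check phi)); last by exists phi.
move=> _ {phi sm} [phi sm ->]; split; first exact/pcont_check/smooth_pcont.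
move=> j; exists (check (fun x => -1 * pderiv j phi x)); first by eexists; last by []; exact/smoothZ/smooth_pderiv.
by move=> x; rewrite /check mulN1r; apply/pdr_check/smooth_pdr.
Qed.

Lemma DD_check s phi : smooth phi -> DD s (check phi) = (fun x => (-1) ^+ size s * check (DD s phi) x).
Proof.
move=> sm; elim: s => [|j s IH].
  by apply: funext => x; rewrite mul1r.
rewrite /= -/(DD s _) IH; apply: funext => x.
rewrite exprS mulN1r; apply: pdr_pderiv; rewrite mulNr -mulrN.
exact/cderMl/pdr_check/smooth_pdr/smooth_DD.
Qed.

(* Frequency attached to the j-th coordinate of xi by differentiating exp(2 i pi xi.t). *)
Definition frq (xi : pt) j : R[i] := 0 +i* (2 * pi * xi ord0 j).

Lemma expiD (a b : R) : expi (a + b) = expi a * expi b.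
Proof. by rewrite /expi cosD sinD; apply/eqP; rewrite eq_complex /=; apply/andP; split; apply/eqP; ring. Qed.

Lemma expi0 : expi (0 : R) = 1.
Proof. by rewrite /expi cos0 sin0. Qed.

Lemma cn_expi (a : R) : cnorm (expi a) = 1.
Proof. by rewrite /cnorm /expi /= cos2Dsin2 sqrtr1. Qed.

Lemma dotp_evec (xi x : pt) (h : R) j : dotp xi (x + h *: evec j) = dotp xi x + h * xi ord0 j.
Proof.
rewrite /dotp; under eq_bigr => i _ do rewrite !mxE mulrDr.
rewrite big_split /=; congr (_ + _); rewrite (bigD1 j) //= eqxx mulr1 mulrC big1 ?addr0 //.
by move=> i /negPf ->; rewrite !mulr0.
Qed.

Lemma pdr_modul xi j phi x z : pdr phi j x z ->
  pdr (modul xi phi) j x (frq xi j * modul xi phi x + modul xi (fun=> z) x).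
Proof.
rewrite /pdr /modul => H.
have := cderM (cderMl (expi (2 * pi * dotp xi x)) (cder_expi 0 (2 * pi * xi ord0 j))) H.
rewrite mulr0 expi0 mulr1 scale0r addr0 => H1.
rewrite (_ : frq xi j * _ = expi (2 * pi * dotp xi x) * (0 +i* (2 * pi * xi ord0 j)) * phi x); last first.
  by rewrite /frq mulrA [_ * expi _]mulrC.
move: H1; rewrite mulr1; apply: cder_eq => h.
rewrite dotp_evec -expiD; congr (expi _ * _); ring.
Qed.

Lemma pcontM phi psi : pcont phi -> pcont psi -> pcont (fun x => phi x * psi x).
Proof.
move=> H1 H2 x e e0.
set K := 1 + cnorm (phi x) + cnorm (psi x).
have g1 := cn_ge0 (phi x); have g2 := cn_ge0 (psi x).
have K1 : 1 <= K by rewrite /K; lra.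
have K0 : 0 < K by lra.
have m0 : 0 < Num.min 1 (e / (2 * K)) by rewrite lt_min ltr01 divr_gt0 // mulr_gt0.
have [d1 p1 {}H1] := H1 x _ m0; have [d2 p2 {}H2] := H2 x _ m0.
exists (Num.min d1 d2); first by rewrite lt_min p1.
move=> y xy.
have {}H1 : cnorm (phi y - phi x) <= Num.min 1 (e / (2 * K)) by apply: H1 => i; have := xy i; rewrite lt_min => /andP[].
have {}H2 : cnorm (psi y - psi x) <= Num.min 1 (e / (2 * K)) by apply: H2 => i; have := xy i; rewrite lt_min => /andP[].
move: H1 H2; rewrite !le_min => /andP[h1 h1'] /andP[h2 h2'].
rewrite (_ : _ - _ = (phi y - phi x) * psi y + phi x * (psi y - psi x)); last by ring.
have -> : e = e / (2 * K) * K + K * (e / (2 * K)) by field; rewrite gt_eqF.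
rewrite (le_trans (cnD _ _)) // !cnM lerD // ler_pM ?cn_ge0 //.
  rewrite -(subrK (psi x) (psi y)) (le_trans (cnD _ _)) // /K; lra.
rewrite /K; lra.
Qed.

Lemma dotpB (xi x y : pt) : dotp xi x - dotp xi y = dotp xi (x - y).
Proof. by rewrite /dotp -sumrB; apply: eq_bigr => i _; rewrite !mxE mulrBr. Qed.

Lemma pcont_expi xi : pcont (fun x => expi (2 * pi * dotp xi x)).
Proof.
move=> x e e0; pose K := 2 * pi * \sum_i `|xi ord0 i|.
have K0 : 0 <= K by rewrite mulr_ge0 ?sumr_ge0 // mulr_ge0 // pi_ge0.
have : ccont (fun s : R => expi (1 * s)) (2 * pi * dotp xi x) by apply: cder_cont; exact: cder_expi.
move=> /(_ _ e0)[dl dl0 Hd].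
exists (dl / (1 + K)); first by rewrite divr_gt0 // ltr_pwDl.
move=> y xy; have := Hd (2 * pi * dotp xi y - 2 * pi * dotp xi x).
rewrite !mul1r subrKC; apply; rewrite -mulrBr dotpB normrM ger0_norm ?mulr_ge0 ?pi_ge0 //.
apply: (@le_lt_trans _ _ (K * (dl / (1 + K)))).
  rewrite /K -mulrA ler_wpM2l ?mulr_ge0 ?pi_ge0 // (le_trans (ler_norm_sum _ _ _)) // mulr_suml.
  by apply: ler_sum => i _; rewrite normrM ler_wpM2l // !mxE ltW.
by rewrite mulrA ltr_pdivrMr ?ltr_pwDl // mulrDr mulr1 mulrC ltrDr.
Qed.

Lemma pderiv_modul xi j phi : smooth phi -> pderiv j (modul xi phi) =
  (fun x => frq xi j * modul xi phi x + modul xi (pderiv j phi) x).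
Proof. by move=> sm; apply: funext => x; exact: (pdr_pderiv (pdr_modul xi (smooth_pdr j x sm))). Qed.

Lemma modulZD xi (c : R[i]) phi psi x :
  modul xi (fun x => c * phi x + psi x) x = c * modul xi phi x + modul xi psi x.
Proof. by rewrite /modul mulrDr mulrCA. Qed.

Lemma smooth_modul xi phi : smooth phi -> smooth (modul xi phi).
Proof.
move=> sm; apply: (@smooth_coind (fun u => exists2 phi, smooth phi & u = modul xi phi)); last by exists phi.
move=> _ {phi sm} [phi sm ->]; split.
  by apply: pcontM; [exact: pcont_expi|exact: smooth_pcont].
move=> j; exists (modul xi (fun x => frq xi j * phi x + pderiv j phi x)).
  by eexists; last reflexivity; apply: smoothZD => //; exact: smooth_pderiv.
by move=> x; rewrite modulZD; exact: (pdr_modul xi (smooth_pdr j x sm)).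
Qed.

(** [G] collects the uniform limits along all words. The lemma serves twice: for convolutions as
    limits of Riemann sums, and for the completeness of the spaces. *)
Lemma smooth_lim (Fn : nat -> testfun) (G : seq 'I_d -> testfun) :
  (forall n, smooth (Fn n)) ->
  (forall s (e : R), 0 < e -> exists N, forall n, (N <= n)%N -> forall x, cnorm (DD s (Fn n) x - G s x) <= e) ->
  smooth (G [::]) /\ forall s, DD s (G [::]) = G s.
Proof.
move=> sm H.
have pd s j x : pdr (G s) j x (G (j :: s) x).
  have := @cder_lim _ (fun n h => DD s (Fn n) (x + h *: evec j)) (fun n h => DD (j :: s) (Fn n) (x + h *: evec j))
    (fun h => G s (x + h *: evec j)) (fun h => G (j :: s) (x + h *: evec j)) 0.
  rewrite scale0r addr0; apply => [n h|h e e0|e e0].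
  - exact/smooth_line/smooth_DD.
  - by have [N HN] := H s e e0; exists N => n /HN.
  - by have [N HN] := H (j :: s) e e0; exists N => n /HN.
have pc s : pcont (G s).
  move=> x e e0; have e30 : 0 < e / 3 by rewrite divr_gt0.
  have [N /(_ N (leqnn _)) HN] := H s _ e30.
  have [dl dl0 Hd] := smooth_pcont (smooth_DD s (sm N)) x e30.
  exists dl => // y /Hd hy.
  rewrite (_ : e = e / 3 + (e / 3 + e / 3)); last by field.
  rewrite (le_trans (cn_tri _ (DD s (Fn N) y) _)) // lerD //; first by rewrite cnBC.
  by rewrite (le_trans (cn_tri _ (DD s (Fn N) x) _)) // lerD.
have D s : DD s (G [::]) = G s.
  by elim: s => [//|j s IH] /=; rewrite -/(DD s _) IH; apply: funext => x; apply: pdr_pderiv.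
split=> //; apply/smoothP => s; rewrite D; split => // j x.
by rewrite (pdr_pderiv (pd s j x)).
Qed.

End Smooth.

(** * Associated functions and the spaces *)

Section WeightFunction.
Variables (R : realType) (M : nat -> R).
Hypothesis wM : weight_seq M.
Definition ew (t : R) := expR (omega M t).
Lemma M_gt0 p : 0 < M p. Proof. by case: wM. Qed.
Let Mp : forall p, 0 < M p. Proof. exact: M_gt0. Qed.
Lemma M_ge0 p : 0 <= M p. Proof. exact: ltW (M_gt0 p). Qed.

(** The supremum is a maximum: the growth of the roots of [M p / M 0] makes the terms at most 1 from
    some index on, and the term of index 0 equals 1. The index attaining it later becomes an order
    of integration by parts. *)
Lemma ew_sup (t : R) : 0 <= t -> (exists p, ew t = t ^+ p * M 0%N / M p) /\
  forall p, t ^+ p * M 0%N / M p <= ew t.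
Proof.
rewrite le_eqVlt => /predU1P[<-|t0].
  have e1 : ew 0 = 1 by rewrite /ew /omega lexx expR0.
  split; first by exists 0%N; rewrite e1 expr0 mul1r divff // gt_eqF.
  by case=> [|p]; rewrite e1 ?expr0 ?mul1r ?divff ?gt_eqF // exprS !mul0r.
pose a p := t ^+ p * M 0%N / M p.
have a_gt0 p : 0 < a p by rewrite divr_gt0 // mulr_gt0 // exprn_gt0.
have [N HN] : exists N, forall p, (N <= p)%N -> a p <= 1.
  have [_ /cvgryPge/(_ t)[N _ HN]] := wM.
  exists N.+1 => p Np; have := HN p (ltnW Np); rewrite /= => ht.
  have p0 : (0 < p)%N by rewrite (leq_ltn_trans _ Np).
  rewrite /a ler_pdivrMr // mul1r -ler_pdivlMr //.
  rewrite -powR_mulrn ?(ltW t0) //.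
  have := @ge0_ler_powR _ (p%:R : R) (ler0n _ _) t ((M p / M 0%N) `^ p%:R^-1).
  rewrite !nnegrE => /(_ (ltW t0) (powR_ge0 _ _) ht) /le_trans; apply.
  by rewrite -powRrM mulVf ?pnatr_eq0 ?gtn_eqF // powRr1 // divr_ge0 // ltW.
have [p0 Hp0] : exists p0, forall p, a p <= a p0.
  have a0 : a 0%N = 1 by rewrite /a expr0 mul1r divff // gt_eqF.
  have [p0 Hp0] : exists p0, forall p, (p <= N)%N -> a p <= a p0.
    elim: N {HN} => [|N [p0 IH]].
      by exists 0%N => p; rewrite leqn0 => /eqP ->.
    have [le|lt] := leP (a N.+1) (a p0).
      exists p0 => p; rewrite leq_eqVlt => /predU1P[-> //|]; exact: IH.
    exists N.+1 => p; rewrite leq_eqVlt => /predU1P[-> //|pN].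
    by rewrite (le_trans (IH _ pN)) // ltW.
  exists p0 => p; have [pN|Np] := leqP p N; first exact: Hp0.
  by rewrite (le_trans (HN _ (ltnW Np))) // -a0 Hp0.
have e1 : ew t = a p0.
  rewrite /ew /omega leNgt t0 /= (_ : ereal_sup _ = (ln (a p0))%:E) /=.
    by rewrite lnK // posrE.
  apply/eqP; rewrite eq_le; apply/andP; split.
    apply: ge_ereal_sup => _ [p _ <-]; rewrite lee_fin ler_ln ?posrE; [exact: Hp0|exact: (a_gt0 p)|exact: a_gt0].
  by apply: ereal_sup_ubound; exists p0.
by split; [exists p0 | move=> p; rewrite e1; exact: Hp0].
Qed.

Lemma ew_att t : 0 <= t -> exists p, ew t = t ^+ p * M 0%N / M p.
Proof. by case/ew_sup. Qed.

Lemma ew_ge t p : 0 <= t -> t ^+ p * M 0%N / M p <= ew t.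
Proof. by case/ew_sup. Qed.

Lemma ew_gt0 t : 0 < ew t. Proof. exact: expR_gt0. Qed.

Lemma ew_ge1 t : 0 <= t -> 1 <= ew t.
Proof. by move=> /(ew_ge 0); rewrite expr0 mul1r divff // gt_eqF. Qed.

Lemma ew_ge0 t : 0 <= ew t. Proof. exact: expR_ge0. Qed.
#[local] Opaque ew.

Lemma ew_mono s t : 0 <= s -> s <= t -> ew s <= ew t.
Proof.
move=> s0 st; have [p ->] := ew_att s0.
apply: le_trans (ew_ge p (le_trans s0 st)).
by rewrite ler_pM2r ?invr_gt0 // ler_pM2r // lerXn2r ?nnegrE // (le_trans s0).
Qed.

(** One factor is the value itself and the other is at least 1. This replaces subadditivity of
    [omega], which fails in general. *)
Lemma ew_max s t : 0 <= s -> 0 <= t -> ew (Num.max s t) <= ew s * ew t.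
Proof.
move=> s0 t0; case: (leP s t) => _.
  by rewrite ler_peMl ?ew_ge1 // ltW ?ew_gt0.
by rewrite ler_peMr ?ew_ge1 // ltW ?ew_gt0.
Qed.

Hypothesis M2 : cond_M2' M.

(** If p attains the supremum at t, then by (M.2)' the term of index p + 1 at H t is at least t / C0
    times as large. *)
Lemma ew_M2 : exists C H : R, [/\ 0 < C, 1 <= H & forall t, 0 <= t -> t * ew t <= C * ew (H * t)].
Proof.
have [C0 [H [C1 [H1 HM]]]] := M2; exists C0, H; split=> [|//|t t0]; first exact: (lt_le_trans ltr01 C1).
have C00 : 0 < C0 by exact: (lt_le_trans ltr01 C1).
have H0 : 0 < H by exact: (lt_le_trans ltr01 H1).
have [p ->] := ew_att t0.
apply: le_trans (_ : C0 * ((H * t) ^+ p.+1 * M 0%N / M p.+1) <= _); last first.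
  by rewrite ler_pM2l // ew_ge // mulr_ge0 // ltW.
rewrite !mulrA -exprS ler_pdivlMr // mulrAC ler_pdivrMr // exprMn.
rewrite [C0 * _](_ : _ = C0 * H ^+ p.+1 * t ^+ p.+1); last by rewrite mulrA.
have -> : t ^+ p.+1 * M 0%N * M p.+1 = t ^+ p.+1 * M 0%N * M p.+1 by [].
rewrite [leRHS](_ : _ = t ^+ p.+1 * M 0%N * (C0 * H ^+ p.+1 * M p)); last by ring.
rewrite ler_wpM2l ?mulr_ge0 ?exprn_ge0 // ?(ltW (Mp _)) // (le_trans (HM p)) //.
rewrite ler_pM2r // ler_pM2l // exprS ler_peMl // exprn_ge0 // ltW //.
Qed.

Lemma ew_pow n : exists C H : R, [/\ 0 < C, 1 <= H & forall t, 0 <= t -> t ^+ n * ew t <= C * ew (H * t)].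
Proof.
elim: n => [|n [C [H [C0 H1 IH]]]].
  by exists 1, 1; split => // t _; rewrite expr0 !mul1r.
have [C' [H' [C'0 H'1 HC]]] := ew_M2.
have H0 : 0 < H by exact: (lt_le_trans ltr01 H1).
exists (C * C'), (H' * H); split; [by rewrite mulr_gt0| |move=> t t0].
  by rewrite (le_trans H1) // ler_peMl // ltW.
rewrite exprS -mulrA (le_trans (ler_wpM2l t0 (IH _ t0))) //.
rewrite mulrCA -mulrA ler_pM2l //.
apply: le_trans (_ : H * t * ew (H * t) <= _).
  by rewrite ler_pM2r ?ew_gt0 // ler_peMl.
by rewrite (le_trans (HC _ _)) ?mulrA // mulr_ge0 // ltW.
Qed.

(** The dilation k is fixed before q, so that the loss can be absorbed by the quantifier over scales
    in the Beurling and in the Roumieu case alike. *)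
Lemma ew_poly n : exists2 k : R, 1 <= k & forall q, 0 < q -> exists2 C : R, 0 < C &
  forall t, 0 <= t -> ew (q * t) * (1 + t ^+ 2) ^+ n <= C * ew (k * q * t).
Proof.
have [C [H [C0 H1 HC]]] := ew_pow (n.*2).
have H0 : 0 < H by exact: (lt_le_trans ltr01 H1).
exists H => // q q0.
exists (2 ^+ n * (1 + (q^-1) ^+ n.*2 * C)).
  by rewrite mulr_gt0 ?exprn_gt0 // ltr_pwDl // mulr_ge0 ?exprn_ge0 ?invr_ge0 // ltW.
move=> t t0.
have qt0 : 0 <= q * t by rewrite mulr_ge0 // ltW.
have ht : (1 + t ^+ 2) ^+ n <= 2 ^+ n * (1 + t ^+ n.*2).
  have [t1|t1] := leP t 1.
    apply: (@le_trans _ _ (2 ^+ n)).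
      rewrite lerXn2r ?nnegrE ?addr_ge0 ?exprn_ge0 //.
      by rewrite -[leRHS]/(1 + 1) lerD2l expr_le1.
    by rewrite ler_peMr ?exprn_ge0 // lerDl exprn_ge0.
  apply: (@le_trans _ _ (2 ^+ n * t ^+ n.*2)).
    rewrite -mul2n exprM -exprMn lerXn2r ?nnegrE ?addr_ge0 ?mulr_ge0 ?exprn_ge0 //.
    have : 1 <= t ^+ 2 by rewrite exprn_ege1 // ltW.
    by lra.
  by rewrite ler_pM2l ?exprn_gt0 // lerDr.
rewrite (le_trans (ler_wpM2l (ew_ge0 _) ht)) // mulrCA -[leRHS]mulrA ler_pM2l ?exprn_gt0 //.
rewrite mulrDr mulr1 mulrDl mul1r lerD //.
  by rewrite ew_mono // -mulrA ler_peMl.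
have qn0 : 0 < q ^+ n.*2 by rewrite exprn_gt0.
rewrite exprVn -(ler_pM2l qn0) mulrCA -exprMn mulrC (le_trans (HC _ qt0)) //.
by rewrite !mulrA divff ?mul1r // gt_eqF.
Qed.

Hypothesis M1 : cond_M1 M.

Lemma M_ratio p k : M p.+1 * M (p + k)%N <= M p * M (p + k).+1.
Proof.
elim: k => [|k IH]; first by rewrite addn0 mulrC.
rewrite addnS -(ler_pM2r (M_gt0 (p + k))) mulrAC (le_trans (ler_wpM2r (M_ge0 _) IH)) //.
rewrite -!mulrA ler_pM2l ?M_gt0 // -expr2 [leRHS]mulrC.
exact: (M1 (ltn0Sn (p + k))).
Qed.

(** By (M.1) the ratios [M p.+1 / M p] increase, so the product of the first j ratios is dominated
    by that of the j ratios starting at index k. *)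
Lemma M_logconv j k : M j * M k <= M 0%N * M (j + k)%N.
Proof.
elim: j => [|j IH]; first by rewrite add0n.
rewrite -(ler_pM2r (M_gt0 j)) mulrAC [M j.+1 * _]mulrC.
have := ler_wpM2r (M_ge0 j.+1) IH; rewrite mulrAC => /le_trans; apply.
rewrite -mulrA -[leRHS]mulrA ler_pM2l ?M_gt0 // mulrC [leRHS]mulrC.
exact: M_ratio.
Qed.

End WeightFunction.

(** * Euclidean norm, splitting of the weight, integrable weights *)

Section Eucl.
Variables (R : realType) (d : nat).
Implicit Types x y : 'rV[R]_d.
Lemma eucl_ge0 x : 0 <= eucl x. Proof. exact: sqrtr_ge0. Qed.

Lemma eucl_sqr x : eucl x ^+ 2 = \sum_(i < d) x ord0 i ^+ 2.
Proof. by rewrite sqr_sqrtr // sumr_ge0 // => i _; exact: sqr_ge0. Qed.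

Lemma eucl_coord x i : `|x ord0 i| <= eucl x.
Proof.
rewrite /eucl -sqrtr_sqr ler_wsqrtr // (bigD1 i) //= lerDl sumr_ge0 // => j _; exact: sqr_ge0.
Qed.

Lemma euclN x : eucl (- x) = eucl x.
Proof. by rewrite /eucl; congr Num.sqrt; apply: eq_bigr => i _; rewrite mxE sqrrN. Qed.

Lemma euclZ (c : R) x : eucl (c *: x) = `|c| * eucl x.
Proof.
rewrite /eucl -sqrtr_sqr -sqrtrM ?sqr_ge0 // mulr_sumr; congr Num.sqrt.
by apply: eq_bigr => i _; rewrite mxE exprMn.
Qed.

Lemma eucl_max x y : eucl (x + y) <= 2 * Num.max (eucl x) (eucl y).
Proof.
have m0 : 0 <= 2 * Num.max (eucl x) (eucl y) by rewrite mulr_ge0 // le_max eucl_ge0.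
rewrite -(ger0_norm m0) -sqrtr_sqr {1}/eucl ler_wsqrtr //.
apply: (@le_trans _ _ (2 * (\sum_(i < d) x ord0 i ^+ 2) + 2 * (\sum_(i < d) y ord0 i ^+ 2))).
  rewrite !mulr_sumr -big_split /=; apply: ler_sum => i _; rewrite mxE.
  have := sqr_ge0 (x ord0 i - y ord0 i); nra.
rewrite -!eucl_sqr -mulrDr exprMn [2 ^+ 2]expr2 -mulrA ler_pM2l // mulr_natl mulr2n lerD //;
  by rewrite lerXn2r ?nnegrE ?le_max ?eucl_ge0 ?lexx ?orbT.
Qed.

Lemma eucl_sum x : eucl x <= \sum_i `|x ord0 i|.
Proof.
have s0 : 0 <= \sum_i `|x ord0 i| by rewrite sumr_ge0.
rewrite -(ger0_norm s0) -sqrtr_sqr /eucl ler_wsqrtr // expr2 mulr_suml.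
apply: ler_sum => i _; rewrite -real_normK ?num_real // expr2 ler_wpM2l //.
by rewrite (bigD1 i) //= lerDl sumr_ge0.
Qed.

(* Integrable weight of product form, suited to iterated one-dimensional estimates. *)
Definition w1 (t : R) : R := (1 + t ^+ 2)^-1.

Definition wt x := \prod_(i < d) w1 (x ord0 i).

Lemma w1_gt0 t : 0 < w1 t.
Proof. by rewrite invr_gt0 ltr_pwDl ?sqr_ge0. Qed.

Lemma w1_ge0 t : 0 <= w1 t. Proof. exact: ltW (w1_gt0 t). Qed.

Lemma w1_le1 t : w1 t <= 1.
Proof. by rewrite invf_le1 ?ltr_pwDl ?sqr_ge0 // lerDl sqr_ge0. Qed.

Lemma wt_gt0 x : 0 < wt x.
Proof. by apply: prodr_gt0 => i _; exact: w1_gt0. Qed.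

Lemma wt_eucl x : 1 <= wt x * (1 + eucl x ^+ 2) ^+ d.
Proof.
rewrite -[X in _ ^+ X](card_ord d) -prodr_const -big_split /=.
rewrite -[leLHS](_ : \prod_(i < d) (1 : R) = 1); last by rewrite big1.
apply: ler_prod => i _.
rewrite ler01 /= /w1 mulrC ler_pdivlMr ?ltr_pwDl ?sqr_ge0 // mul1r lerD2l.
by rewrite -real_normK ?num_real // lerXn2r ?nnegrE ?eucl_ge0 // eucl_coord.
Qed.

Variable A : nat -> R.
Hypotheses (wA : weight_seq A) (A2 : cond_M2' A).
Local Notation ew := (ew A).

(** The factor 2 in the arguments is the price of using [eucl_max] and [ew_max] instead of
    subadditivity. *)
Lemma ew_split (a : R) x y : 0 <= a -> ew (a * eucl x) <= ew (2 * a * eucl (x - y)) * ew (2 * a * eucl y).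
Proof.
move=> a0.
have p (z : 'rV[R]_d) : 0 <= 2 * a * eucl z by apply: mulr_ge0; [exact: mulr_ge0|exact: eucl_ge0].
rewrite (le_trans _ (ew_max wA (p _) (p _))) // ew_mono //; first by rewrite mulr_ge0 // eucl_ge0.
rewrite -maxr_pMr ?mulr_ge0 // (mulrC 2 a) -mulrA ler_wpM2l //.
by rewrite -{1}(subrK y x) eucl_max.
Qed.

(** A polynomial is traded for a fixed dilation of the argument: the power [(1 + |x|^2)^d] pays for
    the integrable weight [wt], and one more factor is kept, with which [choose_p] beats
    constants. *)
Lemma ew_wt : exists2 k : R, 1 <= k & forall q, 0 < q -> exists2 C : R, 0 < C &
  forall x, ew (q * eucl x) * (1 + eucl x ^+ 2) <= C * wt x * ew (k * q * eucl x).
Proof.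
have [k k1 H] := ew_poly wA A2 d.+1; exists k => // q q0.
have [C C0 HC] := H q q0; exists C => // x.
have := HC _ (eucl_ge0 x); rewrite exprSr mulrA => h.
have w0 := wt_gt0 x; have h2 := wt_eucl x; have e0 := ew_ge0 A (q * eucl x).
have e2 : 0 <= 1 + eucl x ^+ 2 by rewrite addr_ge0 // sqr_ge0.
move: (ew (q * _)) (ew (k * q * _)) (1 + _ ^+ 2) ((1 + _ ^+ 2) ^+ d) (wt x) h w0 h2 e0 e2 => a b c e w h w0 h2 a0 c0.
apply: (@le_trans _ _ (w * (a * e * c))); last first.
  by rewrite [C * w]mulrC -[leRHS]mulrA; apply: ler_wpM2l => //; exact: ltW.
rewrite (_ : w * (a * e * c) = a * c * (w * e)); last by ring.
by rewrite ler_peMr // mulr_ge0.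
Qed.

End Eucl.

Lemma ew_scale (R : realType) (M : nat -> R) : weight_seq M -> forall a b t, 0 <= a -> a <= b -> 0 <= t ->
  ew M (a * t) <= ew M (b * t).
Proof.
move=> wM a b t a0 ab t0; apply: (ew_mono wM); first exact: mulr_ge0.
exact: ler_wpM2r.
Qed.

(* [QQ b P] reads "for some l" in the Beurling case and "for all l" in the Roumieu case. *)
Definition QQ (R : realType) (b : bool) (P : R -> Prop) : Prop :=
  if b then exists l : R, 0 < l /\ P l else forall l : R, 0 < l -> P l.

(** * Norm bounds at a fixed scale and quantification over scales *)

Section Spaces.
Variables (R : realType) (d : nat) (M A : nat -> R) (beur : bool).
Hypotheses (wM : weight_seq M) (wA : weight_seq A).
Local Notation pt := (pt R d).
Local Notation testfun := (testfun R d).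
Implicit Types (phi psi : testfun) (l c : R).
Local Notation S := (GS beur M A).

(** The norm of S^{M,l}_{A,1/l} is at most c, in a form free of extended reals and with words
    instead of multi-indices. Increasing l weakens the condition. *)
Definition bnd l c phi := smooth phi /\ forall s x,
  cnorm (DD s phi x) * ew A (l^-1 * eucl x) <= c * (l ^+ size s * M (size s)).

Definition bnd0 l c phi := forall x, cnorm (phi x) * ew A (l^-1 * eucl x) <= c.

Lemma gsnorm_bnd l c phi : 0 < l -> smooth phi ->
  (gsnorm M A l l^-1 phi <= c%:E)%E <-> bnd l c phi.
Proof.
move=> l0 sm.
have Ml s : 0 < l ^+ s * M s by rewrite mulr_gt0 ?exprn_gt0 ?(M_gt0 wM).
split=> [H|[_ H]].
  split=> // s x; rewrite -ler_pdivrMr //.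
  rewrite -lee_fin; apply: le_trans H.
  apply: ereal_sup_ubound; exists (cnt s), x.
  by rewrite -(DD_dmult s sm) mabs_cnt.
apply: ge_ereal_sup => _ [a [x ->]]; rewrite lee_fin ler_pdivrMr //.
by rewrite dmult_DD -size_mseq; exact: H.
Qed.

Lemma gsnorm_ge0 l phi : 0 < l -> (0 <= gsnorm M A l l^-1 phi)%E.
Proof.
move=> l0; apply: (@le_trans _ _ ((cnorm (dmult [ffun=> 0%N] phi 0) * expR (omega A (l^-1 * eucl (0:pt)))
          / (l ^+ mabs ([ffun=> 0%N] : mindex d) * M (mabs ([ffun=> 0%N] : mindex d)))))%:E).
  by rewrite lee_fin divr_ge0 ?mulr_ge0 ?cn_ge0 ?expR_ge0 ?exprn_ge0 ?(M_ge0 wM) // ltW.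
by apply: ereal_sup_ubound; do 2 eexists.
Qed.

Lemma inSlP l phi : 0 < l -> inSl M A l phi <-> exists c, bnd l c phi.
Proof.
move=> l0; split=> [[sm fin]|[c b]].
  have g0 := gsnorm_ge0 phi l0.
  exists (fine (gsnorm M A l l^-1 phi)); apply/gsnorm_bnd => //.
  by rewrite fineK // ge0_fin_numE.
have sm := b.1; split => //.
by move/(gsnorm_bnd c l0 sm): b => /le_lt_trans; apply; rewrite ltry.
Qed.

Lemma GS_P phi : S phi <-> if beur then forall l, 0 < l -> exists c, bnd l c phi
  else exists l, 0 < l /\ exists c, bnd l c phi.
Proof.
rewrite /GS; case: beur; split.
- by move=> H l l0; apply/inSlP => //; exact: H.
- by move=> H l l0; apply/inSlP => //; exact: H.
- by move=> [l [l0 H]]; exists l; split=> //; apply/inSlP.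
- by move=> [l [l0 H]]; exists l; split=> //; apply/inSlP.
Qed.

Lemma GS_smooth phi : S phi -> smooth phi.
Proof.
move=> /GS_P; case: beur; first by move=> /(_ 1 ltr01)[c []].
by move=> [l [_ [c []]]].
Qed.

Lemma bnd_ge0 l c phi : 0 < l -> bnd l c phi -> 0 <= c.
Proof.
move=> l0 [_ /(_ [::] 0)] /=; rewrite expr0 mul1r => h.
rewrite -(pmulr_lge0 _ (M_gt0 wM 0)); apply: le_trans h.
by rewrite mulr_ge0 ?cn_ge0 ?ew_ge0.
Qed.

Lemma bnd_wl l l' c phi : 0 < l -> l <= l' -> bnd l c phi -> bnd l' c phi.
Proof.
move=> l0 ll b; have c0 := bnd_ge0 l0 b; have l'0 := lt_le_trans l0 ll.
case: b => sm H; split=> // s x; apply: le_trans (_ : cnorm (DD s phi x) * ew A (l^-1 * eucl x) <= _).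
  rewrite ler_wpM2l ?cn_ge0 //; apply: ew_scale => //; last exact: eucl_ge0.
    by rewrite invr_ge0 ltW.
  by rewrite lef_pV2.
rewrite (le_trans (H s x)) // ler_wpM2l // ler_wpM2r ?(M_ge0 wM) //.
by rewrite lerXn2r ?nnegrE // ltW.
Qed.

Lemma bnd_wc l c c' phi : 0 < l -> c <= c' -> bnd l c phi -> bnd l c' phi.
Proof.
move=> l0 cc [sm H]; split=> // s x; rewrite (le_trans (H s x)) // ler_wpM2r //.
by rewrite mulr_ge0 ?exprn_ge0 ?(M_ge0 wM) // ltW.
Qed.

Lemma bnd_ZD l c1 c2 (a : R[i]) phi psi : 0 < l -> bnd l c1 phi -> bnd l c2 psi ->
  bnd l (cnorm a * c1 + c2) (fun x => a * phi x + psi x).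
Proof.
move=> l0 [s1 H1] [s2 H2]; split; first exact: smoothZD.
move=> s x; rewrite (DDZD a s s1 s2) mulrDl.
apply: le_trans (_ : (cnorm a * cnorm (DD s phi x) + cnorm (DD s psi x)) * ew A (l^-1 * eucl x) <= _).
  by rewrite ler_wpM2r ?ew_ge0 // (le_trans (cnD _ _)) // cnM.
by rewrite mulrDl lerD // -!mulrA ler_wpM2l ?cn_ge0.
Qed.

Lemma bnd_zero l : 0 < l -> bnd l 0 (fun=> 0).
Proof.
move=> l0; split; first exact: smooth0.
by move=> s x; rewrite DD0 cn0 !mul0r.
Qed.

Lemma bnd_Z l c (a : R[i]) phi : 0 < l -> bnd l c phi -> bnd l (cnorm a * c) (fun x => a * phi x).
Proof.
move=> l0 b; have := bnd_ZD a l0 b (bnd_zero l0); rewrite addr0.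
by congr bnd; apply: funext => x; rewrite addr0.
Qed.

(** A single predicate P of admissible scales serves for both functions, so that later arguments run
    at a fixed scale and return to S through [QQ_imp], in both cases together. *)
Lemma GS_common phi psi : S phi -> S psi -> exists P : R -> Prop,
  (forall l, P l -> 0 < l /\ exists c, bnd l c phi /\ bnd l c psi) /\ (QQ (~~ beur) P).
Proof.
move=> /GS_P h1 /GS_P h2.
exists (fun l => 0 < l /\ exists c, bnd l c phi /\ bnd l c psi); split=> //.
rewrite /QQ; case: (beur) h1 h2 => /=.
  move=> h1 h2 l l0; split=> //; have [c1 b1] := h1 l l0; have [c2 b2] := h2 l l0.
  exists (Num.max c1 c2); split.
    by apply: bnd_wc b1; rewrite // le_max lexx.
  by apply: bnd_wc b2; rewrite // le_max lexx orbT.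
move=> [l1 [l10 [c1 b1]]] [l2 [l20 [c2 b2]]].
have m0 : 0 < Num.max l1 l2 by rewrite lt_max l10.
exists (Num.max l1 l2); split => //; split => //; exists (Num.max c1 c2); split.
  apply: bnd_wc (_ : c1 <= _) _; rewrite ?le_max ?lexx //; apply: bnd_wl b1; rewrite ?le_max ?lexx //.
apply: bnd_wc (_ : c2 <= _) _; rewrite ?le_max ?lexx ?orbT //; apply: bnd_wl b2; rewrite ?le_max ?lexx ?orbT //.
Qed.

Lemma GS_ZD (a : R[i]) phi psi : S phi -> S psi -> S (fun x => a * phi x + psi x).
Proof.
move=> h1 h2; have [P [HP HQ]] := GS_common h1 h2; apply/GS_P; move: HQ; rewrite /QQ.
case: beur => /=.
  move=> H l l0; have [_ [c [b1 b2]]] := HP l (H l l0).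
  by exists (cnorm a * c + c); exact: bnd_ZD.
move=> [l [l0 H]]; have [_ [c [b1 b2]]] := HP l H; exists l; split=> //.
by exists (cnorm a * c + c); exact: bnd_ZD.
Qed.

Lemma GS_0 : S ((fun=> 0) : testfun).
Proof.
apply/GS_P; case: beur => [l l0|]; first by exists 0; exact: bnd_zero.
by exists 1; split => //; exists 0; exact: bnd_zero.
Qed.

Lemma GS_Z (a : R[i]) phi : S phi -> S (fun x => a * phi x).
Proof.
move=> h; have := GS_ZD a h GS_0.
by congr GS; apply: funext => x; rewrite addr0.
Qed.

Lemma GS_sum (I : Type) (r : seq I) (c : I -> R[i]) (F : I -> testfun) :
  (forall i, S (F i)) -> S (fun x => \sum_(i <- r) c i * F i x).
Proof.
move=> h; elim: r => [|i r IH].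
  by move: GS_0; congr GS; apply: funext => x; rewrite big_nil.
by move: (GS_ZD (c i) (h i) IH); congr GS; apply: funext => x; rewrite big_cons.
Qed.

Lemma GS_beur phi : GS true M A phi -> S phi.
Proof.
move=> H; rewrite /GS; case: beur; first exact: H.
by exists 1; split => //; exact: H.
Qed.

Section Ultra.
Variable T : functional R d.
Hypothesis uT : ultradist beur M A T.

Lemma ult_ZD (a : R[i]) phi psi : S phi -> S psi ->
  T (fun x => a * phi x + psi x) = a * T phi + T psi.
Proof. by case: uT => H _; exact: H. Qed.

Lemma ult_0 : T (fun=> 0) = 0.
Proof.
have := ult_ZD (-1) GS_0 GS_0.
rewrite (_ : (fun x => _) = (fun=> 0)); last by apply: funext => x; rewrite mulr0 addr0.
by rewrite [_ * T _]mulN1r addNr.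
Qed.

Lemma ult_Z (a : R[i]) phi : S phi -> T (fun x => a * phi x) = a * T phi.
Proof.
move=> h; have := ult_ZD a h GS_0; rewrite ult_0 addr0 => <-.
by congr T; apply: funext => x; rewrite addr0.
Qed.

Lemma ult_sum (I : Type) (r : seq I) (c : I -> R[i]) (F : I -> testfun) :
  (forall i, S (F i)) -> T (fun x => \sum_(i <- r) c i * F i x) = \sum_(i <- r) c i * T (F i).
Proof.
move=> h; elim: r => [|i r IH].
  rewrite big_nil -[RHS]ult_0; congr T; apply: funext => x; by rewrite big_nil.
rewrite big_cons -IH -(ult_ZD (c i) (h i) (GS_sum r c h)).
by congr T; apply: funext => x; rewrite big_cons.
Qed.

(** The constant supplied by [ultradist] may be negative, hence the passage to [Num.max 0 C]. *)
Lemma ult_bnd : QQ beur (fun l => exists2 C, 0 <= C & forall phi c, S phi -> bnd l c phi -> cnorm (T phi) <= C * c).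
Proof.
have main l C phi c : 0 < l -> bnd l c phi ->
   ((cnorm (T phi))%:E <= C%:E * gsnorm M A l l^-1 phi)%E -> cnorm (T phi) <= Num.max 0 C * c.
  move=> l0 b H; have c0 := bnd_ge0 l0 b; have sm := b.1.
  rewrite -lee_fin EFinM; apply: le_trans H _.
  apply: (@le_trans _ _ ((Num.max 0 C)%:E * gsnorm M A l l^-1 phi)%E).
    by apply: lee_wpmul2r; rewrite ?gsnorm_ge0 // lee_fin le_max lexx orbT.
  by apply: lee_wpmul2l; [rewrite lee_fin le_max lexx|exact/gsnorm_bnd].
case: uT => _; rewrite /QQ /GS; case: beur.
  move=> [l [C [l0 H]]]; exists l; split=> //; exists (Num.max 0 C); first by rewrite le_max lexx.
  by move=> phi c Sphi b; apply: (main l) => //; exact: H.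
move=> H l l0; have [C HC] := H l l0; exists (Num.max 0 C); first by rewrite le_max lexx.
move=> phi c _ b; apply: (main l) => //; apply: HC; apply/inSlP => //; by exists c.
Qed.

End Ultra.

End Spaces.

(** * Riemann sums *)

Section RiemannSums.
Variable R : realType.
Local Notation mu := (@lebesgue_measure R).
Implicit Types (v : R -> R) (C eta : R).

Lemma w1_continuous : continuous (@w1 R).
Proof. exact: continuous_oneDsqrV. Qed.

Lemma w1_integralT : (\int[mu]_x (w1 x)%:E = pi%:E)%E.
Proof.
rewrite ge0_symfun_integralT.
- rewrite (_ : [set x : R | 0 <= x] = `[0, +oo[%classic); last by rewrite set_itvcy.
  rewrite [X in (_ * X)%E](_ : _ = (pi / 2)%:E); last exact: integral0y_oneDsqr.
  by rewrite -EFinM mulrC divfK.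
- by move=> x; exact: w1_ge0.
- exact: w1_continuous.
- by move=> x; rewrite /w1 /= sqrrN.
Qed.

Lemma w1_integrable : mu.-integrable setT (EFin \o @w1 R).
Proof.
apply/integrableP; split.
  apply/measurable_EFinP; exact: continuous_measurable_fun w1_continuous.
under eq_integral => x _ do rewrite /= ger0_norm ?w1_ge0 //.
by rewrite w1_integralT ltry.
Qed.

Lemma w1_integral_itv a b : a < b -> \int[mu]_(x in `[a, b]) w1 x = atan b - atan a.
Proof.
move=> ab; rewrite /Rintegral (@continuous_FTC2 _ (@w1 R) atan) //.
- by apply: continuous_subspaceT; exact: w1_continuous.
- split; first by move=> x _; exact: derivable_atan.
    by apply: cvg_at_right_filter; exact: continuous_atan.
  by apply: cvg_at_left_filter; exact: continuous_atan.
- by move=> x _; exact: derive1_atan.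
Qed.

Definition Lip C v := forall s t, `|v s - v t| <= C * `|s - t|.

Lemma Lip_continuous C v : 0 <= C -> Lip C v -> continuous v.
Proof.
move=> C0 H x; apply/cvgrPdist_le => e e0.
have C1 : 0 < 1 + C by rewrite ltr_pwDl.
apply/nbhs_ballP; exists (e / (1 + C)); first exact: divr_gt0.
move=> y; rewrite /ball /= ltr_pdivlMr // => h.
rewrite (le_trans (H _ _)) // ltW // (le_lt_trans _ h) // mulrC ler_wpM2l // lerDr //.
Qed.

(** One constant controls both the decay and the Lipschitz modulus. On this class Riemann sums
    converge at a rate proportional to that constant, so one variable can be integrated with the
    others as parameters. *)
Definition rcls C v := (forall t, `|v t| <= C * w1 t) /\ Lip C v.

Lemma rcls_ge0 C v : rcls C v -> 0 <= C.
Proof. by case=> /(_ 0) h _; rewrite -(pmulr_lge0 _ (w1_gt0 0)) (le_trans _ h). Qed.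

Lemma rcls_integrable C v (D : set R) : measurable D -> rcls C v -> mu.-integrable D (EFin \o v).
Proof.
move=> mD H; have C0 := rcls_ge0 H; case: H => H1 H2.
apply: (@integrableS _ _ _ _ setT) => //.
apply: (@le_integrable _ _ _ mu setT measurableT _ (fun x => (C * w1 x)%:E)).
- by apply/measurable_EFinP; exact: continuous_measurable_fun (Lip_continuous C0 H2).
- by move=> x _; rewrite /= lee_fin [leRHS]ger0_norm ?mulr_ge0 ?w1_ge0.
- have := @integrableZl _ _ _ mu setT measurableT C _ w1_integrable.
  by congr (integrable _ _ _).
Qed.

Lemma cell_estimate C v p eta q : rcls C v -> 0 < eta -> p <= q <= p + eta ->
  `|\int[mu]_(x in `]p, p + eta]) v x - eta * v q| <= eta * (C * eta).
Proof.
move=> H eta0 /andP[pq qp]; have C0 := rcls_ge0 H.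
have mD : measurable (`]p, p + eta]%classic : set R) by [].
have muD : mu (`]p, p + eta]%classic : set R) = eta%:E.
  by rewrite lebesgue_measure_itv /= lte_fin ltrDl eta0 -EFinB addrC addKr.
have ic r : mu.-integrable (`]p, p + eta]%classic : set R) (EFin \o (fun=> r)).
  apply/integrableP; split; first by apply/measurable_EFinP.
  by rewrite /= integral_cst // [X in (_ * X)%E](_ : _ = eta%:E) // -EFinM ltry.
have cstI r : \int[mu]_(x in `]p, p + eta]) r = r * eta.
  by rewrite Rintegral_cst //; congr (_ * _); rewrite -[RHS]/(fine eta%:E); congr fine; exact: muD.
have ivr : mu.-integrable (`]p, p + eta]%classic : set R) (EFin \o v) by exact: rcls_integrable H.
rewrite (_ : eta * v q = \int[mu]_(x in `]p, p + eta]) v q); last by rewrite cstI mulrC.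
have ivq : mu.-integrable (`]p, p + eta]%classic : set R) (EFin \o (fun x => v x - v q)).
  have := @integrableB _ _ _ mu _ mD (EFin \o v) (EFin \o (fun=> v q)) ivr (ic (v q)).
  by congr (integrable _ _ _).
rewrite -RintegralB // (le_trans (le_normr_Rintegral _ _)) //.
rewrite (_ : eta * (C * eta) = \int[mu]_(x in `]p, p + eta]) (C * eta)); last first.
  by rewrite cstI mulrC.
apply: le_Rintegral => //.
  have := integrable_abse ivq; by congr (integrable _ _ _).
move=> x /=; rewrite in_itv /= => /andP[px xp].
rewrite (le_trans (H.2 _ _)) // ler_wpM2l // ler_norml; apply/andP; split; lra.
Qed.

Lemma riemann_itv C v a eta n : rcls C v -> 0 < eta ->
  `|\int[mu]_(x in `[a, a + n%:R * eta]) v x - \sum_(m < n) eta * v (a + (m%:R + 2^-1) * eta)| <=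
   n%:R * (eta * (C * eta)).
Proof.
move=> H eta0; elim: n => [|n IH].
  by rewrite big_ord0 !mul0r addr0 set_itv1 Rintegral_set1 subr0 normr0.
have lnn : n%:R * eta <= n.+1%:R * eta by rewrite ler_pM2r // ler_nat.
have := @Rintegral_itvB _ v (BLeft a) (BRight (a + n.+1%:R * eta)) (a + n%:R * eta).
move=> /(_ (rcls_integrable (measurable_itv _) H)).
rewrite !bnd_simp lerDl lerD2l mulr_ge0 ?ler0n ?(ltW eta0) //= => /(_ isT lnn) /eqP; rewrite subr_eq => /eqP ->.
rewrite big_ord_recr /= -natr1 mulrDl mul1r addrA.
set I2 := (X in `|_ + X - _|); set I1 := (X in `|X + _ - _|).
rewrite (_ : I1 + I2 - _ = (I2 - \sum_(m < n) eta * v (a + (m%:R + 2^-1) * eta)) +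
  (I1 - eta * v (a + (n%:R + 2^-1) * eta))); last by ring.
rewrite [leRHS]mulrDl mul1r (le_trans (ler_normD _ _)) // lerD //.
apply: cell_estimate => //; rewrite mulrDl addrA; apply/andP; split; lra.
Qed.

(** The part outside the grid is dominated by C times the integral of [w1] there, and the total mass
    of [w1] is pi. *)
Lemma riemann_line C v a eta n : rcls C v -> 0 < eta ->
  `|\int[mu]_x v x - \sum_(m < n) eta * v (a + (m%:R + 2^-1) * eta)| <=
   n%:R * (eta * (C * eta)) + C * (pi - (atan (a + n%:R * eta) - atan a)).
Proof.
move=> H eta0; have C0 := rcls_ge0 H.
have n0 : 0 <= n%:R * eta by rewrite mulr_ge0 // ltW.
set b := a + n%:R * eta.
set D := (`[a, b]%classic : set R).
have mD : measurable D by exact: measurable_itv.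
have split_int f : mu.-integrable setT (EFin \o f) ->
    \int[mu]_x f x = \int[mu]_(x in D) f x + \int[mu]_(x in ~` D) f x.
  move=> fi; rewrite -(setUv D) Rintegral_setU ?setUv //; first exact: measurableC.
  exact/disj_setPCl.
have wD : \int[mu]_(x in D) w1 x = atan b - atan a.
  have [n1|n1] := eqVneq (n%:R * eta) 0.
    by rewrite /D /b n1 addr0 subrr set_itv1 Rintegral_set1.
  by apply: w1_integral_itv; rewrite /b ltrDl lt_def n1.
have wC : \int[mu]_(x in ~` D) w1 x = pi - (atan b - atan a).
  have := split_int _ w1_integrable.
  rewrite {1}/Rintegral w1_integralT /= wD => ->; ring.
rewrite split_int; last exact: rcls_integrable H.
rewrite addrAC (le_trans (ler_normD _ _)) // lerD //; first exact: riemann_itv.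
rewrite -wC -RintegralZl //; first last.
- by apply: integrableS w1_integrable => //; exact: measurableC.
- exact: measurableC.
have iv : mu.-integrable (~` D) (EFin \o v) by apply: (rcls_integrable _ H); exact: measurableC.
rewrite (le_trans (le_normr_Rintegral _ iv)) //; first exact: measurableC.
apply: le_Rintegral.
- exact: measurableC.
- have := integrable_abse iv; by congr (integrable _ _ _).
- apply: (@integrableS _ _ _ mu setT (~` D)) => //; first exact: measurableC.
  have := @integrableZl _ _ _ mu setT measurableT C _ w1_integrable.
  by congr (integrable _ _ _).
- by move=> x _; exact: H.1.
Qed.

(* Midpoint grid on [c - (2N+1)L/2, c + (2N+1)L/2]: 2N+1 cells of length L centred at c + kL,
   each cut into (N+1)^2 pieces. *)
Definition gstep (L : R) (N : nat) : R := L / (N.+1 ^ 2)%:R.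
Definition gnum (N : nat) : nat := ((2 * N).+1 * N.+1 ^ 2)%N.
Definition gpt (L : R) (N m : nat) : R := - ((2 * N).+1%:R * L / 2) + (m%:R + 2^-1) * gstep L N.

Lemma gstep_gt0 L N : 0 < L -> 0 < gstep L N.
Proof. by move=> L0; rewrite divr_gt0 // ltr0n expn_gt0. Qed.

Lemma gnum_step L N : (gnum N)%:R * gstep L N = (2 * N).+1%:R * L.
Proof.
by rewrite /gnum /gstep natrM -mulrA; congr (_ * _); rewrite mulrC divfK // pnatr_eq0 expn_eq0.
Qed.

Lemma archi_le (x : R) : exists n : nat, x <= n%:R.
Proof.
by exists (Num.bound `|x|); rewrite ltW // (le_lt_trans (ler_norm _)) // archi_boundP.
Qed.

(** N0 is chosen before the function and the error is proportional to the class constant; this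
    uniformity carries through to convolutions. The centre c is free so that translated grids are
    covered. *)
Lemma riemann_cvg (L c e : R) : 0 < L -> 0 < e -> exists N0, forall N, (N0 <= N)%N -> forall C v, rcls C v ->
  `|\int[mu]_x v x - \sum_(m < gnum N) gstep L N * v (c + gpt L N m)| <= e * C.
Proof.
move=> L0 e0; have e40 : 0 < e / 4 by rewrite divr_gt0.
have [B B0 HB] : exists2 B : R, 0 <= B & forall x, B <= x -> pi / 2 - atan x <= e / 4.
  have /cvgrPdist_le/(_ _ e40)[B [_ HB]] := @cvgy_atan R.
  exists (Num.max 0 (B + 1)); first by rewrite le_max lexx.
  move=> x; rewrite ge_max => /andP[_ Bx]; rewrite (le_trans (ler_norm _)) //; apply: HB; lra.
(* The first term makes the grid cover [-B, B]; the second makes the total cell error, (2N+1) L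
   times C L / (N+1)^2, at most e C / 2. *)
pose K : R := (B + `|c|) / L + 2 * L * L / (e / 4).
have [N0 HN0] := archi_le K.
exists N0 => N NN C v Hv; have C0 := rcls_ge0 Hv.
have KN : K <= N%:R by rewrite (le_trans HN0) // ler_nat.
have := @riemann_line C v (c - (2 * N).+1%:R * L / 2) (gstep L N) (gnum N) Hv (gstep_gt0 N L0).
under eq_bigr => m _ do rewrite -[c - _ + _]addrA -/(gpt L N m).
move/le_trans; apply.
rewrite gnum_step.
set r := (2 * N).+1%:R * L / 2.
have rL : (2 * N).+1%:R * L = r + r by rewrite /r -splitr.
have rB : B + `|c| <= r.
  have : (B + `|c|) / L <= N%:R.
    by apply: le_trans KN; rewrite /K lerDl divr_ge0 ?ltW // !mulr_gt0.
  rewrite ler_pdivrMr // => /le_trans; apply.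
  rewrite /r -[(_ * L) / 2]mulrAC ler_pM2r // ler_pdivlMr // -natrM ler_nat; lia.
rewrite rL (_ : c - r + (r + r) = c + r); last by ring.
have h1 : pi - (atan (c + r) - atan (c - r)) <= e / 2.
  have -> : c - r = - (r - c) by rewrite opprB.
  rewrite atanN opprK.
  have a1 : pi / 2 - atan (c + r) <= e / 4 by apply: HB; have := ler_norm (- c); rewrite normrN; lra.
  have a2 : pi / 2 - atan (r - c) <= e / 4 by apply: HB; have := ler_norm c; lra.
  lra.
have h2 : (gnum N)%:R * (gstep L N * (C * gstep L N)) <= e / 2 * C.
  rewrite mulrA gnum_step mulrCA mulrC ler_wpM2r //.
  rewrite /gstep mulrA ler_pdivrMr ?ltr0n ?expn_gt0 //.
  have : 2 * L * L / (e / 4) <= N%:R.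
    apply: le_trans KN; rewrite /K lerDr divr_ge0 ?(ltW L0) //.
    by rewrite addr_ge0.
  rewrite ler_pdivrMr // => h; rewrite rL.
  have n1 : (N.+1 ^ 2)%:R = (N%:R + 1) ^+ 2 :> R by rewrite natrX natr1.
  have rr : r + r = (2 * N%:R + 1) * L by rewrite -rL -natr1 natrM.
  rewrite rr n1; have N0' : 0 <= N%:R :> R by [].
  move: h N0'; set n := N%:R; nra.
rewrite mulrC in h1 *; nra.
Qed.

Definition cint (u : R -> R[i]) : R[i] := Defs.Rint (fun t => cRe (u t)) +i* Defs.Rint (fun t => cIm (u t)).
End RiemannSums.

(** * Iterated integrals *)

Section Line.
Variable R : realType.
Implicit Types (u v : R -> R[i]) (C K : R).
Definition cls1 C u := (forall t, cnorm (u t) <= C * w1 t) /\ (forall s t, cnorm (u s - u t) <= C * `|s - t|).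
Definition wsum n (W p : nat -> R) u : R[i] := \sum_(m < n) (W m)%:C * u (p m).

Lemma cls1_ge0 C u : cls1 C u -> 0 <= C.
Proof. by case=> /(_ 0) h _; rewrite -(pmulr_lge0 _ (w1_gt0 0)) (le_trans _ h) // cn_ge0. Qed.

Lemma cls1_Re C u : cls1 C u -> rcls C (fun t => cRe (u t)).
Proof.
by case=> h1 h2; split=> [t|s t]; [rewrite (le_trans (cnRe _)) | rewrite -cReB (le_trans (cnRe _))].
Qed.

Lemma cls1_Im C u : cls1 C u -> rcls C (fun t => cIm (u t)).
Proof.
by case=> h1 h2; split=> [t|s t]; [rewrite (le_trans (cnIm _)) | rewrite -cImB (le_trans (cnIm _))].
Qed.

Lemma cRe_sum (I : Type) (r : seq I) (F : I -> R[i]) : cRe (\sum_(i <- r) F i) = \sum_(i <- r) cRe (F i).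
Proof. by elim: r => [|i r IH]; rewrite ?big_nil ?big_cons // cReD IH. Qed.

Lemma cIm_sum (I : Type) (r : seq I) (F : I -> R[i]) : cIm (\sum_(i <- r) F i) = \sum_(i <- r) cIm (F i).
Proof. by elim: r => [|i r IH]; rewrite ?big_nil ?big_cons // cImD IH. Qed.

Lemma cint_riemann (L c e : R) : 0 < L -> 0 < e -> exists N0, forall N, (N0 <= N)%N -> forall C u, cls1 C u ->
  cnorm (cint u - wsum (gnum N) (fun=> gstep L N) (fun m => c + gpt L N m) u) <= e * C.
Proof.
move=> L0 e0; have e20 : 0 < e / 2 by rewrite divr_gt0.
have [N0 H] := riemann_cvg c L0 e20; exists N0 => N NN C u Hu.
rewrite (le_trans (cn_le _)) // (splitr e) mulrDl lerD //.
  rewrite cReB cRe_sum; under eq_bigr do rewrite cReRM.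
  exact: (H N NN C _ (cls1_Re Hu)).
rewrite cImB cIm_sum; under eq_bigr do rewrite cImRM.
exact: (H N NN C _ (cls1_Im Hu)).
Qed.

(** Integrals are identified through their Riemann sums, so that invariance properties come from
    identities between finite sums. *)
Lemma cint_uniq (L c : R) u C z : 0 < L -> cls1 C u ->
  (forall e, 0 < e -> exists N0, forall N, (N0 <= N)%N ->
     cnorm (wsum (gnum N) (fun=> gstep L N) (fun m => c + gpt L N m) u - z) <= e) -> cint u = z.
Proof.
move=> L0 Hu H; have C0 := cls1_ge0 Hu.
apply/eqP; rewrite -subr_eq0; apply/eqP; apply: cn_arb => e e0.
have e20 : 0 < e / 2 by rewrite divr_gt0.
have [N1 H1] := H _ e20.
have [N2 H2] := cint_riemann c L0 (divr_gt0 e20 (ltr_pwDl ltr01 C0)).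
set N := maxn N1 N2; have {}H1 := H1 N (leq_maxl _ _); have {}H2 := H2 N (leq_maxr _ _) C u Hu.
apply: le_trans (cn_tri _ _ _) _; apply: le_trans (lerD H2 H1) _; rewrite [leRHS]splitr lerD2r.
by rewrite mulrAC ler_pdivrMr ?ltr_pwDl // ler_wpM2l ?(ltW e20) // lerDr.
Qed.

Lemma w1_shift (t c : R) : w1 (t - c) <= 2 * (1 + c ^+ 2) * w1 t.
Proof.
rewrite /w1 ler_pdivlMr ?ltr_pwDl ?sqr_ge0 // mulrC ler_pdivrMr ?ltr_pwDl ?sqr_ge0 //.
have := sqr_ge0 (c * (t - c)); have := sqr_ge0 (t - c - c); rewrite !expr2; nra.
Qed.

Lemma cls1_shift C u c : cls1 C u -> cls1 (2 * (1 + c ^+ 2) * C) (fun t => u (t - c)).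
Proof.
move=> H; have C0 := cls1_ge0 H; case: H => h1 h2; split=> [t|s t].
  by rewrite (le_trans (h1 _)) // [leRHS]mulrAC [leRHS]mulrC ler_wpM2l // w1_shift.
rewrite (le_trans (h2 _ _)) // (_ : s - c - (t - c) = s - t); last by ring.
rewrite ler_wpM2r // ler_peMl //; have := sqr_ge0 c; lra.
Qed.

(** The Riemann sum of the shifted function on the grid centred at 0 is that of u on the grid
    centred at -c. *)
Lemma cint_shift C u c : cls1 C u -> cint (fun t => u (t - c)) = cint u.
Proof.
move=> H; apply: (@cint_uniq 1 0 _ _ _ ltr01 (cls1_shift c H)) => e e0.
have C1 : 0 < 1 + C by rewrite ltr_pwDl // (cls1_ge0 H).
have [N0 HN] := cint_riemann (- c) ltr01 (divr_gt0 e0 C1).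
exists N0 => N /HN/(_ _ _ H); rewrite cnBC.
rewrite (_ : wsum _ _ _ u = wsum (gnum N) (fun=> gstep 1 N) (fun m => 0 + gpt 1 N m) (fun t => u (t - c))).
  by move=> /le_trans; apply; rewrite mulrAC ler_pdivrMr // ler_wpM2l ?(ltW e0) // lerDr.
by apply: eq_bigr => m _; rewrite add0r [- c + _]addrC.
Qed.

Lemma wsum0 n W p u : wsum n W (fun m => 0 + p m) u = wsum n W p u.
Proof. by apply: eq_bigr => m _; rewrite add0r. Qed.

Lemma gpt_rev (L : R) N (m : 'I_(gnum N)) : gpt L N (rev_ord m) = - gpt L N m.
Proof.
rewrite /gpt /= -(gnum_step L) natrB ?ltn_ord // -natr1; by field.
Qed.

Lemma wsum_refl (L : R) N u : wsum (gnum N) (fun=> gstep L N) (gpt L N) (fun t => u (- t)) =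
  wsum (gnum N) (fun=> gstep L N) (gpt L N) u.
Proof.
rewrite /wsum (reindex_inj rev_ord_inj) /=; apply: eq_bigr => m _.
by rewrite -[(gnum N - m.+1)%N]/(nat_of_ord (rev_ord m)) gpt_rev opprK.
Qed.

Lemma cint_refl C u : cls1 C u -> cint (fun t => u (- t)) = cint u.
Proof.
move=> H.
have H' : cls1 C (fun t => u (- t)).
  case: H => h1 h2; split=> [t|s t]; first by have := h1 (- t); rewrite /w1 sqrrN.
  by have := h2 (- s) (- t); rewrite -opprD normrN.
apply: (@cint_uniq 1 0 _ _ _ ltr01 H') => e e0.
have C1 : 0 < 1 + C by rewrite ltr_pwDl // (cls1_ge0 H).
have [N0 HN] := cint_riemann 0 ltr01 (divr_gt0 e0 C1).
exists N0 => N /HN/(_ _ _ H); rewrite cnBC.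
rewrite !wsum0 wsum_refl => /le_trans; apply.
by rewrite mulrAC ler_pdivrMr // ler_wpM2l ?(ltW e0) // lerDr.
Qed.

Lemma w1_rcls : rcls 1 (@w1 R).
Proof.
split=> [t|s t]; first by rewrite mul1r ger0_norm ?w1_ge0.
have p1 (x : R) : 0 < 1 + x ^+ 2 by rewrite ltr_pwDl ?sqr_ge0.
have -> : w1 s - w1 t = (t - s) * ((t + s) * (w1 s * w1 t)).
  by rewrite /w1; field; rewrite !gt_eqF.
rewrite normrM mul1r distrC ler_piMr //.
rewrite normrM [X in _ * X]ger0_norm ?mulr_ge0 ?w1_ge0 // /w1 -invfM ler_pdivrMr ?mulr_gt0 // mul1r.
rewrite ler_norml; apply/andP.
have := sqr_ge0 (s - 1); have := sqr_ge0 (t - 1); have := sqr_ge0 (s + 1); have := sqr_ge0 (t + 1).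
have := sqr_ge0 (s * t); rewrite !expr2; nra.
Qed.

(** On [cls1] these are the functionals vanishing at 0 and Lipschitz for the weighted sup norm. The
    integral, Riemann sums, lattice sums and Fejer sums are all of this kind, so the iteration over
    coordinates is estimated once for all of them. *)
Definition mono K (U : (R -> R[i]) -> R[i]) := U (fun=> 0) = 0 /\
  forall C u v (h : R), cls1 C u -> cls1 C v -> (forall t, cnorm (u t - v t) <= h * w1 t) ->
  cnorm (U u - U v) <= K * h.

Lemma wsum_mono n (W p : nat -> R) K : (forall m, 0 <= W m) -> \sum_(m < n) W m * w1 (p m) <= K -> mono K (wsum n W p).
Proof.
move=> W0 WK; split; first by rewrite /wsum big1 // => m _; rewrite mulr0.
move=> C u v h _ _ uv; rewrite /wsum -sumrB (le_trans (cn_sum _ _ _)) //.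
have h0 : 0 <= h by rewrite -(pmulr_lge0 _ (w1_gt0 0)) (le_trans _ (uv 0)) // cn_ge0.
apply: (@le_trans _ _ (\sum_(m < n) W m * w1 (p m) * h)); last by rewrite -mulr_suml ler_wpM2r.
apply: ler_sum => m _; rewrite -mulrBr cnM cnR ger0_norm // -mulrA ler_wpM2l // mulrC; exact: uv.
Qed.

Lemma grid_w1 (L : R) : 0 < L -> exists N0, forall N, (N0 <= N)%N ->
  \sum_(m < gnum N) gstep L N * w1 (gpt L N m) <= pi + 1.
Proof.
move=> L0; have [N0 HN] := riemann_cvg 0 L0 ltr01; exists N0 => N /HN/(_ _ _ w1_rcls).
rewrite {1}/Rintegral w1_integralT /= mulr1.
under eq_bigr do rewrite add0r.
rewrite ler_norml => /andP[h _]; lra.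
Qed.

Lemma cint_mono : mono (pi + 1) (@cint R).
Proof.
split.
  by rewrite /cint /Defs.Rint /Rintegral !integral0.
move=> C u v h Hu Hv uv; have C0 := cls1_ge0 Hu.
apply/ler_addgt0Pr => e e0.
have e20 : 0 < e / 2 by rewrite divr_gt0.
have [N1 H1] := cint_riemann 0 ltr01 (divr_gt0 e20 (ltr_pwDl ltr01 C0)).
have [N2 H2] := grid_w1 ltr01.
set N := maxn N1 N2; have {}H1 := H1 N (leq_maxl _ _); have {}H2 := H2 N (leq_maxr _ _).
have [_ H3] := @wsum_mono (gnum N) (fun=> gstep 1 N) (gpt 1 N) _ (fun=> ltW (gstep_gt0 N ltr01)) H2.
have bd u' : cls1 C u' -> cnorm (cint u' - wsum (gnum N) (fun=> gstep 1 N) (gpt 1 N) u') <= e / 2.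
  move=> /H1; rewrite wsum0 => /le_trans; apply.
  by rewrite mulrAC ler_pdivrMr ?ltr_pwDl // ler_wpM2l ?(ltW e20) // lerDr.
rewrite (le_trans (cn_tri _ (wsum (gnum N) (fun=> gstep 1 N) (gpt 1 N) u) _)) //.
rewrite [leRHS](_ : _ = e / 2 + ((pi + 1) * h + e / 2)); last by field.
rewrite lerD ?bd // (le_trans (cn_tri _ (wsum (gnum N) (fun=> gstep 1 N) (gpt 1 N) v) _)) // lerD //.
  exact: (H3 C u v h Hu Hv uv).
by rewrite cnBC bd.
Qed.

End Line.

Section Iter.
Variables (R : realType) (d : nat).
Local Notation pt := (pt R d).
Local Notation testfun := (testfun R d).
Implicit Types (g : testfun) (x : pt) (s : seq 'I_d) (C K : R).
(** Weight in the coordinates that remain after those in s have been integrated out. *)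
Definition wo s x : R := \prod_(i < d | i \notin s) w1 (x ord0 i).

(** The Lipschitz bound in coordinate j keeps the decay in the other coordinates and asks for none
    in j: this is the shape that survives the integration of one coordinate. *)
Definition cls C g := (forall x, cnorm (g x) <= C * wt x) /\
  forall x j a b, cnorm (g (upd x j a) - g (upd x j b)) <= C * `|a - b| * wo [:: j] x.

Definition it (U : (R -> R[i]) -> R[i]) s g : testfun :=
  foldr (fun j G x => U (fun t => G (upd x j t))) g s.

Lemma updE x j t k : upd x j t ord0 k = if k == j then t else x ord0 k.
Proof. by rewrite mxE. Qed.

Lemma upd_comm x j k a b : j != k -> upd (upd x j a) k b = upd (upd x k b) j a.
Proof.
move=> jk; apply/rowP => i; rewrite !updE; case: (eqVneq i k) => // ->.
by rewrite eq_sym (negPf jk).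
Qed.

Lemma wo_ge0 s x : 0 <= wo s x.
Proof. by apply: prodr_ge0 => i _; exact: w1_ge0. Qed.

Lemma wo_cons j s x t : j \notin s -> wo s (upd x j t) = w1 t * wo (j :: s) x.
Proof.
move=> js; rewrite /wo (bigD1 j) //= updE eqxx; congr (_ * _).
apply: eq_big => [i|i /andP[_ ij]]; first by rewrite inE negb_or andbC.
by rewrite updE (negPf ij).
Qed.

Lemma wt_wo x : wt x = wo [::] x. Proof. by []. Qed.

(** Integrating out j costs a factor K and removes j from the weight: the slices in direction j lie
    in [cls1], with a constant that still carries the decay in the remaining coordinates. *)
Lemma it_cls K U s g C : mono K U -> cls C g -> uniq s ->
  (forall x, cnorm (it U s g x) <= C * K ^+ size s * wo s x) /\
  (forall x j a b, j \notin s -> cnorm (it U s g (upd x j a) - it U s g (upd x j b)) <=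
     C * K ^+ size s * `|a - b| * wo (j :: s) x).
Proof.
move=> [U0 HU] [g1 g2]; elim: s => [_|j s IH /= /andP[js us]].
  split=> [x|x j a b _]; first by rewrite mulr1 -wt_wo.
  by rewrite mulr1; exact: g2.
have [{}h1 {}h2] := IH us.
have Hc x : cls1 (C * K ^+ size s * wo (j :: s) x) (fun t => it U s g (upd x j t)).
  split=> [t|a b]; first by rewrite (le_trans (h1 _)) // wo_cons // mulrA mulrAC.
  by rewrite (le_trans (h2 _ _ _ _ js)) // mulrAC.
have c0 : cls1 0 (fun=> 0 : R[i]).
  by split=> [t|a b]; rewrite ?subrr cn0 mul0r.
have mono1 C1 u : cls1 C1 u -> cnorm (U u) <= K * C1.
  move=> Hu; rewrite -[U u]subr0 -U0; apply: (HU C1) => //.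
    by have C10 := cls1_ge0 Hu; split=> [t|a b]; rewrite ?subrr cn0 mulr_ge0 ?w1_ge0.
  by move=> t; rewrite subr0; exact: Hu.1.
split=> [x|x k a b]; first by rewrite (le_trans (mono1 _ _ (Hc x))) // exprS; move: (wo _ _) => ?; rewrite le_eqVlt; apply/orP; left; apply/eqP; ring.
rewrite inE negb_or => /andP[kj ks].
(* The class constants of the two slices depend on the base points. The larger one serves for both,
   and it disappears because the conclusion of [mono] does not involve it. *)
set CC := Num.max (C * K ^+ size s * wo (j :: s) (upd x k a)) (C * K ^+ size s * wo (j :: s) (upd x k b)).
have cw c1 c2 (u : R -> R[i]) : c1 <= c2 -> cls1 c1 u -> cls1 c2 u.
  move=> c12 [v1 v2]; split=> [t|y z]; first by rewrite (le_trans (v1 _)) // ler_wpM2r ?w1_ge0.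
  by rewrite (le_trans (v2 _ _)) // ler_wpM2r.
apply: le_trans (HU CC _ _ (C * K ^+ size s * `|a - b| * wo (k :: j :: s) x) (cw _ _ _ _ (Hc _)) (cw _ _ _ _ (Hc _)) _) _.
- by rewrite le_max lexx.
- by rewrite le_max lexx orbT.
- move=> t; rewrite ![upd (upd x k _) j t]upd_comm // (le_trans (h2 _ _ _ _ ks)) // wo_cons ?inE ?negb_or 1?eq_sym ?kj //.
  rewrite (_ : wo (j :: k :: s) x = wo (k :: j :: s) x); last first.
    by apply: eq_bigl => i; rewrite !inE; case: (i == j); case: (i == k).
  by rewrite [w1 t * _]mulrC mulrA.
- by rewrite exprS le_eqVlt; apply/orP; left; apply/eqP; move: (wo _ _) `|_| => ? ?; ring.
Qed.

(** U is exchanged for V one coordinate at a time, which explains the factor [size s]. *)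
Lemma it_approx K U V s g C e : 1 <= K -> mono K U -> mono K V -> cls C g -> uniq s -> 0 <= e ->
  (forall C u, cls1 C u -> cnorm (U u - V u) <= e * C) ->
  forall x, cnorm (it U s g x - it V s g x) <= (size s)%:R * K ^+ size s * e * C * wo s x.
Proof.
move=> K1 HU HV Hg us e0 UV; have K0 : 0 <= K by exact: le_trans ler01 K1.
have C0 : 0 <= C.
  have := Hg.1 0; rewrite -(pmulr_lge0 _ (wt_gt0 (0 : pt))); apply: le_trans; exact: cn_ge0.
elim: s us => [_ x|j s IH /= /andP[js us] x].
  by rewrite subrr cn0 !mul0r.
have {}IH := IH us.
have [hU1 hU2] := it_cls HU Hg us; have [hV1 hV2] := it_cls HV Hg us.
have HcU : cls1 (C * K ^+ size s * wo (j :: s) x) (fun t => it U s g (upd x j t)).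
  split=> [t|a b]; first by rewrite (le_trans (hU1 _)) // wo_cons // mulrA mulrAC.
  by rewrite (le_trans (hU2 _ _ _ _ js)) // mulrAC.
have HcV : cls1 (C * K ^+ size s * wo (j :: s) x) (fun t => it V s g (upd x j t)).
  split=> [t|a b]; first by rewrite (le_trans (hV1 _)) // wo_cons // mulrA mulrAC.
  by rewrite (le_trans (hV2 _ _ _ _ js)) // mulrAC.
rewrite (le_trans (cn_tri _ (V (fun t => it U s g (upd x j t))) _)) //.
apply: le_trans (lerD (UV _ _ HcU) (HV.2 _ _ _ ((size s)%:R * K ^+ size s * e * C * wo (j :: s) x) HcU HcV _)) _.
  by move=> t; rewrite (le_trans (IH _)) // wo_cons // -[leRHS]mulrA [_ * w1 t]mulrC.
rewrite -natr1 exprS.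
have := wo_ge0 (j :: s) x; have := exprn_ge0 (size s) K0; have := ler0n R (size s).
move: (wo _ _) (K ^+ _) (size s)%:R => w k n n0 k0 w0.
rewrite [leRHS](_ : _ = K * (n * k * e * C * w) + K * (e * (C * k * w))); last by ring.
rewrite addrC lerD2l ler_peMl // !mulr_ge0 //.
Qed.

End Iter.

(** * The Fejer kernel *)

Section Trig.
Variable R : realType.
Implicit Types (x t : R).

Lemma sin_MVT x : 0 < x -> exists2 c, 0 < c < x & sin x = cos c * x.
Proof.
move=> x0; have [|c cx e] := @MVT R sin cos 0 x x0 (fun y _ => is_derive_sin y).
  by apply: continuous_subspaceT; exact: continuous_sin.
by exists c => //; move: e; rewrite sin0 !subr0.
Qed.

Lemma sin_le x : 0 <= x -> `|sin x| <= x.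
Proof.
rewrite le_eqVlt => /predU1P[<-|x0]; first by rewrite sin0 normr0.
have [c _ ->] := sin_MVT x0.
by rewrite normrM (gtr0_norm x0) ler_piMl ?(ltW x0) // cos_max.
Qed.

Lemma cos1_ge : 1 / 2 <= cos 1 :> R.
Proof.
have -> : cos 1 = cos ((1 / 2) *+ 2) :> R by congr cos; rewrite -mulr_natr; field.
rewrite cos_mulr2n cos2sin2.
have h : `|sin (1 / 2)| <= 1 / 2 :> R by apply: sin_le; lra.
have : sin (1 / 2 : R) ^+ 2 <= (1 / 2) ^+ 2.
  by rewrite -real_normK ?num_real // lerXn2r ?nnegrE //; lra.
rewrite -[_ *+ 2]mulr_natr; move: (sin _ ^+ 2) => s; rewrite expr2; lra.
Qed.

(** A crude form of Jordan's inequality: the mean value theorem on [0, 1], where cos is at least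
    1/2, then monotonicity of sin up to pi / 2 < 2. *)
Lemma sin_ge x : 0 <= x <= pi / 2 -> x / 4 <= sin x.
Proof.
move=> /andP[x0 xp]; have p2 := pihalf_lt2 R; have p1 := pihalf_ge1 R; have c1 := cos1_ge.
have small (y : R) : 0 <= y <= 1 -> y / 2 <= sin y.
  move=> /andP[]; rewrite le_eqVlt => /predU1P[<- _|y0 y1]; first by rewrite mul0r sin0.
  have [c /andP[c0 cy] ->] := sin_MVT y0.
  rewrite mulrC ler_pM2r //.
  have : cos 1 <= cos c.
    rewrite leNgt ltr_cos ?in_itv /= -?leNgt; [lra|lra|lra].
  lra.
have [x1|x1] := leP x 1; first by have := small x; rewrite x0 x1 => /(_ isT); lra.
have : sin 1 < sin x by rewrite ltr_sin ?in_itv //=; apply/andP; split; lra.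
have := small 1; rewrite ler01 lexx => /(_ isT); lra.
Qed.

Lemma expi_nat (n : nat) : expi (2 * pi * n%:R) = 1 :> R[i].
Proof.
elim: n => [|n IH]; first by rewrite mulr0 expi0.
rewrite -[n.+1%:R]natr1 mulrDr expiD IH mul1r mulr1 /expi mulr_natl cos2pi sin2pi.
by apply/eqP; rewrite eq_complex /= !eqxx.
Qed.

Lemma expiMn (t : R) n : expi (t * n%:R) = expi t ^+ n.
Proof.
elim: n => [|n IH]; first by rewrite mulr0 expi0.
by rewrite -[n.+1%:R]natr1 mulrDr mulr1 expiD IH exprS mulrC.
Qed.

Lemma expi_dist (t : R) : cnorm (expi (2 * t) - 1) = 2 * `|sin t|.
Proof.
rewrite /cnorm /expi /= subr0 mulr_natl cos_mulr2n sin_mulr2n.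
rewrite (_ : _ + _ = (2 * sin t) ^+ 2).
  by rewrite sqrtr_sqr normrM ger0_norm.
have := cos2sin2 t; move: (cos t) (sin t) => c s e.
rewrite (_ : _ + _ = 4 * (c ^+ 2) ^+ 2 - 8 * c ^+ 2 + 4 + 4 * c ^+ 2 * s ^+ 2); last by ring.
by rewrite e; ring.
Qed.

Lemma expi_neq1 (t : R) : 0 < `|t| < 1 -> expi (2 * pi * t) != 1.
Proof.
move=> /andP[t0 t1]; rewrite -subr_eq0; apply/eqP => h.
have := expi_dist (pi * t); rewrite mulrA h cn0 => /esym/eqP; rewrite mulf_eq0 pnatr_eq0 /= normr_eq0 => /eqP e.
have : sin (pi * `|t|) = 0.
  case: (ger0P t) => _; first exact: e.
  by rewrite mulrN sinN e oppr0.
apply/eqP; rewrite gt_eqF // sin_gt0_pi // mulr_gt0 ?pi_gt0 //=.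
by rewrite gtr_pMr ?pi_gt0.
Qed.

(** Fejer kernel of period 1 and mean 1, written as a squared modulus so that positivity is
    immediate and the decay follows from a geometric sum. [FejE] is its expansion into
    exponentials. *)
Definition Fej n t : R := n%:R^-1 * cnorm (\sum_(a < n) expi (2 * pi * (a%:R * t))) ^+ 2.

Lemma Fej_ge0 n t : 0 <= Fej n t.
Proof. by rewrite mulr_ge0 ?invr_ge0 // exprn_ge0 // cn_ge0. Qed.

Lemma cn_sqr (z : R[i]) : (cnorm z ^+ 2)%:C = z * conjc z.
Proof.
case: z => a b; rewrite /cnorm sqr_sqrtr ?addr_ge0 ?sqr_ge0 //=.
by apply/eqP; rewrite eq_complex /=; apply/andP; split; apply/eqP; ring.
Qed.

Lemma expi_conj t : conjc (expi t) = expi (- t) :> R[i].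
Proof. by rewrite /expi cosN sinN. Qed.

Lemma FejE n t : (Fej n t)%:C = (n%:R^-1)%:C * \sum_(a < n) \sum_(b < n) expi (2 * pi * ((a%:R - b%:R) * t)).
Proof.
rewrite /Fej rmorphM /= cn_sqr rmorph_sum /=; congr (_ * _).
rewrite mulr_suml; apply: eq_bigr => a _; rewrite mulr_sumr; apply: eq_bigr => b _.
rewrite -[_ -i* _]/(conjc (expi _)) expi_conj -expiD; congr expi; ring.
Qed.

Lemma Fej_shift n t (k : nat) : Fej n (t + k%:R) = Fej n t.
Proof.
rewrite /Fej; congr (_ * cnorm _ ^+ 2); apply: eq_bigr => a _.
rewrite (_ : 2 * pi * _ = 2 * pi * (a%:R * t) + 2 * pi * (a * k)%:R); last by rewrite natrM; ring.
by rewrite expiD expi_nat mulr1.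
Qed.

Lemma Fej_le n t : (0 < n)%N -> Fej n t <= n%:R.
Proof.
move=> n0; rewrite /Fej ler_pdivrMl ?ltr0n // -expr2 lerXn2r ?nnegrE ?cn_ge0 //.
rewrite (le_trans (cn_sum _ _ _)) //; under eq_bigr do rewrite cn_expi.
by rewrite sumr_const card_ord.
Qed.

Lemma sin_aux (p u s : R) : 0 < u -> 2 <= p -> p * u / 4 <= s -> u <= 2 * s.
Proof. nra. Qed.

Lemma Fej_decay n t : (0 < n)%N -> 0 < `|t| <= 1 / 2 -> Fej n t <= 4 / (n%:R * t ^+ 2).
Proof.
move=> n0 /andP[t0 t1]; set z := expi (2 * pi * t).
have z1 : `|t| <= cnorm (z - 1).
  rewrite /z -mulrA expi_dist.
  have -> : `|sin (pi * t)| = `|sin (pi * `|t|)|.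
    by case: (ger0P t) => // _; rewrite mulrN sinN normrN.
  have h : 0 <= pi * `|t| <= pi / 2.
    by rewrite mulr_ge0 ?pi_ge0 //= ler_wpM2l ?pi_ge0 // -div1r.
  have := sin_ge h; have := ler_norm (sin (pi * `|t|)); have := pi_ge2 R.
  rewrite [X in 2 * X]ger0_norm; last by rewrite (le_trans _ (sin_ge h)) // divr_ge0 // mulr_ge0 ?pi_ge0.
  move=> p2 _; exact: (sin_aux t0 p2).
have hz : cnorm (\sum_(a < n) expi (2 * pi * (a%:R * t))) <= 2 / `|t|.
  rewrite ler_pdivlMr // (le_trans (ler_wpM2l (cn_ge0 _) z1)) // -cnM.
  rewrite (_ : _ * _ = z ^+ n - 1).
    by rewrite (le_trans (cnB _ _)) // cnX cn_expi expr1n cn1.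
  rewrite subrX1 mulrC; congr (_ * _); apply: eq_bigr => a _.
  by rewrite /z -expiMn; congr expi; ring.
rewrite /Fej ler_pdivrMl ?ltr0n //.
have -> : n%:R * (4 / (n%:R * t ^+ 2)) = (2 / `|t|) ^+ 2.
  rewrite -(real_normK (num_real t)) expr_div_n; field.
  by rewrite pnatr_eq0 -lt0n n0 gt_eqF.
by rewrite lerXn2r ?nnegrE ?cn_ge0 // divr_ge0.
Qed.

(** Discrete orthogonality: the frequencies a - b have modulus below n <= D, so over D equidistant
    points only the diagonal terms survive and the mean is exactly 1. *)
Lemma Fej_sum n D : (0 < n)%N -> (n <= D)%N ->
  \sum_(b < D) Fej n ((b%:R + 2^-1) / D%:R - 2^-1) = D%:R.
Proof.
move=> n0 nD; have D0 : (0 < D)%N by exact: leq_trans n0 nD.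
have Dr : D%:R != 0 :> R by rewrite pnatr_eq0 -lt0n.
apply: (@complexI R); rewrite rmorph_sum /=; under eq_bigr do rewrite FejE.
rewrite -mulr_sumr exchange_big /=.
have H (a b : 'I_n) : \sum_(m < D) expi (2 * pi * ((a%:R - b%:R) * ((m%:R + 2^-1) / D%:R - 2^-1))) =
   if a == b then D%:R else 0 :> R[i].
  case: eqP => [->|/eqP ab].
    under eq_bigr do rewrite subrr mul0r mulr0 expi0.
    by rewrite sumr_const card_ord.
  pose c : R[i] := expi (2 * pi * ((a%:R - b%:R) * (2^-1 / D%:R - 2^-1))).
  pose z : R[i] := expi (2 * pi * ((a%:R - b%:R) / D%:R)).
  have zn1 : z != 1.
    apply: expi_neq1; rewrite normrM normfV [`|D%:R|]ger0_norm //.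
    have ab0 : 0 < `|a%:R - b%:R : R|.
      by rewrite normr_gt0 subr_eq0 eqr_nat.
    rewrite divr_gt0 ?ltr0n //= ltr_pdivrMr ?ltr0n // mul1r.
    have an : a%:R < n%:R :> R by rewrite ltr_nat ltn_ord.
    have bn : b%:R < n%:R :> R by rewrite ltr_nat ltn_ord.
    have nDr : n%:R <= D%:R :> R by rewrite ler_nat.
    have a0 : 0 <= a%:R :> R by [].
    have b0 : 0 <= b%:R :> R by [].
    rewrite ltr_norml; apply/andP; split; lra.
  rewrite (eq_bigr (fun m : 'I_D => c * z ^+ m)); last first.
    move=> m _; rewrite /c /z -expiMn -expiD; congr expi; ring.
  rewrite -mulr_sumr.
  have : (z - 1) * \sum_(m < D) z ^+ m = 0.
    rewrite -subrX1 /z -expiMn (_ : _ * D%:R = 2 * pi * (a%:R - b%:R)); last by field.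
    have -> : expi (2 * pi * (a%:R - b%:R)) = 1 :> R[i].
      have := expi_nat a; rewrite -{1}[a%:R](subrK b%:R) mulrDr expiD expi_nat mulr1; exact.
    by rewrite subrr.
  by move=> /eqP; rewrite mulf_eq0 subr_eq0 (negPf zn1) /= => /eqP ->; rewrite mulr0.
under eq_bigr => a _.
  rewrite exchange_big /=; under eq_bigr do rewrite H.
  rewrite -big_mkcond /= (big_pred1 a); last by move=> b; rewrite eq_sym.
  over.
rewrite /= sumr_const card_ord -[X in _ * X]mulr_natr mulrCA.
rewrite -[n%:R : R[i]](rmorph_nat (real_complex R)) -rmorphM /= mulVf ?pnatr_eq0 -?lt0n //.
by rewrite mulr1 rmorph_nat.
Qed.

End Trig.

#[global] Opaque Fej.

(** * Fejer-weighted Riemann sums against lattice sums on the line *)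

Section Fejer1.
Variable R : realType.
Variable L : R.
Hypothesis L0 : 0 < L.
Implicit Types (u : R -> R[i]).

Lemma sum_mul (V : nmodType) K D (f : nat -> V) :
  \sum_(m < K * D) f m = \sum_(k < K) \sum_(b < D) f (k * D + b)%N.
Proof.
elim: K => [|K IH]; first by rewrite !big_ord0.
by rewrite big_ord_recr /= -IH mulSnr big_split_ord.
Qed.

(** Position of the b-th grid point of a cell relative to the centre of the cell. By periodicity the
    Fejer weights depend on this position alone ([fejW_cell]). *)
Definition cpt N b : R := (b%:R + 2^-1) * gstep L N - L / 2.

Lemma gpt_cell N k b : gpt L N (k * N.+1 ^ 2 + b) = L * (k%:R - N%:R) + cpt N b.
Proof.
have nz : (N.+1 ^ 2)%:R != 0 :> R by rewrite pnatr_eq0 expn_eq0.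
by rewrite /gpt /cpt natrD natrM -natr1 natrM /gstep; field.
Qed.

Lemma cpt_le N b : (b < N.+1 ^ 2)%N -> `|cpt N b| <= L / 2.
Proof.
move=> bN; have nz : 0 < (N.+1 ^ 2)%:R :> R by rewrite ltr0n expn_gt0.
have b1 : b%:R + 1 <= (N.+1 ^ 2)%:R :> R by rewrite natr1 ler_nat.
have b0 : 0 <= b%:R :> R by [].
have h : (b%:R + 2^-1) * gstep L N <= L.
  rewrite /gstep mulrA ler_pdivrMr // mulrC ler_pM2l //; lra.
have h2 : 0 <= (b%:R + 2^-1) * gstep L N by rewrite mulr_ge0 ?addr_ge0 // ltW // gstep_gt0.
rewrite /cpt ler_norml; apply/andP; split; lra.
Qed.

Definition fejW n N m : R := gstep L N * Fej n (gpt L N m / L).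

Lemma fejW_cell n N k b : fejW n N (k * N.+1 ^ 2 + b) = gstep L N * Fej n (cpt N b / L).
Proof.
have -> : fejW n N (k * N.+1 ^ 2 + b) = gstep L N * Fej n ((k%:R - N%:R) + cpt N b / L).
  by rewrite /fejW gpt_cell; congr (_ * Fej _ _); field; rewrite gt_eqF.
congr (_ * _).
rewrite -(@Fej_shift _ n _ N) -(@Fej_shift _ n (cpt N b / L) k); congr Fej; ring.
Qed.

Lemma fej_cell_mass n N : (0 < n)%N -> (n <= N.+1 ^ 2)%N ->
  \sum_(b < N.+1 ^ 2) gstep L N * Fej n (cpt N b / L) = L.
Proof.
move=> n0 nN; rewrite -mulr_sumr (_ : \sum_(b < _) _ = (N.+1 ^ 2)%:R).
  by rewrite /gstep divfK // pnatr_eq0 expn_eq0.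
rewrite -(@Fej_sum R n (N.+1 ^ 2)) //; apply: eq_bigr => b _; congr Fej.
have nz : (N.+1 ^ 2)%:R != 0 :> R by rewrite pnatr_eq0 expn_eq0.
by rewrite /cpt /gstep; move: (N.+1 ^ 2)%:R nz => q nz; field; rewrite (gt_eqF L0) nz.
Qed.

Lemma fejc_ge0 n N b : 0 <= gstep L N * Fej n (cpt N b / L).
Proof. by rewrite mulr_ge0 ?Fej_ge0 // ltW // gstep_gt0. Qed.

(** First moment of the weights in a cell: the points within dl of the centre contribute at most dl
    times the mass L, the others are controlled by [Fej_decay]. *)
Lemma fej_cell_conc n N dl : (0 < n)%N -> (n <= N.+1 ^ 2)%N -> 0 < dl ->
  \sum_(b < N.+1 ^ 2) gstep L N * Fej n (cpt N b / L) * `|cpt N b| <= dl * L + L * (4 * L ^+ 2 / (n%:R * dl)).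
Proof.
move=> n0 nN dl0; have g0 := gstep_gt0 N L0.
have e1 : dl * L = \sum_(b < N.+1 ^ 2) dl * (gstep L N * Fej n (cpt N b / L)).
  by rewrite -mulr_sumr fej_cell_mass.
have e : L * (4 * L ^+ 2 / (n%:R * dl)) = \sum_(b < N.+1 ^ 2) gstep L N * (4 * L ^+ 2 / (n%:R * dl)).
  rewrite sumr_const card_ord -[RHS]mulr_natr [RHS]mulrAC; congr (_ * _).
  by rewrite /gstep divfK // pnatr_eq0 expn_eq0.
rewrite e e1 -big_split /=; apply: ler_sum => b _.
rewrite -[X in X <= _]mulrA [dl * _]mulrCA -mulrDr ler_pM2l // -[4 * _ / _]mulrA.
have F0 := Fej_ge0 n (cpt N b / L).
have q0 : 0 <= 4 * (L ^+ 2 / (n%:R * dl)).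
  by rewrite mulr_ge0 // divr_ge0 ?exprn_ge0 ?mulr_ge0 ?(ltW L0) ?(ltW dl0).
have [h|h] := leP `|cpt N b| dl.
  apply: (@le_trans _ _ (Fej n (cpt N b / L) * dl)); first by rewrite ler_wpM2l.
  by rewrite mulrC lerDl.
have c0 : 0 < `|cpt N b| by exact: lt_trans h.
have nc : `|cpt N b / L| = `|cpt N b| / L by rewrite normrM normfV (gtr0_norm L0).
have := @Fej_decay R n (cpt N b / L) n0; rewrite nc divr_gt0 //=.
rewrite ler_pdivrMr // mul1r mulrC cpt_le ?ltn_ord // => /(_ isT) h1.
apply: (@le_trans _ _ (4 / (n%:R * (cpt N b / L) ^+ 2) * `|cpt N b|)); first by rewrite ler_wpM2r.
apply: (@le_trans _ _ (4 * (L ^+ 2 / (n%:R * dl)))); last by rewrite lerDr mulr_ge0 // ltW.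
rewrite -(real_normK (num_real (cpt N b / L))) nc expr_div_n.
have -> : 4 / (n%:R * (`|cpt N b| ^+ 2 / L ^+ 2)) * `|cpt N b| = 4 * (L ^+ 2 / (n%:R * `|cpt N b|)).
  by field; rewrite (gt_eqF c0) (gt_eqF L0) pnatr_eq0 -lt0n n0.
rewrite ler_pM2l // ler_pM2l ?exprn_gt0 // lef_pV2 ?posrE ?mulr_gt0 ?ltr0n // ler_pM2l ?ltr0n //.
exact: ltW.
Qed.

(** The sum over the integers of modulus at most N, arranged from the centre outwards so that the
    tail beyond r splits off. *)
Definition sym (V : nmodType) N (f : R -> V) : V := f 0 + \sum_(j < N) (f j.+1%:R + f (- j.+1%:R)).

Lemma symE (V : nmodType) N (f : R -> V) : \sum_(k < (2 * N).+1) f (k%:R - N%:R) = sym N f.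
Proof.
rewrite /sym; elim: N => [|N IH].
  by rewrite big_ord1 big_ord0 addr0 subr0.
have -> : (2 * N.+1).+1 = (2 * N).+3 by lia.
rewrite big_ord_recl big_ord_recr /= [in RHS]big_ord_recr /=.
have -> : \sum_(i < (2 * N).+1) f ((bump 0 i)%:R - N.+1%:R) = \sum_(k < (2 * N).+1) f (k%:R - N%:R).
  by apply: eq_bigr => k _; congr (f _); rewrite /bump /= add1n -[k.+1%:R]natr1 -[N.+1%:R]natr1; ring.
have -> : (bump 0 (2 * N).+1)%:R - N.+1%:R = N.+1%:R :> R.
  rewrite /bump /= add1n -[(2 * N).+2%:R]natr1 -[(2 * N).+1%:R]natr1 -[N.+1%:R]natr1 natrM; ring.
by rewrite IH sub0r addrC !addrA.
Qed.

Lemma sym_split (V : zmodType) N r (f : R -> V) : (r <= N)%N ->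
  sym N f = sym r f + \sum_(r <= j < N) (f j.+1%:R + f (- j.+1%:R)).
Proof.
by move=> rN; rewrite /sym -addrA -!(big_mkord xpredT (fun j => f j.+1%:R + f (- j.+1%:R))) -big_cat_nat.
Qed.

(** Each pair of terms is at most 4 / L^2 times 1/(j+1) - 1/(j+2), and this telescopes. *)
Lemma w1_tail r N : (r <= N)%N ->
  \sum_(r <= j < N) (w1 (L * j.+1%:R) + w1 (L * - j.+1%:R)) <= 4 / (L ^+ 2 * r.+1%:R).
Proof.
have n1 n : 0 < n.+1%:R :> R by [].
move=> rN; apply: (@le_trans _ _ (\sum_(r <= j < N) 4 / L ^+ 2 * (j.+1%:R^-1 - j.+2%:R^-1))).
  apply: ler_sum_nat => j _; rewrite mulrN /w1 sqrrN -mulr2n -[X in X <= _]mulr_natr.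
  rewrite (_ : 4 / L ^+ 2 * _ = 4 / (L ^+ 2 * (j.+1%:R * j.+2%:R))); last first.
    have p2 := n1 j.+1; have p1 := n1 j; rewrite -[j.+2%:R]natr1 in p2 *.
    by move: (j.+1%:R) p1 p2 => x p1 p2; field; rewrite (gt_eqF L0) (gt_eqF p1) (gt_eqF p2).
  rewrite mulrC ler_pdivrMr ?ltr_pwDl ?sqr_ge0 // mulrAC ler_pdivlMr ?mulr_gt0 ?exprn_gt0 //.
  rewrite exprMn -[j.+2%:R]natr1.
  have h1 : 1 <= j.+1%:R :> R by rewrite ler1n.
  have := exprn_gt0 2 L0; move: (L ^+ 2) (j.+1%:R) h1 => l x x1 l0; rewrite expr2.
  have : 0 <= l * (x * (x - 1)) by rewrite mulr_ge0 ?(ltW l0) // mulr_ge0; lra.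
  have : 0 <= 2 * l * (x * x) by rewrite mulr_ge0 // ?mulr_ge0 // ltW //; lra.
  nra.
rewrite -mulr_sumr (_ : 4 / (L ^+ 2 * r.+1%:R) = 4 / L ^+ 2 * r.+1%:R^-1); last by rewrite invfM mulrA.
rewrite ler_wpM2l ?divr_ge0 ?exprn_ge0 ?(ltW L0) //.
rewrite (telescope_sumr_eq (fun j : nat => - (j.+1%:R^-1) : R)) //.
  by rewrite opprK addrC lerBlDr lerDl invr_ge0.
by move=> j _; rewrite opprK addrC.
Qed.

Definition latW r : (R -> R[i]) -> R[i] := wsum (2 * r).+1 (fun=> L) (fun m => L * (m%:R - r%:R)).
(** A common constant for [latW_mono] and [fejU_mono]: [1 + 4 / L ^+ 2] bounds the lattice sum of
    [w1], and [2 * (1 + L ^+ 2)] its variation within a cell. *)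
Definition fejK : R := 1 + L * (2 * (1 + L ^+ 2)) * (1 + 4 / L ^+ 2).

Lemma fejK_ge1 : 1 <= fejK.
Proof.
rewrite /fejK lerDl !mulr_ge0 ?addr_ge0 ?divr_ge0 ?exprn_ge0 ?(ltW L0) //.
Qed.

Lemma w1_sum N : sym N (fun x => w1 (L * x)) <= 1 + 4 / L ^+ 2.
Proof.
rewrite /sym lerD ?w1_le1 //.
by have := w1_tail (leq0n N); rewrite big_mkord mulr1.
Qed.

Lemma latW_mono r : mono fejK (latW r).
Proof.
apply: wsum_mono => [_|]; first exact: ltW.
rewrite -mulr_sumr (symE r (fun x => w1 (L * x))) /fejK.
apply: (@le_trans _ _ (L * (1 + 4 / L ^+ 2))); first by rewrite ler_pM2l // w1_sum.
have h : 1 <= 2 * (1 + L ^+ 2) by have := sqr_ge0 L; lra.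
have h2 : 0 <= L * (1 + 4 / L ^+ 2) by rewrite mulr_ge0 ?addr_ge0 ?divr_ge0 ?exprn_ge0 // ltW.
rewrite mulrAC; move: (2 * _) h (L * (1 + _)) h2 => a a1 b b0; nra.
Qed.

Lemma w1_cell x s : `|s| <= L / 2 -> w1 (x + s) <= 2 * (1 + L ^+ 2) * w1 x.
Proof.
move=> h; rewrite -[s]opprK (le_trans (w1_shift _ _)) // ler_wpM2r ?w1_ge0 //.
rewrite ler_pM2l // lerD2l sqrrN -(real_normK (num_real s)) lerXn2r ?nnegrE ?(ltW L0) //.
by rewrite (le_trans h) // ler_pdivrMr // ler_pMr // ler1n.
Qed.

Definition fejU n N : (R -> R[i]) -> R[i] := wsum (gnum N) (fejW n N) (gpt L N).

Lemma fejU_mono n N : (0 < n)%N -> (n <= N.+1 ^ 2)%N -> mono fejK (fejU n N).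
Proof.
move=> n0 nN; apply: wsum_mono => [m|].
  by rewrite mulr_ge0 ?Fej_ge0 // ltW // gstep_gt0.
rewrite /gnum (sum_mul _ _ (fun m => fejW n N m * w1 (gpt L N m))).
apply: (@le_trans _ _ (\sum_(k < (2 * N).+1) L * (2 * (1 + L ^+ 2)) * w1 (L * (k%:R - N%:R)))).
  apply: ler_sum => k _; rewrite -mulrA.
  rewrite -[X in _ <= X * _](fej_cell_mass n0 nN) mulr_suml.
  by apply: ler_sum => b _; rewrite fejW_cell gpt_cell ler_wpM2l ?fejc_ge0 // w1_cell // cpt_le.
rewrite -mulr_sumr (symE N (fun x => w1 (L * x))) /fejK.
have h : 0 <= L * (2 * (1 + L ^+ 2)) by rewrite !mulr_ge0 ?addr_ge0 ?exprn_ge0 ?(ltW L0).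
by apply: (le_trans (ler_wpM2l h (w1_sum N))); rewrite lerDr.
Qed.

(** In each cell the Fejer weights act like L times the point mass at the centre. The cut-off r
    comes first, then the kernel order n, then the grid N, and no choice depends on the function. *)
Lemma fejU_latW e : 0 < e -> exists r0, forall r, (r0 <= r)%N -> exists n0, forall n, (n0 <= n)%N ->
  (0 < n)%N /\ exists N0, forall N, (N0 <= N)%N -> (n <= N.+1 ^ 2)%N /\
  forall C u, cls1 C u -> cnorm (latW r u - fejU n N u) <= e * C.
Proof.
move=> e0; have e20 : 0 < e / 2 by rewrite divr_gt0.
set B := L * (2 * (1 + L ^+ 2)).
have B0 : 0 < B by rewrite !mulr_gt0 // ltr_pwDl ?exprn_ge0 // ltW.
have [r0 Hr0] := archi_le (B * (4 / L ^+ 2) / (e / 2)).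
exists r0 => r rr.
have [c cE] : exists c : R, c = (2 * r).+1%:R by eexists.
have c0 : 0 < c by rewrite cE.
(* Half of e is shared by the 2r + 1 central cells, each with an error at most 2 L dl C; the cells
   beyond r use the other half. *)
set dl := e / 2 / (c * (2 * L)).
have dl0 : 0 < dl by rewrite divr_gt0 // !mulr_gt0.
have dlE : c * (dl * (2 * L)) = e / 2.
  by rewrite /dl; field; rewrite (gt_eqF c0) (gt_eqF L0).
clearbody dl.
have [n0 Hn0] := archi_le (4 * L ^+ 2 / (dl * dl)).
exists n0.+1 => n nn; have n1 : (0 < n)%N by exact: leq_ltn_trans nn.
split=> //; exists (maxn r n) => N; rewrite geq_max => /andP[rN nN].
have nN2 : (n <= N.+1 ^ 2)%N by rewrite (leq_trans nN) // -mulnn; lia.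
split=> // C u Hu; have C0 := cls1_ge0 Hu.
set cell := fun x : R => \sum_(b < N.+1 ^ 2) (gstep L N * Fej n (cpt N b / L))%:C * u (L * x + cpt N b).
have -> : fejU n N u = sym N cell.
  rewrite -symE /fejU /wsum /gnum (sum_mul _ _ (fun m => (fejW n N m)%:C * u (gpt L N m))).
  by apply: eq_bigr => k _; apply: eq_bigr => b _; rewrite fejW_cell gpt_cell.
have -> : latW r u = sym r (fun x => L%:C * u (L * x)).
  by rewrite -symE.
have conc x : cnorm (L%:C * u (L * x) - cell x) <= dl * (2 * L) * C.
  rewrite -[X in X%:C * _](fej_cell_mass n1 nN2) rmorph_sum /= mulr_suml -sumrB (le_trans (cn_sum _ _ _)) //.
  apply: (@le_trans _ _ (\sum_(b < N.+1 ^ 2) gstep L N * Fej n (cpt N b / L) * `|cpt N b| * C)).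
    apply: ler_sum => b _; rewrite -mulrBr cnM cnR -mulrA ger0_norm ?fejc_ge0 //.
    rewrite ler_wpM2l ?fejc_ge0 // (le_trans (Hu.2 _ _)) //.
    by rewrite opprD addrA subrr sub0r normrN mulrC.
  rewrite -mulr_suml ler_wpM2r // (le_trans (fej_cell_conc n1 nN2 dl0)) //.
  rewrite (_ : dl * (2 * L) = dl * L + L * dl); last by ring.
  rewrite lerD2l ler_pM2l // ler_pdivrMr ?mulr_gt0 ?ltr0n //.
  move: Hn0; rewrite ler_pdivrMr ?mulr_gt0 // => /le_trans; apply.
  rewrite mulrCA ler_pM2l // ler_pM2r // ler_nat; lia.
have out x : cnorm (cell x) <= B * w1 (L * x) * C.
  rewrite (le_trans (cn_sum _ _ _)) // /B -!mulrA -[X in _ <= X * _](fej_cell_mass n1 nN2) mulr_suml.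
  apply: ler_sum => b _; rewrite cnM cnR ger0_norm ?fejc_ge0 //.
  rewrite ler_wpM2l ?fejc_ge0 // (le_trans (Hu.1 _)) //.
  by rewrite mulrC !mulrA ler_wpM2r // w1_cell // cpt_le.
rewrite (sym_split cell rN) opprD addrA (le_trans (cnB _ _)) // (splitr e) mulrDl lerD //.
  have -> : sym r (fun x => L%:C * u (L * x)) - sym r cell = sym r (fun x => L%:C * u (L * x) - cell x).
    by rewrite -!symE -sumrB.
  rewrite -symE (le_trans (cn_sum _ _ _)) //.
  apply: (@le_trans _ _ (\sum_(k < (2 * r).+1) dl * (2 * L) * C)); first by apply: ler_sum => k _.
  by rewrite sumr_const card_ord -[_ *+ (2 * r).+1]mulr_natl -cE mulrA dlE.
rewrite (le_trans (cn_sum _ _ _)) //.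
apply: (@le_trans _ _ (\sum_(r <= j < N) B * C * (w1 (L * j.+1%:R) + w1 (L * - j.+1%:R)))).
  apply: ler_sum_nat => j _; rewrite (le_trans (cnD _ _)) // mulrDr.
  by rewrite lerD // mulrAC out.
rewrite -mulr_sumr mulrAC mulrC [leRHS]mulrC ler_wpM2l //.
apply: le_trans (ler_wpM2l (ltW B0) (w1_tail rN)) _.
move: Hr0; rewrite ler_pdivrMr // => h.
rewrite invfM !mulrA ler_pdivrMr // -mulrA (le_trans h) // mulrC ler_pM2l // ler_nat; lia.
Qed.

End Fejer1.

(** * Integrals over R^d: product rules, invariance, lattice sums *)

Section Integ.
Variables (R : realType) (d : nat).
Local Notation pt := (pt R d).
Local Notation testfun := (testfun R d).
Implicit Types (g : testfun) (x y : pt) (s : seq 'I_d) (C K L e : R).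
Local Notation evec := (@evec R d).
Local Notation KI := (pi + 1 : R).
Lemma integE g : integ g = it (@cint R) (enum 'I_d) g 0. Proof. by []. Qed.

Lemma wo_enum x : wo (enum 'I_d) x = 1.
Proof. by rewrite /wo big1 // => i; rewrite mem_enum. Qed.

Lemma KI_ge1 : 1 <= KI. Proof. by rewrite lerDr pi_ge0. Qed.

Lemma cls_ge0 C g : cls C g -> 0 <= C.
Proof.
by case=> /(_ 0) h _; rewrite -(pmulr_lge0 _ (wt_gt0 (0 : pt))) (le_trans _ h) // cn_ge0.
Qed.

Definition rsW L N := wsum (gnum N) (fun=> gstep L N) (gpt L N).

Lemma rsW_mono L : 0 < L -> exists N0, forall N, (N0 <= N)%N -> mono KI (rsW L N).
Proof.
move=> L0; have [N0 H] := grid_w1 L0; exists N0 => N /H h.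
by apply: wsum_mono => // m; exact/ltW/gstep_gt0.
Qed.

Lemma integ_riemann L e : 0 < L -> 0 < e -> exists N0, forall N, (N0 <= N)%N -> forall C g, cls C g ->
  cnorm (integ g - it (rsW L N) (enum 'I_d) g 0) <= e * C.
Proof.
move=> L0 e0; set D : R := d%:R * KI ^+ d.
have D0 : 0 <= D by rewrite mulr_ge0 // exprn_ge0 // (le_trans ler01 KI_ge1).
have D1 : 0 < 1 + D by rewrite ltr_pwDl.
have e1 : 0 < e / (1 + D) by rewrite divr_gt0.
have [N1 H1] := rsW_mono L0.
have [N2 H2] := cint_riemann 0 L0 e1.
exists (maxn N1 N2) => N; rewrite geq_max => /andP[/H1 {}H1 /H2 {}H2] C g Hg.
have C0 := cls_ge0 Hg.
rewrite integE; apply: le_trans (it_approx KI_ge1 (cint_mono R) H1 Hg (enum_uniq 'I_d) (ltW e1) _ 0) _.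
  by move=> C1 u Hu; have := H2 C1 u Hu; rewrite wsum0.
rewrite wo_enum mulr1 -cardE card_ord -/D ler_wpM2r //.
by rewrite mulrCA ler_piMr ?(ltW e0) // ler_pdivrMr // mul1r lerDr.
Qed.

Lemma it_outside U s g x x' : (forall i, i \notin s -> x ord0 i = x' ord0 i) -> it U s g x = it U s g x'.
Proof.
elim: s x x' => [|j s IH] x x' h /=; first by congr g; apply/rowP => i; exact: h.
congr U; apply: funext => t; apply: IH => i is_; rewrite !updE; case: (eqVneq i j) => // ij.
by apply: h; rewrite inE negb_or ij.
Qed.

Lemma it_line_cls U K C g s j x : mono K U -> cls C g -> uniq s -> j \notin s ->
  cls1 (C * K ^+ size s * wo (j :: s) x) (fun t => it U s g (upd x j t)).
Proof.
move=> HU Hg us js; have [h1 h2] := it_cls HU Hg us; split=> [t|a b].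
  by rewrite (le_trans (h1 _)) // wo_cons // mulrA mulrAC.
by rewrite (le_trans (h2 _ _ _ _ js)) // mulrAC.
Qed.

Lemma integ_transl C g y : cls C g -> integ (transl y g) = integ g.
Proof.
move=> Hg; rewrite !integE.
have H s : uniq s -> forall x, it (@cint R) s (transl y g) x = it (@cint R) s g (x - y).
  elim: s => [//|j s IH] /= /andP[js us] x.
  rewrite -(cint_shift (y ord0 j) (it_line_cls (x - y) (cint_mono R) Hg us js)).
  congr cint; apply: funext => t; rewrite IH //; congr (it _ _ _ _).
  by apply/rowP => i; rewrite !mxE; case: eqP => // ->.
by rewrite H ?enum_uniq //; apply: it_outside => i; rewrite mem_enum.
Qed.

Lemma integ_check C g : cls C g -> integ (check g) = integ g.
Proof.
move=> Hg; rewrite !integE.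
have H s : uniq s -> forall x, it (@cint R) s (check g) x = it (@cint R) s g (- x).
  elim: s => [//|j s IH] /= /andP[js us] x.
  rewrite -(cint_refl (it_line_cls (- x) (cint_mono R) Hg us js)).
  congr cint; apply: funext => t; rewrite IH //; congr (it _ _ _ _).
  by apply/rowP => i; rewrite !mxE; case: eqP.
by rewrite H ?enum_uniq // oppr0.
Qed.

(** Weights and nodes of the product rule, unrolled into a list: iterated weighted sums become
    finite linear combinations, which also make sense for vectors of E. *)
Fixpoint gr n (W p : nat -> R) s x : seq (R * pt) :=
  if s is j :: s' then flatten [seq [seq (W m * q.1, q.2) | q <- gr n W p s' (upd x j (p m))] | m <- index_iota 0 n]
  else [:: (1, x)].

Lemma it_gr n W p s g x : it (wsum n W p) s g x = \sum_(q <- gr n W p s x) q.1%:C * g q.2.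
Proof.
elim: s x => [|j s IH] x /=; first by rewrite big_seq1 mul1r.
rewrite big_flatten big_map big_mkord.
apply: eq_bigr => m _; rewrite IH big_map mulr_sumr; apply: eq_bigr => q _.
by rewrite rmorphM /= mulrA.
Qed.

Lemma gr_ge0 n W p s x : (forall m, 0 <= W m) -> forall q, q \in gr n W p s x -> 0 <= q.1.
Proof.
move=> W0; elim: s x => [|j s IH] x q /=; first by rewrite inE => /eqP ->.
move=> /flatten_mapP[m _ /mapP[q' hq ->]] /=; rewrite mulr_ge0 //; exact: IH hq.
Qed.

Lemma gr_wt n (W p : nat -> R) s x K : (forall m, 0 <= W m) -> \sum_(m < n) W m * w1 (p m) <= K -> uniq s ->
  \sum_(q <- gr n W p s x) q.1 * wt q.2 <= K ^+ size s * wo s x.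
Proof.
move=> W0 WK; have K0 : 0 <= K.
  by apply: le_trans WK; apply: sumr_ge0 => m _; rewrite mulr_ge0 ?w1_ge0.
elim: s x => [|j s IH] x /=; first by rewrite big_seq1 mul1r.
move=> /andP[js us]; rewrite big_flatten big_map.
apply: (@le_trans _ _ (\sum_(0 <= m < n) W m * (K ^+ size s * (w1 (p m) * wo (j :: s) x)))).
  apply: ler_sum => m _; rewrite big_map; under eq_bigr do rewrite -mulrA.
  by rewrite -mulr_sumr ler_wpM2l // -wo_cons // IH.
rewrite big_mkord exprS; apply: (@le_trans _ _ (K ^+ size s * wo (j :: s) x * (\sum_(m < n) W m * w1 (p m)))).
  by rewrite mulr_sumr le_eqVlt; apply/orP; left; apply/eqP; apply: eq_bigr => m _; ring.
rewrite mulrC -mulrA ler_wpM2r ?mulr_ge0 ?exprn_ge0 ?wo_ge0 //.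
Qed.

(** The Lipschitz constant only guarantees the convergence of the Riemann sums and vanishes in the
    limit, so the bound involves the decay constant alone. *)
Lemma integ_bound C C0 g : cls C g -> (forall x, cnorm (g x) <= C0 * wt x) -> cnorm (integ g) <= KI ^+ d * C0.
Proof.
move=> Hg g0; have C0' := cls_ge0 Hg.
have C00 : 0 <= C0.
  by rewrite -(pmulr_lge0 _ (wt_gt0 (0 : pt))) (le_trans _ (g0 0)) // cn_ge0.
apply/ler_addgt0Pr => e e0.
have [N1 H1] := integ_riemann ltr01 (divr_gt0 e0 (ltr_pwDl ltr01 C0')).
have [N2 H2] := grid_w1 (@ltr01 R).
set N := maxn N1 N2; have {}H1 := H1 N (leq_maxl _ _) C g Hg; have {}H2 := H2 N (leq_maxr _ _).
rewrite -(subrK (it (rsW 1 N) (enum 'I_d) g 0) (integ g)) addrC (le_trans (cnD _ _)) // lerD //; last first.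
  by rewrite (le_trans H1) // mulrAC ler_pdivrMr ?ltr_pwDl // ler_wpM2l ?(ltW e0) // lerDr.
rewrite it_gr (le_trans (cn_sum _ _ _)) //.
have W0 : forall m : nat, 0 <= gstep 1 N :> R by move=> _; exact/ltW/gstep_gt0.
have := gr_wt (0 : pt) W0 H2 (enum_uniq 'I_d); rewrite wo_enum mulr1 -cardE card_ord => h.
apply: le_trans (ler_wpM2r C00 h).
rewrite big_distrl /=; rewrite !big_seq; apply: ler_sum => q hq.
by rewrite cnM cnR (ger0_norm (gr_ge0 W0 hq)) -mulrA ler_wpM2l ?(gr_ge0 W0 hq) // mulrC.
Qed.

Lemma cls_pdr C g : (forall x, cnorm (g x) <= C * wt x) ->
  (forall j x, exists2 z, pdr g j x z & cnorm z <= C * wt x) -> cls (2 * C) g.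
Proof.
move=> g0 g1; have C0 : 0 <= C.
  by rewrite -(pmulr_lge0 _ (wt_gt0 (0 : pt))) (le_trans _ (g0 0)) // cn_ge0.
split=> [x|x j a b].
  by rewrite (le_trans (g0 x)) // ler_wpM2r ?(ltW (wt_gt0 x)) // ler_peMl // ler1n.
have ue t : upd x j t = upd x j 0 + t *: evec j.
  by apply/rowP => i; rewrite !mxE; case: eqP => _; rewrite ?mulr1 ?add0r ?mulr0 ?addr0.
have dg t : cder (fun t => g (upd x j t)) t (pderiv j g (upd x j t)).
  have [z hz _] := g1 j (upd x j t); rewrite (pdr_pderiv hz).
  have := @cder_comp_aff _ (fun h => g (upd x j t + h *: evec j)) 1 (- t) t z.
  rewrite mul1r subrr mul1r => /(_ hz); apply: cder_eq => u.
  by rewrite mul1r ue -addrA -scalerDl subrKC -ue.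
rewrite (_ : 2 * C * `|a - b| * wo [:: j] x = 2 * (C * wo [:: j] x) * `|a - b|); last by ring.
apply: (cn_MVT dg) => t _; have [z hz hb] := g1 j (upd x j t).
rewrite (pdr_pderiv hz) (le_trans hb) // ler_wpM2l // wt_wo wo_cons //.
by rewrite ler_piMl ?wo_ge0 ?w1_le1.
Qed.

Section Product.
Variables (L : R) (n : nat).
Hypotheses (L0 : 0 < L) (n0 : (0 < n)%N).

Lemma Fej_Lip : exists2 B : R, 0 <= B & forall a b : R, `|Fej n (a / L) - Fej n (b / L)| <= B * `|a - b|.
Proof.
exists (4 * (2 * pi) * n%:R ^+ 2 / L).
  by rewrite !mulr_ge0 ?exprn_ge0 ?invr_ge0 ?pi_ge0 ?(ltW L0).
move=> a b; pose S (t : R) : R[i] := \sum_(k < n) expi (2 * pi * (k%:R * t)).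
have Sb t : cnorm (S t) <= n%:R.
  rewrite (le_trans (cn_sum _ _ _)) //; under eq_bigr do rewrite cn_expi.
  by rewrite sumr_const card_ord.
have Sd (s t : R) : cnorm (S s - S t) <= n%:R * (2 * (2 * pi) * n%:R * `|s - t|).
  rewrite /S -sumrB (le_trans (cn_sum _ _ _)) //.
  apply: (@le_trans _ _ (\sum_(k < n) (2 * (2 * pi) * n%:R * `|s - t|))); last by rewrite sumr_const card_ord -[_ *+ n]mulr_natl.
  apply: ler_sum => k _.
  have := @cn_MVT _ (fun u => expi (1 * u)) (fun u => (0 +i* 1) * expi (1 * u)) (2 * pi * (k%:R * t)) (2 * pi * (k%:R * s)) 1 (fun u => cder_expi u 1).
  rewrite !mul1r => h; apply: (le_trans (h _)).
    by move=> u _; rewrite cnM cn_expi mulr1 /cnorm /= expr0n expr1n add0r sqrtr1.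
  rewrite (_ : _ - _ = 2 * pi * k%:R * (s - t)); last by ring.
  rewrite normrM ger0_norm ?mulr_ge0 ?pi_ge0 // mulr1 !mulrA ler_wpM2r // ler_wpM2l ?mulr_ge0 ?pi_ge0 //.
  by rewrite ler_nat ltnW.
have FE t : Fej n t = n%:R^-1 * cnorm (S t) ^+ 2 by [].
have nr : 0 < n%:R :> R by rewrite ltr0n.
rewrite !FE -mulrBr normrM ger0_norm ?invr_ge0 // ler_pdivrMl // subr_sqr normrM.
have h1 : `|cnorm (S (a / L)) - cnorm (S (b / L))| <= n%:R * (2 * (2 * pi) * n%:R * `|a / L - b / L|).
  apply: le_trans (Sd _ _); rewrite ler_norml lerNl opprB; apply/andP; split.
    by rewrite cnBC lerBlDr -{1}(subrK (S (a / L)) (S (b / L))) cnD.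
  by rewrite lerBlDr -{1}(subrK (S (b / L)) (S (a / L))) cnD.
have h2 : `|cnorm (S (a / L)) + cnorm (S (b / L))| <= n%:R + n%:R.
  by rewrite ger0_norm ?addr_ge0 ?cn_ge0 // lerD.
apply: le_trans (ler_pM _ _ h1 h2) _ => //.
rewrite -mulrBl normrM normfV (gtr0_norm L0) le_eqVlt; apply/orP; left; apply/eqP.
by field; rewrite gt_eqF.
Qed.

Definition prodF s y : R := \prod_(i <- s) Fej n (y ord0 i / L).

Lemma prodF_bound s y : 0 <= prodF s y <= n%:R ^+ size s.
Proof.
elim: s => [|j s /andP[h1 h2]]; first by rewrite /prodF big_nil ler01 expr0 lexx.
rewrite /prodF big_cons mulr_ge0 ?Fej_ge0 //= exprS ler_pM ?Fej_ge0 // Fej_le //.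
Qed.

Lemma prodF_upd s y j t : j \notin s -> prodF s (upd y j t) = prodF s y.
Proof.
move=> js; rewrite /prodF !big_seq; apply: eq_bigr => i is_; rewrite updE.
by case: eqP => // e; rewrite -e is_ in js.
Qed.

(** The new class constant depends on n; it serves only to pass from Riemann sums to the integral
    while n is fixed. *)
Lemma cls_prodF C g : cls C g -> exists C', cls C' (fun y => g y * (prodF (enum 'I_d) y)%:C).
Proof.
move=> Hg; have C0 := cls_ge0 Hg; case: Hg => g1 g2; have [B B0 HB] := Fej_Lip.
have nr : 1 <= n%:R :> R by rewrite ler1n.
have nr0 : 0 <= n%:R :> R by [].
exists (C * n%:R ^+ d + C * B * n%:R ^+ d); split=> [x|x j a b].
  have /andP[p0 p1] := prodF_bound (enum 'I_d) x; rewrite -cardE card_ord in p1.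
  rewrite cnM cnR ger0_norm // mulrDl; apply: ler_wpDr.
    by rewrite !mulr_ge0 ?exprn_ge0 // ltW // wt_gt0.
  by rewrite mulrAC ler_pM ?cn_ge0.
have js : j \in enum 'I_d by rewrite mem_enum.
have pE t : prodF (enum 'I_d) (upd x j t) = Fej n (t / L) * prodF (rem j (enum 'I_d)) x.
  rewrite /prodF (perm_big _ (perm_to_rem js)) /= big_cons updE eqxx; congr (_ * _).
  by apply: prodF_upd; rewrite mem_rem_uniqF ?enum_uniq.
have /andP[p0 p1] := prodF_bound (rem j (enum 'I_d)) x.
rewrite size_rem // -cardE card_ord in p1.
have d0 : (0 < d)%N by apply: leq_ltn_trans (ltn_ord j).
have pd : n%:R * prodF (rem j (enum 'I_d)) x <= n%:R ^+ d.
  apply: (@le_trans _ _ (n%:R * n%:R ^+ d.-1)); first by rewrite ler_wpM2l.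
  by rewrite -exprS prednK.
have pd' : prodF (rem j (enum 'I_d)) x <= n%:R ^+ d.
  by apply: le_trans pd; rewrite ler_peMl.
rewrite !pE; set P := prodF _ x in p0 p1 pd pd' *.
rewrite (_ : _ - _ = (g (upd x j a) - g (upd x j b)) * (Fej n (a / L) * P)%:C +
   g (upd x j b) * ((Fej n (a / L) - Fej n (b / L)) * P)%:C); last first.
  by rewrite mulrBl (mulrBl P) (rmorphB (real_complex R)) /= mulrBr addrA subrK.
rewrite (le_trans (cnD _ _)) // !cnM !cnR (mulrDl _ _ `|a - b|) (mulrDl _ _ (wo _ _)) lerD //.
  rewrite [leRHS](_ : _ = C * `|a - b| * wo [:: j] x * n%:R ^+ d); last by ring.
  apply: ler_pM; rewrite ?cn_ge0 // (ger0_norm (mulr_ge0 (Fej_ge0 _ _) p0)).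
  by apply: le_trans pd; apply: ler_wpM2r => //; exact: Fej_le.
rewrite normrM (ger0_norm p0).
apply: (@le_trans _ _ (C * wo [:: j] x * (B * `|a - b| * n%:R ^+ d))); last first.
  by rewrite le_eqVlt; apply/orP; left; apply/eqP; ring.
apply: ler_pM; rewrite ?cn_ge0 ?mulr_ge0 //.
  by rewrite (le_trans (g1 _)) // ler_wpM2l // wt_wo wo_cons // ler_piMl ?wo_ge0 ?w1_le1.
by rewrite ler_pM.
Qed.

Lemma it_coord N (h : R -> R[i]) j s g x : j \notin s ->
  it (rsW L N) s (fun y => g y * h (y ord0 j)) x = h (x ord0 j) * it (rsW L N) s g x.
Proof.
elim: s x => [|k s IH] x /=; first by rewrite mulrC.
rewrite inE negb_or => /andP[jk js]; rewrite /rsW /wsum mulr_sumr; apply: eq_bigr => m _.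
by rewrite IH // updE (negPf jk) mulrCA.
Qed.

(** The kernel may sit in the quadrature weights or in the integrand. The first form compares with
    lattice sums, the second leads to an integral against exponentials. *)
Lemma it_fejU N s g x : uniq s -> it (fejU L n N) s g x = it (rsW L N) s (fun y => g y * (prodF s y)%:C) x.
Proof.
elim: s g x => [|j s IH] g x /=; first by rewrite /prodF big_nil mulr1.
move=> /andP[js us]; rewrite /fejU /rsW /wsum; apply: eq_bigr => m _.
rewrite -/(fejU L n N) -/(rsW L N) IH //.
have := @it_coord N (fun t => (Fej n (t / L))%:C) j s (fun y => g y * (prodF s y)%:C) (upd x j (gpt L N m)) js.
have -> : (fejW L n N m)%:C = (gstep L N)%:C * (Fej n (gpt L N m / L))%:C by exact: rmorphM.
rewrite updE eqxx -mulrA => <-; congr (_ * it _ _ _ _).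
apply: funext => y; rewrite -mulrA; congr (_ * _); rewrite mulrC.
by rewrite /prodF big_cons; symmetry; exact: rmorphM.
Qed.

End Product.

(** Poisson summation in Fejer form: by [it_zbox] the iterated [latW] is L^d times a sum over a box
    of the lattice of mesh L. The error involves the class of g and not that of its product with the
    kernel. *)
Lemma fejer_integ L e : 0 < L -> 0 < e -> exists r0, forall r, (r0 <= r)%N -> exists n0, forall n, (n0 <= n)%N ->
  (0 < n)%N /\ forall C g, cls C g ->
  cnorm (it (latW L r) (enum 'I_d) g 0 - integ (fun y => g y * (prodF L n (enum 'I_d) y)%:C)) <= e * C.
Proof.
move=> L0 e0; set D : R := d%:R * fejK L ^+ d.
have D0 : 0 <= D by rewrite mulr_ge0 // exprn_ge0 // (le_trans ler01 (fejK_ge1 L0)).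
have D1 : 0 < 1 + D by rewrite ltr_pwDl.
have e1 : 0 < e / (1 + D) by rewrite divr_gt0.
have [r0 Hr0] := fejU_latW L0 e1; exists r0 => r rr.
have [n0 Hn0] := Hr0 r rr; exists n0 => n nn.
have [n1 [N0 HN0]] := Hn0 n nn; split=> // C g Hg; have C0 := cls_ge0 Hg.
have [C' Hg'] := cls_prodF L0 n1 Hg; have C'0 := cls_ge0 Hg'.
(* The class constant C' of the product depends on n, so the Riemann error gets a separate tolerance
   h, removed by refining the grid; the main error involves only C. *)
apply/ler_addgt0Pr => h h0.
have [N1 H1] := integ_riemann L0 (divr_gt0 h0 (ltr_pwDl ltr01 C'0)).
set N := maxn N0 N1; have [nN H2] := HN0 N (leq_maxl _ _); have {}H1 := H1 N (leq_maxr _ _) _ _ Hg'.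
rewrite (le_trans (cn_tri _ (it (fejU L n N) (enum 'I_d) g 0) _)) // lerD //; last first.
  rewrite it_fejU ?enum_uniq // cnBC (le_trans H1) //.
  by rewrite mulrAC ler_pdivrMr ?ltr_pwDl // ler_wpM2l ?(ltW h0) // lerDr.
apply: le_trans (it_approx (fejK_ge1 L0) (latW_mono L0 r) (fejU_mono L0 n1 nN) Hg (enum_uniq 'I_d) (ltW e1) H2 0) _.
rewrite wo_enum mulr1 -cardE card_ord -/D ler_wpM2r //.
by rewrite mulrCA ler_piMr ?(ltW e0) // ler_pdivrMr // mul1r lerDr.
Qed.

Definition zpt (z : {ffun 'I_d -> int}) : pt := \row_i (z i)%:~R.
Definition updz (z : {ffun 'I_d -> int}) j (k : int) : {ffun 'I_d -> int} := [ffun i => if i == j then k else z i].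

Fixpoint zb r s (z : {ffun 'I_d -> int}) : seq {ffun 'I_d -> int} :=
  if s is j :: s' then flatten [seq zb r s' (updz z j (m%:Z - r%:Z)) | m <- index_iota 0 (2 * r).+1] else [:: z].

Lemma zb_cons r j s z : zb r (j :: s) z = flatten [seq zb r s (updz z j (m%:Z - r%:Z)) | m <- index_iota 0 (2 * r).+1].
Proof. by []. Qed.

Definition zbox r := zb r (enum 'I_d) [ffun=> 0].

Lemma mem_zb r s z z' : uniq s -> z' \in zb r s z = [forall i, if i \in s then `|z' i| <= r%:Z else z' i == z i].
Proof.
elim: s z => [|j s IH] z.
  move=> _; rewrite inE; apply/eqP/forallP => [-> i //|h]; apply/ffunP => i; apply/eqP; exact: h.
rewrite zb_cons => /andP[js us]; apply/flatten_mapP/forallP => [[m]|h].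
  rewrite mem_index_iota /= => mr; rewrite IH // => /forallP h i; rewrite inE.
  have := h i; rewrite ffunE; case: (eqVneq i j) => [->|ij] //=; rewrite (negPf js) => /eqP ->.
  by rewrite ler_norml; lia.
have := h j; rewrite mem_head ler_norml => /andP[h1 h2].
exists (absz (z' j + r%:Z)); first by rewrite mem_index_iota; lia.
rewrite IH //; apply/forallP => i; rewrite ffunE; have := h i; rewrite inE.
case: (eqVneq i j) => [->|ij] //=; rewrite (negPf js) => _.
by rewrite gez0_abs ?addrK // -lerBlDr sub0r.
Qed.

Lemma zb_uniq r s z : uniq s -> uniq (zb r s z).
Proof.
elim: s z => [//|j s IH] z; rewrite zb_cons => /andP[js us].
have H (t : seq nat) : uniq t -> uniq (flatten [seq zb r s (updz z j (m%:Z - r%:Z)) | m <- t]).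
  elim: t => [//|m t IHt] /= /andP[mt ut]; rewrite cat_uniq IH // IHt // andbT /=.
  apply/hasPn => z' /flatten_mapP[m' m't]; rewrite !mem_zb // => /forallP/(_ j).
  rewrite (negPf js) ffunE eqxx => /eqP e; apply/negP => /forallP/(_ j).
  rewrite (negPf js) ffunE eqxx e => /eqP /addIr [] em.
  by rewrite -em m't in mt.
by apply: H; rewrite iota_uniq.
Qed.

Lemma zbox_uniq r : uniq (zbox r). Proof. exact/zb_uniq/enum_uniq. Qed.

Lemma mem_zbox r z : (z \in zbox r) = [forall i, `|z i| <= r%:Z].
Proof.
by rewrite mem_zb ?enum_uniq //; apply: eq_forallb => i; rewrite mem_enum.
Qed.

Lemma it_latW L r s g z : it (latW L r) s g (L *: zpt z) = \sum_(z' <- zb r s z) (L ^+ size s)%:C * g (L *: zpt z').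
Proof.
elim: s z => [|j s IH] z; first by rewrite big_seq1 expr0 mul1r.
rewrite zb_cons big_flatten big_map big_mkord {1}/it /= -/(it _ _ _) {1}/latW /wsum.
apply: eq_bigr => m _.
have -> : upd (L *: zpt z) j (L * (m%:R - r%:R)) = L *: zpt (updz z j (m%:Z - r%:Z)).
  by apply/rowP => i; rewrite !mxE !ffunE; case: eqP => // _; rewrite intrD rmorphN.
by rewrite IH mulr_sumr; apply: eq_bigr => z' _; rewrite exprS rmorphM /= mulrA.
Qed.

Lemma it_zbox L r g : it (latW L r) (enum 'I_d) g 0 = \sum_(z <- zbox r) (L ^+ d)%:C * g (L *: zpt z).
Proof.
have -> : 0 = L *: zpt [ffun=> 0] :> pt by apply/rowP => i; rewrite !mxE ffunE mulr0.
by rewrite it_latW -cardE card_ord.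
Qed.

End Integ.

(** * Convolution *)

Section IntegLin.
Variables (R : realType) (d : nat).
Local Notation pt := (pt R d).
Local Notation testfun := (testfun R d).
Implicit Types (g : testfun) (x y : pt) (C K L e : R).
Local Notation KI := (pi + 1 : R).
Definition grN N : seq (R * pt) := gr (gnum N) (fun=> gstep 1 N) (gpt 1 N) (enum 'I_d) 0.

Lemma grN_ge0 N q : q \in grN N -> 0 <= q.1.
Proof. by apply: gr_ge0 => _; apply/ltW/gstep_gt0. Qed.

Lemma grN_wt : exists N0, forall N, (N0 <= N)%N -> \sum_(q <- grN N) q.1 * wt q.2 <= KI ^+ d.
Proof.
have [N0 H] := grid_w1 (@ltr01 R); exists N0 => N /H h.
have := gr_wt (0 : pt) (fun=> ltW (gstep_gt0 N ltr01)) h (enum_uniq 'I_d).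
by rewrite wo_enum mulr1 -cardE card_ord.
Qed.

Lemma integ_grN e : 0 < e -> exists N0, forall N, (N0 <= N)%N -> forall C g, cls C g ->
  cnorm (integ g - \sum_(q <- grN N) q.1%:C * g q.2) <= e * C.
Proof.
move=> e0; have [N0 H] := integ_riemann d ltr01 e0; exists N0 => N /H h C g /h.
by rewrite /rsW it_gr.
Qed.

Lemma grN_sym N g : \sum_(q <- grN N) q.1%:C * g (- q.2) = \sum_(q <- grN N) q.1%:C * g q.2.
Proof.
have H s x : it (rsW 1 N) s (check g) x = it (rsW 1 N) s g (- x).
  elim: s x => [//|j s IH] x /=.
  rewrite -[RHS](wsum_refl 1 N); congr (wsum _ _ _ _); apply: funext => t; rewrite IH.
  by congr (it _ _ _ _); apply/rowP => i; rewrite !mxE; case: eqP.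
by have := H (enum 'I_d) 0; rewrite oppr0 /rsW !it_gr.
Qed.

Lemma integ_uniq C g (z : R[i]) : cls C g ->
  (forall e, 0 < e -> exists N0, forall N, (N0 <= N)%N -> cnorm (\sum_(q <- grN N) q.1%:C * g q.2 - z) <= e) ->
  integ g = z.
Proof.
move=> Hg H; apply/eqP; rewrite -subr_eq0; apply/eqP; apply: cn_arb => e e0.
have C1 : 0 < 1 + C by rewrite ltr_pwDl // (cls_ge0 Hg).
have e2 : 0 < e / 2 by rewrite divr_gt0.
have [N1 H1] := integ_grN (divr_gt0 e2 C1); have [N2 H2] := H _ e2.
have := H1 _ (leq_maxl N1 N2) _ _ Hg; have := H2 _ (leq_maxr N1 N2).
move: (\sum_(q <- _) _) => S h2 h1; rewrite [e]splitr (le_trans (cn_tri _ S _)) // lerD //.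
by rewrite (le_trans h1) // mulrAC ler_pdivrMr // ler_wpM2l ?(ltW e2) // lerDr.
Qed.

Lemma cls_ZD (a : R[i]) C1 C2 g1 g2 : cls C1 g1 -> cls C2 g2 -> cls (cnorm a * C1 + C2) (fun x => a * g1 x + g2 x).
Proof.
move=> [h1 k1] [h2 k2]; split=> [x|x j s t].
  by rewrite (le_trans (cnD _ _)) // mulrDl lerD // cnM -mulrA ler_wpM2l ?cn_ge0.
rewrite (_ : _ - _ = a * (g1 (upd x j s) - g1 (upd x j t)) + (g2 (upd x j s) - g2 (upd x j t))).
  rewrite (le_trans (cnD _ _)) // (mulrDl _ _ `|s - t|) (mulrDl _ _ (wo _ _)) lerD // cnM.
  by rewrite -(mulrA (cnorm a)) -(mulrA (cnorm a)) ler_wpM2l ?cn_ge0.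
by rewrite mulrBr opprD addrACA.
Qed.

Lemma cls0 : cls 0 ((fun=> 0) : testfun).
Proof. by split=> [x|x j s t]; rewrite ?subrr cn0 !mul0r. Qed.

Lemma integ0 : integ ((fun=> 0) : testfun) = 0.
Proof.
apply: (integ_uniq cls0) => e e0; exists 0%N => N _.
by rewrite big1 ?subrr ?cn0 ?ltW // => q _; rewrite mulr0.
Qed.

Lemma integ_ZD (a : R[i]) C1 C2 g1 g2 : cls C1 g1 -> cls C2 g2 ->
  integ (fun x => a * g1 x + g2 x) = a * integ g1 + integ g2.
Proof.
move=> H1 H2; apply: (integ_uniq (cls_ZD a H1 H2)) => e e0.
have K0 : 0 < 1 + (cnorm a * C1 + C2) by rewrite ltr_pwDl // addr_ge0 ?mulr_ge0 ?cn_ge0 ?(cls_ge0 H1) ?(cls_ge0 H2).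
have [N0 H] := integ_grN (divr_gt0 e0 K0); exists N0 => N /H {}H.
have := H _ _ H1; have := H _ _ H2.
have -> : \sum_(q <- grN N) q.1%:C * (a * g1 q.2 + g2 q.2) =
   a * (\sum_(q <- grN N) q.1%:C * g1 q.2) + \sum_(q <- grN N) q.1%:C * g2 q.2.
  by rewrite mulr_sumr -big_split /=; apply: eq_bigr => q _; rewrite mulrDr mulrCA.
move: (\sum_(q <- _) _) (\sum_(q <- _) _) => s1 s2 h2 h1.
rewrite (_ : _ - _ = a * (s1 - integ g1) + (s2 - integ g2)); last by rewrite mulrBr opprD addrACA.
rewrite (le_trans (cnD _ _)) // cnM cnBC (cnBC s2).
apply: (@le_trans _ _ (cnorm a * (e / (1 + (cnorm a * C1 + C2)) * C1) + e / (1 + (cnorm a * C1 + C2)) * C2)).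
  by rewrite lerD // ler_wpM2l ?cn_ge0.
rewrite mulrCA -mulrDr mulrAC ler_pdivrMr // ler_wpM2l ?(ltW e0) // lerDr //.
Qed.

Lemma integ_sum (I : Type) (r : seq I) (c : I -> R[i]) (F : I -> testfun) :
  (forall i, exists C, cls C (F i)) ->
  (exists C, cls C (fun x => \sum_(i <- r) c i * F i x)) /\
  integ (fun x => \sum_(i <- r) c i * F i x) = \sum_(i <- r) c i * integ (F i).
Proof.
move=> H; elim: r => [|i r [[C IH1] IH2]].
  have -> : (fun x => \sum_(i <- [::]) c i * F i x) = (fun=> 0) by apply: funext => x; rewrite big_nil.
  by rewrite big_nil integ0; split=> //; exists 0; exact: cls0.
have -> : (fun x => \sum_(i <- i :: r) c i * F i x) = (fun x => c i * F i x + \sum_(i <- r) c i * F i x).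
  by apply: funext => x; rewrite big_cons.
have [C' H'] := H i; split; first by eexists; exact: cls_ZD H' IH1.
by rewrite (integ_ZD (c i) H' IH1) IH2 big_cons.
Qed.

End IntegLin.

Opaque ew.

Section Conv.
Variables (R : realType) (d : nat) (M A : nat -> R).
Hypotheses (wM : weight_seq M) (wA : weight_seq A) (M2 : cond_M2' M) (A2 : cond_M2' A).
Local Notation pt := (pt R d).
Local Notation testfun := (testfun R d).
Implicit Types (phi psi u v : testfun) (l c : R) (x y : pt).
Local Notation bnd := (@bnd R d M A).
Local Notation bnd0 := (@bnd0 R d A).
Local Notation KI := (pi + 1 : R).
Local Notation conv := (@Defs.conv R d).

(** [ew_split] distributes the weight over x - y and y; the factor at y is dilated once more to
    release the integrable weight [wt y]. *)
Lemma prod_decay : exists2 k : R, 1 <= k & forall b, 0 < b -> exists2 C : R, 0 < C &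
  forall x y, ew A (b * eucl x) <= C * wt y * (ew A (k * b * eucl (x - y)) * ew A (k * b * eucl y)).
Proof.
have [k k1 H] := ew_wt d wA A2.
have k0 : 0 < k := lt_le_trans ltr01 k1.
exists (2 * k); first by rewrite (le_trans k1) // ler_peMl ?ler1n // ltW.
move=> b b0; have b20 : 0 < 2 * b by rewrite mulr_gt0.
have [C C0 HC] := H _ b20; exists C => // x y.
apply: le_trans (ew_split wA x y (ltW b0)) _.
have e1 : ew A (2 * b * eucl (x - y)) <= ew A (2 * k * b * eucl (x - y)).
  apply: ew_scale => //; [exact: ltW| |exact: eucl_ge0].
  by rewrite -[2 * k]mulrC -[leRHS]mulrA ler_peMl // ltW.
have e2 : ew A (2 * b * eucl y) <= C * wt y * ew A (2 * k * b * eucl y).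
  apply: le_trans (_ : ew A (2 * b * eucl y) * (1 + eucl y ^+ 2) <= _).
    by rewrite ler_peMr ?ew_ge0 // lerDl sqr_ge0.
  by have := HC y; rewrite mulrA (mulrC k).
rewrite (le_trans (ler_pM (ew_ge0 _ _) (ew_ge0 _ _) e1 e2)) //.
by rewrite mulrCA.
Qed.

(** First derivatives are included because the integrand of a convolution must satisfy the Lipschitz
    part of [cls], which [cls_pdr] extracts from them. *)
Definition dec q c u := smooth u /\ forall x, cnorm (u x) * ew A (q * eucl x) <= c /\
  forall j, cnorm (pderiv j u x) * ew A (q * eucl x) <= c.

Lemma dec_ge0 q c u : dec q c u -> 0 <= c.
Proof. by case=> _ /(_ 0)[h _]; apply: le_trans h; rewrite mulr_ge0 ?cn_ge0 ?ew_ge0. Qed.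

Lemma ew_le_wq (q q' : R) x (z : R[i]) c : 0 <= q' -> q' <= q ->
  cnorm z * ew A (q * eucl x) <= c -> cnorm z * ew A (q' * eucl x) <= c.
Proof.
move=> q0 qq; apply: le_trans; apply: ler_wpM2l (cn_ge0 z) _ _ _.
exact: (ew_scale wA q0 qq (eucl_ge0 x)).
Qed.

Lemma dec_wq (q q' : R) c u : 0 <= q' -> q' <= q -> dec q c u -> dec q' c u.
Proof.
move=> q0 qq [sm h]; split; first exact: sm.
move=> x; have [h1 h2] := h x; split=> [|j]; [exact: (@ew_le_wq q q' x (u x) c q0 qq h1)|exact: (@ew_le_wq q q' x (pderiv j u x) c q0 qq (h2 j))].
Qed.

Lemma pdr_refl_prod u v x y j : smooth u -> smooth v ->
  pdr (fun y => u (x - y) * v y) j y (- pderiv j u (x - y) * v y + u (x - y) * pderiv j v y).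
Proof.
move=> su sv.
have h1 : pdr (fun y => u (x - y)) j y (- pderiv j u (x - y)).
  have := smooth_pdr j (- (y - x)) su => /pdr_check/pdr_transl; rewrite opprB.
  by apply: cder_eq => h; rewrite /transl /check opprB.
have := cderM h1 (smooth_pdr j y sv); by rewrite scale0r addr0.
Qed.

(** Two kinds of constants are kept apart: c1 and c2 also control first derivatives and give the
    class of the integrand, while b1 and b2 control values only and suffice for the size of the
    convolution, by [integ_bound]. *)
Lemma conv_main : exists2 k : R, 1 <= k & forall b, 0 < b -> exists2 C : R, 0 < C &
  forall u v c1 c2, dec (k * b) c1 u -> dec (k * b) c2 v ->
  (forall x, cls (C * (c1 * c2) / ew A (b * eucl x)) (fun y => u (x - y) * v y)) /\
  forall b1 b2, (forall y, cnorm (u y) * ew A (k * b * eucl y) <= b1) ->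
    (forall y, cnorm (v y) * ew A (k * b * eucl y) <= b2) ->
  forall x, cnorm (conv u v x) * ew A (b * eucl x) <= C * (b1 * b2).
Proof.
have [k k1 H] := prod_decay; exists k => // b b0; have [C C0 HC] := H b b0.
exists (4 * C + KI ^+ d * C).
  by rewrite ltr_pwDl ?mulr_gt0 // mulr_ge0 ?exprn_ge0 ?(ltW C0) // addr_ge0 ?pi_ge0.
have P (z w : R[i]) c1 c2 x y : cnorm z * ew A (k * b * eucl (x - y)) <= c1 -> cnorm w * ew A (k * b * eucl y) <= c2 ->
   cnorm (z * w) <= C * (c1 * c2) / ew A (b * eucl x) * wt y.
  move=> h1 h2; rewrite mulrAC ler_pdivlMr ?ew_gt0 // cnM.
  apply: le_trans (ler_wpM2l _ (HC x y)) _; first by rewrite mulr_ge0 ?cn_ge0.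
  have := ler_pM (mulr_ge0 (cn_ge0 z) (ew_ge0 A _)) (mulr_ge0 (cn_ge0 w) (ew_ge0 A _)) h1 h2.
  have : 0 <= C * wt y by rewrite mulr_ge0 ?ltW ?wt_gt0.
  move: (cnorm z) (cnorm w) (ew A _) (ew A (k * b * eucl y)) (wt y) (c1 * c2) => a1 a2 e1 e2 w' c w0 h.
  rewrite (_ : a1 * a2 * _ = C * w' * (a1 * e1 * (a2 * e2))); last by ring.
  by rewrite (_ : C * c * w' = C * w' * c); [exact: ler_wpM2l|ring].
move=> u v c1 c2 Hu Hv; have c10 := dec_ge0 Hu; have c20 := dec_ge0 Hv.
case: Hu => su Hu; case: Hv => sv Hv.
have K0 : 0 <= KI ^+ d * C by rewrite mulr_ge0 ?exprn_ge0 ?(ltW C0) // addr_ge0 ?pi_ge0.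
have Hc x : cls (4 * C * (c1 * c2) / ew A (b * eucl x)) (fun y => u (x - y) * v y).
  (* One factor 2 comes from [cls_pdr], the other from the two terms of the product rule. *)
  rewrite (_ : 4 * C * _ / _ = 2 * (2 * (C * (c1 * c2) / ew A (b * eucl x)))); last by ring.
  apply: cls_pdr => [y|j y].
    rewrite (le_trans (P _ _ _ _ _ _ (Hu (x - y)).1 (Hv y).1)) // ler_wpM2r ?(ltW (wt_gt0 _)) //.
    by rewrite ler_peMl ?ler1n // divr_ge0 ?ew_ge0 // !mulr_ge0 // ltW.
  eexists; first exact: pdr_refl_prod.
  rewrite (le_trans (cnD _ _)) // mulNr cnN -mulrA mulr_natl mulr2n lerD //.
    exact: P _ _ _ _ _ _ ((Hu (x - y)).2 j) (Hv y).1.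
  exact: P _ _ _ _ _ _ (Hu (x - y)).1 ((Hv y).2 j).
split=> [x|b1 b2 h1 h2 x].
  have [k1' k2'] := Hc x.
  have le : 4 * C * (c1 * c2) / ew A (b * eucl x) <= (4 * C + KI ^+ d * C) * (c1 * c2) / ew A (b * eucl x).
    by rewrite ler_wpM2r ?invr_ge0 ?ew_ge0 // ler_wpM2r ?mulr_ge0 // lerDl.
  split=> [y|y j s t].
    by rewrite (le_trans (k1' y)) // ler_wpM2r // ltW // wt_gt0.
  by rewrite (le_trans (k2' y j s t)) // ler_wpM2r ?wo_ge0 // ler_wpM2r.
have b10 : 0 <= b1 by apply: le_trans (h1 0); rewrite mulr_ge0 ?cn_ge0 ?ew_ge0.
have b20 : 0 <= b2 by apply: le_trans (h2 0); rewrite mulr_ge0 ?cn_ge0 ?ew_ge0.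
rewrite -ler_pdivlMr ?ew_gt0 //.
apply: le_trans (integ_bound (Hc x) (C0 := C * (b1 * b2) / ew A (b * eucl x)) _) _.
  by move=> y; exact: P _ _ _ _ _ _ (h1 (x - y)) (h2 y).
rewrite !mulrA ler_wpM2r ?invr_ge0 ?ew_ge0 // ler_wpM2r // ler_wpM2r // lerDr.
by rewrite mulr_ge0 // ltW.
Qed.

Lemma bnd_dec : exists2 H : R, 1 <= H & exists2 C, 0 < C & forall l c phi s, 0 < l -> bnd l c phi ->
  dec l^-1 (c * ((1 + C * l) * ((l * H) ^+ size s * M (size s)))) (DD s phi).
Proof.
have [C0 [H [C01 [H1 HM]]]] := M2; exists H => //; exists C0; first exact: lt_le_trans C01.
move=> l c phi s l0 b; have c0 := bnd_ge0 wM l0 b; case: b => sm b.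
have H0 : 0 < H := lt_le_trans ltr01 H1.
have C00 : 0 < C0 := lt_le_trans ltr01 C01.
have Ms := M_ge0 wM (size s).
have h1 : l ^+ size s * M (size s) <= (l * H) ^+ size s * M (size s).
  by rewrite ler_wpM2r // lerXn2r ?nnegrE ?mulr_ge0 ?(ltW l0) ?(ltW H0) // ler_peMr // ltW.
have p0 : 0 <= (l * H) ^+ size s * M (size s) by rewrite mulr_ge0 ?exprn_ge0 ?mulr_ge0 ?(ltW l0) ?(ltW H0).
split; first exact: smooth_DD.
move=> x; split=> [|j].
  rewrite (le_trans (b s x)) // ler_wpM2l // mulrDl mul1r ler_wpDr //.
  by rewrite mulr_ge0 // mulr_ge0 // ltW.
rewrite (le_trans (b (j :: s) x)) // ler_wpM2l // mulrDl mul1r ler_wpDl //=.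
rewrite exprS exprMn; apply: (@le_trans _ _ (l * l ^+ size s * (C0 * H ^+ size s * M (size s)))).
  by rewrite ler_wpM2l // mulr_ge0 ?exprn_ge0 // ltW.
by rewrite le_eqVlt; apply/orP; left; apply/eqP; ring.
Qed.

(** Riemann sum of the convolution, read as a finite combination of translates of phi: linear
    translation invariant operations pass through it. *)
Definition rsc N phi psi : testfun := fun x => \sum_(q <- grN R d N) (q.1%:C * psi q.2) * transl q.2 phi x.

(** All that is needed about convolution at one scale, with a loss k independent of the scale. In
    the third clause psi enters through its values only, in the fourth phi does so too; the last
    clause is the convergence of the Riemann sums in norm. *)
Definition conv_ok (k : R) := 1 <= k /\ forall l, 0 < l -> exists2 C, 0 < C & forall phi psi c1 c2,
  bnd (l / k) c1 phi -> bnd (l / k) c2 psi ->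
  [/\ smooth (conv phi psi) /\ forall s, DD s (conv phi psi) = conv (DD s phi) psi,
      exists2 K, 0 <= K & forall s x, cls (K * (l ^+ size s * M (size s)) / ew A (l^-1 * eucl x)) (fun y => DD s phi (x - y) * psi y),
      forall b2, bnd0 (l / k) b2 psi -> bnd l (C * (c1 * b2)) (conv phi psi),
      forall b1 b2, bnd0 (l / k) b1 phi -> bnd0 (l / k) b2 psi -> bnd0 l (C * (b1 * b2)) (conv phi psi) &
      forall e, 0 < e -> exists N0, forall N, (N0 <= N)%N -> bnd l e (fun x => conv phi psi x - rsc N phi psi x)].

Lemma smooth_rsc N phi psi : smooth phi -> smooth (rsc N phi psi) /\
  forall s x, DD s (rsc N phi psi) x = \sum_(q <- grN R d N) q.1%:C * (DD s phi (x - q.2) * psi q.2).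
Proof.
move=> sm; have h q : smooth (transl q phi) by exact: smooth_transl.
split; first by apply: (smooth_sum _ _ (fun q => h q.2)).
move=> s x; rewrite (DD_sum _ _ s (fun q => h q.2)); apply: eq_bigr => q _.
by rewrite DD_transl // /transl -mulrA [psi _ * _]mulrC.
Qed.

Lemma conv_ok_ex : exists k, conv_ok k.
Proof.
have [k k1 Hk] := conv_main; have [H H1 [C1 C10 Hd]] := bnd_dec.
have k0 : 0 < k := lt_le_trans ltr01 k1. have H0 : 0 < H := lt_le_trans ltr01 H1.
have kH0 : 0 < k * H by rewrite mulr_gt0.
exists (k * H); split; first by rewrite -[1]mulr1 ler_pM.
move=> l l0; have li : 0 < l^-1 by rewrite invr_gt0.
have [C C0 HC] := Hk _ li.
set l1 := l / (k * H); have l10 : 0 < l1 by rewrite divr_gt0.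
have l1i : k / l <= l1^-1.
  by rewrite /l1 invf_div ler_wpM2r ?(ltW li) // ler_peMr // ltW.
have kl0 : 0 <= k / l by rewrite divr_ge0 ?ltW.
set D := 1 + C1 * l1; have D0 : 0 < D by rewrite ltr_pwDl // mulr_ge0 // ltW.
exists (C * D * D * (1 + M 0%N)).
  by rewrite !mulr_gt0 // ltr_pwDl // (M_ge0 wM).
have CC : C <= C * D * D * (1 + M 0%N).
  have D1 : 1 <= D by rewrite lerDl mulr_ge0 // ltW.
  rewrite -!mulrA ler_peMr ?(ltW C0) // mulr_ege1 // mulr_ege1 // lerDl (M_ge0 wM) //.
move=> phi psi c1 c2 b1 b2; have c10 := bnd_ge0 wM l10 b1; have c20 := bnd_ge0 wM l10 b2.
have Ms s : 0 <= l ^+ size s * M (size s) by rewrite mulr_ge0 ?exprn_ge0 ?(M_ge0 wM) // ltW.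
have lHl : l1 * H <= l.
  by rewrite /l1 invfM mulrA mulfVK ?gt_eqF // ler_pdivrMr // ler_peMr // ltW.
have d1 s : dec (k / l) (c1 * (D * (l ^+ size s * M (size s)))) (DD s phi).
  have := dec_wq kl0 l1i (Hd _ _ _ s l10 b1) => -[sm h]; split=> // x.
  have le : c1 * (D * ((l1 * H) ^+ size s * M (size s))) <= c1 * (D * (l ^+ size s * M (size s))).
    have lH0 : 0 <= l1 * H := mulr_ge0 (ltW l10) (ltW H0).
    by rewrite ler_wpM2l // ler_wpM2l ?(ltW D0) // ler_wpM2r ?(M_ge0 wM) // lerXn2r ?nnegrE ?lH0 ?(ltW l0).
  by have [h1 h2] := h x; split=> [|j]; [exact: le_trans h1 le|exact: le_trans (h2 j) le].
have d2 : dec (k / l) (c2 * (D * M 0%N)) psi.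
  by have := dec_wq kl0 l1i (Hd _ _ _ [::] l10 b2); rewrite /= expr0 mul1r.
have cl s x := (HC _ _ _ _ (d1 s) d2).1 x.
have RS (e : R) : 0 < e -> exists N0, forall N, (N0 <= N)%N -> forall s x,
   cnorm (DD s (rsc N phi psi) x - conv (DD s phi) psi x) * ew A (l^-1 * eucl x) <= e * (l ^+ size s * M (size s)).
  move=> e0; set K := C * (c1 * D * (c2 * (D * M 0%N))).
  have K0 : 0 <= K by rewrite !mulr_ge0 ?(ltW C0) ?(ltW D0) ?(M_ge0 wM).
  have K1 : 0 < 1 + K by rewrite ltr_pwDl.
  have [N0 HN] := integ_grN d (divr_gt0 e0 K1); exists N0 => N /HN h s x.
  rewrite ((smooth_rsc N psi b1.1).2 s x) cnBC -ler_pdivlMr ?ew_gt0 // (le_trans (h _ _ (cl s x))) //.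
  rewrite mulrA ler_wpM2r ?invr_ge0 ?ew_ge0 //.
  rewrite (_ : C * _ = K * (l ^+ size s * M (size s))); last by rewrite /K; ring.
  rewrite mulrA ler_wpM2r // mulrAC ler_pdivrMr // ler_wpM2l ?(ltW e0) // lerDr //.
have cE : conv phi psi = (fun s => conv (DD s phi) psi) [::] by [].
(* In place of differentiation under the integral sign: derivatives of Riemann sums are Riemann sums
   of derivatives, and these converge uniformly. *)
have [sm dd] : smooth (conv phi psi) /\ forall s, DD s (conv phi psi) = conv (DD s phi) psi.
  rewrite cE; apply: (@smooth_lim _ _ (fun N => rsc N phi psi)).
    by move=> N; exact: (smooth_rsc N psi b1.1).1.
  move=> s e e0; have Q0 : 0 < l ^+ size s * M (size s) by rewrite mulr_gt0 ?exprn_gt0 // (M_gt0 wM).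
  have [N0 HN] := RS _ (divr_gt0 e0 Q0); exists N0 => N /HN /(_ s) h x.
  apply: le_trans (_ : _ * ew A (l^-1 * eucl x) <= _); last by apply: le_trans (h x) _; rewrite divfK ?gt_eqF.
  by rewrite ler_peMr ?cn_ge0 // ew_ge1 // mulr_ge0 ?eucl_ge0 // ltW.
split.
- by split.
- exists (C * (c1 * D * (c2 * (D * M 0%N)))).
    by rewrite !mulr_ge0 ?(ltW C0) ?(ltW D0) ?(M_ge0 wM).
  move=> s x; have := cl s x; congr (cls (_ / _) _); ring.
- move=> b hb; have b0 : 0 <= b by apply: le_trans (hb 0); rewrite mulr_ge0 ?cn_ge0 ?ew_ge0.
  split=> // s x; rewrite dd.
  apply: le_trans ((HC _ _ _ _ (d1 s) d2).2 (c1 * (D * (l ^+ size s * M (size s)))) b _ _ x) _.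
  + by move=> y; have [_ /(_ y)[]] := d1 s.
  + by move=> y; apply: ew_le_wq (hb y).
  rewrite (_ : C * (_ * b) = C * D * (c1 * b) * (l ^+ size s * M (size s))); last by ring.
  rewrite ler_wpM2r // ler_wpM2r ?mulr_ge0 //.
  have D1 : 1 <= D by rewrite lerDl mulr_ge0 // ltW.
  rewrite -[leRHS]mulrA ler_peMr ?mulr_ge0 ?(ltW C0) ?(ltW D0) // mulr_ege1 // lerDl (M_ge0 wM) //.
- move=> a b ha hb x.
  have a0 : 0 <= a by apply: le_trans (ha 0); rewrite mulr_ge0 ?cn_ge0 ?ew_ge0.
  have b0 : 0 <= b by apply: le_trans (hb 0); rewrite mulr_ge0 ?cn_ge0 ?ew_ge0.
  apply: le_trans ((HC _ _ _ _ (d1 [::]) d2).2 a b _ _ x) _.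
  + by move=> y; apply: ew_le_wq (ha y).
  + by move=> y; apply: ew_le_wq (hb y).
  by rewrite ler_wpM2r ?mulr_ge0.
- move=> e e0; have [N0 HN] := RS e e0; exists N0 => N /HN h.
  have -> : (fun x => conv phi psi x - rsc N phi psi x) = (fun x => -1 * rsc N phi psi x + conv phi psi x).
    by apply: funext => x; rewrite mulN1r addrC.
  have [sr _] := smooth_rsc N psi b1.1.
  split=> [|s x]; first exact: smoothZD.
  by rewrite (DDZD (-1) s sr sm) dd mulN1r addrC cnBC h.
Qed.

End Conv.

(** * Calculus of the quantifier over scales *)

Section QQ.
Variable R : realType.
Implicit Types (b : bool) (P Q : R -> Prop) (l k : R).

Lemma QQ_imp b P Q : (forall l, 0 < l -> P l -> Q l) -> QQ b P -> QQ b Q.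
Proof. by case: b => H; [move=> [l [l0 h]]; exists l; split=> //; exact: H|move=> h l l0; apply: H => //; exact: h]. Qed.

Lemma QQ_scale b P k : 0 < k -> QQ b P -> QQ b (fun l => P (l / k)).
Proof.
move=> k0; case: b => [[l [l0 h]]|h l l0]; last by apply: h; rewrite divr_gt0.
by exists (l * k); rewrite mulr_gt0 // mulfK ?gt_eqF.
Qed.

(** Of the two quantifiers one is existential and the other universal, hence a common scale.
    Typically P is a continuity estimate and Q the membership of a test function or a convergence in
    S. *)
Lemma QQ_meet b P Q : QQ b P -> QQ (~~ b) Q -> exists2 l, 0 < l & P l /\ Q l.
Proof.
by case: b => /= [[l [l0 p]] q|p [l [l0 q]]]; exists l => //; split=> //; [exact: q|exact: p].
Qed.

Lemma QQ_and b P Q : (forall l l', 0 < l' -> l' <= l -> P l -> P l') -> (forall l l', 0 < l' -> l' <= l -> Q l -> Q l') ->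
  QQ b P -> QQ b Q -> QQ b (fun l => P l /\ Q l).
Proof.
case: b => HP HQ; last by move=> p q l l0; split; [exact: p|exact: q].
move=> [l1 [l10 p]] [l2 [l20 q]]; exists (Num.min l1 l2); rewrite lt_min l10 l20; split=> //.
by split; [apply: HP p|apply: HQ q]; rewrite ?lt_min ?l10 // ge_min lexx ?orbT.
Qed.

End QQ.

(** * Translations, modulations and convolution on S *)

Section ConvS.
Variables (R : realType) (d : nat) (beur : bool) (M A : nat -> R).
Hypotheses (wM : weight_seq M) (wA : weight_seq A) (M1 : cond_M1 M) (M2 : cond_M2' M) (A2 : cond_M2' A).
Local Notation pt := (pt R d).
Local Notation testfun := (testfun R d).
Implicit Types (phi psi theta : testfun) (l c : R) (x y : pt).
Local Notation bnd := (@bnd R d M A).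
Local Notation bnd0 := (@bnd0 R d A).
Local Notation conv := (@Defs.conv R d).
Local Notation S := (GS beur M A).

Lemma GS_QQ phi : S phi <-> QQ (~~ beur) (fun l => exists c, bnd l c phi).
Proof. by rewrite GS_P //; case: beur. Qed.

(** A fixed factor K in the scale is absorbed by the quantifier over scales, in both cases. *)
Lemma GS_map2 (K : R) phi psi theta : 0 < K ->
  (forall l c1 c2, 0 < l -> bnd l c1 phi -> bnd l c2 psi -> exists c, bnd (K * l) c theta) ->
  S phi -> S psi -> S theta.
Proof.
move=> K0 H h1 h2; have [P [HP HQ]] := GS_common wM wA h1 h2; apply/GS_QQ.
move: (QQ_scale K0 HQ); apply: QQ_imp => l l0 /HP[lk [c [b1 b2]]].
by have := H _ _ _ lk b1 b2; rewrite mulrC divfK ?gt_eqF.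
Qed.

Lemma GS_map (K : R) phi theta : 0 < K ->
  (forall l c, 0 < l -> bnd l c phi -> exists c', bnd (K * l) c' theta) -> S phi -> S theta.
Proof. by move=> K0 H h; apply: (GS_map2 K0 _ h h) => l c1 _ l0 b _; exact: H b. Qed.

Lemma GS_ev phi : S phi -> exists2 l0, 0 < l0 & forall l, l0 <= l -> exists c, bnd l c phi.
Proof.
move=> /GS_QQ; case: beur => /= [H|[l [l0 [c b]]]].
  by exists 1 => // l l1; apply: H; exact: lt_le_trans l1.
by exists l => // l' ll; exists c; exact: bnd_wl b.
Qed.

Lemma bnd_transl l c y phi : 0 < l -> bnd l c phi -> bnd (2 * l) (c * ew A (l^-1 * eucl y)) (transl y phi).
Proof.
move=> l0 b; have c0 := bnd_ge0 wM l0 b; case: b => sm b; split; first exact: smooth_transl.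
move=> s x; rewrite DD_transl // /transl.
have h : ew A ((2 * l)^-1 * eucl x) <= ew A (l^-1 * eucl (x - y)) * ew A (l^-1 * eucl y).
  have := ew_split wA x y (_ : 0 <= (2 * l)^-1).
  rewrite (_ : 2 * (2 * l)^-1 = l^-1); last by rewrite invfM mulrA divff ?mul1r // pnatr_eq0.
  by apply; rewrite invr_ge0 mulr_ge0 // ltW.
apply: (le_trans (ler_wpM2l (cn_ge0 _) h)); rewrite [leLHS]mulrA.
apply: (le_trans (ler_wpM2r (ew_ge0 A (l^-1 * eucl y)) (b s (x - y)))).
rewrite [leRHS]mulrAC ler_wpM2r ?ew_ge0 // ler_wpM2l // ler_wpM2r ?(M_ge0 wM) // lerXn2r ?nnegrE ?mulr_ge0 ?(ltW l0) //.
by rewrite ler_peMl ?ler1n // ltW.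
Qed.

Lemma bnd_check l c phi : bnd l c phi -> bnd l c (check phi).
Proof.
move=> [sm b]; split; first exact: smooth_check.
move=> s x; rewrite DD_check // cnM cnX cnN cn1 expr1n mul1r /check.
by have := b s (- x); rewrite euclN.
Qed.

(** Derivatives falling on the exponential produce powers of 2 pi |xi|, which [ew M] converts into
    l^n M_n / M_0. Log-convexity recombines M_n M_m, and the 2^|s| terms of the product rule double
    the scale. *)
Lemma bnd_modul l c xi phi : 0 < l -> bnd l c phi -> bnd (2 * l) (c * ew M (2 * pi * eucl xi / l)) (modul xi phi).
Proof.
move=> l0 b; have c0 := bnd_ge0 wM l0 b; case: b => sm b; split; first exact: smooth_modul.
set a : R := 2 * pi * eucl xi; set W := ew M (a / l).
have a0 : 0 <= a by rewrite !mulr_ge0 ?pi_ge0 ?eucl_ge0.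
have Mg := M_gt0 wM. have Mg0 p := ltW (Mg p).
have aW n m : a ^+ n * (l ^+ m * M m) <= W * (l ^+ (n + m) * M (n + m)%N).
  have h1 : a ^+ n <= W * (l ^+ n * M n / M 0%N).
    have := ew_ge wM n (divr_ge0 a0 (ltW l0)); rewrite -/W expr_div_n.
    rewrite -ler_pdivrMr ?divr_gt0 ?mulr_gt0 ?exprn_gt0 //; apply: le_trans.
    by rewrite le_eqVlt; apply/orP; left; apply/eqP; field; rewrite !gt_eqF ?exprn_gt0.
  have W0 : 0 <= W := ew_ge0 _ _.
  apply: le_trans (ler_wpM2r _ h1) _; first by rewrite mulr_ge0 ?exprn_ge0 // ltW.
  rewrite -[leLHS]mulrA ler_wpM2l // exprD -[leRHS]mulrA.
  rewrite (_ : _ / _ * _ = l ^+ n * (l ^+ m * (M n * M m / M 0%N))); last by ring.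
  rewrite ler_wpM2l ?exprn_ge0 ?(ltW l0) // ler_wpM2l ?exprn_ge0 ?(ltW l0) //.
  by rewrite ler_pdivrMr // mulrC mulrC [leRHS]mulrC (M_logconv wM M1).
(* Here n counts the powers of a already produced and m the derivatives already on psi; both must
   vary for the induction on the word to close. *)
have main (b0 : R) x s : 0 <= b0 -> forall psi n m, smooth psi ->
    (forall s', cnorm (DD s' psi x) <= b0 * (l ^+ (m + size s') * M (m + size s')%N)) ->
    a ^+ n * cnorm (DD s (modul xi psi) x) <= b0 * (2 ^+ size s * (W * (l ^+ (n + m + size s) * M (n + m + size s)%N))).
  move=> b00; elim/last_ind: s => [|s j IH] psi n m spsi h.
    rewrite expr0 mul1r addn0 /modul cnM cn_expi mul1r.
    apply: (@le_trans _ _ (a ^+ n * (b0 * (l ^+ m * M m)))).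
      by rewrite ler_wpM2l ?exprn_ge0 //; have := h [::]; rewrite addn0.
    by rewrite mulrCA ler_wpM2l.
  have sj := smooth_pderiv j spsi.
  have -> : DD (rcons s j) (modul xi psi) x = frq xi j * DD s (modul xi psi) x + DD s (modul xi (pderiv j psi)) x.
    rewrite -cats1 DD_cat /= pderiv_modul //.
    by rewrite (DDZD (frq xi j) s (smooth_modul xi spsi) (smooth_modul xi sj)).
  have h' s' : cnorm (DD s' (pderiv j psi) x) <= b0 * (l ^+ (m.+1 + size s') * M (m.+1 + size s')%N).
    by have := h (rcons s' j); rewrite -cats1 DD_cat size_cat addn1 addnS addSn.
  have i1 := IH psi n.+1 m spsi h; have i2 := IH (pderiv j psi) n m.+1 sj h'.
  rewrite size_rcons exprS -mulrA mulrCA [leRHS]mulr_natl mulr2n.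
  rewrite (_ : (n.+1 + m + size s = n + m + (size s).+1)%N) in i1; last by lia.
  rewrite (_ : (n + m.+1 + size s = n + m + (size s).+1)%N) in i2; last by lia.
  apply: le_trans (_ : a ^+ n * (a * cnorm (DD s (modul xi psi) x) + cnorm (DD s (modul xi (pderiv j psi)) x)) <= _).
    rewrite ler_wpM2l ?exprn_ge0 // (le_trans (cnD _ _)) // lerD2r cnM ler_wpM2r ?cn_ge0 //.
    rewrite /frq /cnorm /= expr0n add0r sqrtr_sqr normrM ger0_norm ?mulr_ge0 ?pi_ge0 //.
    by rewrite ler_wpM2l ?mulr_ge0 ?pi_ge0 // eucl_coord.
  by rewrite mulrDr; apply: lerD => //; rewrite mulrA -exprSr.
move=> s x; set E := ew A ((2 * l)^-1 * eucl x).
have E0 : 0 < E := ew_gt0 _ _.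
have hs s' : cnorm (DD s' phi x) * E <= c * (l ^+ size s' * M (size s')).
  apply: le_trans (b s' x); rewrite ler_wpM2l ?cn_ge0 // /E ew_scale //.
  - by rewrite invr_ge0 mulr_ge0 // ltW.
  - by rewrite lef_pV2 ?posrE ?mulr_gt0 // ler_peMl ?ler1n // ltW.
  - exact: eucl_ge0.
have cE : 0 <= c / E by rewrite divr_ge0 // ltW.
have := main (c / E) x s cE phi 0%N 0%N sm; rewrite expr0 mul1r => /(_ _)/le_trans h.
rewrite -ler_pdivlMr //; apply: h => [s'|].
  by rewrite mulrAC ler_pdivlMr // hs.
by rewrite !add0n exprMn le_eqVlt; apply/orP; left; apply/eqP; ring.
Qed.

Lemma bnd_pderiv : exists2 H : R, 1 <= H & exists2 C, 0 < C & forall l c phi j, 0 < l -> bnd l c phi ->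
  bnd (H * l) (C * l * c) (pderiv j phi).
Proof.
have [C0 [H [C01 [H1 HM]]]] := M2; exists H => //; exists C0; first exact: lt_le_trans C01.
move=> l c phi j l0 b; have c0 := bnd_ge0 wM l0 b; case: b => sm b.
have H0 : 0 < H := lt_le_trans ltr01 H1.
split=> [|s x]; first exact: smooth_pderiv.
have Hl : 0 < H * l by rewrite mulr_gt0.
have := b (rcons s j) x; rewrite -cats1 DD_cat size_cat addn1 => h.
apply: le_trans (_ : cnorm (DD s (pderiv j phi) x) * ew A (l^-1 * eucl x) <= _).
  rewrite ler_wpM2l ?cn_ge0 // ew_scale //; [by rewrite invr_ge0 ltW| |exact: eucl_ge0].
  by rewrite lef_pV2 ?posrE // ler_peMl // ltW.
rewrite (le_trans h) // exprS exprMn.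
apply: le_trans (_ : c * (l * l ^+ size s * (C0 * H ^+ size s * M (size s))) <= _).
  by rewrite ler_wpM2l // ler_wpM2l // mulr_ge0 ?exprn_ge0 // ltW.
by rewrite le_eqVlt; apply/orP; left; apply/eqP; ring.
Qed.

Lemma GS_transl y phi : S phi -> S (transl y phi).
Proof. by apply: (@GS_map 2) => // l c l0 b; eexists; exact: bnd_transl l0 b. Qed.

Lemma GS_check phi : S phi -> S (check phi).
Proof. by apply: (@GS_map 1) => // l c l0 b; rewrite mul1r; exists c; exact: bnd_check. Qed.

Lemma GS_modul xi phi : S phi -> S (modul xi phi).
Proof. by apply: (@GS_map 2) => // l c l0 b; eexists; exact: bnd_modul l0 b. Qed.

Lemma GS_pderiv j phi : S phi -> S (pderiv j phi).
Proof.
have [H H1 [C _ h]] := bnd_pderiv; apply: (@GS_map H); first exact: lt_le_trans H1.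
by move=> l c l0 b; eexists; exact: h l0 b.
Qed.

Lemma GS_DD s phi : S phi -> S (DD s phi).
Proof. by move=> h; elim: s => [//|j s IH]; exact: GS_pderiv. Qed.

(** Convergence in S: in every norm in the Beurling case, in one step of the inductive limit in the
    Roumieu case. *)
Definition cvS (u : nat -> testfun) phi := QQ (~~ beur) (fun l => forall e, 0 < e ->
  exists N, forall n, (N <= n)%N -> bnd l e (fun x => phi x - u n x)).

Lemma conv_facts phi psi : S phi -> S psi ->
  [/\ S (conv phi psi), forall s, DD s (conv phi psi) = conv (DD s phi) psi,
   forall x, exists C, cls C (fun y => phi (x - y) * psi y) & cvS (fun N => rsc N phi psi) (conv phi psi)].
Proof.
move=> h1 h2; have [k [k1 Hk]] := conv_ok_ex d wM wA M2 A2; have k0 : 0 < k := lt_le_trans ltr01 k1.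
have [P [HP HQ]] := GS_common wM wA h1 h2.
have main l : P l -> [/\ exists c, bnd (k * l) c (conv phi psi), forall s, DD s (conv phi psi) = conv (DD s phi) psi,
   forall x, exists C, cls C (fun y => phi (x - y) * psi y) &
   forall e, 0 < e -> exists N0, forall N, (N0 <= N)%N -> bnd (k * l) e (fun x => conv phi psi x - rsc N phi psi x)].
  move=> /HP[l0 [c [b1 b2]]]; have kl : 0 < k * l by rewrite mulr_gt0.
  have [C C0] := Hk _ kl; rewrite (_ : k * l / k = l); last by rewrite mulrC mulKf ?gt_eqF.
  move=> /(_ _ _ _ _ b1 b2)[[sm dd] [K _ cl] bb _ cv]; split=> //; last by move=> x; eexists; exact: (cl [::] x).
  eexists; apply: bb => x; have := b2.2 [::] x; exact.
have [l lP] : exists l, P l by move: HQ; case: (~~ beur) => [[l [_ p]]|/(_ 1 ltr01)]; [exists l|exists 1].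
have [_ dd cl _] := main l lP; split=> //.
  apply/GS_QQ; move: (QQ_scale k0 HQ); apply: QQ_imp => l' l0 /main[h _ _ _].
  by move: h; rewrite mulrC divfK ?gt_eqF.
move: (QQ_scale k0 HQ); apply: QQ_imp => l' l0 /main[_ _ _].
by rewrite mulrC divfK ?gt_eqF.
Qed.

Lemma GS_conv phi psi : S phi -> S psi -> S (conv phi psi).
Proof. by move=> h1 h2; case: (conv_facts h1 h2). Qed.

Lemma conv_DD s phi psi : S phi -> S psi -> DD s (conv phi psi) = conv (DD s phi) psi.
Proof. by move=> h1 h2; case: (conv_facts h1 h2). Qed.

Lemma conv_cls phi psi x : S phi -> S psi -> exists C, cls C (fun y => phi (x - y) * psi y).
Proof. by move=> h1 h2; case: (conv_facts h1 h2). Qed.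

Lemma conv_cvS phi psi : S phi -> S psi -> cvS (fun N => rsc N phi psi) (conv phi psi).
Proof. by move=> h1 h2; case: (conv_facts h1 h2). Qed.

Lemma GS_rsc N phi psi : S phi -> S (rsc N phi psi).
Proof. by move=> h; apply: (GS_sum wM wA _ _ (F := fun q => transl q.2 phi)) => q; exact: GS_transl. Qed.

Lemma conv_comm phi psi : S phi -> S psi -> conv phi psi = conv psi phi.
Proof.
move=> h1 h2; apply: funext => x.
have [C c1] := conv_cls x h1 h2; have [C' c2] := conv_cls x h2 h1.
rewrite /Defs.conv -(integ_check c1) -(integ_transl (- x) c2); congr integ.
by apply: funext => y; rewrite /check /transl !opprK opprD addrC addrCA subrr addr0 mulrC addrC.
Qed.

Lemma conv_transl y phi psi : conv (transl y phi) psi = transl y (conv phi psi).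
Proof. by apply: funext => x; congr integ; apply: funext => z; rewrite /transl addrAC. Qed.

Lemma conv_suml (I : Type) (r : seq I) (c : I -> R[i]) (F : I -> testfun) psi :
  (forall i, S (F i)) -> S psi ->
  conv (fun x => \sum_(i <- r) c i * F i x) psi = (fun x => \sum_(i <- r) c i * conv (F i) psi x).
Proof.
move=> h hp; apply: funext => x.
have [_ <-] := integ_sum r c (F := fun i y => F i (x - y) * psi y) (fun i => conv_cls x (h i) hp).
by congr integ; apply: funext => y; rewrite mulr_suml; apply: eq_bigr => i _; rewrite mulrA.
Qed.

Lemma conv_sumr (I : Type) (r : seq I) (c : I -> R[i]) (F : I -> testfun) psi :
  (forall i, S (F i)) -> S psi ->
  conv psi (fun x => \sum_(i <- r) c i * F i x) = (fun x => \sum_(i <- r) c i * conv psi (F i) x).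
Proof.
move=> h hp; rewrite conv_comm // ?conv_suml //; last exact: GS_sum.
by apply: funext => x; apply: eq_bigr => i _; rewrite conv_comm.
Qed.

Lemma conv_ZDl (a : R[i]) phi1 phi2 psi : S phi1 -> S phi2 -> S psi ->
  conv (fun x => a * phi1 x + phi2 x) psi = (fun x => a * conv phi1 psi x + conv phi2 psi x).
Proof.
move=> h1 h2 hp; apply: funext => x.
have [C c1] := conv_cls x h1 hp; have [C' c2] := conv_cls x h2 hp.
rewrite /Defs.conv -(integ_ZD a c1 c2); congr integ.
by apply: funext => y; rewrite mulrDl mulrA.
Qed.

Lemma conv_DDr s phi psi : S phi -> S psi -> conv phi (DD s psi) = DD s (conv phi psi).
Proof. by move=> h1 h2; rewrite conv_comm // ?(conv_comm h1 h2) ?conv_DD //; exact: GS_DD. Qed.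

Lemma expi_dotD xi x y : expi (2 * pi * dotp xi (x + y)) = expi (2 * pi * dotp xi x) * expi (2 * pi * dotp xi y).
Proof. by rewrite -expiD -mulrDr -{2}(addrK y x) -dotpB subrK. Qed.

Lemma modul_conv xi phi psi : S phi -> S psi -> modul xi (conv phi psi) = conv (modul xi phi) (modul xi psi).
Proof.
move=> h1 h2; apply: funext => x; have [C c1] := conv_cls x h1 h2.
have := integ_ZD (expi (2 * pi * dotp xi x)) c1 (cls0 R d); rewrite integ0 addr0 /modul => <-.
congr integ; apply: funext => y; rewrite addr0 mulrACA -expi_dotD subrK //.
Qed.

Lemma modulK xi phi : modul (- xi) (modul xi phi) = phi.
Proof.
apply: funext => x; rewrite /modul mulrA -expiD -mulrDr (_ : dotp _ _ + _ = 0); last first.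
  by rewrite /dotp -big_split big1 // => i _; rewrite !mxE /= mulNr addNr.
by rewrite mulr0 expi0 mul1r.
Qed.

Lemma checkK phi : check (check phi) = phi.
Proof. by apply: funext => x; rewrite /check opprK. Qed.

(** In place of Fubini: [conv psi theta] is replaced by its Riemann sums, for which associativity is
    commutation with translations, and the remainder [eta] is small in a norm that convolution with
    phi respects. *)
Lemma conv_assoc phi psi theta : S phi -> S psi -> S theta -> conv phi (conv psi theta) = conv (conv phi psi) theta.
Proof.
move=> h1 h2 h3; apply: funext => x; symmetry.
have hpt := GS_conv h2 h3; have hpp := GS_conv h1 h2.
have [C cl] := conv_cls x hpp h3; apply: (integ_uniq cl) => e e0.
have [k [k1 Hk]] := conv_ok_ex d wM wA M2 A2; have k0 : 0 < k := lt_le_trans ltr01 k1.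
have [l1 l10 H1] := GS_ev h1; have [l2 l20 H2] := GS_ev h2; have [l3 l30 H3] := GS_ev h3.
pose l := l1 + l2 + l3; have l0 : 0 < l by rewrite !addr_gt0.
have [c2 b2] : exists c, bnd l c psi by apply: H2; rewrite /l addrAC lerDr addr_ge0 ?ltW.
have [c3 b3] : exists c, bnd l c theta by apply: H3; rewrite lerDr addr_ge0 ?ltW.
have kl0 : 0 < k * l by rewrite mulr_gt0.
have [c1 b1] : exists c, bnd (k * l) c phi.
  by apply: H1; rewrite (le_trans (_ : _ <= l)) ?ler_peMl ?(ltW l0) // /l -addrA lerDl addr_ge0 ?ltW.
have kkl0 : 0 < k * (k * l) by rewrite mulr_gt0.
have [Ca Ca0] := Hk _ kl0; rewrite (_ : k * l / k = l); last by rewrite mulrC mulKf ?gt_eqF.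
move=> /(_ _ _ _ _ b2 b3)[_ _ _ _ cv].
have [Cb Cb0] := Hk _ kkl0; rewrite (_ : k * (k * l) / k = k * l); last by rewrite mulrC mulKf ?gt_eqF.
move=> Hb; have c10 := bnd_ge0 wM kl0 b1.
have K0 : 0 < 1 + Cb * c1 * M 0%N * M 0%N.
  by rewrite ltr_pwDl // !mulr_ge0 ?(ltW Cb0) ?(M_ge0 wM).
have [N0 HN] := cv _ (divr_gt0 e0 K0); exists N0 => N /HN; set eta := fun x => _ => b.
have b' : bnd0 (k * l) (e / (1 + Cb * c1 * M 0%N * M 0%N) * M 0%N) eta.
  by move=> z; have := b.2 [::] z; rewrite expr0 mul1r.
have [_ _ /(_ _ b')[_ hb] _ _] := Hb _ _ _ _ b1 b.
have hr q : conv phi (transl q psi) = transl q (conv phi psi).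
  by rewrite conv_comm // ?conv_transl ?(conv_comm h1 h2) //; exact: GS_transl.
have etaE : conv phi eta x = conv phi (conv psi theta) x - \sum_(q <- grN R d N) q.1%:C * (conv phi psi (x - q.2) * theta q.2).
  have -> : eta = (fun z => -1 * rsc N psi theta z + conv psi theta z).
    by apply: funext => z; rewrite mulN1r addrC.
  have hrs : S (rsc N psi theta) by exact: GS_rsc.
  rewrite conv_comm //; last exact: GS_ZD.
  rewrite conv_ZDl // (conv_comm hpt h1) mulN1r addrC; congr (_ - _).
  rewrite conv_comm // /rsc conv_sumr //; last by move=> q; exact: GS_transl.
  by apply: eq_bigr => q _; rewrite hr /transl -mulrA [theta _ * _]mulrC.
rewrite cnBC -etaE.
have := hb [::] x; rewrite expr0 mul1r => h.
apply: (@le_trans _ _ (cnorm (conv phi eta x) * ew A ((k * (k * l))^-1 * eucl x))).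
  by rewrite ler_peMr ?cn_ge0 // ew_ge1 // mulr_ge0 ?eucl_ge0 // invr_ge0 ltW.
apply: (le_trans h).
rewrite [size _]/= (_ : _ * M 0%N = e * (Cb * c1 * M 0%N * M 0%N) / (1 + Cb * c1 * M 0%N * M 0%N)); last by ring.
by rewrite ler_pdivrMr // ler_wpM2l ?(ltW e0) // lerDr.
Qed.

End ConvS.

(** * Unconditional sums in normed groups *)

Section NormedSums.
Variables (R : realType) (V : zmodType) (N : V -> R).

Definition ncomplete := forall u : nat -> V,
  (forall e : R, 0 < e -> exists n0, forall m n, (n0 <= m)%N -> (n0 <= n)%N -> N (u m - u n) < e) ->
  exists l, forall e : R, 0 < e -> exists n0, forall n, (n0 <= n)%N -> N (u n - l) < e.

(** Only the additive group enters, so the same results serve for scalars with [cnorm] and for E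
    with [nE]. *)
Definition nspace := [/\ forall v, 0 <= N v, N 0 = 0 /\ forall v, N v = 0 -> v = 0, forall v, N (- v) = N v,
  forall u v, N (u + v) <= N u + N v & ncomplete].

Hypothesis HN : nspace.
Lemma nge0 v : 0 <= N v. Proof. by case: HN. Qed.
Lemma nN v : N (- v) = N v. Proof. by case: HN. Qed.
Lemma nD u v : N (u + v) <= N u + N v. Proof. by case: HN. Qed.
Lemma nBC u v : N (u - v) = N (v - u). Proof. by rewrite -nN opprB. Qed.
Lemma nB u v : N (u - v) <= N u + N v. Proof. by rewrite -(nN v) nD. Qed.

Lemma n_tri w u v : N (u - v) <= N (u - w) + N (w - v).
Proof. by rewrite (_ : u - v = (u - w) + (w - v)) ?nD // addrA subrK. Qed.

Lemma n_arb v : (forall e, 0 < e -> N v <= e) -> v = 0.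
Proof.
move=> H; case: HN => _ [_ h0] _ _ _; apply: h0; apply/eqP; rewrite eq_le nge0 andbT.
by apply/ler_addgt0Pr => e e0; rewrite add0r H.
Qed.

Lemma n_arb_eq u v : (forall e, 0 < e -> N (u - v) <= e) -> u = v.
Proof. by move=> H; apply/eqP; rewrite -subr_eq0; apply/eqP/n_arb. Qed.

Lemma nrm0 : N 0 = 0. Proof. by case: HN => _ []. Qed.

Lemma n_sum (I : Type) (r : seq I) (P : pred I) (u : I -> V) :
  N (\sum_(i <- r | P i) u i) <= \sum_(i <- r | P i) N (u i).
Proof.
elim/big_ind2: _ => [|x a y b ha hb|//]; first by rewrite nrm0.
by rewrite (le_trans (nD _ _)) // lerD.
Qed.

Section Sums.
Variable I : eqType.
Implicit Types (u : I -> V) (F G : seq I).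

(** Convergence along finite sets, encoded as duplicate-free lists; it has the form of the
    unconditional convergence in [sum_cvgS]. *)
Definition hasSum u l := forall e : R, 0 < e -> exists F0, forall F, uniq F -> {subset F0 <= F} ->
  N (\sum_(i <- F) u i - l) <= e.

Definition abs_le u (C : R) := forall F, uniq F -> \sum_(i <- F) N (u i) <= C.

Lemma hasSum_uniq u l l' : hasSum u l -> hasSum u l' -> l = l'.
Proof.
move=> h h'; apply: n_arb_eq => e e0; have e2 : 0 < e / 2 by rewrite divr_gt0.
have [F HF] := h _ e2; have [F' HF'] := h' _ e2.
have s1 : {subset F <= undup (F ++ F')} by move=> i; rewrite mem_undup mem_cat => ->.
have s2 : {subset F' <= undup (F ++ F')} by move=> i; rewrite mem_undup mem_cat orbC => ->.
have := HF _ (undup_uniq _) s1; have := HF' _ (undup_uniq _) s2.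
by have := n_tri (\sum_(i <- undup (F ++ F')) u i) l l'; rewrite (nBC l (\sum_(i <- _) _)); lra.
Qed.

Lemma big_diff (W : zmodType) (f : I -> W) F G : uniq F -> uniq G -> {subset F <= G} ->
  \sum_(i <- G) f i = \sum_(i <- F) f i + \sum_(i <- G | i \notin F) f i.
Proof.
move=> uF uG s; rewrite (bigID (mem F)) /=; congr (_ + _).
rewrite -big_filter; apply: perm_big; apply: uniq_perm => //; first exact: filter_uniq.
by move=> i; rewrite mem_filter; case: (boolP (i \in F)) => // /s ->.
Qed.

(** A finite set whose sum of norms is within e of the supremum leaves only tails below e. *)
Lemma abs_tail u C : abs_le u C -> forall e, 0 < e -> exists F0, uniq F0 /\ forall F, uniq F ->
  (forall i, i \in F -> i \notin F0) -> \sum_(i <- F) N (u i) <= e.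
Proof.
move=> H e e0; pose X := [set x | exists2 F, uniq F & x = \sum_(i <- F) N (u i)].
have hs : has_sup X.
  split; first by exists 0; exists [::]; rewrite ?big_nil.
  by exists C => _ [F uF ->]; exact: H.
have [x [F0 u0 ->] hx] := sup_adherent e0 hs; exists F0; split=> // F uF dis.
have u1 : uniq (F0 ++ F).
  by rewrite cat_uniq u0 uF andbT /=; apply/hasPn => i /dis.
have : \sum_(i <- F0 ++ F) N (u i) <= sup X by apply: ub_le_sup; [exact: hs.2|exists (F0 ++ F)].
rewrite big_cat /=; move: (sup X) hx => s; lra.
Qed.

Lemma sum_diff_small u e F0 : 0 <= e -> uniq F0 -> (forall F, uniq F -> (forall i, i \in F -> i \notin F0) -> \sum_(i <- F) N (u i) <= e) ->
  forall F, uniq F -> {subset F0 <= F} -> N (\sum_(i <- F) u i - \sum_(i <- F0) u i) <= e.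
Proof.
move=> e0 u0 H F uF s; rewrite (big_diff u u0 uF s) addrAC subrr add0r -big_filter.
rewrite (le_trans (n_sum _ _ _)) // H ?filter_uniq // => i; by rewrite mem_filter => /andP[].
Qed.

Lemma hasSum_ex u C : abs_le u C -> exists l, hasSum u l /\ N l <= C.
Proof.
move=> H.
have /boolp.choice[T HT] : forall n : nat, exists T, uniq T /\ forall F, uniq F ->
  (forall i, i \in F -> i \notin T) -> \sum_(i <- F) N (u i) <= n.+1%:R^-1.
  by move=> n; apply: (abs_tail H); rewrite invr_gt0.
have i0 n : 0 <= n.+1%:R^-1 :> R by rewrite invr_ge0.
have tail n := sum_diff_small (i0 n) (HT n).1 (HT n).2.
pose v n := \sum_(i <- T n) u i.
have small (e : R) : 0 < e -> exists n0, forall n, (n0 <= n)%N -> n.+1%:R^-1 <= e.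
  move=> e0; have [n0 hn0] := archi_le e^-1; exists n0 => n nn.
  rewrite -[e]invrK lef_pV2 ?posrE ?invr_gt0 // (le_trans hn0) // ler_nat; lia.
have [l Hl] : exists l, forall e : R, 0 < e -> exists n0, forall n, (n0 <= n)%N -> N (v n - l) < e.
  case: HN => _ _ _ _; apply=> e e0.
  have e3 : 0 < e / 3 by rewrite divr_gt0.
  have [n0 h0] := small _ e3; exists n0 => m n /h0 hm /h0 hn.
  set G := undup (T m ++ T n).
  have s1 : {subset T m <= G} by move=> i; rewrite mem_undup mem_cat => ->.
  have s2 : {subset T n <= G} by move=> i; rewrite mem_undup mem_cat orbC => ->.
  have t1 : N (\sum_(i <- G) u i - v m) <= m.+1%:R^-1 := tail m _ (undup_uniq _) s1.
  have t2 : N (\sum_(i <- G) u i - v n) <= n.+1%:R^-1 := tail n _ (undup_uniq _) s2.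
  rewrite nBC in t1.
  have {hm}t1 := le_trans t1 hm; have {hn}t2 := le_trans t2 hn.
  have := n_tri (\sum_(i <- G) u i) (v m) (v n); lra.
have hsum : hasSum u l.
  move=> e e0; have e2 : 0 < e / 2 by rewrite divr_gt0.
  have [n1 h1] := small _ e2; have [n2 h2] := Hl _ e2.
  set n := maxn n1 n2; have {}h1 := h1 n (leq_maxl _ _); have {}h2 := h2 n (leq_maxr _ _).
  exists (T n) => F uF s; have {h1}t : N (\sum_(i <- F) u i - v n) <= e / 2 := le_trans (tail n _ uF s) h1.
  have := n_tri (v n) (\sum_(i <- F) u i) l; lra.
exists l; split=> //.
apply/ler_addgt0Pr => e e0; have [F0 h] := hsum e e0.
have := h (undup F0) (undup_uniq _); rewrite nBC => /(_ _) h1.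
have {}h1 : N (l - \sum_(i <- undup F0) u i) <= e by apply: h1 => i; rewrite mem_undup.
have h2 : N (\sum_(i <- undup F0) u i) <= C.
  by rewrite (le_trans (n_sum _ _ _)) // H ?undup_uniq.
have := nD (l - \sum_(i <- undup F0) u i) (\sum_(i <- undup F0) u i); rewrite subrK; lra.
Qed.

Lemma hasSum_norm u l C : hasSum u l -> (forall F, uniq F -> N (\sum_(i <- F) u i) <= C) -> N l <= C.
Proof.
move=> h H; apply/ler_addgt0Pr => e e0; have [F0 h0] := h e e0.
have {}h0 : N (\sum_(i <- undup F0) u i - l) <= e by apply: h0; rewrite ?undup_uniq // => i; rewrite mem_undup.
rewrite nBC in h0.
have := nD (l - \sum_(i <- undup F0) u i) (\sum_(i <- undup F0) u i); rewrite subrK.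
have := H _ (undup_uniq F0); lra.
Qed.

End Sums.

End NormedSums.

Section SumMaps.
Variables (R : realType) (V W : zmodType) (N : V -> R) (N' : W -> R).

Lemma hasSum_map (I : eqType) (u : I -> V) l (f : V -> W) (K : R) : 0 <= K ->
  f 0 = 0 -> (forall a b, f (a + b) = f a + f b) -> (forall a b, N' (f a - f b) <= K * N (a - b)) ->
  hasSum N u l -> hasSum N' (fun i => f (u i)) (f l).
Proof.
move=> K0 f0 fD fN h e e0; have K1 : 0 < 1 + K by rewrite ltr_pwDl.
have [F0 HF] := h _ (divr_gt0 e0 K1); exists F0 => F uF s.
have -> : \sum_(i <- F) f (u i) = f (\sum_(i <- F) u i) by symmetry; apply: big_morph.
rewrite (le_trans (fN _ _)) //; apply: le_trans (ler_wpM2l K0 (HF _ uF s)) _.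
by rewrite mulrCA ler_piMr ?(ltW e0) // ler_pdivrMr // mul1r lerDr.
Qed.

End SumMaps.

(** * Exchange of the order of summation *)

Section DoubleSums.
Variables (R : realType) (V : zmodType) (N : V -> R).
Hypothesis HN : nspace N.
Variables (I J : eqType).

(** For a finite set F of rows one finite set of columns serves all rows at once, with a tolerance
    divided by [(size F).+1]. *)
Lemma hasSum_fst (v : I * J -> V) S (r : I -> V) : hasSum N v S -> (forall i, hasSum N (fun j => v (i, j)) (r i)) ->
  hasSum N r S.
Proof.
move=> hS hr e e0; have e2 : 0 < e / 2 by rewrite divr_gt0.
have [F0 H0] := hS _ e2; exists (map fst F0) => F uF sF.
have k0 : 0 < (size F).+1%:R :> R by [].
have := divr_gt0 e2 k0; set e' := e / 2 / _ => e3.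
have [G HG] : exists G : seq J, forall i, i \in F -> forall G', uniq G' -> {subset G <= G'} ->
   N (\sum_(j <- G') v (i, j) - r i) <= e'.
  elim: (F) => [|i F' [G IH]]; first by exists [::].
  have [G1 H1] := hr i _ e3; exists (G1 ++ G) => i'; rewrite inE => /orP[/eqP ->|i'F] G' uG' sG'.
    by apply: H1 => // j jG; apply: sG'; rewrite mem_cat jG.
  by apply: IH => // j jG; apply: sG'; rewrite mem_cat jG orbT.
set G' := undup (G ++ map snd F0).
have sub : {subset F0 <= [seq (i, j) | i <- F, j <- G']}.
  move=> [i j] ij; apply/allpairsP; exists (i, j); split=> //=.
    by apply: sF; apply/mapP; exists (i, j).
  by rewrite mem_undup mem_cat; apply/orP; right; apply/mapP; exists (i, j).
have uP : uniq [seq (i, j) | i <- F, j <- G'].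
  by apply: allpairs_uniq; rewrite ?undup_uniq // => -[a b] [a' b'] _ _ [-> ->].
have h1 := H0 _ uP sub.
rewrite big_allpairs /= in h1.
have h2 : N (\sum_(i <- F) r i - \sum_(i <- F) \sum_(j <- G') v (i, j)) <= e / 2.
  rewrite -sumrB (le_trans (n_sum HN _ _ _)) //.
  apply: (@le_trans _ _ (\sum_(i <- F) e')).
    rewrite !big_seq; apply: ler_sum => i iF; rewrite nBC //; apply: HG => //; first exact: undup_uniq.
    by move=> j jG; rewrite mem_undup mem_cat jG.
  rewrite big_const_seq count_predT iter_addr_0 -[e' *+ _]mulr_natr /e' mulrAC ler_pdivrMr //.
  by rewrite ler_wpM2l ?(ltW e2) // ler_nat.
have := n_tri HN (\sum_(i <- F) \sum_(j <- G') v (i, j)) (\sum_(i <- F) r i) S; lra.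
Qed.

Lemma hasSum_swap (v : I * J -> V) S : hasSum N v S -> hasSum N (fun q : J * I => v (q.2, q.1)) S.
Proof.
move=> h e e0; have [F0 H] := h e e0; exists [seq (q.2, q.1) | q <- F0] => F uF sF.
have := H [seq (q.2, q.1) | q <- F]; rewrite big_map; apply.
  by rewrite map_inj_uniq // => -[a b] [a' b'] [-> ->].
move=> [a b] ab; apply/mapP; exists (b, a) => //; apply: sF; by apply/mapP; exists (a, b).
Qed.

Lemma abs_pairs (v : I * J -> V) (x : I -> R) (y : J -> R) (X Y : R) : (forall i j, N (v (i, j)) <= x i * y j) ->
  (forall i, 0 <= x i) -> (forall j, 0 <= y j) ->
  (forall F, uniq F -> \sum_(i <- F) x i <= X) -> (forall F, uniq F -> \sum_(j <- F) y j <= Y) ->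
  abs_le N v (X * Y).
Proof.
move=> h x0 y0 hX hY F uF.
set A := undup (map fst F); set B := undup (map snd F).
have sub : {subset F <= [seq (i, j) | i <- A, j <- B]}.
  move=> [i j] ij; apply/allpairsP; exists (i, j); split=> //=; rewrite mem_undup; apply/mapP; exists (i, j) => //.
have uP : uniq [seq (i, j) | i <- A, j <- B].
  by apply: allpairs_uniq; rewrite ?undup_uniq // => -[a b] [a' b'] _ _ [-> ->].
apply: (@le_trans _ _ (\sum_(q <- [seq (i, j) | i <- A, j <- B]) N (v q))).
  rewrite (big_diff (fun q => N (v q)) uF uP sub) lerDl sumr_ge0 // => q _; exact: (nge0 HN).
rewrite big_allpairs /=; apply: (@le_trans _ _ (\sum_(i <- A) x i * \sum_(j <- B) y j)).
  by apply: ler_sum => i _; rewrite mulr_sumr; apply: ler_sum.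
rewrite -mulr_suml ler_pM ?sumr_ge0 ?hX ?hY ?undup_uniq //.
Qed.

End DoubleSums.

(** Domination by a product of summable families makes the double family absolutely summable, so
    both iterated sums equal the sum over pairs. *)
Lemma sum_swap (R : realType) (V : zmodType) (N : V -> R) (I J : eqType) (v : I * J -> V) x y X Y r c s t : nspace N ->
  (forall i j, N (v (i, j)) <= x i * y j) ->
  (forall i, 0 <= x i) -> (forall j, 0 <= y j) ->
  (forall F, uniq F -> \sum_(i <- F) x i <= X) -> (forall F, uniq F -> \sum_(j <- F) y j <= Y) ->
  (forall i, hasSum N (fun j => v (i, j)) (r i)) -> (forall j, hasSum N (fun i => v (i, j)) (c j)) ->
  hasSum N r s -> hasSum N c t -> s = t.
Proof.
move=> HN h x0 y0 hX hY hr hc hs ht.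
have [S [HS _]] := hasSum_ex HN (abs_pairs HN h x0 y0 hX hY).
rewrite (hasSum_uniq HN hs (hasSum_fst HN HS hr)); symmetry.
have h2 := @hasSum_fst R V N HN J I (fun q => v (q.2, q.1)) S c (hasSum_swap HS) hc.
exact: (hasSum_uniq HN ht h2).
Qed.

Section Scalars.
Variable R : realType.

Lemma real_complete (u : nat -> R) : (forall e : R, 0 < e -> exists n0, forall m n, (n0 <= m)%N -> (n0 <= n)%N -> `|u m - u n| < e) ->
  exists l, forall e : R, 0 < e -> exists n0, forall n, (n0 <= n)%N -> `|u n - l| < e.
Proof.
move=> H; have c : cvg (u @ \oo).
  apply/cauchy_cvgP/cauchy_exP => e e0; have [n0 h] := H e e0.
  exists (u n0); exists n0 => // n /= nn; exact: h.
exists (lim (u @ \oo)) => e e0.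
have /cvgrPdist_lt/(_ e e0)[n0 _ h] := c; exists n0 => n nn; rewrite distrC; exact: h.
Qed.

Lemma cn_nspace : nspace (@cnorm R).
Proof.
split; [exact: cn_ge0|by split; [exact: cn0|exact: cn_eq0]|exact: cnN|exact: cnD|].
move=> u H.
have [a Ha] : exists l, forall e : R, 0 < e -> exists n0, forall n, (n0 <= n)%N -> `|cRe (u n) - l| < e.
  apply: real_complete => e /H[n0 h]; exists n0 => m n hm hn.
  by rewrite -cReB (le_lt_trans (cnRe _)) // h.
have [b Hb] : exists l, forall e : R, 0 < e -> exists n0, forall n, (n0 <= n)%N -> `|cIm (u n) - l| < e.
  apply: real_complete => e /H[n0 h]; exists n0 => m n hm hn.
  by rewrite -cImB (le_lt_trans (cnIm _)) // h.
exists (a +i* b) => e e0; have e2 : 0 < e / 2 by rewrite divr_gt0.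
have [n1 h1] := Ha _ e2; have [n2 h2] := Hb _ e2.
exists (maxn n1 n2) => n; rewrite geq_max => /andP[/h1 {}h1 /h2 {}h2].
rewrite (le_lt_trans (cn_le _)) // cReB cImB /= [e]splitr ltrD //.
Qed.

End Scalars.

(** * Neumann series for an additive perturbation of the identity *)

Section Neumann.
Variables (R : realType) (V : zmodType) (N : V -> R).
Hypothesis HN : nspace N.

Lemma half_le (n : nat) : 2^-1 ^+ n <= n.+1%:R^-1 :> R.
Proof.
rewrite exprVn lef_pV2 ?posrE ?exprn_gt0 // -natrX ler_nat; exact: ltn_expl.
Qed.

Lemma geom_lim (y : nat -> V) (c : R) : 0 <= c -> (forall n, N (y n.+1 - y n) <= c * 2^-1 ^+ n) ->
  exists l, forall e : R, 0 < e -> exists n0, forall n, (n0 <= n)%N -> N (y n - l) < e.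
Proof.
move=> c0 H; have h2 n : 0 <= 2^-1 ^+ n :> R by rewrite exprn_ge0 // invr_ge0.
have step n k : N (y (n + k)%N - y n) <= c * 2^-1 ^+ n * (2 - 2 * 2^-1 ^+ k).
  elim: k => [|k IH]; first by rewrite addn0 subrr (nrm0 HN) expr0 mulr1 subrr mulr0.
  have := H (n + k)%N; rewrite exprD addnS => h.
  have := n_tri HN (y (n + k)%N) (y (n + k).+1) (y n).
  move/le_trans; apply; apply: le_trans (lerD h IH) _.
  rewrite exprS le_eqVlt; by apply/orP; left; apply/eqP; field.
case: HN => _ _ _ _; apply=> e e0.
have K0 : 0 < 1 + 4 * c by rewrite ltr_pwDl // mulr_ge0.
have [n0 hn0] := archi_le ((1 + 4 * c) / e); exists n0.
have small n : (n0 <= n)%N -> 4 * (c * 2^-1 ^+ n) < e.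
  move=> nn; have h : 2^-1 ^+ n <= n.+1%:R^-1 :> R by exact: half_le.
  have k0 : 0 < n.+1%:R :> R by [].
  apply: le_lt_trans (_ : (4 * c) / n.+1%:R < _); first by rewrite -mulrA ler_wpM2l // ler_wpM2l.
  rewrite ltr_pdivrMr // -ltr_pdivrMl // mulrC.
  apply: lt_le_trans (_ : (1 + 4 * c) / e <= _).
    by rewrite ltr_pM2r ?invr_gt0 // ltrDr.
  by rewrite (le_trans hn0) // ler_nat; lia.
have main m n : (n0 <= m)%N -> (m <= n)%N -> N (y n - y m) < e.
  move=> hm mn; have := step m (n - m)%N; rewrite subnKC // => /le_lt_trans; apply.
  apply: le_lt_trans (small m hm); rewrite [leRHS]mulrC ler_wpM2l ?mulr_ge0 //.
  have := h2 (n - m)%N; lra.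
move=> m n hm hn; case: (leqP m n) => [mn|/ltnW nm]; first by rewrite nBC // main.
exact: main.
Qed.

(** The solution is the limit of the iteration [y -> x - K y], whose increments are halved at each
    step; additivity of K is all that is used. The bound 2 is 1 / (1 - 1/2). *)
Lemma neumann (K : V -> V) : (forall a b, K (a + b) = K a + K b) -> (forall a, N (K a) <= 2^-1 * N a) ->
  forall x, exists2 y, y + K y = x & N y <= 2 * N x.
Proof.
move=> KD KN x.
have K0 : K 0 = 0 by apply: (addrI (K 0)); rewrite -KD !addr0.
have KB a b : K (a - b) = K a - K b by apply: (addIr (K b)); rewrite -KD !subrK.
pose y := fix y n := if n is n'.+1 then x - K (y n') else 0.
have y0 : y 0%N = 0 by [].
have yS n : y n.+1 = x - K (y n) by [].
clearbody y.
have [|l hl] := @geom_lim y (N x) (nge0 HN x).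
  elim=> [|n IH]; first by rewrite yS y0 K0 !subr0 expr0 mulr1.
  have -> : y n.+2 - y n.+1 = - K (y n.+1 - y n).
    by rewrite (yS n.+1) [X in _ - _ - X = _]yS KB !opprB [LHS]addrC addrA subrK.
  by rewrite (nN HN) (le_trans (KN _)) // exprS mulrCA ler_wpM2l ?invr_ge0.
have e : l + K l = x.
  apply: (n_arb_eq HN) => e e0; have e2 : 0 < e / 2 by rewrite divr_gt0.
  have [n0 h] := hl _ e2; have h1 := h n0.+1 (leqnSn _); have h0 := h n0 (leqnn _).
  have -> : l + K l - x = (l - y n0.+1) + K (l - y n0).
    rewrite yS KB opprB -[RHS]addrA (addrC (K (y n0) - x)).
    by rewrite (addrA (K l - _)) subrK addrA.
  have := nD HN (l - y n0.+1) (K (l - y n0)); have := KN (l - y n0).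
  rewrite !(nBC HN l); lra.
exists l => //; have := nB HN x (K l); rewrite -{1}e addrK; have := KN l; lra.
Qed.

End Neumann.

(** * Zabreiko's lemma *)

Section Levels.
Variables (R : realType) (d : nat) (M A : nat -> R).
Hypotheses (wM : weight_seq M) (wA : weight_seq A).
Local Notation pt := (pt R d).
Local Notation testfun := (testfun R d).
Implicit Types (phi psi : testfun) (x y : pt).
Local Notation bnd := (@bnd R d M A).

Lemma bnd_sub l c1 c2 phi psi : 0 < l -> bnd l c1 phi -> bnd l c2 psi -> bnd l (c1 + c2) (fun x => phi x - psi x).
Proof.
move=> l0 b1 b2; have := bnd_ZD (-1) l0 b2 b1; rewrite cnN cn1 mul1r addrC.
by congr bnd; apply: funext => x; rewrite mulN1r addrC.
Qed.

Lemma bnd_add l c1 c2 phi psi : 0 < l -> bnd l c1 phi -> bnd l c2 psi -> bnd l (c1 + c2) (fun x => phi x + psi x).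
Proof.
move=> l0 b1 b2; have := bnd_ZD 1 l0 b1 b2; rewrite cn1 mul1r.
by congr bnd; apply: funext => x; rewrite mul1r.
Qed.

Lemma DD_sub s phi psi : smooth phi -> smooth psi -> DD s (fun x => phi x - psi x) = (fun x => DD s phi x - DD s psi x).
Proof.
move=> s1 s2; have := DDZD (-1) s s2 s1.
have -> : (fun x => -1 * psi x + phi x) = (fun x => phi x - psi x) by apply: funext => x; rewrite mulN1r addrC.
by move=> ->; apply: funext => x; rewrite mulN1r addrC.
Qed.

(** The scale may shrink with n, as it does for the gliding hump in the Beurling case. Derivatives
    converge uniformly because all scales are below [l 0], and each bound passes to the limit at its
    own scale. *)
Lemma bnd_complete (u : nat -> testfun) (l e : nat -> R) :
  (forall n, smooth (u n)) -> (forall n, 0 < l n) -> (forall n, l n <= l 0%N) ->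
  (forall r, 0 < r -> exists n, e n <= r) ->
  (forall n m, (n <= m)%N -> bnd (l n) (e n) (fun x => u m x - u n x)) ->
  exists phi, forall n, bnd (l n) (e n) (fun x => phi x - u n x).
Proof.
move=> su l0 ll e0 H.
have Q0 (s : seq 'I_d) : 0 < l 0%N ^+ size s * M (size s) by rewrite mulr_gt0 ?exprn_gt0 // (M_gt0 wM).
have en n : 0 <= e n := bnd_ge0 wM (l0 n) (H n n (leqnn _)).
have close s n m x : (n <= m)%N -> cnorm (DD s (u m) x - DD s (u n) x) <= e n * (l 0%N ^+ size s * M (size s)).
  move=> nm; have := (H n m nm).2 s x; rewrite DD_sub // => h.
  apply: (@le_trans _ _ (cnorm (DD s (u m) x - DD s (u n) x) * ew A ((l n)^-1 * eucl x))).
    by rewrite ler_peMr ?cn_ge0 // ew_ge1 // mulr_ge0 ?eucl_ge0 // invr_ge0 ltW.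
  rewrite (le_trans h) // ler_wpM2l // ler_wpM2r ?(M_ge0 wM) // lerXn2r ?nnegrE ?(ltW (l0 _)) //.
have /boolp.choice[G HG] : forall sx : seq 'I_d * pt, exists z : R[i], forall r, 0 < r -> exists n0, forall n, (n0 <= n)%N ->
    cnorm (DD sx.1 (u n) sx.2 - z) < r.
  move=> [s x]; case: (cn_nspace R) => _ _ _ _; apply=> r r0 /=.
  have r3 : 0 < r / 3 by rewrite divr_gt0.
  have [n0 h] := e0 _ (divr_gt0 r3 (Q0 s)); exists n0 => m n hm hn.
  have h3 : e n0 * (l 0%N ^+ size s * M (size s)) <= r / 3 by rewrite -ler_pdivlMr.
  have c1 := close s n0 m x hm; have c2 := close s n0 n x hn; rewrite cnBC in c2.
  have := cn_tri (DD s (u m) x) (DD s (u n0) x) (DD s (u n) x); lra.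
pose g s x := G (s, x).
have lim s x n : cnorm (DD s (u n) x - g s x) <= e n * (l 0%N ^+ size s * M (size s)).
  apply/ler_addgt0Pr => r r0; have [n0 h] := HG (s, x) r r0.
  have h1 := h (maxn n n0) (leq_maxr _ _); have h2 := close s n (maxn n n0) x (leq_maxl _ _).
  rewrite cnBC in h2; rewrite /= -/(g s x) in h1.
  have := cn_tri (DD s (u n) x) (DD s (u (maxn n n0)) x) (g s x); lra.
have emono n m : (n <= m)%N -> forall s x, cnorm (DD s (u m) x - g s x) <= 2 * (e n * (l 0%N ^+ size s * M (size s))).
  move=> nm s x; have := cn_tri (DD s (u m) x) (DD s (u n) x) (g s x).
  have := lim s x n; have := close s n m x nm; lra.
have hyp s (r : R) : 0 < r -> exists N, forall n, (N <= n)%N -> forall x, cnorm (DD s (u n) x - g s x) <= r.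
  move=> r0; have Q := Q0 s; have r2 : 0 < r / 2 by rewrite divr_gt0.
  have [n0 h] := e0 _ (divr_gt0 r2 Q); exists n0 => m hm x.
  have {}h : e n0 * (l 0%N ^+ size s * M (size s)) <= r / 2 by rewrite -ler_pdivlMr.
  have := emono n0 m hm s x; lra.
have [sm dd] := smooth_lim su hyp.
exists (g [::]) => n; split.
  have := smoothZD (-1) (su n) sm; congr smooth.
  by apply: funext => x; rewrite mulN1r addrC.
move=> s x; rewrite DD_sub // dd.
have E0 : 0 < ew A ((l n)^-1 * eucl x) := ew_gt0 _ _.
rewrite -ler_pdivlMr //; apply/ler_addgt0Pr => r r0; have [n0 h] := HG (s, x) r r0.
have h1 := h (maxn n n0) (leq_maxr _ _); rewrite /= -/(g s x) in h1.
have := (H n (maxn n n0) (leq_maxl _ _)).2 s x; rewrite DD_sub // -ler_pdivlMr // => h2.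
move: (_ / _) h2 => B h2.
have := cn_tri (g s x) (DD s (u (maxn n n0)) x) (DD s (u n) x); rewrite (cnBC (g s x) (DD s (u (maxn n n0)) x)); lra.
Qed.

Section Zabreiko.
Variables (lev : nat -> R) (p : testfun -> R).
Hypotheses (lev0 : forall j, 0 < lev j) (levD : forall i j, (i <= j)%N -> lev j <= lev i).
(** A chain of levels that shrinks to 0 gives the Frechet space of the Beurling case; a constant
    chain gives a single Banach step of the Roumieu case. *)
Definition Xs phi := forall j, exists c, bnd (lev j) c phi.
Hypothesis p0 : forall phi, Xs phi -> 0 <= p phi.
Hypothesis pZD : forall (a : R[i]) phi psi, Xs phi -> Xs psi -> p (fun x => a * phi x + psi x) <= cnorm a * p phi + p psi.
Hypothesis pZ : forall (a : R[i]) phi, Xs phi -> p (fun x => a * phi x) <= cnorm a * p phi.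
Hypothesis pS : forall (u : nat -> testfun) phi (K : R), (forall n, Xs (u n)) -> Xs phi ->
  (forall n, \sum_(i < n) p (u i) <= K) ->
  (forall j r, 0 < r -> exists N, forall n, (N <= n)%N -> bnd (lev j) r (fun x => phi x - \sum_(i < n) u i x)) -> p phi <= K.

Lemma Xs_ZD (a : R[i]) phi psi : Xs phi -> Xs psi -> Xs (fun x => a * phi x + psi x).
Proof. by move=> h1 h2 j; have [c1 b1] := h1 j; have [c2 b2] := h2 j; eexists; exact: (bnd_ZD a (lev0 j) b1 b2). Qed.

Lemma Xs_0 : Xs (fun=> 0).
Proof. by move=> j; exists 0; exact: bnd_zero. Qed.

Lemma Xs_Z (a : R[i]) phi : Xs phi -> Xs (fun x => a * phi x).
Proof. by move=> h j; have [c b] := h j; eexists; exact: (bnd_Z a (lev0 j) b). Qed.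

Lemma Xs_sub phi psi : Xs phi -> Xs psi -> Xs (fun x => phi x - psi x).
Proof. by move=> h1 h2 j; have [c1 b1] := h1 j; have [c2 b2] := h2 j; eexists; exact: (bnd_sub (lev0 j) b1 b2). Qed.

Lemma bnd_lev i j c phi : (i <= j)%N -> bnd (lev j) c phi -> bnd (lev i) c phi.
Proof. by move=> /levD; exact: bnd_wl. Qed.

Lemma pZD1 phi psi : Xs phi -> Xs psi -> p (fun x => phi x - psi x) <= p phi + p psi.
Proof.
move=> h1 h2; have := pZD (-1) h2 h1; rewrite cnN cn1 mul1r addrC.
by congr (p _ <= _); apply: funext => x; rewrite mulN1r addrC.
Qed.

(* Gliding hump: if the balls of every level escape every set {p <= C} + (small ball),
   a lacunary series of witnesses has infinite p. *)

Lemma zab_dense : exists j (C : R), forall j' (dl : R) phi, 0 < dl -> Xs phi -> bnd (lev j) 1 phi ->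
  exists2 u, Xs u & p u <= C /\ bnd (lev j') dl (fun x => phi x - u x).
Proof.
apply: contrapT => neg.
have /boolp.choice[F HF] : forall q : nat * R, exists r : nat * R * testfun,
   [/\ (q.1 <= r.1.1)%N, 0 < r.1.2 <= 1, Xs r.2, bnd (lev q.1) 1 r.2 &
     forall u, Xs u -> p u <= q.2 -> ~ bnd (lev r.1.1) r.1.2 (fun x => r.2 x - u x)].
  move=> [j C]; apply: contrapT => /= n; apply: neg; exists j, C => j' dl phi dl0 X b.
  apply: contrapT => n2; apply: n; exists (maxn j j', Num.min dl 1, phi); split=> //=.
  - exact: leq_maxl.
  - by rewrite lt_min dl0 ltr01 ge_min lexx orbT.
  move=> u Xu pu bu; apply: n2; exists u => //; split=> //.
  apply: bnd_lev (leq_maxr j j') _; apply: bnd_wc bu => //; by rewrite ge_min lexx.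
pose nx n (s : nat * R * testfun) := F (s.1.1, (n%:R + p s.2) / s.1.2).
(* The state is a triple: level, scale t, partial sum. The new witness enters with coefficient t;
   dividing the next scale by 4 keeps everything added afterwards, rescaled by 1 / t, within half of
   the radius that the witness excludes. *)
pose st := fix st n : nat * R * testfun := if n is n'.+1 then
   let s := st n' in let r := nx n' s in
   (maxn r.1.1 s.1.1.+1, s.1.2 * r.1.2 / 4, fun x => s.1.2%:C * r.2 x + s.2 x) else (0%N, 1, fun=> 0).
pose jn n := (st n).1.1; pose tn n := (st n).1.2; pose sg n := (st n).2.
pose rn n := nx n (st n).
have rP n : [/\ (jn n <= (rn n).1.1)%N, 0 < (rn n).1.2 <= 1, Xs (rn n).2, bnd (lev (jn n)) 1 (rn n).2 &
    forall u, Xs u -> p u <= (n%:R + p (sg n)) / tn n -> ~ bnd (lev (rn n).1.1) (rn n).1.2 (fun x => (rn n).2 x - u x)].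
  exact: HF (jn n, (n%:R + p (sg n)) / tn n).
have jS n : jn n.+1 = maxn (rn n).1.1 (jn n).+1 by [].
have tS n : tn n.+1 = tn n * (rn n).1.2 / 4 by [].
have sS n : sg n.+1 = (fun x => (tn n)%:C * (rn n).2 x + sg n x) by [].
have t0 n : 0 < tn n.
  elim: n => [|n IH]; first exact: ltr01.
  by rewrite tS divr_gt0 ?mulr_gt0 //; have [_ /andP[]] := rP n.
have s0 : Xs (sg 0%N) by exact: Xs_0.
clearbody rn; have j0 : jn 0%N = 0%N by []. have t00 : tn 0%N = 1 by [].
clearbody jn tn sg; clear st nx.
have tq n : tn n.+1 <= tn n / 4.
  rewrite tS ler_wpM2r ?invr_ge0 // ler_piMr ?(ltW (t0 n)) //; by have [_ /andP[]] := rP n.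
have jinc n m : (n <= m)%N -> (jn n <= jn m)%N.
  elim: m => [|m IH]; first by rewrite leqn0 => /eqP ->.
  rewrite leq_eqVlt => /orP[/eqP -> //|]; rewrite ltnS => /IH h; rewrite jS.
  by apply: leq_trans (leq_maxr _ _); exact: leqW.
have jge n : (n <= jn n)%N.
  by elim: n => [//|n IH]; rewrite jS leq_max ltnS IH orbT.
have Xsg n : Xs (sg n).
  by elim: n => [//|n IH]; rewrite sS; apply: Xs_ZD => //; have [_ _] := rP n.
have tl n : tn n <= 2^-1 ^+ n.
  elim: n => [|n IH]; first by rewrite t00 expr0.
  rewrite (le_trans (tq n)) // exprS; have := t0 n; lra.
have step n m : (n <= m)%N -> bnd (lev (jn n)) (2 * tn n - 2 * tn m) (fun x => sg m x - sg n x).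
  elim: m => [|m IH].
    rewrite leqn0 => /eqP ->; rewrite subrr; have := @bnd_zero R d M A _ (lev0 (jn 0%N)).
    by congr bnd; apply: funext => x; rewrite subrr.
  rewrite leq_eqVlt => /orP[/eqP ->|].
    rewrite subrr; have := @bnd_zero R d M A _ (lev0 (jn m.+1)).
    by congr bnd; apply: funext => x; rewrite subrr.
  rewrite ltnS => nm; have [_ _ Xr br _] := rP m.
  have {}br := bnd_lev (jinc _ _ nm) br.
  have := bnd_ZD (tn m)%:C (lev0 _) br (IH nm); rewrite mulr1 cnR (gtr0_norm (t0 m)) => b.
  have := bnd_wc wM (lev0 _) (_ : _ <= 2 * tn n - 2 * tn m.+1) b; rewrite sS.
  rewrite (_ : (fun x => _) = (fun x => (tn m)%:C * (rn m).2 x + sg m x - sg n x)); last by apply: funext => x; rewrite addrA.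
  apply; have := tq m; have := t0 m; lra.
have stp n m (nm : (n <= m)%N) : bnd (lev (jn n)) (2 * tn n) (fun x => sg m x - sg n x).
  apply: (bnd_wc wM (lev0 _)) (step _ _ nm); have := t0 m; lra.
have [phi Hphi] : exists phi, forall n, bnd (lev (jn n)) (2 * tn n) (fun x => phi x - sg n x).
  apply: bnd_complete => //.
  - by move=> n; have [c []] := Xsg n 0%N.
  - by move=> n; apply: levD; apply: jinc.
  move=> r r0; have [n hn] := archi_le (2 / r); exists n.
  have := tl n; have h := half_le R n; have n1 : 0 < n.+1%:R :> R by [].
  have h3 : 2 / n.+1%:R <= r.
    rewrite ler_pdivrMr // mulrC -ler_pdivrMr // (le_trans hn) // ler_nat; lia.
  move=> h1; have h2 := le_trans h1 h; apply: le_trans h3; rewrite ler_wpM2l //.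
have Xphi : Xs phi.
  move=> j; have [c b] := Xsg j j; have b' := bnd_lev (jge j) (Hphi j).
  exists (2 * tn j + c); have := bnd_add (lev0 j) b' b.
  by congr bnd; apply: funext => x; rewrite subrK.
(* For n above p(phi), the function (phi - sg n) / tn n has p at most (n + p(sg n)) / tn n and yet
   lies too close to the n-th witness. *)
have [n hn] := archi_le (p phi).
have [_ _ Xr _ no] := rP n.
have tni : 0 < (tn n)^-1 by rewrite invr_gt0.
apply: (no (fun x => ((tn n)^-1)%:C * (phi x - sg n x))).
- by apply: Xs_Z; apply: Xs_sub.
- apply: le_trans (pZ _ (Xs_sub Xphi (Xsg n))) _.
  rewrite cnR (gtr0_norm tni) mulrC ler_wpM2r ?(ltW tni) //.
  by apply: le_trans (pZD1 Xphi (Xsg n)) _; rewrite lerD2r.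
have b : bnd (lev (rn n).1.1) (2 * tn n.+1) (fun x => phi x - sg n.+1 x).
  by apply: bnd_lev (Hphi n.+1); rewrite jS leq_maxl.
have := bnd_Z (- ((tn n)^-1)%:C) (lev0 _) b; rewrite cnN cnR (gtr0_norm tni) => {}b.
have -> : (fun x => (rn n).2 x - ((tn n)^-1)%:C * (phi x - sg n x)) = (fun x => - ((tn n)^-1)%:C * (phi x - sg n.+1 x)).
  apply: funext => x; rewrite sS mulNr -mulrN.
  have e1 : ((tn n)^-1)%:C * (tn n)%:C = 1 by rewrite -rmorphM mulVf ?gt_eqF.
  rewrite -[(rn n).2 x in LHS]mul1r -e1 -mulrA -mulrBr; congr (_ * _).
  by rewrite !opprB -[RHS]addrA; congr (_ + _); rewrite opprB.
apply: (bnd_wc wM (lev0 _)) b; have [_ /andP[dl0 _] _ _ _] := rP n.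
rewrite tS (_ : _ * _ = (rn n).1.2 / 2); last by field; rewrite gt_eqF.
by rewrite ler_pdivrMr // ler_peMr ?ler1n // ltW.
Qed.

(** The remainder left by [zab_dense] is rescaled and approximated again; the n-th approximant has p
    at most C / 2^n, and countable subadditivity adds these up to 2 C. *)
Lemma zabreiko : exists j (C : R), 0 <= C /\ forall phi c, Xs phi -> bnd (lev j) c phi -> p phi <= C * c.
Proof.
have [j [C dense]] := zab_dense.
have C0 : 0 <= C.
  have b0 : bnd (lev j) 1 (fun=> 0) by apply: (bnd_wc wM (lev0 j) ler01); exact: bnd_zero.
  by have [u Xu [pu _]] := dense 0%N 1 _ ltr01 Xs_0 b0; exact: le_trans (p0 Xu) pu.
have h0 n : 0 < 2^-1 ^+ n :> R by rewrite exprn_gt0.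
have /boolp.choice[G HG] : forall q : nat * testfun, exists u, Xs q.2 -> bnd (lev j) (2^-1 ^+ q.1) q.2 ->
   Xs u /\ p u <= 2^-1 ^+ q.1 * C /\ bnd (lev (maxn j q.1)) (2^-1 ^+ q.1.+1) (fun x => q.2 x - u x).
  move=> [n r] /=; apply: contrapT => no; apply: no; have [Xr|] := pselect (Xs r /\ bnd (lev j) (2^-1 ^+ n) r); last first.
    by move=> nX; exists (fun=> 0) => X b; case: nX.
  have {Xr} [Xr br] := Xr; have hn := h0 n; have hi : 0 < (2^-1 ^+ n)^-1 :> R by rewrite invr_gt0.
  have := bnd_Z (((2^-1 ^+ n)^-1)%:C) (lev0 _) br; rewrite cnR (gtr0_norm hi) mulVf ?gt_eqF // => b.
  have i2 : 0 < 2^-1 :> R by rewrite invr_gt0.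
  have [u Xu [pu bu]] := dense (maxn j n) _ _ i2 (Xs_Z _ Xr) b.
  exists (fun x => (2^-1 ^+ n)%:C * u x) => _ _; split; first exact: Xs_Z.
  split; first by rewrite (le_trans (pZ _ Xu)) // cnR (gtr0_norm hn) ler_wpM2l // ltW.
  have := bnd_Z ((2^-1 ^+ n)%:C) (lev0 _) bu; rewrite cnR (gtr0_norm hn) -exprSr.
  congr bnd; apply: funext => x; rewrite mulrBr mulrA -rmorphM divff ?gt_eqF //= mul1r //.
have main phi : Xs phi -> bnd (lev j) 1 phi -> p phi <= 2 * C.
  move=> Xphi bphi.
  pose rr := fix rr n : testfun := if n is n'.+1 then fun x => rr n' x - G (n', rr n') x else phi.
  pose uu n := G (n, rr n).
  have inv n : Xs (rr n) /\ bnd (lev j) (2^-1 ^+ n) (rr n).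
    elim: n => [//|n [X b]]; have [Xu [_ bu]] := HG (n, rr n) X b.
    by split; [exact: Xs_sub|apply: bnd_lev bu; exact: leq_maxl].
  have all n := HG (n, rr n) (inv n).1 (inv n).2.
  have rE n x : rr n x = phi x - \sum_(i < n) uu i x.
    elim: n => [|n IH]; first by rewrite big_ord0 subr0.
    by rewrite big_ord_recr /= IH opprD addrA.
  apply: (@pS uu) => //.
  - by move=> n; have [] := all n.
  - have h n : \sum_(i < n) p (uu i) <= C * (2 - 2 * 2^-1 ^+ n).
      elim: n => [|n IH]; first by rewrite big_ord0 expr0 mulr1 subrr mulr0.
      rewrite big_ord_recr /=; have [_ [pu _]] := all n; apply: le_trans (lerD IH pu) _.
      by rewrite /= exprS le_eqVlt; apply/orP; left; apply/eqP; field.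
    move=> n; rewrite (le_trans (h n)) // mulrC ler_wpM2r // lerBlDr lerDl mulr_ge0 // ltW //.
  move=> j' r r0; have [n0 hn0] := archi_le r^-1; exists (maxn j' n0).+1 => -[//|n]; rewrite ltnS geq_max => /andP[h1 h2].
  have [_ [_ b]] := all n.
  have {}b := bnd_lev (leq_trans h1 (leq_maxr j n)) b.
  have := bnd_wc wM (lev0 _) (_ : _ <= r) b; rewrite (_ : (fun x => _) = (fun x => phi x - \sum_(i < n.+1) uu i x)).
    apply; rewrite (le_trans (half_le R _)) // -[r]invrK lef_pV2 ?posrE ?invr_gt0 //.
    by rewrite (le_trans hn0) // ler_nat; exact: (leq_trans h2 (leqW (leqnSn n))).
  by apply: funext => x; rewrite -rE.
exists j, (2 * C); split; first by rewrite mulr_ge0.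
move=> phi c Xphi b; have c0 := bnd_ge0 wM (lev0 _) b; apply/ler_addgt0Pr => e e0.
have K0 : 0 < 1 + 2 * C by rewrite ltr_pwDl // mulr_ge0.
have e1 : 0 < e / (1 + 2 * C) by rewrite divr_gt0.
(* c may be 0, so the normalization divides by a slightly larger number. *)
set c' := c + e / (1 + 2 * C); have c'0 : 0 < c' by rewrite ltr_wpDl.
have ci : 0 < c'^-1 by rewrite invr_gt0.
have b' : bnd (lev j) 1 (fun x => (c'^-1)%:C * phi x).
  have := bnd_Z (c'^-1)%:C (lev0 _) b; rewrite cnR (gtr0_norm ci); apply: (bnd_wc wM (lev0 _)).
  by rewrite mulrC ler_pdivrMr // mul1r lerDl ltW.
have := pZ c'%:C (Xs_Z (c'^-1)%:C Xphi); rewrite cnR (gtr0_norm c'0).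
rewrite (_ : (fun x => _) = phi); last by apply: funext => x; rewrite mulrA -rmorphM divff ?gt_eqF //= mul1r.
move=> h; apply: (le_trans h); apply: le_trans (ler_wpM2l (ltW c'0) (main _ (Xs_Z _ Xphi) b')) _.
rewrite /c' mulrDl [c * _]mulrC lerD2l mulrAC ler_pdivrMr // ler_wpM2l ?(ltW e0) // lerDr //.
Qed.

End Zabreiko.

End Levels.

Lemma QQ_up (R : realType) b (P Q : R -> Prop) : (forall l l', 0 < l -> l <= l' -> P l -> P l') ->
  (forall l l', 0 < l -> l <= l' -> Q l -> Q l') -> QQ b P -> QQ b Q -> QQ b (fun l => P l /\ Q l).
Proof.
case: b => HP HQ; last by move=> p q l l0; split; [exact: p|exact: q].
move=> [l1 [l10 p]] [l2 [l20 q]]; exists (Num.max l1 l2); split; first by rewrite lt_max l10.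
by split; [apply: HP p|apply: HQ q]; rewrite // le_max lexx ?orbT.
Qed.

(** * Continuity on S, the pairing, bounded sets *)

Section More.
Variables (R : realType) (d : nat) (beur : bool) (M A : nat -> R).
Hypotheses (wM : weight_seq M) (wA : weight_seq A) (M1 : cond_M1 M) (M2 : cond_M2' M) (A2 : cond_M2' A).
Local Notation pt := (pt R d).
Local Notation testfun := (testfun R d).
Implicit Types (phi psi eta theta : testfun) (l c : R) (x y : pt).
Local Notation bnd := (@bnd R d M A).
Local Notation bnd0 := (@bnd0 R d A).
Local Notation conv := (@Defs.conv R d).
Local Notation S := (GS beur M A).
Local Notation cvS := (@cvS R d beur M A).
Local Notation cC := (@conv_comm R d beur M A wM wA M2 A2).
Local Notation cZD := (@conv_ZDl R d beur M A wM wA M2 A2).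

Lemma bnd_bnd0 l c phi : bnd l c phi -> bnd0 l (c * M 0%N) phi.
Proof. by move=> [_ b] x; have := b [::] x; rewrite expr0 mul1r. Qed.

Lemma GS_bnd0 phi : S phi -> QQ (~~ beur) (fun l => exists c, bnd0 l c phi).
Proof. by move/(GS_QQ beur A wM); apply: QQ_imp => l _ [c /bnd_bnd0 b]; eexists; exact: b. Qed.

Lemma GS_sub phi psi : S phi -> S psi -> S (fun x => phi x - psi x).
Proof.
move=> h1 h2; have := GS_ZD wM wA (-1) h2 h1; congr GS.
by apply: funext => x; rewrite mulN1r addrC.
Qed.

Lemma GS_sum1 n (u : nat -> testfun) : (forall i, S (u i)) -> S (fun x => \sum_(i < n) u i x).
Proof.
move=> h; have := GS_sum wM wA (index_enum 'I_n) (fun=> 1) (fun i : 'I_n => h i); congr GS.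
by apply: funext => x; apply: eq_bigr => i _; rewrite mul1r.
Qed.

Lemma cvS_up (u : nat -> testfun) phi l l' : 0 < l -> l <= l' ->
  (forall e, 0 < e -> exists N, forall n, (N <= n)%N -> bnd l e (fun x => phi x - u n x)) ->
  (forall e, 0 < e -> exists N, forall n, (N <= n)%N -> bnd l' e (fun x => phi x - u n x)).
Proof. by move=> l0 ll H e /H[N h]; exists N => n /h; exact: bnd_wl. Qed.

Lemma cvS_conv (u : nat -> testfun) phi eta : (forall n, S (u n)) -> S phi -> S eta -> cvS u phi ->
  cvS (fun n => conv eta (u n)) (conv eta phi).
Proof.
move=> Su Sp Se cv; have [k [k1 Hk]] := conv_ok_ex d wM wA M2 A2; have k0 : 0 < k := lt_le_trans ltr01 k1.
have up (l l' : R) : 0 < l -> l <= l' -> (exists c, bnd l c eta) -> exists c, bnd l' c eta.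
  by move=> l0 ll [c b]; exists c; exact: bnd_wl b.
have := QQ_scale k0 (QQ_up (@cvS_up u phi) up cv ((GS_QQ beur A wM eta).1 Se)).
apply: QQ_imp => l l0 [H [c b]] e e0.
have [C C0 HC] := Hk l l0; have lk : 0 < l / k by rewrite divr_gt0.
have c0 := bnd_ge0 wM lk b.
have K0 : 0 < 1 + C * c * M 0%N by rewrite ltr_pwDl // !mulr_ge0 ?(ltW C0) ?(M_ge0 wM).
have [N hN] := H _ (divr_gt0 e0 K0); exists N => n /hN b'.
have [_ _ /(_ _ (bnd_bnd0 b')) h _ _] := HC _ _ _ _ b b'.
have <- : conv eta (fun x => phi x - u n x) = (fun x => conv eta phi x - conv eta (u n) x).
  have -> : (fun x => phi x - u n x) = (fun x => -1 * u n x + phi x).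
    by apply: funext => x; rewrite mulN1r addrC.
  rewrite cC //; last exact: GS_ZD.
  rewrite cZD //; apply: funext => x.
  by rewrite mulN1r addrC (cC Sp Se) (cC (Su n) Se).
apply: (bnd_wc wM l0) h.
rewrite (_ : _ * _ = e * (C * c * M 0%N) / (1 + C * c * M 0%N)); last by ring.
by rewrite ler_pdivrMr // ler_wpM2l ?(ltW e0) // lerDr.
Qed.

Lemma ult_cvg T (u : nat -> testfun) phi : ultradist beur M A T -> (forall n, S (u n)) -> S phi -> cvS u phi ->
  forall e, 0 < e -> exists N, forall n, (N <= n)%N -> cnorm (T phi - T (u n)) <= e.
Proof.
move=> uT Su Sp cv e e0; have [l l0 [[C C0 HC] H]] := QQ_meet (ult_bnd wM uT) cv.
have K0 : 0 < 1 + C by rewrite ltr_pwDl.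
have [N hN] := H _ (divr_gt0 e0 K0); exists N => n /hN b.
have := HC _ _ (GS_sub Sp (Su n)) b.
have -> : (fun x => phi x - u n x) = (fun x => -1 * u n x + phi x).
  by apply: funext => x; rewrite mulN1r addrC.
rewrite (ult_ZD uT) // mulN1r addrC => /le_trans; apply.
by rewrite mulrCA ler_piMr ?(ltW e0) // ler_pdivrMr // mul1r lerDr.
Qed.

Lemma pair_cls phi psi : S phi -> S psi -> exists C, cls C (fun x => phi x * psi x).
Proof.
move=> h1 h2; have [C c] := conv_cls wM wA M2 A2 0 (GS_check wM wA h1) h2.
by exists C; move: c; congr cls; apply: funext => y; rewrite /check sub0r opprK.
Qed.

Lemma pairing_transl y phi psi : S phi -> S psi -> pairing (transl y phi) psi = pairing phi (transl (- y) psi).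
Proof.
move=> h1 h2; have [C c] := pair_cls h1 (GS_transl wM wA (- y) h2).
rewrite /pairing -(integ_transl y c); congr integ; apply: funext => x.
by rewrite /transl opprK subrK.
Qed.

Lemma pairing_sum (I : Type) (r : seq I) (a : I -> R[i]) (F : I -> testfun) psi : (forall i, S (F i)) -> S psi ->
  pairing (fun x => \sum_(i <- r) a i * F i x) psi = \sum_(i <- r) a i * pairing (F i) psi.
Proof.
move=> h hp; have [_ <-] := integ_sum r a (F := fun i y => F i y * psi y) (fun i => pair_cls (h i) hp).
by congr integ; apply: funext => y; rewrite mulr_suml; apply: eq_bigr => i _; rewrite mulrA.
Qed.

Lemma pairing_sub phi1 phi2 psi : S phi1 -> S phi2 -> S psi ->
  pairing (fun x => phi1 x - phi2 x) psi = pairing phi1 psi - pairing phi2 psi.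
Proof.
move=> h1 h2 hp; have [C1 c1] := pair_cls h1 hp; have [C2 c2] := pair_cls h2 hp.
have := integ_ZD (-1) c2 c1; rewrite mulN1r addrC => <-; congr integ; apply: funext => x.
by rewrite [RHS]addrC mulN1r mulrBl.
Qed.

Lemma GS_lev (l : R) phi : 0 < l -> (exists c, bnd l c phi) -> beur = false -> S phi.
Proof. by move=> l0 b e; apply/GS_QQ => //; rewrite e; exists l. Qed.

Lemma zab_S (p : testfun -> R) : (forall phi, S phi -> 0 <= p phi) ->
  (forall (a : R[i]) phi psi, S phi -> S psi -> p (fun x => a * phi x + psi x) <= cnorm a * p phi + p psi) ->
  (forall (a : R[i]) phi, S phi -> p (fun x => a * phi x) <= cnorm a * p phi) ->
  (forall (u : nat -> testfun) phi (K : R), (forall n, S (u n)) -> S phi -> (forall n, \sum_(i < n) p (u i) <= K) ->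
     cvS (fun n x => \sum_(i < n) u i x) phi -> p phi <= K) ->
  QQ beur (fun l => exists2 C, 0 <= C & forall phi c, S phi -> bnd l c phi -> p phi <= C * c).
Proof.
move=> p0 pZD pZ pS.
have main (lev : nat -> R) : (forall j, 0 < lev j) -> (forall i j, (i <= j)%N -> lev j <= lev i) ->
    (forall phi, Xs M A lev phi -> S phi) ->
    (forall (u : nat -> testfun) phi, (forall j r, 0 < r -> exists N, forall n, (N <= n)%N -> bnd (lev j) r (fun x => phi x - \sum_(i < n) u i x)) ->
       cvS (fun n x => \sum_(i < n) u i x) phi) ->
    exists j, exists2 C : R, 0 <= C & forall phi c, Xs M A lev phi -> bnd (lev j) c phi -> p phi <= C * c.
  move=> l0 lD XS cv.
  have [||||j [C [C0 H]]] := @zabreiko R d M A wM wA lev p l0 lD.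
  - by move=> phi /XS; exact: p0.
  - by move=> a phi psi /XS h1 /XS h2; exact: pZD.
  - by move=> a phi /XS; exact: pZ.
  - by move=> u phi K Xu /XS Sp hK c; apply: pS (hK) (cv _ _ c) => // n; exact: XS.
  by exists j; exists C.
have [be|be] := boolP beur.
  have [||||j [C C0 H]] := main (fun j => j.+1%:R^-1).
  - by move=> j; rewrite invr_gt0.
  - by move=> i j ij; rewrite lef_pV2 ?posrE // ler_nat.
  - move=> phi X; apply/GS_QQ => //; rewrite be /= => l l0.
    have [n hn] := archi_le l^-1; have [c b] := X n; exists c; apply: (bnd_wl wM wA _ _ b); rewrite ?invr_gt0 //.
    by rewrite -[l]invrK lef_pV2 ?posrE ?invr_gt0 // (le_trans hn) // ler_nat.
  - move=> u phi H; rewrite /cvS be /= => l l0 e e0.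
    have [n hn] := archi_le l^-1; have [N h] := H n e e0; exists N => m /h; apply: bnd_wl; rewrite ?invr_gt0 //.
    by rewrite -[l]invrK lef_pV2 ?posrE ?invr_gt0 // (le_trans hn) // ler_nat.
  exists j.+1%:R^-1; rewrite invr_gt0 ltr0Sn; split=> //; exists C => // phi c Sp b; apply: H => // i.
  by have := (GS_QQ true A wM phi).1 Sp; apply; rewrite invr_gt0.
move=> l l0; rewrite -(negPf be).
have [||||j [C C0 H]] := main (fun=> l) => //.
- by move=> phi X; exact: (GS_lev l0 (X 0%N) (negbTE be)).
- by move=> u phi H; rewrite /cvS (negPf be) /=; exists l; split => //; exact: H 0%N.
by exists C => // phi c Sp b; apply: H => // i; exists c.
Qed.

(** Every neighbourhood contains a small multiple of phi. Applied to singletons, statements about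
    the strong dual become pointwise ones. *)
Lemma boundedS1 phi : S phi -> boundedS beur M A [set phi].
Proof.
move=> Sp; split=> [_ ->//|U [_ [_ HU]]].
suff [t t0 Ut] : exists2 t : R, 0 < t & U (fun x => t%:C * phi x).
  by exists t^-1; rewrite invr_gt0; split=> // _ ->; rewrite invrK.
have key (l r : R) : 0 < l -> 0 < r -> (exists c, bnd l c phi) -> exists2 t : R, 0 < t &
     inSl M A l (fun x => t%:C * phi x) /\ (gsnorm M A l l^-1 (fun x => (t%:C * phi x)%R) < r%:E)%E.
  move=> l0 r0 [c b]; have c0 := bnd_ge0 wM l0 b; have c1 : 0 < c + 1 by rewrite ltr_wpDl.
  have t0 : 0 < r / 2 / (c + 1) by rewrite !divr_gt0.
  exists (r / 2 / (c + 1)) => //; have := bnd_Z (r / 2 / (c + 1))%:C l0 b; rewrite cnR (gtr0_norm t0) => b'.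
  split; first by apply/inSlP => //; eexists; exact: b'.
  have sm := b'.1; move/(gsnorm_bnd A wM _ l0 sm): b' => /le_lt_trans; apply; rewrite lte_fin.
  by rewrite mulrAC ltr_pdivrMr //; nra.
move: HU; have := (GS_QQ beur A wM phi).1 Sp; rewrite /QQ.
case: (boolP beur) => be /=.
  move=> H [l [r [l0 [r0 HU]]]]; have [t t0 [i1 i2]] := key l r l0 r0 (H l l0).
  by exists t => //; apply: HU => //; have := GS_Z wM wA t%:C Sp; rewrite be.
move=> [l [l0 H]] HU; have [r [r0 h]] := HU l l0; have [t t0 [i1 i2]] := key l r l0 r0 H.
by exists t => //; exact: h.
Qed.

End More.

(** * The space E *)

Section Tmib.
Variables (R : realType) (d : nat) (beur : bool) (M A : nat -> R).
Hypotheses (wM : weight_seq M) (wA : weight_seq A) (M1 : cond_M1 M) (M2 : cond_M2' M) (A2 : cond_M2' A).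
Variables (E : lmodType R[i]) (nE : E -> R) (iota : E -> functional R d).
Hypothesis HT : is_TMIB beur M A nE iota.
Local Notation pt := (pt R d).
Local Notation testfun := (testfun R d).
Implicit Types (phi psi eta theta : testfun) (l c : R) (x y : pt) (e : E).
Local Notation bnd := (@bnd R d M A).
Local Notation S := (GS beur M A).
Local Notation eqS := (eqS beur M A).
Local Notation cvS := (@cvS R d beur M A).
Local Notation cC := (@conv_comm R d beur M A wM wA M2 A2).
Lemma nE_ge0 e : 0 <= nE e. Proof. by case: HT => [[]]. Qed.
Lemma nEZ a e : nE (a *: e) = cnorm a * nE e. Proof. by case: HT => [[]]. Qed.

Lemma E_nspace : nspace nE.
Proof.
case: HT => [[n0 n1 nZ nD nC] _]; split=> //.
- by split=> //; rewrite -(scale0r 0) nZ cn0 mul0r.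
- by move=> v; rewrite -scaleN1r nZ cnN cn1 mul1r.
Qed.

Lemma iotaZD a e1 e2 phi : S phi -> iota (a *: e1 + e2) phi = a * iota e1 phi + iota e2 phi.
Proof. by case: HT => [_ [h _]]; exact: h. Qed.

Lemma iota_ult e : ultradist beur M A (iota e).
Proof. by case: HT => [_ [_ [h _]]]; exact: h. Qed.

Lemma iota_inj e1 e2 : eqS (iota e1) (iota e2) -> e1 = e2.
Proof. by case: HT => [_ [_ [_ [h _]]]]; exact: h. Qed.

Lemma iota_E0 phi : S phi -> iota 0 phi = 0.
Proof.
move=> h; have := iotaZD (-1) 0 0 h; rewrite scaler0 addr0 mulN1r => e.
by rewrite e addNr.
Qed.

Lemma iotaZ a e phi : S phi -> iota (a *: e) phi = a * iota e phi.
Proof. by move=> h; rewrite -[a *: e]addr0 iotaZD // iota_E0 // addr0. Qed.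

Lemma iotaD e1 e2 phi : S phi -> iota (e1 + e2) phi = iota e1 phi + iota e2 phi.
Proof. by move=> h; rewrite -{1}[e1]scale1r iotaZD // mul1r. Qed.

Lemma iotaB e1 e2 phi : S phi -> iota (e1 - e2) phi = iota e1 phi - iota e2 phi.
Proof. by move=> h; rewrite addrC -scaleN1r iotaZD // mulN1r addrC. Qed.

Lemma iota_sum (I : Type) (r : seq I) (P : pred I) (F : I -> E) phi : S phi ->
  iota (\sum_(i <- r | P i) F i) phi = \sum_(i <- r | P i) iota (F i) phi.
Proof.
by move=> h; elim/big_rec2: _ => [|i y1 y2 _ <-]; [exact: iota_E0|exact: iotaD].
Qed.

Lemma iota_pt phi : S phi -> exists2 C, 0 <= C & forall e, cnorm (iota e phi) <= C * nE e.
Proof.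
move=> h; have [C HC] : exists C : R, forall e phi', [set phi] phi' -> cnorm (iota e phi') <= C * nE e.
  by case: HT => [_ [_ [_ [_ [b _]]]]]; apply: b; exact: boundedS1.
exists (Num.max 0 C); first by rewrite le_max lexx.
move=> e; rewrite (le_trans (HC e phi erefl)) // ler_wpM2r ?nE_ge0 // le_max lexx orbT //.
Qed.

Lemma emb_ex phi : S phi -> exists e, eqS (iota e) (pairing phi).
Proof. by case: HT => [_ [_ [_ [_ [_ [_ [h _]]]]]]]; exact: h. Qed.

Lemma emb_bnd : QQ beur (fun l => exists2 C, 0 <= C & forall phi e c, S phi -> eqS (iota e) (pairing phi) ->
  bnd l c phi -> nE e <= C * c).
Proof.
have main l C phi e c : 0 < l -> bnd l c phi ->
   ((nE e)%:E <= C%:E * gsnorm M A l l^-1 phi)%E -> nE e <= Num.max 0 C * c.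
  move=> l0 b H; have c0 := bnd_ge0 wM l0 b; have sm := b.1.
  rewrite -lee_fin EFinM; apply: le_trans H _.
  apply: (@le_trans _ _ ((Num.max 0 C)%:E * gsnorm M A l l^-1 phi)%E).
    by apply: lee_wpmul2r; rewrite ?gsnorm_ge0 // lee_fin le_max lexx orbT.
  by apply: lee_wpmul2l; [rewrite lee_fin le_max lexx|exact/gsnorm_bnd].
case: HT => [_ [_ [_ [_ [_ [_ [_ [h _]]]]]]]]; move: h main; rewrite /QQ /Defs.eqS /GS.
case: (beur) => h main.
  have [l [C [l0 H]]] := h; exists l; split=> //; exists (Num.max 0 C); first by rewrite le_max lexx.
  by move=> phi e c Sp he b; exact: (main l C phi e c l0 b (H phi e Sp he)).
move=> l l0; have [C HC] := h l l0; exists (Num.max 0 C); first by rewrite le_max lexx.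
move=> phi e c Sp he b; apply: (main l C phi e c l0 b); apply: HC he; apply/inSlP => //; by exists c.
Qed.

Lemma emb_dense e (r : R) : 0 < r -> exists phi e', S phi /\ eqS (iota e') (pairing phi) /\ nE (e - e') < r.
Proof. by case: HT => [_ [_ [_ [_ [_ [_ [_ [_ [h _]]]]]]]]]; exact: h. Qed.

(** Rescaling to the unit ball; a vector of norm 0 cannot be rescaled and is handled by the
    injectivity of [iota]. *)
Lemma opn_le (m : testfun -> testfun) (B : R) : (forall phi, S phi -> S (m phi)) ->
  (opnormE beur M A nE iota (fun T phi => T (m phi)) <= B%:E)%E ->
  forall e e', eqS (iota e') (fun phi => iota e (m phi)) -> nE e' <= B * nE e.
Proof.
move=> Sm HB e e' he.
have key (v v' : E) : nE v <= 1 -> eqS (iota v') (fun phi => iota v (m phi)) -> nE v' <= B.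
  by move=> v1 hv; rewrite -lee_fin; apply: le_trans HB; apply: ereal_sup_ubound; exists v, v'.
have [z|nz] := eqVneq (nE e) 0.
  have -> : e' = 0.
    case: HT => [[_ h0 _ _ _] _]; have e0 := h0 _ z; apply: iota_inj => phi h.
    by rewrite he // e0 !iota_E0 //; exact: Sm.
  by rewrite (nrm0 E_nspace) z mulr0.
have p : 0 < nE e by rewrite lt_neqAle eq_sym nz nE_ge0.
have pi : 0 < (nE e)^-1 by rewrite invr_gt0.
have := key ((nE e)^-1%:C *: e) ((nE e)^-1%:C *: e') _ _.
rewrite !nEZ cnR (gtr0_norm pi) mulVf // lexx -ler_pdivlMl ?invrK // mulrC; apply=> //.
by move=> phi h; rewrite !iotaZ ?he //; exact: Sm.
Qed.

Lemma tr_ex : exists2 tr : pt -> E -> E, forall y e phi, S phi -> iota (tr y e) phi = iota e (transl (- y) phi) &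
  QQ beur (fun q => exists2 C, 0 < C & forall y e, nE (tr y e) <= C * ew A (q * eucl y) * nE e).
Proof.
case: HT => [_ [_ [_ [_ [_ [_ [_ [_ [_ [h [_ b]]]]]]]]]]].
have /boolp.choice[t Ht] : forall ye : pt * E, exists e', eqS (iota e') (translD ye.1 (iota ye.2)).
  by move=> [y e]; exact: h.
exists (fun y e => t (y, e)); first by move=> y e phi; exact: (Ht (y, e)).
have key q C : (forall x : pt, (omegaE beur M A nE iota x <= (C * expR (omega A (q * eucl x)))%:E)%E) ->
   forall y e, nE (t (y, e)) <= C * ew A (q * eucl y) * nE e.
  move=> H y e; apply: (@opn_le (transl (- y)) _ _ (H y)); last exact: (Ht (y, e)).
  by move=> phi; exact: GS_transl.
move: b; rewrite /QQ; case: (beur) key => key b.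
  by have [q [C [q0 [C0 [H _]]]]] := b; exists q; split=> //; exists C => //; exact: key.
by move=> q q0; have [C [C0 [H _]]] := b q q0; exists C => //; exact: key.
Qed.

Definition nu xi := fine (nuE beur M A nE iota xi).

Lemma nuE_fin xi : nuE beur M A nE iota xi = (nu xi)%:E /\ 0 <= nu xi.
Proof.
have h0 : (0 <= nuE beur M A nE iota xi)%E.
  apply: ereal_sup_ubound; exists 0, 0; rewrite (nrm0 E_nspace) ler01; split=> //; split=> // phi h.
  by rewrite /modD !iota_E0 //; exact: GS_modul.
have [B HB] : exists B : R, (nuE beur M A nE iota xi <= B%:E)%E.
  case: HT => [_ [_ [_ [_ [_ [_ [_ [_ [_ [_ [_ b]]]]]]]]]]].
  move: b; case: (beur) => b; first by have [q [C [_ [_ [_ H]]]]] := b; eexists; exact: H.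
  by have [C [_ [_ H]]] := b 1 ltr01; eexists; exact: H.
have fn : nuE beur M A nE iota xi \is a fin_num by rewrite ge0_fin_numE // (le_lt_trans HB) // ltry.
by rewrite /nu fineK //; split=> //; exact: fine_ge0.
Qed.

Lemma md_ex xi e : exists e', (forall phi, S phi -> iota e' phi = iota e (modul (- xi) phi)) /\ nE e' <= nu xi * nE e.
Proof.
case: HT => [_ [_ [_ [_ [_ [_ [_ [_ [_ [_ [h _]]]]]]]]]]].
have [e' he] := h (- xi) e; exists e'; split; first exact: he.
apply: (@opn_le (modul (- xi)) _ _ _ _ _ he); first by move=> phi; exact: GS_modul.
by have [<- _] := nuE_fin xi.
Qed.

Lemma condG_nu : condG beur M A nE iota -> if beur then forall q0 : R, 0 < q0 -> exists q1 C : R, 0 < q1 /\ 0 < C /\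
      forall xi, nu xi * ew M (q0 * eucl xi) <= C * ew M (q1 * eucl xi)
   else forall q1 : R, 0 < q1 -> exists q0 C : R, 0 < q0 /\ 0 < C /\
      forall xi, nu xi * ew M (q0 * eucl xi) <= C * ew M (q1 * eucl xi).
Proof.
have key q0 q1 C xi : (nuE beur M A nE iota xi * (expR (omega M (q0 * eucl xi)))%:E
     <= (C * expR (omega M (q1 * eucl xi)))%:E)%E -> nu xi * ew M (q0 * eucl xi) <= C * ew M (q1 * eucl xi).
  by have [-> _] := nuE_fin xi; rewrite -EFinM lee_fin.
rewrite /condG; case: (beur) key => key H q q00.
  have [q1 [C [q10 [C0 h]]]] := H q q00; exists q1, C; split; first exact: q10.
  split; first exact: C0.
  by move=> xi; exact: (key _ _ _ _ (h xi)).
have [q1 [C [q10 [C0 h]]]] := H q q00; exists q1, C; split; first exact: q10.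
  split; first exact: C0.
  by move=> xi; exact: (key _ _ _ _ (h xi)).
Qed.

(** * Closed graph theorem for convolution with f *)

Section ClosedGraph.
Variables (f : functional R d) (Tf : testfun -> E).
Hypotheses (uf : ultradist beur M A f) (HTf : forall phi, S phi -> eqS (iota (Tf phi)) (convD f phi)).

Lemma convD_ZD (T : functional R d) (a : R[i]) phi psi eta : ultradist beur M A T -> S phi -> S psi -> S eta ->
  convD T (fun x => a * phi x + psi x) eta = a * convD T phi eta + convD T psi eta.
Proof.
move=> uT h1 h2 h3; have c1 := GS_check wM wA h1; have c2 := GS_check wM wA h2.
have g1 := GS_conv wM wA M2 A2 h3 c1; have g2 := GS_conv wM wA M2 A2 h3 c2.
rewrite /convD -(ult_ZD uT a g1 g2); congr T.
have -> : check (fun x => a * phi x + psi x) = (fun x => a * check phi x + check psi x) by [].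
rewrite cC // ?(@conv_ZDl _ _ beur _ _ wM wA M2 A2) // ?(cC c1 h3) ?(cC c2 h3) //; exact: GS_ZD.
Qed.

(** Zabreiko's lemma for [nE (Tf phi)]. If the norms of [Tf (u i)] are summable, the series
    converges in E, and its sum is recognized as [Tf phi] by testing against eta, because f and
    convolution with eta are continuous. *)
Lemma closed_graph : QQ beur (fun l => exists2 C, 0 <= C & forall phi c, S phi -> bnd l c phi -> nE (Tf phi) <= C * c).
Proof.
have TZD (a : R[i]) phi psi : S phi -> S psi -> Tf (fun x => a * phi x + psi x) = a *: Tf phi + Tf psi.
  move=> h1 h2; apply: iota_inj => eta he; rewrite iotaZD // !HTf //; last exact: GS_ZD.
  exact: convD_ZD.
have T0 : Tf (fun=> 0) = 0.
  have h0 : S (fun=> 0) := GS_0 d A beur wM.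
  have := TZD (-1) _ _ h0 h0; rewrite (_ : (fun x => _) = (fun=> 0)); last by apply: funext => x; rewrite mulr0 addr0.
  by rewrite scaleN1r addNr.
have TZ (a : R[i]) phi : S phi -> Tf (fun x => a * phi x) = a *: Tf phi.
  move=> h1; have := TZD a _ _ h1 (GS_0 d A beur wM); rewrite T0 addr0 => <-; congr Tf.
  by apply: funext => x; rewrite addr0.
have Tsum n (u : nat -> testfun) : (forall i, S (u i)) -> Tf (fun x => \sum_(i < n) u i x) = \sum_(i < n) Tf (u i).
  move=> Su; elim: n => [|n IH].
    by rewrite big_ord0 -T0; congr Tf; apply: funext => x; rewrite big_ord0.
  have := TZD 1 _ _ (Su n) (@GS_sum1 R d beur M A wM wA n u Su); rewrite IH scale1r big_ord_recr /= addrC => <-.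
  by congr Tf; apply: funext => x; rewrite big_ord_recr /= mul1r addrC.
apply: (zab_S wM wA (p := fun phi => nE (Tf phi))).
- by move=> phi _; exact: nE_ge0.
- by move=> a phi psi h1 h2; rewrite TZD // (le_trans (nD E_nspace _ _)) // nEZ.
- by move=> a phi h; rewrite TZ // nEZ.
move=> u phi K Su h HK cv.
have abs : abs_le nE (fun i => Tf (u i)) K.
  move=> F uF; pose n := (\max_(i <- F) i).+1.
  have sub : {subset F <= index_iota 0 n}.
    by move=> i iF; rewrite mem_index_iota /= ltnS; exact: (@leq_bigmax_seq _ F xpredT id i iF isT).
  apply: le_trans (HK n); rewrite -(big_mkord xpredT (fun i => nE (Tf (u i)))).
  rewrite (big_diff (fun i => nE (Tf (u i))) uF (iota_uniq _ _) sub) lerDl sumr_ge0 // => i _; exact: nE_ge0.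
have [y [hy ny]] := hasSum_ex E_nspace abs.
suff -> : Tf phi = y by [].
apply: iota_inj => eta he; rewrite HTf //.
apply: (n_arb_eq (cn_nspace R)) => r r0; have r2 : 0 < r / 2 by rewrite divr_gt0.
have cu n : S (check (fun x => \sum_(i < n) u i x)) by apply: GS_check => //; exact: GS_sum1.
have cv' : cvS (fun n => check (fun x => \sum_(i < n) u i x)) (check phi).
  apply: QQ_imp cv => l l0 H s s0; have [N HN] := H s s0; exists N => n /HN; exact: bnd_check.
have cp : S (check phi) by exact: GS_check.
have [N1 H1] := ult_cvg wM wA uf (fun n => GS_conv wM wA M2 A2 he (cu n)) (GS_conv wM wA M2 A2 he cp)
   (cvS_conv wM wA M2 A2 cu cp he cv') r2.
have [C C0 HC] := iota_pt he; have C1 : 0 < 1 + C by rewrite ltr_pwDl.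
have [F HF] := hy _ (divr_gt0 r2 C1).
pose n := maxn N1 (\max_(i <- F) i).+1.
have sub : {subset F <= index_iota 0 n}.
  by move=> i iF; rewrite mem_index_iota /= leq_max; apply/orP; right; rewrite ltnS; exact: (@leq_bigmax_seq _ F xpredT id i iF isT).
have := HF _ (iota_uniq _ _) sub; rewrite big_mkord -Tsum // => h2.
have := H1 n (leq_maxl _ _) => h1.
have := HC (Tf (fun x => \sum_(i < n) u i x) - y); rewrite iotaB // HTf //; last exact: GS_sum1.
move=> h3; have h4 : C * nE (Tf (fun x => \sum_(i < n) u i x) - y) <= r / 2.
  apply: le_trans (ler_wpM2l C0 h2) _.
  by rewrite mulrCA ler_piMr ?(ltW r2) // ler_pdivrMr // mul1r lerDr.
have h5 := le_trans h3 h4.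
have := cn_tri (convD f phi eta) (convD f (fun x => \sum_(i < n) u i x) eta) (iota y eta).
by move=> h6; apply: (le_trans h6); rewrite [r]splitr; exact: (lerD h1 h5).
Qed.

End ClosedGraph.

End Tmib.

(** Growth parameters and scales are reciprocal to each other, and inversion respects the
    quantifier. *)
Lemma QQ_inv (R : realType) b (P : R -> Prop) (k : R) : 0 < k -> QQ b P -> QQ b (fun l => P ((k * l)^-1)).
Proof.
move=> k0; case: b => [[q [q0 h]]|h l l0]; last by apply: h; rewrite invr_gt0 mulr_gt0.
exists (k * q)^-1; rewrite invr_gt0 mulr_gt0 //; split=> //.
by rewrite (_ : (k * (k * q)^-1)^-1 = q) //; field; rewrite !gt_eqF.
Qed.

(** * Convolution of vectors of E with test functions *)

Section ConvE.
Variables (R : realType) (d : nat) (beur : bool) (M A : nat -> R).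
Hypotheses (wM : weight_seq M) (wA : weight_seq A) (M1 : cond_M1 M) (M2 : cond_M2' M) (A2 : cond_M2' A).
Variables (E : lmodType R[i]) (nE : E -> R) (iota : E -> functional R d).
Hypothesis HT : is_TMIB beur M A nE iota.
Local Notation pt := (pt R d).
Local Notation testfun := (testfun R d).
Implicit Types (phi psi eta theta : testfun) (l c : R) (x y : pt) (e : E).
Local Notation bnd0 := (@bnd0 R d A).
Local Notation S := (GS beur M A).
Local Notation eqS := (eqS beur M A).
Local Notation KI := (pi + 1 : R).
Local Notation HN := (E_nspace HT).
Variable tr : pt -> E -> E.
Hypothesis Htr : forall y e phi, S phi -> iota (tr y e) phi = iota e (transl (- y) phi).
Hypothesis Ntr : QQ beur (fun q => exists2 C, 0 < C & forall y e, nE (tr y e) <= C * ew A (q * eucl y) * nE e).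

Lemma trZD y a e1 e2 : tr y (a *: e1 + e2) = a *: tr y e1 + tr y e2.
Proof.
apply: (iota_inj HT) => phi h; have h' := GS_transl wM wA (- y) h.
by rewrite (iotaZD HT) // !Htr // (iotaZD HT).
Qed.

Lemma tr0 y : tr y 0 = 0.
Proof. by have := trZD y (-1) 0 0; rewrite scaler0 addr0 scaleN1r addNr. Qed.

Lemma trD y e1 e2 : tr y (e1 + e2) = tr y e1 + tr y e2.
Proof. by rewrite -{1}[e1]scale1r trZD scale1r. Qed.

Lemma trZ y a e : tr y (a *: e) = a *: tr y e.
Proof. by rewrite -[a *: e]addr0 trZD tr0 addr0. Qed.

(** Riemann sum for the integral of psi(y) T_y e over y, a vector of E. *)
Definition wsE N psi e : E := \sum_(q <- grN R d N) (q.1%:C * psi q.2) *: tr q.2 e.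

Lemma wsE_sub N psi e1 e2 : wsE N psi (e1 - e2) = wsE N psi e1 - wsE N psi e2.
Proof.
rewrite /wsE -sumrB; apply: eq_bigr => q _.
by rewrite -scaleN1r trD trZ scalerDr scaleN1r scalerN.
Qed.

Lemma iota_wsE N psi e phi : S phi -> iota (wsE N psi e) phi = \sum_(q <- grN R d N) (q.1%:C * psi q.2) * iota e (transl (- q.2) phi).
Proof.
move=> h; rewrite /wsE (iota_sum HT) //; apply: eq_bigr => q _.
by rewrite (iotaZ HT) // Htr.
Qed.

Lemma wsE_emb N psi eta e : S eta -> eqS (iota e) (pairing eta) -> eqS (iota (wsE N psi e)) (pairing (rsc N eta psi)).
Proof.
move=> he h phi hp; rewrite iota_wsE // /rsc (@pairing_sum _ _ beur _ _ wM wA M2 A2 _ _ _ (fun q => transl q.2 eta)) //.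
  by apply: eq_bigr => q _; rewrite h ?(pairing_transl wM wA M2 A2 _ he hp) //; exact: GS_transl.
by move=> q; exact: GS_transl.
Qed.

Lemma wsE_emb_cvg psi eta e : S psi -> S eta -> eqS (iota e) (pairing eta) -> exists z, forall r, 0 < r ->
  exists N0, forall N, (N0 <= N)%N -> nE (wsE N psi e - z) <= r.
Proof.
move=> hp he h; have hc := GS_conv wM wA M2 A2 he hp.
have [z hz] := emb_ex HT hc; exists z => r r0.
have [l l0 [[C C0 HC] H]] := QQ_meet (emb_bnd wM HT) (conv_cvS wM wA M2 A2 he hp).
have K0 : 0 < 1 + C by rewrite ltr_pwDl.
have [N0 hN] := H _ (divr_gt0 r0 K0); exists N0 => N /hN b.
have hr := GS_rsc wM wA N psi he.
have hs := GS_sub wM wA hc hr.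
rewrite (nBC HN) (le_trans (HC _ _ _ hs _ b)) //.
  move=> phi hphi; rewrite (iotaB HT) // hz // (wsE_emb N psi he h) // (@pairing_sub _ _ beur _ _ wM wA M2 A2) //.
by rewrite mulrCA ler_piMr ?(ltW r0) // ler_pdivrMr // mul1r lerDr.
Qed.

(** For large N the sums [wsE] are uniformly bounded operators on E, and they converge on the dense
    image of S by [wsE_emb_cvg]; hence they converge on all of E. The bound sees only the values of
    psi. *)
Lemma convE_main q C0 : 0 < q -> 0 < C0 -> (forall y e, nE (tr y e) <= C0 * ew A (q * eucl y) * nE e) ->
  forall k, 1 <= k -> (exists2 C : R, 0 < C & forall x, ew A (q * eucl x) * (1 + eucl x ^+ 2) <= C * wt x * ew A (k * q * eucl x)) ->
  exists2 C : R, 0 <= C & forall e psi c, S psi -> bnd0 (k * q)^-1 c psi ->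
  exists y : E, eqS (iota y) (convD (iota e) psi) /\ nE y <= C * c * nE e.
Proof.
move=> q0 C00 HC0 k k1 [C1 C10 HC1].
have KI0 : 0 <= KI ^+ d by rewrite exprn_ge0 // addr_ge0 ?pi_ge0.
have CC : 0 <= C0 * C1 * KI ^+ d by rewrite !mulr_ge0 // ltW.
exists (C0 * C1 * KI ^+ d) => // e psi c hp b.
have c0 : 0 <= c by apply: le_trans (b 0); rewrite mulr_ge0 ?cn_ge0 ?ew_ge0.
have [N1 HN1] := grN_wt R d.
set C := C0 * C1 * KI ^+ d * c; have Cc : 0 <= C by rewrite mulr_ge0.
have wb N v : (N1 <= N)%N -> nE (wsE N psi v) <= C * nE v.
  move=> /HN1 h; rewrite /wsE (le_trans (n_sum HN _ _ _)) //.
  apply: (@le_trans _ _ (\sum_(p <- grN R d N) (C0 * C1 * c * nE v) * (p.1 * wt p.2))).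
    rewrite !big_seq; apply: ler_sum => p pg; have p0 := grN_ge0 pg.
    rewrite (nEZ HT) cnM cnR (ger0_norm p0).
    have h1 : cnorm (psi p.2) * ew A (q * eucl p.2) <= C1 * c * wt p.2.
      apply: (@le_trans _ _ (cnorm (psi p.2) * (C1 * wt p.2 * ew A (k * q * eucl p.2)))).
        rewrite ler_wpM2l ?cn_ge0 // (le_trans _ (HC1 _)) // ler_peMr ?ew_ge0 // lerDl sqr_ge0 //.
      have := b p.2; rewrite invrK => h1.
      rewrite (_ : cnorm _ * _ = C1 * wt p.2 * (cnorm (psi p.2) * ew A (k * q * eucl p.2))); last by ring.
      by rewrite [leRHS]mulrAC; apply: ler_wpM2l h1; rewrite mulr_ge0 ?(ltW C10) // ltW // wt_gt0.
    apply: (@le_trans _ _ (p.1 * cnorm (psi p.2) * (C0 * ew A (q * eucl p.2) * nE v))).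
      by rewrite ler_wpM2l // mulr_ge0 ?cn_ge0.
    rewrite (_ : p.1 * _ * _ = p.1 * C0 * nE v * (cnorm (psi p.2) * ew A (q * eucl p.2))); last by ring.
    apply: le_trans (ler_wpM2l _ h1) _; first by rewrite !mulr_ge0 ?(nE_ge0 HT) // ltW.
    by rewrite le_eqVlt; apply/orP; left; apply/eqP; ring.
  rewrite -mulr_sumr /C (_ : C0 * C1 * _ * c * _ = C0 * C1 * c * nE v * KI ^+ d); last by ring.
  by rewrite ler_wpM2l // !mulr_ge0 ?(nE_ge0 HT) // ltW.
have C1' : 0 < 1 + C by rewrite ltr_pwDl.
have cau (r : R) : 0 < r -> exists n0, forall m n, (n0 <= m)%N -> (n0 <= n)%N -> nE (wsE m psi e - wsE n psi e) < r.
  move=> r0; have r5 : 0 < r / 5 by rewrite divr_gt0.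
  have [eta [e' [he [h1 h2]]]] := emb_dense HT e (divr_gt0 r5 C1').
  have [z hz] := wsE_emb_cvg hp he h1; have [N0 h0] := hz _ r5.
  have near m : (maxn N0 N1 <= m)%N -> nE (wsE m psi e - z) <= 2 * (r / 5).
    rewrite geq_max => /andP[/h0 a1 /wb a2].
    have := n_tri HN (wsE m psi e') (wsE m psi e) z; rewrite -wsE_sub.
    have : nE (wsE m psi (e - e')) <= r / 5.
      rewrite (le_trans (a2 _)) // (le_trans (ler_wpM2l Cc (ltW h2))) //.
      by rewrite mulrCA ler_piMr ?(ltW r5) // ler_pdivrMr // mul1r lerDr.
    lra.
  exists (maxn N0 N1) => m n /near hm /near hn; rewrite (nBC HN) in hn.
  have := n_tri HN z (wsE m psi e) (wsE n psi e); lra.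
have [y hy] : exists y : E, forall r : R, 0 < r -> exists n0, forall n, (n0 <= n)%N -> nE (wsE n psi e - y) < r.
  by case: HN => _ _ _ _; apply.
exists y; split; last first.
  rewrite -/C; apply/ler_addgt0Pr => r r0; have [n0 h0] := hy r r0.
  have := h0 _ (leq_maxl n0 N1); have := wb _ e (leq_maxr n0 N1); rewrite (nBC HN).
  have := nD HN (y - wsE (maxn n0 N1) psi e) (wsE (maxn n0 N1) psi e); rewrite subrK; lra.
move=> phi hphi; apply: (n_arb_eq (cn_nspace R)) => r r0; have r2 : 0 < r / 2 by rewrite divr_gt0.
have [Cp Cp0 HCp] := iota_pt wM wA HT hphi.
have K0 : 0 < 1 + Cp by rewrite ltr_pwDl.
have [n0 h0] := hy _ (divr_gt0 r2 K0).
have hcp := GS_check wM wA hp.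
have [n1 h1] := ult_cvg wM wA (iota_ult HT e) (fun N => GS_rsc wM wA N (check psi) hphi) (GS_conv wM wA M2 A2 hphi hcp)
   (conv_cvS wM wA M2 A2 hphi hcp) r2.
set n := maxn n0 n1.
have e1 : iota (wsE n psi e) phi = iota e (rsc n phi (check psi)).
  rewrite iota_wsE // /rsc (ult_sum wM wA (iota_ult HT e) _ _ (F := fun q => transl q.2 phi)); last first.
    by move=> q0'; exact: GS_transl.
  (* The symmetry of the grid turns psi(y) into psi(-y), as the reflection in [convD] requires. *)
  have := grN_sym n (fun z : pt => psi z * iota e (transl (- z) phi)) => sy.
  under eq_bigr do rewrite -mulrA; rewrite -sy; apply: eq_bigr => q' _.
  by rewrite opprK /check mulrA.
have a1 : cnorm (iota y phi - iota (wsE n psi e) phi) <= r / 2.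
  rewrite -(iotaB HT) // (le_trans (HCp _)) // (nBC HN).
  apply: le_trans (ler_wpM2l Cp0 (ltW (h0 _ (leq_maxl _ _)))) _.
  by rewrite mulrCA ler_piMr ?(ltW r2) // ler_pdivrMr // mul1r lerDr.
have a2 := h1 n (leq_maxr _ _); rewrite -e1 cnBC in a2.
rewrite (le_trans (cn_tri _ (iota (wsE n psi e) phi) _)) // [r]splitr; exact: (lerD a1 a2).
Qed.

Lemma convE : QQ beur (fun l => exists2 C, 0 <= C & forall e psi c, S psi -> bnd0 l c psi ->
  exists y : E, eqS (iota y) (convD (iota e) psi) /\ nE y <= C * c * nE e).
Proof.
have [k k1 Hk] := ew_wt d wA A2; have k0 : 0 < k := lt_le_trans ltr01 k1.
apply: QQ_imp (QQ_inv k0 Ntr) => l l0 [C C0 HC].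
have kl : 0 < (k * l)^-1 by rewrite invr_gt0 mulr_gt0.
have [C' C'0 H] := convE_main kl C0 HC k1 (Hk _ kl).
exists C'; first exact: C'0.
have el : (k * (k * l)^-1)^-1 = l by field; rewrite !gt_eqF.
by move=> e psi c hp b; apply: (H _ _ _ hp); rewrite el.
Qed.

Lemma convE_ex e psi : S psi -> exists y : E, eqS (iota y) (convD (iota e) psi).
Proof.
move=> hp; have [l l0 [[C C0 H] [c b]]] := QQ_meet convE (GS_bnd0 wM hp).
by have [y [hy _]] := H e psi c hp b; exists y.
Qed.

Lemma convE_bnd : QQ beur (fun l => exists2 C, 0 <= C & forall e psi c (y : E), S psi -> bnd0 l c psi ->
  eqS (iota y) (convD (iota e) psi) -> nE y <= C * c * nE e).
Proof.
apply: QQ_imp convE => l l0 [C C0 H]; exists C => // e psi c y hp b hy.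
have [y' [hy' ny]] := H e psi c hp b.
by rewrite (_ : y = y') //; apply: (iota_inj HT) => phi h; rewrite hy // hy'.
Qed.

End ConvE.

(** * Fejer summation and Poisson summation *)

Section Averages.
Variables (R : realType) (d : nat).
Local Notation zd := {ffun 'I_d -> int}.
Implicit Types (k : zd) (G : zd -> R[i]).
Definition kz n (p : {ffun 'I_d -> 'I_n * 'I_n}) : zd := [ffun i => (p i).1%:Z - (p i).2%:Z].
(** Fejer mean over the frequencies: the weight of k is proportional to the number of pairs with
    difference k. Summing over pairs keeps all coefficients equal. *)
Definition avg n G : R[i] := \sum_(p : {ffun 'I_d -> 'I_n * 'I_n}) ((n%:R^-1 : R) ^+ d)%:C * G (kz p).
Definition sd n (p : {ffun 'I_d -> 'I_n * 'I_n}) : {ffun 'I_d -> 'I_n} := [ffun i => (p i).2].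
(** For fixed second components b the frequencies are distinct and fill a translate of a cube of
    side n. A Fejer mean is thus an average of n^d plain partial sums. *)
Definition Kb n (b : {ffun 'I_d -> 'I_n}) : seq zd := [seq kz p | p <- enum [pred p | sd p == b]].

Lemma Kb_uniq n (b : {ffun 'I_d -> 'I_n}) : uniq (Kb b).
Proof.
rewrite map_inj_in_uniq ?enum_uniq // => p q; rewrite !mem_enum !inE => /eqP hp /eqP hq /ffunP h.
apply/ffunP => i; have := h i; rewrite !ffunE.
have : (p i).2 = (q i).2 by have := congr1 (fun f : {ffun 'I_d -> 'I_n} => f i) (etrans hp (esym hq)); rewrite !ffunE.
case: (p i) => a1 b1; case: (q i) => a2 b2 /= -> /addIr [] e; congr (_, _); exact: val_inj.
Qed.

Lemma avgE (V : zmodType) n (H : zd -> V) :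
  \sum_(p : {ffun 'I_d -> 'I_n * 'I_n}) H (kz p) = \sum_(b : {ffun 'I_d -> 'I_n}) \sum_(k <- Kb b) H k.
Proof.
rewrite (partition_big (@sd n) xpredT) //=; apply: eq_bigr => b _.
by rewrite /Kb big_map big_enum.
Qed.

Lemma avg_bound n G (B : R) : (0 < n)%N -> (forall F, uniq F -> \sum_(k <- F) cnorm (G k) <= B) -> cnorm (avg n G) <= B.
Proof.
move=> n0 H; have nn : 0 < n%:R ^+ d :> R by rewrite exprn_gt0 // ltr0n.
rewrite /avg -mulr_sumr avgE cnM cnR exprVn ger0_norm ?invr_ge0 ?(ltW nn) // ler_pdivrMl //.
rewrite (le_trans (cn_sum _ _ _)) //; apply: (@le_trans _ _ (\sum_(b : {ffun 'I_d -> 'I_n}) B)).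
  by apply: ler_sum => b _; rewrite (le_trans (cn_sum _ _ _)) // H // Kb_uniq.
by rewrite sumr_const card_ffun !card_ord -[B *+ _]mulr_natl natrX.
Qed.

Lemma bernoulli (x : R) m : 0 <= x <= 1 -> 1 - x ^+ m <= m%:R * (1 - x).
Proof.
move=> /andP[x0 x1]; elim: m => [|m IH]; first by rewrite expr0 subrr mul0r.
have h : x ^+ m <= 1 by rewrite exprn_ile1.
rewrite exprS -[m.+1%:R]natr1; have : 0 <= x ^+ m by rewrite exprn_ge0.
nra.
Qed.

Lemma card_mid r m : (m <= #|[pred j : 'I_(r + m + r) | (r <= j)%N && (j < r + m)%N]|)%N.
Proof.
pose f (j : 'I_m) : 'I_(r + m + r) := lshift r (rshift r j).
have fi : injective f by move=> a b /lshift_inj/rshift_inj.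
rewrite -{1}(card_ord m) -(card_codom fi); apply: subset_leq_card; apply/fintype.subsetP => _ /codomP[j ->].
by rewrite inE /= leq_addr ltn_add2l ltn_ord.
Qed.

Lemma int_mid (r n b : nat) (z : int) : (absz z <= r)%N -> (r <= b)%N && (b < n - r)%N ->
  (absz (b%:Z + z)%R < n)%N /\ z = (absz (b%:Z + z)%R)%:Z - b%:Z.
Proof. by move=> h1 /andP[h2 h3]; split; lia. Qed.

(** The cubes with b at distance r from the boundary contain F0. The others form a fraction at most
    2 r d / n by Bernoulli's inequality, and each of them costs at most 2 B. *)
Lemma avg_cvg G (B : R) s : abs_le (@cnorm R) G B -> hasSum (@cnorm R) G s ->
  forall e : R, 0 < e -> exists n0, forall n, (n0 <= n)%N -> cnorm (avg n G - s) <= e.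
Proof.
move=> HB Hs e e0; have e2 : 0 < e / 2 by rewrite divr_gt0.
have HN := cn_nspace R.
have B0 : 0 <= B by have := HB [::] isT; rewrite big_nil.
have sB : cnorm s <= B.
  by apply: (hasSum_norm HN Hs) => F uF; rewrite (le_trans (cn_sum _ _ _)) // HB.
have [F0 HF0] := Hs _ e2.
pose r := (\max_(k <- F0) \max_(i < d) `|k i|%N)%N.
have hr k i : k \in F0 -> (`|k i| <= r)%N.
  move=> kF; apply: leq_trans (@leq_bigmax_seq _ F0 xpredT (fun k => \max_(i < d) `|k i|%N)%N k kF isT).
  exact: (@leq_bigmax _ (fun i => `|k i|%N) i).
have [N HNN] := archi_le (2 * B * (d%:R * (2 * r)%:R) / (e / 2)).
exists (maxn N.+1 (2 * r).+1) => n; rewrite geq_max => /andP[nN nr].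
have n0 : (0 < n)%N by apply: leq_trans nN.
have nn : 0 < n%:R :> R by rewrite ltr0n.
have nd : 0 < n%:R ^+ d :> R by rewrite exprn_gt0.
pose good (b : {ffun 'I_d -> 'I_n}) := [forall i, (r <= b i)%N && (b i < n - r)%N].
have hg b : good b -> {subset F0 <= Kb b}.
  move=> /forallP gb k kF; apply/mapP.
  have lt i := int_mid (hr k i kF) (gb i).
  pose p : {ffun 'I_d -> 'I_n * 'I_n} := [ffun i => (Ordinal (lt i).1, b i)].
  exists p; first by rewrite mem_enum inE; apply/eqP/ffunP => i; rewrite !ffunE.
  by apply/ffunP => i; rewrite !ffunE /= -(lt i).2.
have -> : avg n G - s = ((n%:R^-1 : R) ^+ d)%:C * \sum_(b : {ffun 'I_d -> 'I_n}) (\sum_(k <- Kb b) G k - s).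
  rewrite /avg -mulr_sumr avgE sumrB mulrBr; congr (_ - _).
  rewrite sumr_const card_ffun !card_ord -[s *+ _]mulr_natl mulrA -(rmorph_nat (real_complex R)).
  by rewrite -rmorphM natrX /= exprVn mulVf ?gt_eqF // mul1r.
rewrite cnM cnR exprVn ger0_norm ?invr_ge0 ?(ltW nd) // ler_pdivrMl //.
rewrite (le_trans (cn_sum _ _ _)) // (bigID good) /=.
have h1 : \sum_(b | good b) cnorm (\sum_(k <- Kb b) G k - s) <= n%:R ^+ d * (e / 2).
  apply: (@le_trans _ _ (\sum_(b : {ffun 'I_d -> 'I_n}) (e / 2))); last first.
    by rewrite sumr_const card_ffun !card_ord -[_ *+ _]mulr_natl natrX.
  apply: (@le_trans _ _ (\sum_(b | good b) (e / 2))).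
    by apply: ler_sum => b /hg sb; apply: HF0 sb; exact: Kb_uniq.
  by rewrite [leRHS](bigID good) /= lerDl sumr_ge0 // => b _; exact: ltW.
have h2 : \sum_(b | ~~ good b) cnorm (\sum_(k <- Kb b) G k - s) <= 2 * B * (n%:R ^+ d - (n - 2 * r)%:R ^+ d).
  apply: (@le_trans _ _ (\sum_(b | ~~ good b) (2 * B))).
    apply: ler_sum => b _; rewrite (le_trans (cnB _ _)) // mulr_natl mulr2n lerD //.
    by rewrite (le_trans (cn_sum _ _ _)) // HB // Kb_uniq.
  rewrite sumr_const -[_ *+ _]mulr_natr ler_wpM2l ?mulr_ge0 //.
  have cg : ((n - 2 * r) ^ d <= #|good|)%N.
    have -> : #|good| = #|(ffun_on [pred j : 'I_n | (r <= j)%N && (j < n - r)%N] : simpl_pred {ffun 'I_d -> 'I_n})|.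
      by apply: eq_card => b; rewrite !unfold_in; apply: eq_forallb => i.
    rewrite card_ffun_on card_ord; have [d0|d0] := posnP d; first by rewrite d0 !expn0.
    rewrite leq_exp2r //; have := card_mid r (n - 2 * r).
    have e1 : (r + (n - 2 * r) + r = n)%N by move: nr; clear; lia.
    have e3 : (r + (n - 2 * r) = n - r)%N by move: nr; clear; lia.
    by rewrite e1 e3.
  have cc := cardC good; rewrite card_ffun !card_ord in cc.
  have -> : #|[pred b | ~~ good b]| = (n ^ d - #|good|)%N by rewrite -cc addKn.
  rewrite natrB ?natrX ?lerB //; last by rewrite -cc leq_addr.
  by rewrite -natrX ler_nat.
apply: le_trans (lerD h1 h2) _.
have x01 : 0 <= ((n - 2 * r)%:R / n%:R : R) <= 1.
  by rewrite divr_ge0 //= ler_pdivrMr // mul1r ler_nat leq_subr.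
have := bernoulli d x01; rewrite expr_div_n => hb.
have e4 : 1 - (n - 2 * r)%:R / n%:R = (2 * r)%:R / n%:R :> R.
  rewrite natrB; last by apply: ltnW.
  by rewrite mulrBl divff ?gt_eqF // subKr.
rewrite {}e4 in hb.
have h3 : 2 * B * (d%:R * ((2 * r)%:R / n%:R)) <= e / 2.
  rewrite !mulrA ler_pdivrMr //.
  rewrite ler_pdivrMr // !mulrA in HNN; apply: (le_trans HNN).
  by rewrite -[leLHS]mulrA [leRHS]mulrC ler_wpM2r ?(ltW e2) // ler_nat ltnW.
have -> : n%:R ^+ d - (n - 2 * r)%:R ^+ d = n%:R ^+ d * (1 - (n - 2 * r)%:R ^+ d / n%:R ^+ d) :> R.
  by field; rewrite gt_eqF.
have h4 := ler_wpM2l (_ : 0 <= 2 * B) hb.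
have {}h4 : 2 * B * (1 - (n - 2 * r)%:R ^+ d / n%:R ^+ d) <= e / 2.
  by apply: le_trans (h4 _) h3; rewrite mulr_ge0.
have := ler_wpM2l (ltW nd) h4; move: (1 - _) => X; move: (n%:R ^+ d) => Y; lra.
Qed.

End Averages.

(** * Poisson summation tested against ultradistributions *)

Section FejerS.
Variables (R : realType) (d : nat) (beur : bool) (M A : nat -> R).
Hypotheses (wM : weight_seq M) (wA : weight_seq A) (M1 : cond_M1 M) (M2 : cond_M2' M) (A2 : cond_M2' A).
Local Notation pt := (pt R d).
Local Notation testfun := (testfun R d).
Implicit Types (phi psi eta theta zeta : testfun) (l c L : R) (x y : pt).
Local Notation bnd := (@bnd R d M A).
Local Notation conv := (@Defs.conv R d).
Local Notation S := (GS beur M A).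
Local Notation zd := {ffun 'I_d -> int}.

Lemma expi_sum (I : Type) (r : seq I) (t : I -> R) : expi (\sum_(i <- r) t i) = \prod_(i <- r) expi (t i).
Proof. by apply: big_morph; [exact: expiD|exact: expi0]. Qed.

Lemma prodF_exp L n y : (prodF L n (enum 'I_d) y)%:C =
  \sum_(p : {ffun 'I_d -> 'I_n * 'I_n}) ((n%:R^-1 : R) ^+ d)%:C * expi (2 * pi * dotp (L^-1 *: zpt R (kz p)) y).
Proof.
rewrite /prodF big_enum /= rmorph_prod.
under eq_bigr => i _ do rewrite /= FejE pair_bigA /= mulr_sumr.
rewrite bigA_distr_bigA /=; apply: eq_bigr => p _.
rewrite big_split /= prodr_const card_ord -rmorphXn /=; congr (_ * _).
rewrite -expi_sum; congr expi; rewrite -mulr_sumr; congr (_ * _).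
apply: eq_bigr => i _; rewrite !mxE ffunE.
have -> : ((p i).1%:Z - (p i).2%:Z)%:~R = (p i).1%:R - (p i).2%:R :> R by rewrite intrD rmorphN.
by rewrite [RHS]mulrAC mulrC [L^-1 * _]mulrC.
Qed.

(* The two sides of Poisson summation for [y |-> phi (x - y) * zeta y]: Fejer means of the modulated
   convolutions, and truncated lattice sums. *)
Definition Qn L zeta n phi : testfun := fun x =>
  \sum_(p : {ffun 'I_d -> 'I_n * 'I_n}) ((n%:R^-1 : R) ^+ d)%:C * conv phi (modul (L^-1 *: zpt R (kz p)) zeta) x.

Definition Pr L zeta r phi : testfun := fun x =>
  \sum_(z <- zbox d r) ((L ^+ d)%:C * zeta (L *: zpt R z)) * transl (L *: zpt R z) phi x.

Lemma GS_Pr L zeta r phi : S phi -> S (Pr L zeta r phi).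
Proof. by move=> h; apply: (GS_sum wM wA _ _ (F := fun z => transl (L *: zpt R z) phi)) => z; exact: GS_transl. Qed.

Lemma GS_Qn L zeta n phi : S phi -> S zeta -> S (Qn L zeta n phi).
Proof.
move=> h hz; apply: (GS_sum wM wA _ _ (F := fun p => conv phi (modul (L^-1 *: zpt R (kz p)) zeta))) => p.
by apply: GS_conv => //; exact: GS_modul.
Qed.

(** [fejer_integ] is applied to every derivative at every point. The class constant from the second
    clause of [conv_ok] contains the right weights, so the error is small in the norm of scale l. *)
Lemma fejer_S L zeta phi : 0 < L -> S zeta -> S phi -> QQ (~~ beur) (fun l => forall e : R, 0 < e ->
  exists r0, forall r, (r0 <= r)%N -> exists n0, forall n, (n0 <= n)%N ->
  (0 < n)%N /\ bnd l e (fun x => Qn L zeta n phi x - Pr L zeta r phi x)).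
Proof.
move=> L0 hz hp; have [k [k1 Hk]] := conv_ok_ex d wM wA M2 A2; have k0 : 0 < k := lt_le_trans ltr01 k1.
have [P [HP HQ]] := GS_common wM wA hp hz.
apply: QQ_imp (QQ_scale k0 HQ) => l l0 /HP[lk [c [b1 b2]]].
have [C C0 HC] := Hk l l0; have [_ [K K0 Hcl] _ _ _] := HC _ _ _ _ b1 b2.
move=> e e0; have K1 : 0 < 1 + K by rewrite ltr_pwDl.
have e1 : 0 < e / (1 + K) by rewrite divr_gt0.
have [r0 Hr0] := fejer_integ d L0 e1.
exists r0 => r /Hr0[n0 Hn0]; exists n0 => n /Hn0[n1 H]; split=> //.
have sp := GS_smooth wM hp.
have hm k' : S (modul k' zeta) by exact: GS_modul.
have sQ := GS_smooth wM (GS_Qn L n hp hz); have sP := GS_smooth wM (GS_Pr L zeta r hp).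
split=> [|s x]; first by have := smoothZD (-1) sP sQ; congr smooth; apply: funext => x; rewrite mulN1r addrC.
rewrite DD_sub //; have := H _ _ (Hcl s x); rewrite cnBC.
have hs := GS_DD wM wA M2 s hp.
have -> : DD s (Qn L zeta n phi) x = integ (fun y => DD s phi (x - y) * zeta y * (prodF L n (enum 'I_d) y)%:C).
  rewrite /Qn (DD_sum _ _ s (F := fun p => conv phi (modul (L^-1 *: zpt R (kz p)) zeta))); last first.
    by move=> p; apply: (GS_smooth wM (beur := beur)); exact: (GS_conv wM wA M2 A2 hp (hm _)).
  under eq_bigr do rewrite (@conv_DD _ _ beur _ _ wM wA M2 A2) //.
  have [_ <-] := integ_sum (index_enum _) (fun p : {ffun 'I_d -> 'I_n * 'I_n} => ((n%:R^-1 : R) ^+ d)%:C)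
     (F := fun p y => DD s phi (x - y) * modul (L^-1 *: zpt R (kz p)) zeta y) (fun p => conv_cls wM wA M2 A2 x hs (hm _)).
  congr integ; apply: funext => y; rewrite prodF_exp mulr_sumr; apply: eq_bigr => p _.
  by rewrite /modul [LHS]mulrCA -[RHS]mulrA [zeta y * _]mulrCA [expi _ * zeta y]mulrC [LHS]mulrCA mulrCA.
have -> : DD s (Pr L zeta r phi) x = it (latW L r) (enum 'I_d) (fun y => DD s phi (x - y) * zeta y) 0.
  rewrite it_zbox /Pr (DD_sum _ _ s (F := fun z => transl (L *: zpt R z) phi)); last by move=> z; exact: smooth_transl.
  by apply: eq_bigr => z _; rewrite DD_transl // /transl -mulrA [zeta _ * _]mulrC.
rewrite -ler_pdivlMr ?ew_gt0 // => h; apply: (le_trans h).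
rewrite [leLHS]mulrA; apply: ler_wpM2r; first by rewrite invr_ge0 ew_ge0.
rewrite [leLHS]mulrA; apply: ler_wpM2r.
  by rewrite mulr_ge0 ?exprn_ge0 ?(M_ge0 wM) // ltW.
by rewrite mulrAC ler_pdivrMr // ler_wpM2l ?(ltW e0) // lerDr.
Qed.

Section Functional.
Variables (T : functional R d) (L : R) (zeta phi : testfun).
Hypotheses (uT : ultradist beur M A T) (L0 : 0 < L) (hz : S zeta) (hp : S phi).

Lemma T_Pr r : T (Pr L zeta r phi) = \sum_(z <- zbox d r) ((L ^+ d)%:C * zeta (L *: zpt R z)) * T (transl (L *: zpt R z) phi).
Proof. by rewrite /Pr (ult_sum wM wA uT _ _ (F := fun z => transl (L *: zpt R z) phi)) // => z; exact: GS_transl. Qed.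

Definition Gk (k : zd) : R[i] := T (conv phi (modul (L^-1 *: zpt R k) zeta)).

Lemma T_Qn n : T (Qn L zeta n phi) = avg n Gk.
Proof.
rewrite /Qn (ult_sum wM wA uT _ _ (F := fun p => conv phi (modul (L^-1 *: zpt R (kz p)) zeta))) // => p.
by apply: GS_conv => //; exact: GS_modul.
Qed.

Lemma fejer_T (e : R) : 0 < e -> exists r0, forall r, (r0 <= r)%N -> exists n0, forall n, (n0 <= n)%N ->
  (0 < n)%N /\ cnorm (avg n Gk - T (Pr L zeta r phi)) <= e.
Proof.
move=> e0; have [l l0 [[C C0 HC] H]] := QQ_meet (ult_bnd wM uT) (fejer_S L0 hz hp).
have K0 : 0 < 1 + C by rewrite ltr_pwDl.
have [r0 H0] := H _ (divr_gt0 e0 K0); exists r0 => r /H0[n0 H1]; exists n0 => n /H1[n1 b]; split=> //.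
have hQ := GS_Qn L n hp hz; have hP := GS_Pr L zeta r hp.
have := HC _ _ (GS_sub wM wA hQ hP) b.
have -> : (fun x => Qn L zeta n phi x - Pr L zeta r phi x) = (fun x => -1 * Pr L zeta r phi x + Qn L zeta n phi x).
  by apply: funext => x; rewrite mulN1r addrC.
rewrite (ult_ZD uT) // mulN1r addrC T_Qn => /le_trans; apply.
by rewrite mulrCA ler_piMr ?(ltW e0) // ler_pdivrMr // mul1r lerDr.
Qed.

(** A Fejer mean obeys any bound valid for all absolute partial sums, so an estimate on the
    frequency side transfers to the lattice side in the limit. *)
Lemma Pr_bound (B e : R) : 0 < e -> (forall F, uniq F -> \sum_(k <- F) cnorm (Gk k) <= B) ->
  exists r0, forall r, (r0 <= r)%N -> cnorm (T (Pr L zeta r phi)) <= B + e.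
Proof.
move=> e0 HB; have [r0 H] := fejer_T e0; exists r0 => r /H[n0 /(_ n0 (leqnn _))[n1 h]].
have := avg_bound n1 HB; have := cnD (T (Pr L zeta r phi) - avg n0 Gk) (avg n0 Gk).
rewrite subrK cnBC; lra.
Qed.

Lemma Pr_cvg (B : R) s : abs_le (@cnorm R) Gk B -> hasSum (@cnorm R) Gk s -> forall e : R, 0 < e ->
  exists r0, forall r, (r0 <= r)%N -> cnorm (T (Pr L zeta r phi) - s) <= e.
Proof.
move=> HB Hs e e0; have e2 : 0 < e / 2 by rewrite divr_gt0.
have [r0 H] := fejer_T e2; exists r0 => r /H[n0 H0].
have [n1 H1] := avg_cvg HB Hs e2.
have [_ h] := H0 _ (leq_maxl n0 n1); have := H1 _ (leq_maxr n0 n1); rewrite cnBC in h.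
have := cn_tri (T (Pr L zeta r phi)) (avg (maxn n0 n1) Gk) s; lra.
Qed.

End Functional.

Lemma wt_cls : cls 1 (fun x : pt => (wt x)%:C).
Proof.
split=> [x|x j a b]; first by rewrite cnR ger0_norm ?mul1r // ltW // wt_gt0.
have e t : wt (upd x j t) = w1 t * wo [:: j] x by rewrite wt_wo wo_cons.
rewrite !e -rmorphB cnR -mulrBl normrM (ger0_norm (wo_ge0 _ _)) ler_wpM2r ?wo_ge0 //.
by case: (@w1_rcls R) => _; apply.
Qed.

Lemma wt_sum : exists2 W : R, 0 <= W & forall F : seq zd, uniq F -> \sum_(z <- F) wt (zpt R z) <= W.
Proof.
exists (fejK (1 : R) ^+ d); first by rewrite exprn_ge0 // (le_trans ler01 (fejK_ge1 ltr01)).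
move=> F uF; pose r := (\max_(k <- F) \max_(i < d) `|k i|%N)%N.
have sub : {subset F <= zbox d r}.
  move=> k kF; rewrite mem_zbox; apply/forallP => i; rewrite -abszE lez_nat.
  apply: leq_trans (@leq_bigmax _ (fun i => `|k i|%N) i) _.
  exact: (@leq_bigmax_seq _ F xpredT (fun k => \max_(i < d) `|k i|%N)%N k kF isT).
apply: (@le_trans _ _ (\sum_(z <- zbox d r) wt (zpt R z))).
  rewrite (big_diff (fun z => wt (zpt R z)) uF (zbox_uniq _ _) sub) lerDl sumr_ge0 // => z _; exact/ltW/wt_gt0.
have [h _] := it_cls (latW_mono ltr01 r) wt_cls (enum_uniq 'I_d); have := h 0.
rewrite it_zbox wo_enum mulr1 mul1r -cardE card_ord expr1n.
under eq_bigr do rewrite mul1r scale1r.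
by rewrite -rmorph_sum cnR ger0_norm // sumr_ge0 // => z _; exact/ltW/wt_gt0.
Qed.

(** A nonzero integer point has a coordinate of modulus at least 1, and this coordinate alone gains
    2 / L^2. *)
Lemma wt_scale L (z : zd) : 1 <= L -> z != [ffun=> 0] -> wt (L *: zpt R z) <= 2 / L ^+ 2 * wt (zpt R z).
Proof.
move=> L1 nz; have L0 : 0 < L := lt_le_trans ltr01 L1.
have [i zi] : exists i, z i != 0.
  apply/existsP; rewrite -negb_forall; apply: contra nz => /forallP h; apply/eqP/ffunP => i; rewrite ffunE; exact/eqP.
rewrite /wt (bigD1 i) //= [in leRHS](bigD1 i) //= mulrA; apply: ler_pM.
- exact: w1_ge0.
- by apply: prodr_ge0 => j _; exact: w1_ge0.
- rewrite !mxE /w1; set t : R := (z i)%:~R.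
  have t1 : 1 <= t ^+ 2.
    rewrite -real_normK ?num_real // exprn_ege1 // /t -intr_norm ler1z.
    by rewrite -gtz0_ge1 normr_gt0.
  have p (u : R) : 0 < 1 + u ^+ 2 by rewrite ltr_pwDl // sqr_ge0.
  have L2 : 0 < L ^+ 2 by rewrite exprn_gt0.
  rewrite -[(1 + t ^+ 2)^-1]mul1r mulrA mulr1 ler_pdivlMr // mulrC ler_pdivrMr // mulrAC ler_pdivlMr //.
  rewrite exprMn; nra.
apply: ler_prod => j _; rewrite w1_ge0 /= !mxE /w1 lef_pV2 ?posrE ?ltr_pwDl ?sqr_ge0 // lerD2l exprMn.
by rewrite ler_peMl ?sqr_ge0 // exprn_ege1.
Qed.

End FejerS.

(** * The parametrix *)

Lemma QQ_ex (R : realType) b (P : R -> Prop) : QQ b P -> exists2 l, 0 < l & P l.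
Proof. by case: b => [[l [l0 h]]|h]; [exists l|exists 1 => //; exact: h]. Qed.

Section Window.
Variables (R : realType) (d : nat) (M A : nat -> R).
Hypotheses (wM : weight_seq M) (wA : weight_seq A) (M1 : cond_M1 M) (M2 : cond_M2' M) (A2 : cond_M2' A).
Local Notation pt := (pt R d).
Local Notation testfun := (testfun R d).
Implicit Types (phi psi eta theta zeta : testfun) (l c L : R) (x y : pt).
Local Notation bnd := (@bnd R d M A).
Local Notation conv := (@Defs.conv R d).
Local Notation zd := {ffun 'I_d -> int}.
Local Notation z0 := ([ffun=> 0] : zd).

Lemma lattice_sum zeta (q : R) : GS true M A zeta -> 0 < q -> exists2 C, 0 <= C & forall L (F : seq zd), 1 <= L -> uniq F ->
  (forall z, z \in F -> z != z0) ->
  \sum_(z <- F) cnorm (zeta (L *: zpt R z)) * ew A (q * eucl (L *: zpt R z)) <= C / L ^+ 2.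
Proof.
move=> hz q0; have [k k1 Hk] := ew_wt d wA A2; have [C1 C10 HC1] := Hk q q0.
have k0 : 0 < k := lt_le_trans ltr01 k1.
have kq : 0 < (k * q)^-1 by rewrite invr_gt0 mulr_gt0.
have [c b] := (GS_QQ true A wM zeta).1 hz _ kq; have c0 := bnd_ge0 wM kq b.
have [W W0 HW] := @wt_sum R d.
have M0 := M_ge0 wM 0.
have C0 : 0 <= C1 * (c * M 0%N) by rewrite !mulr_ge0 // ltW.
exists (C1 * (c * M 0%N) * (2 * W)); first by rewrite mulr_ge0 // mulr_ge0.
move=> L F L1 uF nz; have L0 : 0 < L := lt_le_trans ltr01 L1.
have key x : cnorm (zeta x) * ew A (q * eucl x) <= C1 * (c * M 0%N) * wt x.
  have h := bnd_bnd0 b x; rewrite invrK in h.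
  apply: (@le_trans _ _ (cnorm (zeta x) * (C1 * wt x * ew A (k * q * eucl x)))).
    rewrite ler_wpM2l ?cn_ge0 // (le_trans _ (HC1 x)) // ler_peMr ?ew_ge0 // lerDl sqr_ge0 //.
  rewrite (_ : _ * _ = C1 * wt x * (cnorm (zeta x) * ew A (k * q * eucl x))); last by ring.
  by rewrite [leRHS]mulrAC; apply: ler_wpM2l h; rewrite mulr_ge0 ?(ltW C10) // ltW // wt_gt0.
apply: (@le_trans _ _ (\sum_(z <- F) C1 * (c * M 0%N) * (2 / L ^+ 2 * wt (zpt R z)))).
  rewrite !big_seq; apply: ler_sum => z zF; rewrite (le_trans (key _)) // ler_wpM2l //.
  by apply: wt_scale => //; exact: nz.
rewrite -mulr_sumr -mulr_sumr (_ : _ * (2 * W) / L ^+ 2 = C1 * (c * M 0%N) * (2 / L ^+ 2 * W)); last by ring.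
by rewrite ler_wpM2l // ler_wpM2l ?HW // divr_ge0 // exprn_ge0 // ltW.
Qed.

Section Density.
Variable beur : bool.
Local Notation S := (GS beur M A).

(* Summing over a lattice of mesh [L] and letting [L] grow isolates the term at the origin. *)
Lemma density T : (exists zeta, GS true M A zeta /\ exists x, zeta x != 0) -> ultradist beur M A T ->
  (forall phi theta, S phi -> S theta -> T (conv phi theta) = 0) -> forall phi, S phi -> T phi = 0.
Proof.
move=> [zt [hzt [x0 nz]]] uT H phi hp.
pose zeta := transl (- x0) zt.
have hz : GS true M A zeta by exact: GS_transl.
have n0 : zeta 0 != 0 by rewrite /zeta /transl opprK add0r.
have hzS : S zeta by exact: GS_beur.
have [l l0 [[C C0 HC] [c b]]] := QQ_meet (ult_bnd wM uT) (QQ_scale (ltr0n R 2) ((GS_QQ beur A wM phi).1 hp)).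
have l20 : 0 < l / 2 by rewrite divr_gt0.
have Tt y : cnorm (T (transl y phi)) <= C * c * ew A ((l / 2)^-1 * eucl y).
  have := bnd_transl wM wA y l20 b; rewrite mulrC divfK // => b'.
  by rewrite -mulrA; apply: HC b'; exact: GS_transl.
have qi : 0 < (l / 2)^-1 by rewrite invr_gt0.
have [C2 C20 HL] := lattice_sum hz qi.
have c0 := bnd_ge0 wM l20 b.
have K0 : 0 <= C * c * C2 by rewrite !mulr_ge0.
have main L : 1 <= L -> cnorm (zeta 0 * T phi) <= C * c * C2 / L ^+ 2.
  move=> L1; have L0 : 0 < L := lt_le_trans ltr01 L1.
  have Ld : 0 < L ^+ d by rewrite exprn_gt0.
  apply/ler_addgt0Pr => e e0.
  have G0 F : uniq F -> \sum_(k <- F) cnorm (Gk T L zeta phi k) <= 0.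
    by move=> _; rewrite big1 // => k _; rewrite /Gk H ?cn0 //; exact: GS_modul.
  have [r0 Hr] := Pr_bound wM wA M1 M2 A2 uT L0 hzS hp (mulr_gt0 e0 Ld) G0.
  have := Hr r0 (leqnn _); rewrite add0r (T_Pr wM wA L zeta uT) //.
  have zz : z0 \in zbox d r0 by rewrite mem_zbox; apply/forallP => i; rewrite ffunE normr0.
  rewrite (big_rem z0 zz) /=.
  have -> : L *: zpt R z0 = 0 by apply/rowP => i; rewrite !mxE ffunE mulr0.
  have -> : transl 0 phi = phi by apply: funext => x; rewrite /transl subr0.
  have -> : \sum_(z <- rem z0 (zbox d r0)) (L ^+ d)%:C * zeta (L *: zpt R z) * T (transl (L *: zpt R z) phi) =
     (L ^+ d)%:C * \sum_(z <- rem z0 (zbox d r0)) zeta (L *: zpt R z) * T (transl (L *: zpt R z) phi).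
    by rewrite mulr_sumr; apply: eq_bigr => z _; rewrite mulrA.
  rewrite -mulrA -mulrDr cnM cnR (gtr0_norm Ld) mulrC ler_pM2r // => h.
  have h2 : cnorm (\sum_(z <- rem z0 (zbox d r0)) zeta (L *: zpt R z) * T (transl (L *: zpt R z) phi)) <= C * c * C2 / L ^+ 2.
    rewrite (le_trans (cn_sum _ _ _)) // -mulrA.
    have hl := HL L (rem z0 (zbox d r0)) L1 (rem_uniq _ (zbox_uniq _ _)).
    apply: le_trans (ler_wpM2l _ (hl _)); rewrite ?mulr_ge0 //; last first.
      by move=> z; rewrite mem_rem_uniq ?zbox_uniq // inE => /andP[].
    rewrite mulr_sumr; apply: ler_sum => z _; rewrite cnM mulrCA ler_wpM2l ?cn_ge0 //.
  have := cnB (zeta 0 * T phi + \sum_(z <- rem z0 (zbox d r0)) zeta (L *: zpt R z) * T (transl (L *: zpt R z) phi))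
    (\sum_(z <- rem z0 (zbox d r0)) zeta (L *: zpt R z) * T (transl (L *: zpt R z) phi)).
  rewrite addrK; lra.
have : zeta 0 * T phi = 0.
  apply: cn_arb => e e0; have [n hn] := archi_le (1 + C * c * C2 / e).
  have n1 : 1 <= n%:R :> R by apply: le_trans hn; rewrite lerDl divr_ge0 // ltW.
  rewrite (le_trans (main _ n1)) // ler_pdivrMr ?exprn_gt0 ?(lt_le_trans ltr01) //.
  rewrite -ler_pdivrMl // [leLHS]mulrC; apply: (@le_trans _ _ n%:R); first by apply: le_trans hn; rewrite lerDr.
  by rewrite expr2 ler_peMr // (le_trans ler01 n1).
by move/eqP; rewrite mulf_eq0 (negPf n0) /= => /eqP.
Qed.

End Density.

(** Evaluation at 0 is an ultradistribution. If it vanished on every convolution, [density] would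
    make it vanish on the whole space, and by translation every test function would be 0. *)
Lemma window_ex : (exists zeta, GS true M A zeta /\ exists x, zeta x != 0) ->
  exists chi1 chi2, [/\ GS true M A chi1, GS true M A chi2 & conv chi1 chi2 0 = 1].
Proof.
move=> hex; pose T : functional R d := fun phi => phi 0.
have uT : ultradist true M A T.
  split=> //; exists 1, (M 0%N); split=> // phi hp.
  have [sm fin] := hp 1 ltr01; have g0 := gsnorm_ge0 A wM phi ltr01.
  have fn : gsnorm M A 1 1^-1 phi \is a fin_num by rewrite ge0_fin_numE.
  have b : bnd 1 (fine (gsnorm M A 1 1^-1 phi)) phi by apply/gsnorm_bnd => //; rewrite fineK.
  rewrite -(fineK fn) -EFinM lee_fin; have := bnd_bnd0 b 0; rewrite [fine _ * _]mulrC => h; apply: le_trans h.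
  by rewrite ler_peMr ?cn_ge0 // ew_ge1 // mulr_ge0 ?eucl_ge0 // invr_ge0.
have [|no] := pselect (exists chi1 chi2, [/\ GS true M A chi1, GS true M A chi2 & conv chi1 chi2 0 != 0]).
  move=> [c1 [c2 [h1 h2 n]]]; exists (fun x => (conv c1 c2 0)^-1 * c1 x), c2; split=> //; first exact: GS_Z.
  have := @conv_suml _ _ true _ _ wM wA M2 A2 _ [:: tt] (fun=> (conv c1 c2 0)^-1) (fun=> c1) c2 (fun=> h1) h2.
  have -> : (fun x => \sum_(i <- [:: tt]) (conv c1 c2 0)^-1 * c1 x) = (fun x => (conv c1 c2 0)^-1 * c1 x).
    by apply: funext => x; rewrite big_seq1.
  by move=> ->; rewrite big_seq1 mulVf.
have [zt [hzt [x0 nz]]] := hex; exfalso; move/negP: nz; apply; apply/eqP.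
have := density hex uT _ (GS_transl wM wA (- x0) hzt); rewrite /T /transl opprK add0r; apply=> c1 c2 h1 h2.
by apply/eqP; apply: contrapT => /negP n; apply: no; exists c1, c2.
Qed.

End Window.

Section Parametrix.
Variables (R : realType) (d : nat) (beur : bool) (M A : nat -> R).
Hypotheses (wM : weight_seq M) (wA : weight_seq A) (M1 : cond_M1 M) (M2 : cond_M2' M) (A2 : cond_M2' A).
Variables (E : lmodType R[i]) (nE : E -> R) (iota : E -> functional R d).
Hypothesis HT : is_TMIB beur M A nE iota.
Local Notation pt := (pt R d).
Local Notation testfun := (testfun R d).
Implicit Types (phi psi eta theta zeta : testfun) (l c L : R) (x y : pt) (e : E).
Local Notation S := (GS beur M A).
Local Notation zd := {ffun 'I_d -> int}.
Local Notation z0 := ([ffun=> 0] : zd).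
Local Notation HN := (E_nspace HT).

(** The mesh is a natural number above 1 + 2 C C2, so that C C2 / L^2 <= 1/2: the Neumann series
    then inverts P, and the same bound makes P injective. *)
Lemma parametrix zeta : GS true M A zeta -> zeta 0 = 1 -> exists L (P Pinv : E -> E), [/\ 1 <= L,
  (forall a b, P (a + b) = P a + P b) /\ (forall e, nE (P e) <= 2 * nE e),
  (forall e, P (Pinv e) = e /\ nE (Pinv e) <= 2 * nE e), (forall e, P e = 0 -> e = 0) &
  forall e phi (r : R), S phi -> 0 < r -> exists n0, forall n, (n0 <= n)%N ->
    cnorm (iota e (Pr L zeta n phi) - (L ^+ d)%:C * iota (P e) phi) <= r].
Proof.
move=> hz zeta1; have [tr Htr Ntr] := tr_ex wM wA HT.
have [q q0 [C C0 HC]] := QQ_ex Ntr.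
have [C2 C20 HL] := lattice_sum wM wA A2 hz q0.
have [N HNN] := archi_le (1 + 2 * (C * C2)).
pose L : R := N%:R.
have CC : 0 <= C * C2 by rewrite mulr_ge0 // ltW.
have L1 : 1 <= L by apply: le_trans HNN; rewrite lerDl mulr_ge0.
have L0 : 0 < L := lt_le_trans ltr01 L1.
have CL : C * C2 / L ^+ 2 <= 2^-1.
  rewrite ler_pdivrMr ?exprn_gt0 // ler_pdivlMl //.
  apply: (@le_trans _ _ L); first by apply: le_trans HNN; rewrite lerDr.
  by rewrite expr2 ler_peMr // ltW.
(* The term at the origin is the identity, because zeta(0) = 1, and is kept apart. *)
pose u e (z : zd) : E := if z == z0 then 0 else zeta (L *: zpt R z) *: tr (- (L *: zpt R z)) e.
have au e : abs_le nE (u e) (2^-1 * nE e).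
  move=> F uF; apply: le_trans (ler_wpM2r (nE_ge0 HT e) CL).
  rewrite (bigID (fun z => z == z0)) /= big1 ?add0r; last first.
    by move=> z; rewrite /u => ->; rewrite (nrm0 HN).
  rewrite -big_filter.
  have nz z : z \in [seq z <- F | z != z0] -> z != z0 by rewrite mem_filter => /andP[].
  have := HL L _ L1 (filter_uniq (fun z => z != z0) uF) nz => hl.
  rewrite (_ : C * C2 / L ^+ 2 * nE e = C * nE e * (C2 / L ^+ 2)); last by ring.
  apply: le_trans (ler_wpM2l _ hl); last by rewrite mulr_ge0 ?(nE_ge0 HT) // ltW.
  rewrite mulr_sumr !big_seq; apply: ler_sum => z /nz zn; rewrite /u (negPf zn) (nEZ HT).
  have := HC (- (L *: zpt R z)) e; rewrite euclN => h.
  apply: le_trans (ler_wpM2l (cn_ge0 _) h) _.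
  by rewrite le_eqVlt; apply/orP; left; apply/eqP; ring.
have /boolp.choice[K HK] : forall e, exists k, hasSum nE (u e) k /\ nE k <= 2^-1 * nE e.
  by move=> e; exact: (hasSum_ex HN (au e)).
have KD a b : K (a + b) = K a + K b.
  apply: (hasSum_uniq HN (HK (a + b)).1) => e e0; have e2 : 0 < e / 2 by rewrite divr_gt0.
  have [F1 H1] := (HK a).1 _ e2; have [F2 H2] := (HK b).1 _ e2.
  exists (F1 ++ F2) => F uF s.
  have s1 : {subset F1 <= F} by move=> z zF; apply: s; rewrite mem_cat zF.
  have s2 : {subset F2 <= F} by move=> z zF; apply: s; rewrite mem_cat zF orbT.
  have -> : \sum_(i <- F) u (a + b) i - (K a + K b) = (\sum_(i <- F) u a i - K a) + (\sum_(i <- F) u b i - K b).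
    rewrite addrACA -big_split /= opprD; congr (_ + _); apply: eq_bigr => z _; rewrite /u; case: eqP => _; first by rewrite addr0.
    by rewrite (trD wM wA HT Htr) scalerDr.
  by rewrite (le_trans (nD HN _ _)) // [e]splitr lerD ?H1 ?H2.
have KN e : nE (K e) <= 2^-1 * nE e := (HK e).2.
have /boolp.choice[Pi HPi] : forall e, exists y : E, y + K y = e /\ nE y <= 2 * nE e.
  by move=> e; have [y h1 h2] := neumann HN KD KN e; exists y.
exists L, (fun e => e + K e), Pi; split=> //.
- split=> [a b|e]; first by rewrite KD addrACA.
  by have := nD HN e (K e); have := KN e; have := nE_ge0 HT e; lra.
- move=> e h; case: HN => _ [_ hn0] _ _ _; apply: hn0.
  have : nE e = nE (K e) by rewrite -(nN HN (K e)); congr nE; apply/eqP; rewrite -addr_eq0 h.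
  by have := KN e; have := nE_ge0 HT e; lra.
move=> e phi r hp r0; have [Cp Cp0 HCp] := iota_pt wM wA HT hp.
have Ld : 0 < L ^+ d by rewrite exprn_gt0.
have K1 : 0 < 1 + L ^+ d * Cp by rewrite ltr_pwDl // mulr_ge0 // ltW.
have [F HF] := (HK e).1 _ (divr_gt0 r0 K1).
pose n0 := (\max_(k <- F) \max_(i < d) `|k i|%N)%N.
exists n0 => n hn.
have sub : {subset F <= zbox d n}.
  move=> k kF; rewrite mem_zbox; apply/forallP => i; rewrite -abszE lez_nat; apply: leq_trans hn.
  apply: leq_trans (@leq_bigmax _ (fun i => `|k i|%N) i) _.
  exact: (@leq_bigmax_seq _ F xpredT (fun k => \max_(i < d) `|k i|%N)%N k kF isT).
have h := HF _ (zbox_uniq _ _) sub.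
have zz : z0 \in zbox d n by rewrite mem_zbox; apply/forallP => i; rewrite ffunE normr0.
have E1 : iota e (Pr L zeta n phi) = (L ^+ d)%:C * iota (e + \sum_(z <- zbox d n) u e z) phi.
  rewrite (T_Pr wM wA L zeta (iota_ult HT e)) // (iotaD HT) // (iota_sum HT) //.
  rewrite (big_rem z0 zz) /= [in RHS](big_rem z0 zz) /= {1}/u eqxx (iota_E0 HT) // add0r.
  have -> : L *: zpt R z0 = 0 by apply/rowP => i; rewrite !mxE ffunE mulr0.
  have -> : transl 0 phi = phi by apply: funext => x; rewrite /transl subr0.
  rewrite zeta1 mulr1 mulrDr; congr (_ + _); rewrite mulr_sumr !big_seq; apply: eq_bigr => z.
  rewrite mem_rem_uniq ?zbox_uniq // inE => /andP[zn _]; rewrite /u (negPf zn) (iotaZ HT) // Htr // opprK mulrA //.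
rewrite E1 -mulrBr cnM cnR (gtr0_norm Ld) -(iotaB HT) // opprD addrACA subrr add0r.
apply: le_trans (ler_wpM2l (ltW Ld) (le_trans (HCp _) (ler_wpM2l Cp0 h))) _.
by rewrite mulrA mulrCA ler_piMr ?(ltW r0) // ler_pdivrMr // mul1r lerDr.
Qed.

End Parametrix.

(** * The derivative estimate *)

Lemma if_imp2 (b : bool) (A1 A2 B1 B2 C1 C2 : Prop) : (A1 -> B1 -> C1) -> (A2 -> B2 -> C2) ->
  (if b then A1 else A2) -> (if b then B1 else B2) -> if b then C1 else C2.
Proof. by case: b. Qed.

Section WeightTrade.
Variables (R : realType) (M : nat -> R).
Hypothesis wM : weight_seq M.

(* [n + p] is the index at which the supremum defining [ew M (Q * t)] is attained (or [n] when
   that index is smaller). With [v] the norm of a modulation, this is where condition (G) enters. *)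
Lemma weight_trade (q0 Q t v B c : R) n : 0 < q0 -> q0 <= Q -> 0 <= t -> 0 <= v -> 0 < c -> 0 <= B ->
  v * ew M (q0 * t) <= B * ew M (Q * t) ->
  exists p, (t = 0 -> p = 0%N) /\ v * ((c / Q) ^+ (n + p) * M (n + p)%N) <= B * ((c / q0) ^+ n * M n) * (c * t) ^+ p.
Proof.
move=> q00 qQ t0 v0 c0 B0 h; have Q0 := lt_le_trans q00 qQ.
have [n1 e1] := ew_att wM (mulr_ge0 (ltW Q0) t0); exists (n1 - n)%N.
have Mp := M_gt0 wM; have ep := ew_gt0 M (q0 * t).
rewrite e1 in h; split=> [tz|].
  have := ew_ge1 wM (mulr_ge0 (ltW Q0) t0); rewrite e1 tz mulr0.
  by case: n1 {e1 h} => [|n1]; [|rewrite expr0n mul0r mul0r ler10].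
case: (leqP n1 n) => nn.
  have -> : (n1 - n = 0)%N by apply/eqP; rewrite subn_eq0.
  rewrite addn0 expr0 mulr1.
  have h2 := ew_ge wM n1 (mulr_ge0 (ltW q00) t0).
  have v1 : v <= B * (Q / q0) ^+ n1.
    rewrite -(ler_pM2r ep) (le_trans h) // -[leRHS]mulrA; apply: ler_wpM2l => //.
    apply: le_trans (ler_wpM2l _ h2); last by rewrite exprn_ge0 // divr_ge0 // ltW.
    rewrite le_eqVlt; apply/orP; left; apply/eqP.
    by rewrite !mulrA -exprMn mulrA divfK // gt_eqF.
  have Qq : 1 <= Q / q0 by rewrite ler_pdivlMr // mul1r.
  have v2 : v <= B * (Q / q0) ^+ n by apply: (le_trans v1); rewrite ler_wpM2l // ler_weXn2l.
  rewrite mulrA [leRHS]mulrA; apply: ler_wpM2r; first exact: ltW.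
  have cQ : 0 <= (c / Q) ^+ n by rewrite exprn_ge0 // divr_ge0 // ltW.
  apply: le_trans (ler_wpM2r cQ v2) _.
  rewrite -mulrA -exprMn (_ : Q / q0 * (c / Q) = c / q0) //.
  by rewrite mulrC mulrA divfK // gt_eqF.
have tp : 0 < t.
  rewrite lt_neqAle t0 andbT; apply/negP => /eqP tz.
  have := ew_ge1 wM (mulr_ge0 (ltW Q0) t0); rewrite e1 -tz mulr0.
  by move: nn; case: (n1) => [//|m _]; rewrite expr0n mul0r mul0r ler10.
rewrite (subnKC (ltnW nn)).
have h2 := ew_ge wM n (mulr_ge0 (ltW q00) t0).
rewrite -(ler_pM2r (_ : 0 < (q0 * t) ^+ n * M 0%N / M n * (Q ^+ n1 / M n1))); last first.
  by rewrite !(mulr_gt0, divr_gt0, exprn_gt0, invr_gt0).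
have Qn : Q ^+ n1 != 0 by rewrite expf_neq0 // gt_eqF.
have qn : q0 ^+ n != 0 by rewrite expf_neq0 // gt_eqF.
have M1' : M n1 != 0 by rewrite gt_eqF.
have M2' : M n != 0 by rewrite gt_eqF.
have -> : v * ((c / Q) ^+ n1 * M n1) * ((q0 * t) ^+ n * M 0%N / M n * (Q ^+ n1 / M n1)) =
   c ^+ n1 * (v * ((q0 * t) ^+ n * M 0%N / M n)).
  by rewrite !exprMn exprVn; field; rewrite ?M1' ?M2' ?Qn.
apply: (@le_trans _ _ (c ^+ n1 * (B * ((Q * t) ^+ n1 * M 0%N / M n1)))).
  rewrite ler_wpM2l ?exprn_ge0 ?(ltW c0) //; apply: le_trans h.
  by rewrite ler_wpM2l.
rewrite le_eqVlt; apply/orP; left; apply/eqP.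
have [m nm] : exists m, n1 = (n + m)%N by exists (n1 - n)%N; rewrite (subnKC (ltnW nn)).
rewrite nm addKn !exprMn exprVn !exprD; rewrite nm in M1'.
by field; rewrite ?qn ?M1' ?M2'.
Qed.

End WeightTrade.

Section Star.
Variables (R : realType) (d : nat) (beur : bool) (M A : nat -> R).
Hypotheses (wM : weight_seq M) (wA : weight_seq A) (M1 : cond_M1 M) (M2 : cond_M2' M) (A2 : cond_M2' A).
Variables (E : lmodType R[i]) (nE : E -> R) (iota : E -> functional R d).
Hypothesis HT : is_TMIB beur M A nE iota.
Local Notation pt := (pt R d).
Local Notation testfun := (testfun R d).
Implicit Types (phi psi eta theta zeta chi : testfun) (l c L : R) (xi : pt) (x y e : E) (s : seq 'I_d).
Local Notation S := (GS beur M A).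
Local Notation conv := (@Defs.conv R d).
Local Notation bnd := (@bnd R d M A).
Local Notation bnd0 := (@bnd0 R d A).
Local Notation zd := {ffun 'I_d -> int}.
Local Notation nu := (nu beur M A nE iota).
Lemma nu_ge0 xi : 0 <= nu xi. Proof. by have [] := nuE_fin wM wA M1 HT xi. Qed.

Lemma bnd0_check l c phi : bnd0 l c phi -> bnd0 l c (check phi).
Proof. by move=> b x; rewrite /check -(euclN x). Qed.

Lemma bnd0_modul l c xi phi : bnd0 l c phi -> bnd0 l c (modul xi phi).
Proof. by move=> b x; rewrite /modul cnM cn_expi mul1r. Qed.

Lemma bnd0_DD l c s phi : bnd l c phi -> bnd0 l (c * (l ^+ size s * M (size s))) (DD s phi).
Proof. by move=> [_ H] x; exact: H. Qed.

Lemma bnd0_ge0 l c phi : 0 < l -> bnd0 l c phi -> 0 <= c.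
Proof. by move=> l0 /(_ 0) h; apply: le_trans h; rewrite mulr_ge0 ?cn_ge0 ?ew_ge0. Qed.

Lemma bnd0_wl l l' c phi : 0 < l -> l <= l' -> bnd0 l c phi -> bnd0 l' c phi.
Proof.
move=> l0 ll b x; apply: le_trans (b x); rewrite ler_wpM2l ?cn_ge0 //.
by apply: (ew_scale wA); rewrite ?eucl_ge0 ?invr_ge0 ?(le_trans (ltW l0) ll) // lef_pV2 // posrE (lt_le_trans l0 ll).
Qed.

(** Modulations distribute over convolutions, so M_xi moves onto e. Then psi and chi act by
    convolution in E at the cost of their values alone, and the resulting vector is paired with the
    fixed chi2. *)
Lemma modulated_conv_bound chi2 : S chi2 -> QQ beur (fun l => exists2 C, 0 <= C & forall xi e psi chi b b', S psi -> S chi ->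
  bnd0 l b psi -> bnd0 l b' chi ->
  cnorm (iota e (conv psi (modul xi (conv chi chi2)))) <= C * nu (- xi) * b * b' * nE e).
Proof.
move=> h2; have [tr Htr Ntr] := tr_ex wM wA HT; have [C2 C20 HC2] := iota_pt wM wA HT h2.
have conv_ex := convE_ex wM wA M2 A2 HT Htr Ntr.
apply: QQ_imp (convE_bnd wM wA M2 A2 HT Htr Ntr) => l l0 [C C0 HC].
exists (C2 * C * C); first by rewrite !mulr_ge0.
move=> xi e psi chi b b' hp hc bp bc.
have [e' [He' ne']] := md_ex wM wA M1 HT (- xi) e.
pose th := modul (- xi) psi; have hth : S th by exact: GS_modul.
have hcth : S (check th) by exact: GS_check.
have [z Hz] := conv_ex e' _ hcth.
have hcc : S (check chi) by exact: GS_check.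
have [z2 Hz2] := conv_ex z _ hcc.
have hcv : S (conv chi chi2) by exact: GS_conv.
have -> : iota e (conv psi (modul xi (conv chi chi2))) = iota z2 chi2.
  rewrite (Hz2 _ h2) /convD checkK (@conv_comm _ _ beur _ _ wM wA M2 A2 _ _ h2 hc) (Hz _ hcv) /convD checkK.
  rewrite He' ?opprK; last exact: GS_conv.
  rewrite (@modul_conv _ _ beur _ _ wM wA M2 A2 xi _ _ hcv hth) (_ : modul xi th = psi); last first.
    by rewrite /th -[X in modul X (modul _ _)](opprK xi) modulK.
  by rewrite (@conv_comm _ _ beur _ _ wM wA M2 A2) //; exact: GS_modul.
apply: le_trans (HC2 z2) _; rewrite -!mulrA; apply: ler_wpM2l => //.
have b'0 := bnd0_ge0 l0 bc; have b0 := bnd0_ge0 l0 bp.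
have k1 := HC _ _ _ _ hcc (bnd0_check bc) Hz2.
have k2 := HC _ _ _ _ hcth (bnd0_check (bnd0_modul (- xi) bp)) Hz.
apply: le_trans k1 _; rewrite -!mulrA; apply: ler_wpM2l => //.
rewrite (_ : C * _ = b' * (C * b * (nu (- xi) * nE e))); last by ring.
apply: ler_wpM2l => //; apply: le_trans k2 _.
by apply: ler_wpM2l => //; rewrite mulr_ge0.
Qed.

(** Product rule: frequency times M_xi v is the derivative of M_xi v minus M_xi applied to the
    derivative of v. The first derivative moves onto phi, the second falls on chi. *)
Lemma freq_step xi i T chi2 phi chi : ultradist beur M A T -> S phi -> S chi -> S chi2 ->
  frq xi i * T (conv phi (modul xi (conv chi chi2))) =
  T (conv (pderiv i phi) (modul xi (conv chi chi2))) - T (conv phi (modul xi (conv (pderiv i chi) chi2))).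
Proof.
move=> uT hp hc h2.
have hv : S (conv chi chi2) by exact: GS_conv.
have hmv := GS_modul wM wA M1 xi hv.
have hdv := GS_pderiv wM wA M2 i hv.
have hdm := GS_modul wM wA M1 xi hdv.
have e2 : pderiv i (conv chi chi2) = conv (pderiv i chi) chi2.
  exact: (@conv_DD _ _ beur _ _ wM wA M2 A2 [:: i] _ _ hc h2).
have e3 : conv (pderiv i phi) (modul xi (conv chi chi2)) =
   (fun x : pt => frq xi i * conv phi (modul xi (conv chi chi2)) x + conv phi (modul xi (conv (pderiv i chi) chi2)) x).
  rewrite -[pderiv i phi]/(DD [:: i] phi) -(@conv_DD _ _ beur _ _ wM wA M2 A2 [:: i] _ _ hp hmv).
  rewrite -(@conv_DDr _ _ beur _ _ wM wA M2 A2 [:: i] _ _ hp hmv) /= (pderiv_modul xi i (GS_smooth wM hv)).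
  rewrite (@conv_comm _ _ beur _ _ wM wA M2 A2 _ _ hp); last by apply: (GS_ZD wM wA).
  rewrite (@conv_ZDl _ _ beur _ _ wM wA M2 A2 _ _ _ _ hmv hdm hp) -e2.
  rewrite (@conv_comm _ _ beur _ _ wM wA M2 A2 _ _ hp hmv).
  by rewrite (@conv_comm _ _ beur _ _ wM wA M2 A2 _ _ hp hdm).
have hu := GS_conv wM wA M2 A2 hp hmv.
have hu1 := GS_conv wM wA M2 A2 hp hdm; rewrite e2 in hu1.
by rewrite e3 (ult_ZD uT _ hu hu1) addrK.
Qed.

(** p uses of [freq_step] produce 2^p terms, each with p further derivatives shared between phi and
    chi, all in the single direction i. *)
Lemma freq_trade xi i T chi2 phi chi (K lam : R) (W : nat -> R) : ultradist beur M A T ->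
  S phi -> S chi -> S chi2 ->
  (forall m j, cnorm (T (conv (DD (nseq m i) phi) (modul xi (conv (DD (nseq j i) chi) chi2)))) <= K * (lam ^+ (m + j) * W (m + j)%N)) ->
  forall p m j, cnorm (frq xi i) ^+ p * cnorm (T (conv (DD (nseq m i) phi) (modul xi (conv (DD (nseq j i) chi) chi2)))) <=
    2 ^+ p * (K * (lam ^+ (m + j + p) * W (m + j + p)%N)).
Proof.
move=> uT hp hc h2 H; elim=> [|p IH] m j; first by rewrite !expr0 !mul1r addn0.
have e := freq_step xi i uT (GS_DD wM wA M2 (nseq m i) hp) (GS_DD wM wA M2 (nseq j i) hc) h2.
rewrite exprSr -mulrA -cnM e.
apply: le_trans (ler_wpM2l _ (cnB _ _)) _; first by rewrite exprn_ge0 // cn_ge0.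
rewrite mulrDr; apply: le_trans (lerD (IH m.+1 j) (IH m j.+1)) _.
by rewrite exprS addSn addnS addSn -mulrA -mulr2n -[leLHS]mulr_natl !addnS.
Qed.

(** If every coordinate were below |xi| / (d + 1), their sum could not reach |xi|. With d + 1
    instead of d the contradiction stays strict and d = 0 is covered. *)
Lemma frq_max xi : eucl xi = 0 \/ exists i, 2 * pi / d.+1%:R * eucl xi <= cnorm (frq xi i).
Proof.
have [->|nz] := eqVneq (eucl xi) 0; [by left|right].
have h := eucl_sum xi; apply: contrapT => no.
have lt i : `|xi ord0 i| < eucl xi / d.+1%:R.
  have p2 : 0 < 2 * pi :> R by rewrite mulr_gt0 // pi_gt0.
  rewrite ltNge; apply/negP => h2; apply: no; exists i.
  have -> : cnorm (frq xi i) = 2 * pi * `|xi ord0 i|.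
    rewrite /frq /cnorm /= expr0n add0r sqrtr_sqr normrM ger0_norm // ltW //.
  by rewrite -mulrA [_^-1 * _]mulrC ler_wpM2l // ltW.
have ep : 0 < eucl xi by rewrite lt_neqAle eq_sym nz eucl_ge0.
have : \sum_i `|xi ord0 i| <= \sum_(i < d) (eucl xi / d.+1%:R) by apply: ler_sum => i _; exact/ltW.
rewrite sumr_const card_ord -[_ *+ d]mulr_natr => h3.
have := le_trans h h3; rewrite -mulrA ler_pMr // mulrC ler_pdivlMr ?ltr0n // mul1r ler_nat ltnn //.
Qed.

Definition deriv_bound (l ell : R) := exists2 C, 0 <= C & forall x phi c s, S phi -> bnd l c phi ->
  cnorm (iota x (DD s phi)) <= C * c * (ell ^+ size s * M (size s)) * nE x.

Hypothesis nz : exists zeta, GS true M A zeta /\ exists x : pt, zeta x != 0.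
Local Notation c0 := (2 * pi / d.+1%:R : R).

Lemma deriv_est_core : QQ beur (fun l => forall lam q0 Q : R, 0 < lam -> lam <= l -> 0 < q0 -> q0 <= Q -> 2 * lam <= c0 / Q ->
  (forall L, 1 <= L -> exists2 B, 0 <= B & forall k : zd, nu (- (L^-1 *: zpt R k)) * ew M (q0 * eucl (L^-1 *: zpt R k)) <=
    B * wt (zpt R k) * ew M (Q * eucl (L^-1 *: zpt R k))) ->
  deriv_bound lam (c0 / q0)).
Proof.
have [chi1 [chi2 [h1 h2 e12]]] := window_ex wM wA M1 M2 A2 nz.
pose zeta := conv chi1 chi2; have hz : GS true M A zeta by exact: GS_conv.
have h1S := GS_beur beur h1; have h2S := GS_beur beur h2; have hzS := GS_beur beur hz.
have [L [P [Pinv [L1 [PD PN] HPi Pinj Plim]]]] := parametrix wM wA A2 HT hz e12.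
have L0 : 0 < L := lt_le_trans ltr01 L1.
have [W W0 HW] := @wt_sum R d.
apply: QQ_imp (modulated_conv_bound h2S) => l l0 [C C0 HC] lam q0 Q lam0 laml q00 qQ lQ /(_ L L1)[B B0 HB].
have Q0 := lt_le_trans q00 qQ.
have c00 : 0 < c0 by rewrite divr_gt0 // ?mulr_gt0 // ?pi_gt0.
have [cx bx] := (GS_QQ true A wM chi1).1 h1 lam lam0; have cx0 := bnd_ge0 wM lam0 bx.
have M00 := M_ge0 wM 0.
pose D := C * cx * M 0%N; have D0 : 0 <= D by rewrite !mulr_ge0.
exists (D * B * W * 2); first by rewrite !mulr_ge0.
move=> x phi c s hp bp; have cc0 := bnd_ge0 wM lam0 bp; set n := size s; set y := Pinv x.
have [PPi nPi] := HPi x.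
have ny := nE_ge0 HT y.
pose U := (c0 / q0) ^+ n * M n.
have U0 : 0 <= U by rewrite mulr_ge0 ?exprn_ge0 ?(M_ge0 wM) // divr_ge0 // ltW.
have hs := GS_DD wM wA M2 s hp.
(* At each frequency, p integrations by parts on top of the n derivatives already present lead to (2
   lam)^(n+p) M_(n+p). The hypothesis 2 lam <= c0 / Q makes this the quantity that [weight_trade]
   estimates. *)
have term k : cnorm (Gk (iota y) L zeta (DD s phi) k) <= D * B * c * U * nE y * wt (zpt R k).
  set xi := L^-1 *: zpt R k; set v := nu (- xi).
  have v0 : 0 <= v by exact: nu_ge0.
  have Bk : 0 <= B * wt (zpt R k) by rewrite mulr_ge0 // ltW // wt_gt0.
  have [p [pz hv]] := weight_trade wM n q00 qQ (eucl_ge0 xi) v0 c00 Bk (HB k).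
  rewrite -/U in hv.
  have base i m j : cnorm (iota y (conv (DD (nseq m i) (DD s phi)) (modul xi (conv (DD (nseq j i) chi1) chi2)))) <=
     (D * c * v * nE y) * (lam ^+ (m + j) * (lam ^+ n * M (m + j + n)%N)).
    have b1 := bnd0_DD (nseq m i ++ s) bp; have b2 := bnd0_DD (nseq j i) bx.
    rewrite DD_cat in b1.
    have := HC xi y _ _ _ _ (GS_DD wM wA M2 (nseq m i) hs) (GS_DD wM wA M2 (nseq j i) h1S) (bnd0_wl lam0 laml b1) (bnd0_wl lam0 laml b2).
    rewrite -/v !size_cat !size_nseq -/n => h; apply: (le_trans h).
    have lc := M_logconv wM M1 (m + n) j.
    rewrite (_ : C * v * _ * _ * _ = (C * cx * c * v * nE y * (lam ^+ (m + j) * lam ^+ n)) * (M (m + n)%N * M j)); last by rewrite !exprD; ring.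
    rewrite (_ : D * c * v * _ * _ = (C * cx * c * v * nE y * (lam ^+ (m + j) * lam ^+ n)) * (M 0%N * M (m + j + n)%N)); last by rewrite /D; ring.
    rewrite addnAC; apply: ler_wpM2l => //; rewrite !mulr_ge0 ?exprn_ge0 ?(ltW lam0) //.
  have fin : cnorm (Gk (iota y) L zeta (DD s phi) k) * (c0 * eucl xi) ^+ p <= (D * c * v * nE y) * ((2 * lam) ^+ (n + p) * M (n + p)%N).
    have [ez|[i hi]] := frq_max xi.
      have p0 := pz ez; rewrite p0 expr0 mulr1 addn0.
      have h := HC xi y _ _ _ _ hs h1S (bnd0_wl lam0 laml (bnd0_DD s bp)) (bnd0_wl lam0 laml (bnd0_DD [::] bx)).
      apply: (le_trans h); rewrite -/v -/n expr0 mul1r /D.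
      rewrite [leLHS](_ : _ = (C * cx * M 0%N * c * v * nE y * M n) * lam ^+ n); last by ring.
      rewrite [leRHS](_ : _ = (C * cx * M 0%N * c * v * nE y * M n) * (2 * lam) ^+ n); last by ring.
      apply: ler_wpM2l; first by rewrite !mulr_ge0 ?(M_ge0 wM).
      by rewrite lerXn2r ?nnegrE ?mulr_ge0 ?(ltW lam0) // ler_peMl ?(ltW lam0) // ler1n.
    have ft := @freq_trade xi i (iota y) chi2 (DD s phi) chi1 (D * c * v * nE y) lam (fun r => lam ^+ n * M (r + n)%N) (iota_ult HT y) hs h1S h2S (base i) p 0 0.
    rewrite mulrC; apply: le_trans (le_trans _ ft) _.
      apply: ler_wpM2r; first exact: cn_ge0.
      by rewrite lerXn2r ?nnegrE ?cn_ge0 // mulr_ge0 ?eucl_ge0 // ltW.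
    rewrite !add0n (_ : 2 ^+ p * _ = (D * c * v * nE y) * M (p + n)%N * (2 ^+ p * (lam ^+ (p + n)))); last by rewrite exprD; ring.
    rewrite addnC -mulrA; apply: ler_wpM2l; first by rewrite !mulr_ge0.
    rewrite mulrC; apply: ler_wpM2r; first exact: M_ge0.
    rewrite exprMn; apply: ler_wpM2r; first by rewrite exprn_ge0 // ltW.
    by rewrite ler_weXn2l ?ler1n // leq_addl.
  have step : cnorm (Gk (iota y) L zeta (DD s phi) k) * (c0 * eucl xi) ^+ p <= (D * B * c * U * nE y * wt (zpt R k)) * (c0 * eucl xi) ^+ p.
    apply: (le_trans fin).
    apply: (@le_trans _ _ (D * c * nE y * (v * ((c0 / Q) ^+ (n + p) * M (n + p)%N)))).
      rewrite (_ : D * c * v * _ * _ = D * c * nE y * (v * ((2 * lam) ^+ (n + p) * M (n + p)%N))); last by ring.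
      apply: ler_wpM2l; first by rewrite !mulr_ge0.
      apply: ler_wpM2l => //; apply: ler_wpM2r; first exact: M_ge0.
      have l2 : 0 <= 2 * lam by rewrite mulr_ge0 // ltW.
      by apply: lerXn2r => //; rewrite nnegrE (le_trans l2).
    apply: le_trans (ler_wpM2l _ hv) _; first by rewrite !mulr_ge0.
    by rewrite le_eqVlt; apply/orP; left; apply/eqP; ring.
  (* At frequency 0 one cannot divide by the power of |xi|, but there p = 0. *)
  have [ez|ep] := eqVneq (eucl xi) 0; first by move: step; rewrite (pz ez) !expr0 !mulr1.
  by move: step; rewrite ler_pM2r // exprn_gt0 // mulr_gt0 // lt_neqAle eq_sym ep eucl_ge0.
have DU : 0 <= D * B * c * U := mulr_ge0 (mulr_ge0 (mulr_ge0 D0 B0) cc0) U0.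
pose Bd := D * B * c * U * nE y * W.
have tot F : uniq F -> \sum_(k <- F) cnorm (Gk (iota y) L zeta (DD s phi) k) <= Bd.
  move=> uF; apply: (@le_trans _ _ (\sum_(k <- F) D * B * c * U * nE y * wt (zpt R k))); first by apply: ler_sum => k _.
  by rewrite -mulr_sumr; apply: (ler_wpM2l (mulr_ge0 DU ny) (HW _ uF)).
have main : cnorm (iota x (DD s phi)) <= Bd.
  apply/ler_addgt0Pr => e e0; have e2 : 0 < e / 2 by rewrite divr_gt0.
  have [r0 H0] := Pr_bound wM wA M1 M2 A2 (iota_ult HT y) L0 hzS hs e2 tot.
  have [n0 Hn] := Plim y _ _ hs e2.
  have k1 := H0 _ (leq_maxl r0 n0); have k2 := Hn _ (leq_maxr r0 n0).
  rewrite PPi in k2.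
  have := cn_tri ((L ^+ d)%:C * iota x (DD s phi)) (iota y (Pr L zeta (maxn r0 n0) (DD s phi))) 0.
  rewrite !subr0 cnBC => k3.
  have Ld : 1 <= L ^+ d by rewrite exprn_ege1.
  have k4 : cnorm (iota x (DD s phi)) <= cnorm ((L ^+ d)%:C * iota x (DD s phi)).
    by rewrite cnM cnR ger0_norm ?(le_trans ler01 Ld) // ler_peMl // cn_ge0.
  by apply: (le_trans k4); apply: (le_trans k3); rewrite (le_trans (lerD k2 k1)) // addrCA -splitr lexx.
apply: (le_trans main); rewrite /Bd -/U.
rewrite (_ : D * B * W * 2 * c * U * nE x = D * B * c * U * W * (2 * nE x)); last by ring.
by rewrite [leLHS]mulrAC; apply: ler_wpM2l => //; exact: mulr_ge0.
Qed.

(** (M.2)' pays for the summable weight [wt], so that the bound in (G) can be summed over the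
    lattice of frequencies. *)
Lemma nu_wt : exists2 k : R, 1 <= k & forall q0 q1 C : R, 0 < q1 -> 0 < C ->
  (forall xi, nu xi * ew M (q0 * eucl xi) <= C * ew M (q1 * eucl xi)) ->
  forall L, 1 <= L -> exists2 B, 0 <= B & forall k' : zd, nu (- (L^-1 *: zpt R k')) * ew M (q0 * eucl (L^-1 *: zpt R k')) <=
    B * wt (zpt R k') * ew M (k * q1 * eucl (L^-1 *: zpt R k')).
Proof.
have [k k1 Hk] := ew_wt d wM M2; exists k => // q0 q1 C q10 C0 H L L1.
have L0 : 0 < L := lt_le_trans ltr01 L1.
have qL : 0 < q1 / L by rewrite divr_gt0.
have [C1 C10 HC1] := Hk _ qL; exists (C * C1); first by rewrite mulr_ge0 // ltW.
move=> z; have := H (- (L^-1 *: zpt R z)); rewrite euclN => h; apply: (le_trans h).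
rewrite -!mulrA; apply: ler_wpM2l; first exact: ltW.
have := HC1 (zpt R z); rewrite euclZ ger0_norm ?invr_ge0 ?(ltW L0) // !mulrA => h2.
by apply: le_trans h2; rewrite ler_peMr ?ew_ge0 // lerDl sqr_ge0.
Qed.

(** Order of the choices. Beurling: ell fixes q0 = c0 / ell, (G) gives q1, then Q and lam follow.
    Roumieu: lam fixes Q = c0 / (2 lam), (G) gives q0, and ell = c0 / min(q0, Q). *)
Lemma deriv_est : condG beur M A nE iota -> if beur then forall ell : R, 0 < ell -> exists2 lam, 0 < lam & deriv_bound lam ell
  else forall lam : R, 0 < lam -> exists2 ell, 0 < ell & deriv_bound lam ell.
Proof.
move=> HG; have := condG_nu wM wA M1 HT HG.
have [k k1 Hk] := nu_wt; have k0 : 0 < k := lt_le_trans ltr01 k1.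
have c00 : 0 < c0 by rewrite divr_gt0 // ?mulr_gt0 // ?pi_gt0.
move: deriv_est_core; move: c0 c00 => c c00.
rewrite /QQ; apply: if_imp2 => [[l [l0 H]] G ell e0|H G lam lam0].
  have q00 : 0 < c / ell by rewrite divr_gt0.
  have [q1 [C [q10 [C0 h]]]] := G _ q00.
  pose Q := Num.max (c / ell) (k * q1).
  have Q0 : 0 < Q by rewrite lt_max q00.
  have lQ : 0 < c / Q / 2 by rewrite divr_gt0 // divr_gt0.
  exists (Num.min l (c / Q / 2)); first by rewrite lt_min l0.
  have := H (Num.min l (c / Q / 2)) (c / ell) Q; rewrite invf_div mulrCA divff ?mulr1 ?gt_eqF //; apply.
  - by rewrite lt_min l0.
  - by rewrite ge_min lexx.
  - exact: q00.
  - by rewrite le_max lexx.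
  - by rewrite mulrC -ler_pdivlMr // ge_min lexx orbT.
  move=> L L1; have [B B0 HB] := Hk _ _ _ q10 C0 h L L1; exists B; [exact: B0|move=> z].
  apply: (le_trans (HB z)); apply: ler_wpM2l; first by rewrite mulr_ge0 // ltW // wt_gt0.
  by apply: (ew_scale wM); rewrite ?mulr_ge0 ?eucl_ge0 ?(ltW k0) ?(ltW q10) // le_max lexx orbT.
pose Q := c / (2 * lam); have Q0 : 0 < Q by rewrite divr_gt0 // mulr_gt0.
have [q0 [C [q00 [C0 h]]]] := G (Q / k) (divr_gt0 Q0 k0).
pose q := Num.min q0 Q; have qp : 0 < q by rewrite lt_min q00.
exists (c / q); first by rewrite divr_gt0.
apply: (H lam lam0 lam q Q) => //.
- by rewrite ge_min lexx orbT.
- by rewrite /Q invf_div mulrCA divff ?mulr1 ?gt_eqF.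
move=> L L1; have [B B0 HB] := Hk _ _ _ (divr_gt0 Q0 k0) C0 h L L1; exists B; [exact: B0|move=> z].
have kQ : k * (Q / k) = Q by rewrite mulrC divfK // gt_eqF.
rewrite kQ in HB; apply: le_trans (HB z).
apply: ler_wpM2l; first exact: nu_ge0.
by apply: (ew_scale wM); rewrite ?eucl_ge0 ?(ltW qp) // ge_min lexx.
Qed.

End Star.

(** * Coefficients *)

(** [nn k] is the largest admissible n not exceeding [mx k]; the cap ensures that a maximum exists
    and does no harm at infinity. *)
Lemma diag_choice (T : Type) (mx : T -> nat) (P : nat -> T -> Prop) : (forall k, P 0%N k) ->
  (forall n, exists r, forall k, (r <= mx k)%N -> P n k) ->
  exists nn : T -> nat, (forall k, P (nn k) k) /\ forall n, exists r, forall k, (r <= mx k)%N -> (n <= nn k)%N.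
Proof.
move=> P0 HP.
have ex k : exists n, `[< P n k /\ (n <= mx k)%N >] by exists 0%N; apply/asboolP.
have ub k n : `[< P n k /\ (n <= mx k)%N >] -> (n <= mx k)%N by move=> /asboolP[].
exists (fun k => ex_maxn (ex k) (ub k)); split=> [k|n].
  by case: ex_maxnP => m /asboolP[].
have [r Hr] := HP n; exists (maxn r n) => k; rewrite geq_max => /andP[k1 k2].
by case: ex_maxnP => m _ h; apply: h; apply/asboolP; split; [exact: Hr|].
Qed.

Section Forward.
Variables (R : realType) (d : nat) (beur : bool) (M A : nat -> R).
Hypotheses (wM : weight_seq M) (wA : weight_seq A) (M1 : cond_M1 M) (M2 : cond_M2' M) (A2 : cond_M2' A).
Variables (E : lmodType R[i]) (nE : E -> R) (iota : E -> functional R d).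
Hypothesis HT : is_TMIB beur M A nE iota.
Local Notation pt := (pt R d).
Local Notation testfun := (testfun R d).
Implicit Types (phi psi eta theta zeta chi : testfun) (l c : R) (xi : pt) (x y e : E) (s : seq 'I_d).
Local Notation S := (GS beur M A).
Local Notation conv := (@Defs.conv R d).
Local Notation bnd0 := (@bnd0 R d A).
Local Notation zd := {ffun 'I_d -> int}.
Local Notation HN := (E_nspace HT).
Local Notation c0 := (2 * pi / d.+1%:R : R).
Variables (f : functional R d) (Tf : testfun -> E) (chi1 chi2 : testfun) (L : R).
Hypotheses (uf : ultradist beur M A f) (HTf : forall phi, S phi -> eqS beur M A (iota (Tf phi)) (convD f phi)).
Hypotheses (h1 : GS true M A chi1) (h2 : GS true M A chi2) (L0 : 0 < L).
Implicit Type k : zd.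
Definition fq k : pt := L^-1 *: zpt R k.
(** The vectors [wk k] and [xs s k] are convolutions of f with reflected windows; thanks to the
    reflection their pairing with phi is f at [conv phi theta], see [iota_Tf]. *)
Definition wk k : E := Tf (check (modul (fq k) chi2)).
Definition xs s k : E := Tf (check (modul (fq k) (conv (DD s chi1) chi2))).
Let h1S : S chi1. Proof. exact: (GS_beur beur h1). Qed.
Let h2S : S chi2. Proof. exact: (GS_beur beur h2). Qed.

Lemma iota_Tf theta phi : S theta -> S phi -> iota (Tf (check theta)) phi = f (conv phi theta).
Proof. by move=> ht hp; rewrite (HTf (GS_check wM wA ht)) // /convD checkK. Qed.

(** The closed graph theorem applied to the modulations of chi2, whose norms grow like [ew M] by
    [bnd_modul]. *)
Lemma Tf_bound : QQ beur (fun q => exists2 C, 0 <= C & forall k, nE (wk k) <= C * ew M (q * eucl (fq k))).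
Proof.
(* [bnd_modul] starts at l / 2 in order to end at l; with l = 4 pi / q the quotient 2 pi / (l / 2)
   is q. *)
have p0 : 0 < (4 * pi)^-1 :> R by rewrite invr_gt0 mulr_gt0 // pi_gt0.
apply: QQ_imp (QQ_inv p0 (closed_graph wM wA M2 A2 HT uf HTf)) => q q0 [C C0 HC].
set l := ((4 * pi)^-1 * q)^-1 in HC.
have l0 : 0 < l by rewrite invr_gt0 mulr_gt0.
have l2 : 0 < l / 2 by rewrite divr_gt0.
have [c b] := (GS_QQ true A wM chi2).1 h2 _ l2; have cc := bnd_ge0 wM l2 b.
exists (C * c); first by rewrite mulr_ge0.
move=> k; have bm := bnd_modul wM wA M1 (fq k) l2 b.
have e1 : 2 * (l / 2) = l by rewrite mulrC divfK.
rewrite e1 in bm.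
have := HC _ _ (GS_check wM wA (GS_modul wM wA M1 (fq k) h2S)) (bnd_check bm).
have -> : 2 * pi * eucl (fq k) / (l / 2) = q * eucl (fq k).
  have pn : (pi : R) != 0 by rewrite gt_eqF // pi_gt0.
  have qn : q != 0 by rewrite gt_eqF.
  have -> : l = 4 * pi / q by rewrite /l invfM invrK.
  by move: (pi : R) pn => P pn; field; rewrite qn pn.
by rewrite mulrA.
Qed.

Definition mx k := (\max_(i < d) `|k i|)%N.

Lemma mx_eucl k : (mx k)%:R <= eucl (zpt R k).
Proof.
rewrite /mx; elim/big_ind: _ => [|x y hx hy|i _]; first exact: eucl_ge0.
  by rewrite /maxn; case: ifP.
have := eucl_coord (zpt R k) i; rewrite mxE -intr_norm; congr (_ <= _).
Qed.

Lemma mx_zbox r k : (mx k < r)%N -> k \in zbox d r.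
Proof.
move=> h; rewrite mem_zbox; apply/forallP => i; rewrite -abszE lez_nat.
exact: leq_trans (@leq_bigmax _ (fun i => `|k i|%N) i) (ltnW h).
Qed.

Lemma ew_arg0 q p : 0 <= q -> ew M (q * 0) = (q * 0) ^+ p * M 0%N / M p -> p = 0%N.
Proof.
move=> q0 h; have := ew_ge1 wM (mulr_ge0 q0 (lexx 0)); rewrite h mulr0.
by case: p {h} => [//|p]; rewrite expr0n mul0r mul0r ler10.
Qed.

(* Beurling case: the supremum defining [ew M] at a fixed scale is attained at [p k]. Roumieu case:
   the same at the scale [1 / nn k], where [nn k] tends to infinity slowly enough. *)
Lemma choose_p : exists p : zd -> nat, (forall k, eucl (fq k) = 0 -> p k = 0%N) /\
  QQ beur (fun c => exists2 C, 0 <= C & forall k, nE (wk k) * M (p k) <= C * wt (zpt R k) * (c * eucl (fq k)) ^+ p k).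
Proof.
have [kk kk1 Hk] := ew_wt d wM M2; have kk0 : 0 < kk := lt_le_trans ltr01 kk1.
have Mp := M_gt0 wM.
have pow k c p : ew M (c * eucl (fq k)) = (c * eucl (fq k)) ^+ p * M 0%N / M p ->
   ew M (c * eucl (fq k)) * M p = M 0%N * (c * eucl (fq k)) ^+ p.
  by move=> ->; rewrite divfK ?gt_eqF // mulrC.
(* The spare factor of [ew_wt] matters in the Roumieu case: at large frequencies it exceeds the
   constant C attached to each scale. *)
have dec : QQ beur (fun c => exists2 C, 0 < C & forall k, nE (wk k) * (1 + eucl (zpt R k) ^+ 2) <= C * wt (zpt R k) * ew M (c * eucl (fq k))).
  apply: QQ_imp (QQ_scale kk0 Tf_bound) => c cc [C C0 HC].
  have q0 : 0 < c / kk / L by rewrite divr_gt0 // divr_gt0.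
  have [C1 C10 HC1] := Hk _ q0; exists ((1 + C) * C1); first by rewrite mulr_gt0 // ltr_pwDl.
  move=> k; have e0 := HC1 (zpt R k).
  have ef : eucl (fq k) = L^-1 * eucl (zpt R k) by rewrite euclZ ger0_norm // invr_ge0 ltW.
  have e1 : c / kk * eucl (fq k) = c / kk / L * eucl (zpt R k) by rewrite ef mulrA.
  have e2 : c * eucl (fq k) = kk * (c / kk / L) * eucl (zpt R k).
    by rewrite ef !mulrA (mulrC kk c) mulfK // gt_eqF.
  rewrite e2; have := HC k; rewrite e1 => h.
  have s0 : 0 <= 1 + eucl (zpt R k) ^+ 2 by rewrite addr_ge0 // sqr_ge0.
  apply: le_trans (ler_wpM2r s0 h) _; rewrite -[leLHS]mulrA.
  have e3 : 0 <= C1 * wt (zpt R k) * ew M (kk * (c / kk / L) * eucl (zpt R k)).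
    by rewrite !mulr_ge0 ?ew_ge0 ?(ltW C10) // ltW // wt_gt0.
  apply: le_trans (ler_wpM2l C0 e0) _.
  by rewrite -2![leRHS]mulrA mulrDl mul1r [in leRHS]mulrA lerDr.
have H1 k : 1 <= 1 + eucl (zpt R k) ^+ 2 by rewrite lerDl sqr_ge0.
have N0 k : 0 <= nE (wk k) := nE_ge0 HT _.
have wk0 k := wt_gt0 (zpt R k).
move: dec; rewrite /QQ.
have goB : (exists l : R, 0 < l /\ exists2 C, 0 < C & forall k, nE (wk k) * (1 + eucl (zpt R k) ^+ 2) <= C * wt (zpt R k) * ew M (l * eucl (fq k))) ->
   exists p : zd -> nat, (forall k, eucl (fq k) = 0 -> p k = 0%N) /\
  exists c : R, 0 < c /\ exists2 C, 0 <= C & forall k, nE (wk k) * M (p k) <= C * wt (zpt R k) * (c * eucl (fq k)) ^+ p k.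
  move=> [c [cc [C C0 HC]]].
  have /boolp.choice[p Hp] : forall k, exists p, ew M (c * eucl (fq k)) = (c * eucl (fq k)) ^+ p * M 0%N / M p.
    by move=> k; apply: (ew_att wM); rewrite mulr_ge0 ?eucl_ge0 // ltW.
  exists p; split=> [k ez|]; first by apply: (ew_arg0 (ltW cc)); rewrite -ez.
  exists c; split; first exact: cc.
  exists (C * M 0%N); first by rewrite mulr_ge0 ?(ltW C0) // ltW.
  move=> k; have := HC k => h.
  apply: (@le_trans _ _ (C * wt (zpt R k) * ew M (c * eucl (fq k)) * M (p k))).
    by apply: ler_wpM2r; [exact/ltW|apply: le_trans h; rewrite ler_peMr].
  by rewrite -mulrA (pow _ _ _ (Hp k)) le_eqVlt; apply/orP; left; apply/eqP; ring.
have goR : (forall l : R, 0 < l -> exists2 C, 0 < C & forall k, nE (wk k) * (1 + eucl (zpt R k) ^+ 2) <= C * wt (zpt R k) * ew M (l * eucl (fq k))) ->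
   exists p : zd -> nat, (forall k, eucl (fq k) = 0 -> p k = 0%N) /\
  forall c : R, 0 < c -> exists2 C, 0 <= C & forall k, nE (wk k) * M (p k) <= C * wt (zpt R k) * (c * eucl (fq k)) ^+ p k.
  move=> H.
  (* The bound at scale 1 / n with constant 1, void for n = 0 so that the diagonal choice always has
     a candidate. *)
  pose P n k := (0 < n)%N -> nE (wk k) <= wt (zpt R k) * ew M (n%:R^-1 * eucl (fq k)).
  have [|n|nn [Pn Hn]] := @diag_choice _ mx P; first by [].
    case: n => [|n]; first by exists 0%N.
    have i0 : 0 < (n.+1%:R : R)^-1 by rewrite invr_gt0.
    have [C C0 HC] := H _ i0; have [r hr] := archi_le (1 + C); exists r => k rk _.
    have Ce : C <= 1 + eucl (zpt R k) ^+ 2.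
      have r1 : C <= eucl (zpt R k).
        apply: le_trans (mx_eucl k); apply: (@le_trans _ _ r%:R); last by rewrite ler_nat.
        by apply: le_trans hr; rewrite lerDr.
      by have := sqr_ge0 (eucl (zpt R k) - 1); have := eucl_ge0 (zpt R k); nra.
    have := HC k => h; rewrite -(ler_pM2l C0) mulrA; apply: le_trans h.
    by rewrite mulrC; apply: ler_wpM2l.
  have /boolp.choice[p Hp] : forall k, exists p, if nn k == 0%N then p = 0%N else
     ew M ((nn k)%:R^-1 * eucl (fq k)) = ((nn k)%:R^-1 * eucl (fq k)) ^+ p * M 0%N / M p.
    move=> k; case: eqP => _; first by exists 0%N.
    by apply: (ew_att wM); rewrite mulr_ge0 ?eucl_ge0 // invr_ge0 ler0n.
  have pz k : eucl (fq k) = 0 -> p k = 0%N.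
    move=> ez; have := Hp k; case: eqP => // _ h; apply: (@ew_arg0 (nn k)%:R^-1); first by rewrite invr_ge0 ler0n.
    by rewrite -ez.
  exists p; split; first exact: pz.
  move=> c cc; have [n hn] := archi_le (1 + c^-1).
  have [r Hr] := Hn n.+1.
  pose t k := wt (zpt R k) * (c * eucl (fq k)) ^+ p k.
  have t0 k : 0 < t k.
    rewrite mulr_gt0 // ?wk0 //; have [ez|ep] := eqVneq (eucl (fq k)) 0; first by rewrite (pz _ ez) expr0.
    by rewrite exprn_gt0 // mulr_gt0 // lt_neqAle eq_sym ep eucl_ge0.
  pose X k := nE (wk k) * M (p k) / t k.
  have X0 k : 0 <= X k by apply: divr_ge0; [apply: mulr_ge0; [exact: N0|exact/ltW]|exact/ltW].
  (* Finitely many frequencies may have [nn k] too small for the given c; the sum of their quotients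
     X k pays for them. *)
  exists (M 0%N + \sum_(k <- zbox d r) X k); first by rewrite addr_ge0 ?(ltW (Mp _)) // sumr_ge0.
  move=> k; rewrite -mulrA -/(t k) -ler_pdivrMr // -/(X k).
  have [kr|kr] := ltnP (mx k) r.
    rewrite (big_rem k (mx_zbox kr)) /= addrCA lerDl addr_ge0 ?(ltW (Mp _)) //.
    by rewrite sumr_ge0.
  apply: (@le_trans _ _ (M 0%N)); last by rewrite lerDl sumr_ge0.
  have nk := Hr k kr; have np : (0 < nn k)%N by apply: leq_trans nk.
  have := Hp k; rewrite gtn_eqF // => hp; have := Pn k np => h.
  rewrite /X ler_pdivrMr //; apply: (@le_trans _ _ (wt (zpt R k) * ew M ((nn k)%:R^-1 * eucl (fq k)) * M (p k))).
    by apply: ler_wpM2r; [exact/ltW|].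
  rewrite -mulrA (pow _ _ _ hp) mulrCA; apply: ler_wpM2l; first exact/ltW.
  apply: ler_wpM2l; first exact/ltW/wk0.
  have ni : (nn k)%:R^-1 <= c.
    rewrite -[c]invrK lef_pV2 ?posrE ?invr_gt0 ?ltr0n //.
    apply: (@le_trans _ _ n%:R); first by apply: le_trans hn; rewrite lerDr.
    by rewrite ler_nat (leq_trans _ nk).
  apply: lerXn2r; rewrite ?nnegrE ?mulr_ge0 ?eucl_ge0 ?invr_ge0 ?ler0n ?(ltW cc) //.
  by apply: ler_wpM2r => //; exact: eucl_ge0.
by clear -goB goR; case: (beur) goB goR => gB gR; [exact: gB|exact: gR].
Qed.

Lemma iota_xs s k phi : S phi -> iota (xs s k) phi = f (conv phi (modul (fq k) (conv (DD s chi1) chi2))).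
Proof.
move=> hp; apply: iota_Tf => //; apply: (GS_modul wM wA M1); apply: (GS_conv wM wA M2 A2) => //.
exact: (GS_DD wM wA M2 _ h1S).
Qed.

Lemma iota_wk k phi : S phi -> iota (wk k) phi = f (conv phi (modul (fq k) chi2)).
Proof. by move=> hp; apply: iota_Tf => //; exact: (GS_modul wM wA M1 _ h2S). Qed.

Lemma xs_step i s k phi : S phi -> frq (fq k) i * iota (xs s k) phi = iota (xs s k) (pderiv i phi) - iota (xs (i :: s) k) phi.
Proof.
move=> hp; rewrite (iota_xs _ _ hp) (iota_xs _ _ hp) (iota_xs _ _ (GS_pderiv wM wA M2 i hp)).
exact: (freq_step wM wA M1 M2 A2 _ _ uf hp (GS_DD wM wA M2 _ h1S) h2S).
Qed.

(** By associativity [xs s k] is [wk k] convolved with a modulated derivative of chi1, and the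
    absolute value of the latter does not see the modulation. *)
Lemma xs_bound h : 0 < h -> exists2 K, 0 <= K & forall s k, nE (xs s k) <= K * (h ^+ size s * M (size s)) * nE (wk k).
Proof.
move=> h0; have [tr Htr Ntr] := tr_ex wM wA HT.
have [l l0 [C C0 HC]] := QQ_ex (convE_bnd wM wA M2 A2 HT Htr Ntr).
pose m := Num.min h l; have m0 : 0 < m by rewrite lt_min h0.
have [c b] := (GS_QQ true A wM chi1).1 h1 _ m0; have cc := bnd_ge0 wM m0 b.
exists (C * c); first by rewrite mulr_ge0.
move=> s k; have hj := GS_DD wM wA M2 s h1S; set j := size s.
have hm := GS_modul wM wA M1 (fq k) hj; have hm2 := GS_modul wM wA M1 (fq k) h2S.
have bj : bnd0 l (c * (m ^+ j * M j)) (check (modul (fq k) (DD s chi1))).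
  apply: bnd0_check; apply: bnd0_modul; have := bnd0_DD s b.
  by apply: (bnd0_wl wA); rewrite // ge_min lexx orbT.
have eq : eqS beur M A (iota (xs s k)) (convD (iota (wk k)) (check (modul (fq k) (DD s chi1)))).
  move=> phi hp; rewrite (iota_xs _ _ hp) /convD checkK iota_wk; last exact: GS_conv.
  rewrite (@modul_conv _ _ beur _ _ wM wA M2 A2 _ _ _ hj h2S).
  by rewrite (@conv_assoc _ _ beur _ _ wM wA M2 A2 _ _ _ hp hm hm2).
apply: le_trans (HC _ _ _ _ (GS_check wM wA hm) bj eq) _.
rewrite -!mulrA; apply: ler_wpM2l => //; apply: ler_wpM2l => //; apply: ler_wpM2r; first by rewrite mulr_ge0 ?(M_ge0 wM) ?(nE_ge0 HT).
by apply: lerXn2r; rewrite ?nnegrE ?(ltW m0) ?(ltW h0) // ge_min lexx.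
Qed.

(** Vector form of [freq_trade]: [y m] collects the terms in which m of the p derivatives fell on
    phi and p - m on chi1. The recursion is Pascal's rule with signs, hence 2^p. *)
Lemma freq_pow_expand i k p : forall s, exists y : nat -> E,
  (forall phi, S phi -> frq (fq k) i ^+ p * iota (xs s k) phi = \sum_(m < p.+1) iota (y m) (DD (nseq m i) phi)) /\
  forall W : nat -> R, (forall s, nE (xs s k) <= W (size s)) -> forall m, (m <= p)%N -> nE (y m) <= 2 ^+ p * W (size s + p - m)%N.
Proof.
elim: p => [|p IH] s.
  exists (fun=> xs s k); split=> [phi hp|W HW m]; first by rewrite expr0 mul1r big_ord1.
  by rewrite leqn0 => /eqP ->; rewrite expr0 mul1r addn0 subn0.
have [y [Hy By]] := IH s; have [y' [Hy' By']] := IH (i :: s).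
(* Out of range members are 0: the shifted family has none at m = 0, the other none at m = p + 1. *)
exists (fun m => (if m is m'.+1 then y m' else 0) - (if (m <= p)%N then y' m else 0)); split=> [phi hp|W HW].
  have hd := GS_pderiv wM wA M2 i hp.
  have hD m : S (DD (nseq m i) phi) := GS_DD wM wA M2 _ hp.
  rewrite exprSr -mulrA xs_step // mulrBr Hy // Hy'; last exact: hp.
  under [RHS]eq_bigr => m _ do rewrite (iotaB HT _ _ (hD m)).
  rewrite sumrB; congr (_ - _).
    rewrite [RHS]big_ord_recl /= (iota_E0 HT hp) add0r; apply: eq_bigr => m _ /=.
    by congr (iota _ _); rewrite -[pderiv i phi]/(DD (nseq 1 i) phi) -DD_cat -nseqD addn1.
  rewrite [RHS]big_ord_recr [X in _ = _ + X](_ : _ = 0) ?addr0; last by rewrite /= ltnn; exact: (iota_E0 HT (hD p.+1)).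
  apply: eq_bigr => m _ /=; by rewrite -ltnS ltn_ord.
move=> m mp; have W0 j : 0 <= W j by have := HW (nseq j i); rewrite size_nseq; apply: le_trans; exact: nE_ge0 HT _.
have P0 : 0 <= 2 ^+ p :> R by rewrite exprn_ge0.
have b1 : nE (if m is m'.+1 then y m' else 0) <= 2 ^+ p * W (size s + p.+1 - m)%N.
  case: m mp => [_|m mp]; first by rewrite (nrm0 HN) mulr_ge0.
  by rewrite addnS subSS; exact: By.
have b2 : nE (if (m <= p)%N then y' m else 0) <= 2 ^+ p * W (size s + p.+1 - m)%N.
  case: ifP => [mp'|_]; last by rewrite (nrm0 HN) mulr_ge0.
  by rewrite -addSnnS; exact: By'.
apply: le_trans (nB HN _ _) _; apply: le_trans (lerD b1 b2) _.
by rewrite exprS -mulrA mulr_natl mulr2n.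
Qed.

(** Division by the p-th power of a dominant frequency component. For each k a single multi-index
    [b m] of each order m occurs. *)
Lemma modulated_expand k p : (eucl (fq k) = 0 -> p = 0%N) -> exists (g : nat -> E) (b : nat -> mindex d),
  [/\ forall m, (m <= p)%N -> mabs (b m) = m,
   forall phi, S phi -> f (conv phi (modul (fq k) (conv chi1 chi2))) = \sum_(m < p.+1) iota (g m) (dmult (b m) phi) &
   forall W : nat -> R, (forall s, nE (xs s k) <= W (size s)) ->
     forall m, (m <= p)%N -> (c0 * eucl (fq k)) ^+ p * nE (g m) <= 2 ^+ p * W (p - m)%N].
Proof.
move=> pz; have [ez|nz] := eqVneq (eucl (fq k)) 0.
  rewrite (pz ez); exists (fun=> xs [::] k), (fun=> cnt [::]); split.
  - by move=> m; rewrite leqn0 => /eqP ->; rewrite mabs_cnt.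
  - move=> phi hp; by rewrite big_ord1 -(iota_xs [::] k hp) -(DD_dmult [::] (GS_smooth wM hp)).
  by move=> W HW m; rewrite leqn0 => /eqP ->; rewrite !expr0 !mul1r; exact: HW.
have [//|[i hi]] := frq_max (fq k); first by move=> ez; rewrite ez eqxx in nz.
have tp : 0 < c0 * eucl (fq k).
  by rewrite mulr_gt0 ?divr_gt0 ?mulr_gt0 ?pi_gt0 // lt_neqAle eq_sym nz eucl_ge0.
have fp : 0 < cnorm (frq (fq k) i) := lt_le_trans tp hi.
have f0 : frq (fq k) i != 0 by apply/negP => /eqP ee; move: fp; rewrite ee cn0 ltxx.
have [y [Hy By]] := freq_pow_expand i k p [::].
exists (fun m => (frq (fq k) i ^+ p)^-1 *: y m), (fun m => cnt (nseq m i)); split.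
- by move=> m _; rewrite mabs_cnt size_nseq.
- move=> phi hp; rewrite -(iota_xs [::] k hp) -[LHS](mulKf (expf_neq0 p f0)) Hy // mulr_sumr; apply: eq_bigr => m _.
  have sm := GS_smooth wM hp.
  by rewrite -(DD_dmult _ sm) (iotaZ HT) //; exact: (GS_DD wM wA M2 _ hp).
move=> W HW m mp; rewrite (nEZ HT) cnV cnX mulrA; apply: le_trans (By W HW m mp).
rewrite ler_piMl ?(nE_ge0 HT) // ler_pdivrMr ?exprn_gt0 // mul1r.
by apply: lerXn2r; rewrite ?nnegrE ?(ltW tp) ?(ltW fp).
Qed.

Lemma GS_dmult a phi : S phi -> S (dmult a phi).
Proof. by rewrite dmult_DD; exact: GS_DD. Qed.

Lemma coeff_family : exists u : mindex d -> zd -> E,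
  (forall k, exists Fk : seq (mindex d), forall phi Fs, S phi -> uniq Fs -> {subset Fk <= Fs} ->
     \sum_(a <- Fs) iota (u a k) (dmult a phi) = f (conv phi (modul (fq k) (conv chi1 chi2)))) /\
  QQ beur (fun lam => exists2 C, 0 <= C & forall a k, nE (u a k) * M (mabs a) <= C * wt (zpt R k) * lam ^+ mabs a).
Proof.
have [p [pz Qp]] := choose_p.
have /boolp.choice[g Hg] := fun k => modulated_expand (pz k).
have /boolp.choice[b Hb] := Hg.
(* The part of the k-th term carrying the derivative a; it is 0 unless a is the multi-index that k
   uses at this order. *)
pose u (a : mindex d) k : E := if (mabs a <= p k)%N && (a == b k (mabs a)) then g k (mabs a) else 0.
exists u; split=> [k|].
  have [b1 b2 _] := Hb k.
  pose Fk := [seq b k m | m <- index_iota 0 (p k).+1].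
  have uFk : uniq Fk.
    rewrite map_inj_in_uniq ?iota_uniq // => m m'; rewrite !mem_index_iota /= !ltnS => mp mp' e.
    by rewrite -(b1 m mp) -(b1 m' mp') e.
  exists Fk => phi Fs hp uF sub; rewrite (big_diff _ uFk uF sub) [X in _ + X]big1 ?addr0; last first.
    move=> a na; rewrite /u; case: ifP => [/andP[ap /eqP ea]|_]; last exact: (iota_E0 HT (GS_dmult _ hp)).
    by exfalso; move/negP: na; apply; apply/mapP; exists (mabs a); rewrite // mem_index_iota.
  rewrite b2 // big_map big_mkord; apply: eq_bigr => m _.
  by rewrite /u (b1 m) ?leq_ord // eqxx.
have c00 : 0 < c0 by rewrite divr_gt0 // mulr_gt0 // pi_gt0.
(* Rescaling by 2 / c0 cancels both 2^p and (c0 |fq k|)^p. With [xs_bound] at 1 / lam, the quotient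
   lam^p / lam^(p-m) leaves lam^m. *)
apply: QQ_imp (QQ_scale (divr_gt0 (ltr0n R 2) c00) Qp) => lam l0 [C C0 HC].
have li : 0 < lam^-1 by rewrite invr_gt0.
have [K K0 HK] := xs_bound li.
have M00 := M_ge0 wM 0.
exists (K * M 0%N * C); first by rewrite !mulr_ge0.
move=> a k; set m := mabs a; have [_ _ b3] := Hb k.
have wk0 := ltW (wt_gt0 (zpt R k)).
rewrite /u -/m; case: ifP => [/andP[mp _]|_]; last by rewrite (nrm0 HN) mul0r !mulr_ge0 ?exprn_ge0 // ltW.
have tp : 0 < (c0 * eucl (fq k)) ^+ p k.
  have [ez|nz] := eqVneq (eucl (fq k)) 0; first by rewrite (pz k ez) expr0.
  by rewrite exprn_gt0 // mulr_gt0 // lt_neqAle eq_sym nz eucl_ge0.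
have := b3 (fun j => K * (lam^-1 ^+ j * M j) * nE (wk k)) (fun s => HK s k) m mp => h.
rewrite -(ler_pM2l tp) mulrA; apply: le_trans (ler_wpM2r (M_ge0 wM m) h) _.
have lc := M_logconv wM M1 (p k - m) m; rewrite subnK // in lc.
have N0 := nE_ge0 HT (wk k).
rewrite (_ : 2 ^+ p k * _ * _ = 2 ^+ p k * K * lam^-1 ^+ (p k - m) * nE (wk k) * (M (p k - m)%N * M m)); last by ring.
have P0 : 0 <= 2 ^+ p k * K * lam^-1 ^+ (p k - m) by rewrite !mulr_ge0 // exprn_ge0 // ltW.
apply: le_trans (ler_wpM2l (mulr_ge0 P0 N0) lc) _.
rewrite (_ : 2 ^+ p k * _ * _ * _ * _ = 2 ^+ p k * K * lam^-1 ^+ (p k - m) * M 0%N * (nE (wk k) * M (p k))); last by ring.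
apply: le_trans (ler_wpM2l (mulr_ge0 P0 M00) (HC k)) _.
rewrite le_eqVlt; apply/orP; left; apply/eqP.
move: (c0) => c1.
rewrite (_ : lam / (2 / c1) = lam * c1 / 2); last by rewrite invf_div mulrA.
have [n en] : exists n, p k = (n + m)%N by exists (p k - m)%N; rewrite subnK.
rewrite en addnK !exprMn !exprD !exprVn; have ln : lam ^+ n != 0 by rewrite expf_neq0 // gt_eqF.
by field; rewrite ln ?expf_neq0 // pnatr_eq0.
Qed.

End Forward.

(** * Series of derivatives *)

Lemma if_imp1 (b : bool) (A1 A2 C1 C2 : Prop) : (b = true -> A1 -> C1) -> (b = false -> A2 -> C2) ->
  (if b then A1 else A2) -> if b then C1 else C2.
Proof. by case: b => h1 h2; [exact: h1|exact: h2]. Qed.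

Section MultiIndex.
Variables (R : realType) (d : nat).
Local Notation mi := (mindex d).
Definition mibox n : seq mi := [seq [ffun i => nat_of_ord (b i)] | b : {ffun 'I_d -> 'I_n.+1}].

Lemma mem_mibox n (a : mi) : (mabs a <= n)%N -> a \in mibox n.
Proof.
move=> h; have lt i : (a i < n.+1)%N.
  by rewrite ltnS (leq_trans _ h) // /mabs (bigD1 i) //= leq_addr.
apply/mapP; exists [ffun i => Ordinal (lt i)]; first by rewrite mem_enum.
by apply/ffunP => i; rewrite !ffunE.
Qed.

(** Over a box the sum factorizes into d geometric sums, each below 2. *)
Lemma mi_sum (F : seq mi) : uniq F -> \sum_(a <- F) (2^-1 : R) ^+ mabs a <= 2 ^+ d.
Proof.
move=> uF; pose n := (\max_(a <- F) mabs a)%N.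
have lt (a : mi) (aF : a \in F) i : (a i < n.+1)%N.
  rewrite ltnS; apply: leq_trans (@leq_bigmax_seq _ F xpredT (@mabs d) a aF isT).
  by rewrite /mabs (bigD1 i) //= leq_addr.
pose h (b : {ffun 'I_d -> 'I_n.+1}) : mi := [ffun i => nat_of_ord (b i)].
have hi : injective h by move=> b b' /ffunP e; apply/ffunP => i; apply: val_inj; have := e i; rewrite !ffunE.
have sub : {subset F <= mibox n}.
  move=> a aF; apply: mem_mibox; exact: (@leq_bigmax_seq _ F xpredT (@mabs d) a aF isT).
have ub : uniq (mibox n) by rewrite map_inj_uniq ?enum_uniq.
apply: (@le_trans _ _ (\sum_(a <- mibox n) (2^-1 : R) ^+ mabs a)).
  by rewrite (big_diff (fun a => 2^-1 ^+ mabs a) uF ub sub) lerDl sumr_ge0 // => a _; rewrite exprn_ge0.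
rewrite /mibox big_map big_enum /=.
have -> : \sum_(b : {ffun 'I_d -> 'I_n.+1}) (2^-1 : R) ^+ mabs (h b) = \prod_(i < d) \sum_(j < n.+1) (2^-1 : R) ^+ j.
  rewrite bigA_distr_bigA /=; apply: eq_bigr => b _; rewrite /mabs expr_sum; apply: eq_bigr => i _.
  by rewrite ffunE.
have s0 : 0 <= \sum_(j < n.+1) (2^-1 : R) ^+ j by apply: sumr_ge0 => j _; rewrite exprn_ge0.
rewrite prodr_const card_ord; apply: lerXn2r; rewrite ?nnegrE //.
have g m : \sum_(j < m) (2^-1 : R) ^+ j = 2 - 2 * 2^-1 ^+ m.
  elim: m => [|m IH]; first by rewrite big_ord0 expr0; ring.
  by rewrite big_ord_recr /= IH exprS; field.
by rewrite g gerBl mulr_ge0 // exprn_ge0.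
Qed.

End MultiIndex.

Lemma hasSum_tail (R : realType) (V : zmodType) (N : V -> R) (I : eqType) (v : I -> V) s Fs (r : R) : nspace N -> uniq Fs ->
  hasSum N v s -> (forall F, uniq F -> (forall i, i \in F -> i \notin Fs) -> \sum_(i <- F) N (v i) <= r) ->
  N (\sum_(i <- Fs) v i - s) <= r.
Proof.
move=> HN uF hs ht; have r0 : 0 <= r by have := ht [::] isT; rewrite big_nil; apply.
apply/ler_addgt0Pr => e e0; have [F0 H] := hs e e0.
pose F1 := undup (F0 ++ Fs).
have s0 : {subset F0 <= F1} by move=> i iF; rewrite mem_undup mem_cat iF.
have s1 : {subset Fs <= F1} by move=> i iF; rewrite mem_undup mem_cat iF orbT.
have k1 := H F1 (undup_uniq _) s0.
have k2 := sum_diff_small HN r0 uF ht (undup_uniq _) s1.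
apply: le_trans (n_tri HN (\sum_(i <- F1) v i) _ _) _.
by rewrite (nBC HN); exact: lerD.
Qed.

Section Series.
Variables (R : realType) (d : nat) (beur : bool) (M A : nat -> R).
Hypotheses (wM : weight_seq M) (wA : weight_seq A) (M1 : cond_M1 M) (M2 : cond_M2' M) (A2 : cond_M2' A).
Variables (E : lmodType R[i]) (nE : E -> R) (iota : E -> functional R d).
Hypothesis HT : is_TMIB beur M A nE iota.
Local Notation pt := (pt R d).
Local Notation testfun := (testfun R d).
Implicit Types (phi psi eta theta zeta chi : testfun) (l c : R) (xi : pt) (x y : E) (s : seq 'I_d).
Local Notation S := (GS beur M A).
Local Notation bnd := (@bnd R d M A).
Local Notation mi := (mindex d).
Hypothesis nz : exists zeta, GS true M A zeta /\ exists x : pt, zeta x != 0.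
Hypothesis HG : condG beur M A nE iota.

Lemma ult_of_bnd (T : functional R d) : (forall (a : R[i]) phi psi, S phi -> S psi -> T (fun x : pt => a * phi x + psi x) = a * T phi + T psi) ->
  QQ beur (fun l => exists2 C, 0 <= C & forall phi c, S phi -> bnd l c phi -> cnorm (T phi) <= C * c) -> ultradist beur M A T.
Proof.
move=> TZD QB; split; first exact: TZD.
have main l C phi : 0 < l -> 0 <= C -> smooth phi -> (gsnorm M A l l^-1 phi < +oo)%E ->
   (forall c, bnd l c phi -> cnorm (T phi) <= C * c) -> ((cnorm (T phi))%:E <= C%:E * gsnorm M A l l^-1 phi)%E.
  move=> l0 C0 sm fin H; have g0 := gsnorm_ge0 A wM phi l0.
  have fn : gsnorm M A l l^-1 phi \is a fin_num by rewrite ge0_fin_numE.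
  have b : bnd l (fine (gsnorm M A l l^-1 phi)) phi by apply/gsnorm_bnd => //; rewrite fineK.
  by rewrite -(fineK fn) -EFinM lee_fin; exact: H.
have SlS l phi : 0 < l -> beur = false -> inSl M A l phi -> S phi.
  by move=> l0 -> h; exists l.
move: QB SlS; rewrite /QQ /GS; case: (beur) => [[l [l0 [C C0 HC]]] _|H SlS l l0].
  exists l, C; split; first exact: l0.
  by move=> phi h; have [sm fin] := h l l0; apply: (main _ _ _ l0 C0 sm fin) => c b; exact: HC h b.
have [C C0 HC] := H l l0; exists C => phi h; have [sm fin] := h.
by apply: (main _ _ _ l0 C0 sm fin) => c b; apply: HC b; exact: (SlS l phi l0 erefl h).
Qed.

(** The gain 4^-|a|, due to lam = 1 / (4 ell), is shared later: one factor 2^-|a| makes the series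
    summable, the other allows the weight 2^|a| in [series_abs]. The parameter j becomes the
    frequency in [forward]. *)
Lemma family_bnd (J : Type) (w : J -> R) (u : J -> mi -> E) : (forall j, 0 <= w j) ->
  QQ beur (fun lam => exists2 C, 0 <= C & forall j a, nE (u j a) * M (mabs a) <= C * w j * lam ^+ mabs a) ->
  QQ beur (fun l => exists2 C, 0 <= C & forall phi c j a, S phi -> bnd l c phi ->
    cnorm (iota (u j a) (dmult a phi)) <= C * c * (4^-1) ^+ mabs a * w j).
Proof.
move=> w0 Hu.
have key l (ell lam : R) : 0 < l -> 0 < ell -> lam = (4 * ell)^-1 -> deriv_bound beur M A nE iota l ell -> (exists2 C, 0 <= C & forall j a, nE (u j a) * M (mabs a) <= C * w j * lam ^+ mabs a) ->
   exists2 C, 0 <= C & forall phi c j a, S phi -> bnd l c phi -> cnorm (iota (u j a) (dmult a phi)) <= C * c * (4^-1) ^+ mabs a * w j.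
  move=> l0 e0 el [K K0 HK] [C C0 HC]; exists (K * C); first by rewrite mulr_ge0.
  move=> phi c j a hp b; have cc := bnd_ge0 wM l0 b; rewrite dmult_DD; apply: le_trans (HK _ _ _ _ hp b) _; rewrite size_mseq.
  rewrite (_ : K * c * _ * _ = K * c * ell ^+ mabs a * (nE (u j a) * M (mabs a))); last by ring.
  apply: le_trans (ler_wpM2l _ (HC j a)) _; first by rewrite !mulr_ge0 // exprn_ge0 // ltW.
  rewrite el invfM [_^-1 * _]mulrC !exprMn !exprVn; have : ell ^+ mabs a != 0 by rewrite expf_neq0 // gt_eqF.
  have : 4 ^+ mabs a != 0 :> R by rewrite expf_neq0.
  move: (_ ^+ _) => p p0; move: (_ ^+ _) => q q0; rewrite le_eqVlt; apply/orP; left; apply/eqP; field.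
  by rewrite p0 q0.
move: Hu (deriv_est wM wA M1 M2 A2 HT nz HG); rewrite /QQ; apply: if_imp2.
  move=> [lam [lam0 H]] G; have e0 : 0 < (4 * lam)^-1 by rewrite invr_gt0 mulr_gt0.
  have [l l0 HK] := G _ e0; exists l; split; first exact: l0.
  apply: (key l _ lam l0 e0 _ HK H).
  by rewrite invfM invrK mulrA mulVf ?mul1r // pnatr_eq0.
move=> H G l l0; have [ell e0 HK] := G l l0.
apply: (key l ell _ l0 e0 erefl HK); apply: H; by rewrite invr_gt0 mulr_gt0.
Qed.

Variable e : mi -> E.
Hypothesis He : QQ beur (fun lam => exists2 C, 0 <= C & forall a, nE (e a) * M (mabs a) <= C * lam ^+ mabs a).
Local Notation ev a phi := (iota (e a) (dmult a phi)).

Lemma series_bnd : QQ beur (fun l => exists2 C, 0 <= C & forall phi c a, S phi -> bnd l c phi ->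
  cnorm (ev a phi) <= C * c * (4^-1) ^+ mabs a).
Proof.
have Hu : QQ beur (fun lam => exists2 C, 0 <= C & forall (j : unit) a, nE (e a) * M (mabs a) <= C * 1 * lam ^+ mabs a).
  by apply: QQ_imp He => lam _ [C C0 HC]; exists C => // _ a; rewrite mulr1.
apply: QQ_imp (@family_bnd unit (fun=> 1) (fun=> e) (fun=> ler01) Hu) => l l0 [C C0 HC].
by exists C => // phi c a hp b; have := HC phi c tt a hp b; rewrite mulr1.
Qed.

Lemma series_abs : QQ beur (fun l => exists2 C, 0 <= C & forall phi c F, S phi -> bnd l c phi -> uniq F ->
  \sum_(a <- F) 2 ^+ mabs a * cnorm (ev a phi) <= C * c).
Proof.
apply: QQ_imp series_bnd => l l0 [C C0 HC]; exists (C * 2 ^+ d); first by rewrite mulr_ge0 // exprn_ge0.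
move=> phi c F hp b uF; have c0 := bnd_ge0 wM l0 b.
apply: (@le_trans _ _ (\sum_(a <- F) C * c * 2^-1 ^+ mabs a)).
  apply: ler_sum => a _; apply: le_trans (ler_wpM2l _ (HC _ _ a hp b)) _; first by rewrite exprn_ge0.
  rewrite mulrCA; apply: ler_wpM2l; first exact: mulr_ge0.
  by rewrite -exprMn (_ : 2 / 4 = 2^-1 :> R) //; field.
rewrite -mulr_sumr [leRHS]mulrAC; apply: ler_wpM2l; [exact: mulr_ge0|exact: mi_sum].
Qed.

Lemma series_pt phi : S phi -> exists2 X : R, 0 <= X & forall F, uniq F -> \sum_(a <- F) 2 ^+ mabs a * cnorm (ev a phi) <= X.
Proof.
move=> hp; have [l l0 [[C C0 HC] [c b]]] := QQ_meet series_abs ((GS_QQ beur A wM phi).1 hp).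
exists (C * c); first by rewrite mulr_ge0 ?(bnd_ge0 wM l0 b).
by move=> F uF; exact: HC hp b uF.
Qed.

Lemma ler_2pow (a : mi) phi : cnorm (ev a phi) <= 2 ^+ mabs a * cnorm (ev a phi).
Proof. by rewrite ler_peMl ?cn_ge0 // exprn_ege1 // ler1n. Qed.

Lemma series_ex : exists g : functional R d, ultradist beur M A g /\
  forall phi, S phi -> hasSum (@cnorm R) (fun a => ev a phi) (g phi).
Proof.
have ex phi : exists z, S phi -> hasSum (@cnorm R) (fun a => ev a phi) z.
  have [hp|nS] := pselect (S phi); last by exists 0.
  have [X X0 HX] := series_pt hp.
  have ab : abs_le (@cnorm R) (fun a => ev a phi) X.
    by move=> F uF; apply: le_trans (HX F uF); apply: ler_sum => a _; exact: ler_2pow.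
  by have [z [hz _]] := hasSum_ex (cn_nspace R) ab; exists z.
have /boolp.choice[g Hg] := ex; exists g; split; last exact: Hg.
apply: ult_of_bnd => [b phi psi hp hq|].
  apply: (hasSum_uniq (cn_nspace R) (Hg _ (GS_ZD wM wA b hp hq))) => r r0.
  have b0 : 0 < 1 + cnorm b by rewrite ltr_pwDl ?cn_ge0.
  have r1 : 0 < r / 2 / (1 + cnorm b) by rewrite !divr_gt0.
  have r2 : 0 < r / 2 by rewrite divr_gt0.
  have [F1 H1] := Hg _ hp _ r1; have [F2 H2] := Hg _ hq _ r2.
  exists (F1 ++ F2) => F uF s.
  have s1 : {subset F1 <= F} by move=> z zF; apply: s; rewrite mem_cat zF.
  have s2 : {subset F2 <= F} by move=> z zF; apply: s; rewrite mem_cat zF orbT.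
  have sp := GS_smooth wM hp; have sq := GS_smooth wM hq.
  have -> : \sum_(a <- F) ev a (fun x : pt => b * phi x + psi x) - (b * g phi + g psi) =
     b * (\sum_(a <- F) ev a phi - g phi) + (\sum_(a <- F) ev a psi - g psi).
    rewrite mulrBr addrACA -opprD mulr_sumr -big_split /=; congr (_ - _); apply: eq_bigr => a _.
    rewrite !dmult_DD DDZD // (ult_ZD (iota_ult HT _)) //; exact: (GS_DD wM wA M2).
  have k1 := H1 F uF s1; have k2 := H2 F uF s2.
  apply: le_trans (cnD _ _) _; rewrite [r]splitr; apply: lerD k2; rewrite cnM.
  apply: le_trans (ler_wpM2l (cn_ge0 b) k1) _; rewrite mulrA ler_pdivrMr // mulrC; apply: ler_wpM2l; first exact: ltW.
  by rewrite lerDr.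
apply: QQ_imp series_abs => l l0 [C C0 HC]; exists C => // phi c hp b.
apply: (hasSum_norm (cn_nspace R) (Hg _ hp)) => F uF; apply: le_trans (HC _ _ F hp b uF).
by apply: le_trans (cn_sum _ _ _) _; apply: ler_sum => a _; exact: ler_2pow.
Qed.

(** U, where the sum weighted by 2^|a| is at most 1, is an absolutely convex neighbourhood by
    [series_abs]. A bounded set is absorbed by it, so on the whole set the tail over |a| > n is at
    most lam / 2^n. *)
Lemma series_cvg g : (forall phi, S phi -> hasSum (@cnorm R) (fun a => ev a phi) (g phi)) ->
  sum_cvgS beur M A (fun a phi => ev a phi) g.
Proof.
move=> Hg B [BS HB] r r0.
pose U phi := S phi /\ forall F, uniq F -> \sum_(a <- F) 2 ^+ mabs a * cnorm (ev a phi) <= 1.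
have evZ (b : R[i]) a phi : S phi -> ev a (fun x : pt => b * phi x) = b * ev a phi.
  move=> hp; rewrite !dmult_DD DDZ; last exact: (GS_smooth wM hp).
  by rewrite (ult_Z wM (iota_ult HT _)) //; exact: (GS_DD wM wA M2).
have evD a phi psi : S phi -> S psi -> ev a (fun x : pt => phi x + psi x) = ev a phi + ev a psi.
  move=> hp hq; have e1 : (fun x : pt => phi x + psi x) = (fun x : pt => 1 * phi x + psi x) by apply: funext => x; rewrite mul1r.
  rewrite e1 !dmult_DD DDZD; [|exact: (GS_smooth wM hp)|exact: (GS_smooth wM hq)].
  by rewrite (ult_ZD (iota_ult HT _)) ?mul1r //; exact: (GS_DD wM wA M2).
have nU : nbhs0S beur M A U.
  split; first by move=> phi [].
  split=> [b c phi psi [hp Up] [hq Uq] bc|].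
    have hbp := GS_Z wM wA b hp; have hcq := GS_Z wM wA c hq; split.
      by have := GS_ZD wM wA b hp hcq.
    move=> F uF; apply: le_trans bc.
    apply: (@le_trans _ _ (\sum_(a <- F) (cnorm b * (2 ^+ mabs a * cnorm (ev a phi)) + cnorm c * (2 ^+ mabs a * cnorm (ev a psi))))).
      apply: ler_sum => a _; rewrite (evD _ _ _ hbp hcq) (evZ _ _ _ hp) (evZ _ _ _ hq).
      rewrite [leRHS](_ : _ = 2 ^+ mabs a * (cnorm b * cnorm (ev a phi) + cnorm c * cnorm (ev a psi))); last by ring.
      rewrite -!cnM; apply: ler_wpM2l; [by rewrite exprn_ge0|exact: cnD].
    rewrite big_split /= -!mulr_sumr; apply: lerD.
      by rewrite ler_piMr ?cn_ge0 // Up.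
    by rewrite ler_piMr ?cn_ge0 // Uq.
  have key l C phi : 0 < l -> 0 <= C -> (forall phi c F, S phi -> bnd l c phi -> uniq F ->
     \sum_(a <- F) 2 ^+ mabs a * cnorm (ev a phi) <= C * c) -> S phi -> inSl M A l phi ->
     (gsnorm M A l l^-1 phi < ((1 + C)^-1)%:E)%E -> U phi.
    move=> l0 C0 HC hp [sm _] lt; have C1 : 0 < 1 + C by rewrite ltr_pwDl.
    have b : bnd l (1 + C)^-1 phi by apply/gsnorm_bnd => //; exact: ltW.
    split=> [//|F uF]; apply: le_trans (HC _ _ F hp b uF) _.
    by rewrite ler_pdivrMr // mul1r lerDr.
  have SlS l phi : 0 < l -> beur = false -> inSl M A l phi -> S phi.
    by move=> l0 -> h; exists l.
  have Sin : beur = true -> forall l phi, 0 < l -> S phi -> inSl M A l phi by move=> -> l phi l0; apply.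
  have C1 (C : R) : 0 <= C -> 0 < (1 + C)^-1 by move=> C0; rewrite invr_gt0 ltr_pwDl.
  move: series_abs; rewrite /QQ; apply: if_imp1 => be.
    move=> [l [l0 [C C0 HC]]]; exists l, (1 + C)^-1; split; first exact: l0.
    by split=> [|phi hp lt]; [exact: C1|apply: (key l C) => //; exact: Sin].
  move=> H l l0; have [C C0 HC] := H l l0; exists (1 + C)^-1; split; first exact: C1.
  by move=> phi h lt; apply: (key l C) => //; exact: (SlS l).
have [lam [lam0 Hl]] := HB U nU.
have tot phi F : B phi -> uniq F -> \sum_(a <- F) 2 ^+ mabs a * cnorm (ev a phi) <= lam.
  move=> Bp uF; have [_ h] := Hl _ Bp; have := h F uF.
  under eq_bigr => a _ do rewrite (evZ _ _ _ (BS _ Bp)) cnM cnR gtr0_norm ?invr_gt0 // mulrCA.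
  by rewrite -mulr_sumr ler_pdivrMl // mulr1.
have [n hn] := archi_le (lam / r).
exists (mibox d n) => Fs uF sub phi Bp.
apply: (hasSum_tail (cn_nspace R) uF (Hg _ (BS _ Bp))) => F uF2 disj.
have n0 : 0 < 2 ^+ n :> R by rewrite exprn_gt0.
rewrite -(ler_pM2l n0); apply: (@le_trans _ _ lam).
  apply: le_trans (tot _ F Bp uF2); rewrite mulr_sumr !big_seq; apply: ler_sum => a aF.
  apply: ler_wpM2r; first exact: cn_ge0.
  have na : (n < mabs a)%N.
    rewrite ltnNge; apply/negP => le; move/negP: (disj _ aF); apply; apply: sub; exact: mem_mibox.
  by rewrite ler_weXn2l ?ler1n // ltnW.
rewrite -ler_pdivrMr //; apply: (le_trans hn); rewrite -natrX ler_nat; exact/ltnW/ltn_expl.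
Qed.

End Series.

(** * The representation theorem *)

Section Identify.
Variables (R : realType) (d : nat) (beur : bool) (M A : nat -> R).
Hypotheses (wM : weight_seq M) (wA : weight_seq A) (M1 : cond_M1 M) (M2 : cond_M2' M) (A2 : cond_M2' A).
Variables (E : lmodType R[i]) (nE : E -> R) (iota : E -> functional R d).
Hypothesis HT : is_TMIB beur M A nE iota.
Local Notation pt := (pt R d).
Local Notation testfun := (testfun R d).
Implicit Types (phi psi eta theta zeta chi : testfun) (l c : R) (xi : pt) (x y : E) (s : seq 'I_d).
Local Notation S := (GS beur M A).
Local Notation conv := (@Defs.conv R d).
Local Notation bnd := (@bnd R d M A).
Local Notation bnd0 := (@bnd0 R d A).
Local Notation mi := (mindex d).
Local Notation zd := {ffun 'I_d -> int}.
Local Notation HN := (E_nspace HT).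
Hypothesis nz : exists zeta, GS true M A zeta /\ exists x : pt, zeta x != 0.
Hypothesis HG : condG beur M A nE iota.

Lemma conv_Pr L zeta n phi theta : S phi -> S theta -> conv (Pr L zeta n phi) theta = Pr L zeta n (conv phi theta).
Proof.
move=> hp ht; rewrite /Pr (@conv_suml _ _ beur _ _ wM wA M2 A2 _ _ _ (fun z => transl (L *: zpt R z) phi)) //; last first.
  by move=> z; exact: GS_transl.
by apply: funext => x; apply: eq_bigr => z _; rewrite conv_transl.
Qed.

Lemma DD_Pr L zeta n s phi : S phi -> DD s (Pr L zeta n phi) = Pr L zeta n (DD s phi).
Proof.
move=> hp; have sp := GS_smooth wM hp; rewrite /Pr (DD_sum _ _ s (F := fun z => transl (L *: zpt R z) phi)); last first.
  by move=> z; exact: smooth_transl.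
by apply: funext => x; apply: eq_bigr => z _; rewrite DD_transl.
Qed.

Lemma ult_sub f g : ultradist beur M A f -> ultradist beur M A g -> ultradist beur M A (fun phi => f phi - g phi).
Proof.
move=> uf ug; apply: (ult_of_bnd wM) => [a p q Sp Sq|].
  by rewrite (ult_ZD uf) // (ult_ZD ug) // mulrBr opprD addrACA.
have down (T : functional R d) l l' : 0 < l' -> l' <= l -> (exists2 C, 0 <= C & forall phi c, S phi -> bnd l c phi -> cnorm (T phi) <= C * c) ->
   (exists2 C, 0 <= C & forall phi c, S phi -> bnd l' c phi -> cnorm (T phi) <= C * c).
  move=> l0 ll [C C0 HC]; exists C => // phi c hp b; apply: HC => //; exact: (bnd_wl wM wA l0 ll b).
apply: QQ_imp (QQ_and (down f) (down g) (ult_bnd wM uf) (ult_bnd wM ug)) => l l0 [[C C0 HC] [C' C'0 HC']].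
exists (C + C') => [|phi c hp b]; first exact: addr_ge0.
by apply: le_trans (cnB _ _) _; rewrite mulrDl; apply: lerD; [exact: HC|exact: HC'].
Qed.

Section Data.
Variables (L : R) (zeta : testfun) (P : E -> E).
Hypotheses (L1 : 1 <= L) (PD : forall a b, P (a + b) = P a + P b) (PN : forall e, nE (P e) <= 2 * nE e).
Hypothesis Plim : forall e phi (r : R), S phi -> 0 < r -> exists n0, forall n, (n0 <= n)%N ->
    cnorm (iota e (Pr L zeta n phi) - (L ^+ d)%:C * iota (P e) phi) <= r.

Lemma PB a b : P (a - b) = P a - P b.
Proof. by apply/eqP; rewrite eq_sym subr_eq -PD subrK. Qed.

Lemma P_uniq e phi (v : nat -> R[i]) t : S phi -> (forall n, iota e (Pr L zeta n phi) = v n) ->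
  (forall r : R, 0 < r -> exists n0, forall n, (n0 <= n)%N -> cnorm (v n - t) <= r) -> (L ^+ d)%:C * iota (P e) phi = t.
Proof.
move=> hp Hv Ht; apply: (n_arb_eq (cn_nspace R)) => r r0; have r2 : 0 < r / 2 by rewrite divr_gt0.
have [n1 H1] := Plim e hp r2; have [n2 H2] := Ht _ r2.
have k1 := H1 _ (leq_maxl n1 n2); have k2 := H2 _ (leq_maxr n1 n2); rewrite Hv cnBC in k1.
apply: le_trans (cn_tri _ (v (maxn n1 n2)) _) _; rewrite [r]splitr; exact: lerD.
Qed.

(** Lattice sums commute with derivatives and with convolution; P inherits this as their limit. *)
Lemma P_comm x y s theta : S theta -> (forall phi, S phi -> iota y phi = iota x (DD s (conv phi theta))) ->
  forall phi, S phi -> iota (P y) phi = iota (P x) (DD s (conv phi theta)).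
Proof.
move=> ht H phi hp; have hc : S (conv phi theta) by exact: GS_conv.
have hd := GS_DD wM wA M2 s hc.
have Ld : (L ^+ d)%:C != 0.
  apply/negP => /eqP/(congr1 (@cnorm R)); rewrite cnR cn0 => /eqP; apply/negP.
  by rewrite normr_eq0 expf_neq0 // gt_eqF // (lt_le_trans ltr01).
apply: (mulfI Ld); symmetry; apply: (@P_uniq x _ (fun n => iota y (Pr L zeta n phi))) => // [n|r r0].
  by rewrite H ?(conv_Pr _ _ _ hp ht) ?DD_Pr //; exact: GS_Pr.
exact: (Plim y hp r0).
Qed.

End Data.

Lemma hasSum_iota psi (I : eqType) (v : I -> E) w : S psi -> hasSum nE v w ->
  hasSum (@cnorm R) (fun i => iota (v i) psi) (iota w psi).
Proof.
move=> hq; have [K K0 HK] := iota_pt wM wA HT hq.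
apply: (hasSum_map (f := fun x => iota x psi) K0); first exact: (iota_E0 HT hq).
  by move=> a b; exact: (iotaD HT _ _ hq).
by move=> a b; rewrite -(iotaB HT _ _ hq).
Qed.

(** The derivatives move onto theta, where they cost l^|a| M_a; against [nE (e a)] times M_a,
    bounded by C' (2 l)^-|a|, this leaves the summable 2^-|a|. Both implications of the theorem rely
    on it. *)
Lemma conv_series (e : mi -> E) (g : functional R d) theta :
  QQ beur (fun lam => exists2 C, 0 <= C & forall a, nE (e a) * M (mabs a) <= C * lam ^+ mabs a) ->
  (forall phi, S phi -> hasSum (@cnorm R) (fun a => iota (e a) (dmult a phi)) (g phi)) -> S theta ->
  exists z zg, [/\ forall a psi, S psi -> iota (z a) psi = iota (e a) (DD (mseq a) (conv psi theta)),
    hasSum nE z zg & forall psi, S psi -> iota zg psi = g (conv psi theta)].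
Proof.
move=> Qe Hg ht.
have hd a := GS_dmult wM wA M2 a ht.
have [tr Htr Ntr] := tr_ex wM wA HT.
have exz a : exists z : E, eqS beur M A (iota z) (convD (iota (e a)) (check (dmult a theta))).
  by apply: (convE_ex wM wA M2 A2 HT Htr Ntr); apply: GS_check => //; exact: hd.
have /boolp.choice[z Hz] := exz.
have Hz' a psi : S psi -> iota (z a) psi = iota (e a) (DD (mseq a) (conv psi theta)).
  move=> hq; rewrite (Hz a _ hq) /convD checkK dmult_DD.
  by rewrite (@conv_DDr _ _ beur _ _ wM wA M2 A2 _ _ _ hq ht).
have [X X0 HX] : exists2 X, 0 <= X & abs_le nE z X.
  have down1 l l' : 0 < l' -> l' <= l -> (exists2 C, 0 <= C & forall e psi c y, S psi -> bnd0 l c psi ->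
      eqS beur M A (iota y) (convD (iota e) psi) -> nE y <= C * c * nE e) ->
    (exists2 C, 0 <= C & forall e psi c y, S psi -> bnd0 l' c psi ->
      eqS beur M A (iota y) (convD (iota e) psi) -> nE y <= C * c * nE e).
    move=> l0 ll [C C0 HC]; exists C => // x psi c y hq b; apply: HC => //; exact: (bnd0_wl wA l0 ll b).
  have down2 l l' : 0 < l' -> l' <= l -> (exists2 C, 0 <= C & forall a, nE (e a) * M (mabs a) <= C * ((2 * l)^-1) ^+ mabs a) ->
    (exists2 C, 0 <= C & forall a, nE (e a) * M (mabs a) <= C * ((2 * l')^-1) ^+ mabs a).
    move=> l0 ll [C C0 HC]; exists C => // a; apply: le_trans (HC a) _; apply: ler_wpM2l => //.
    have l'0 := lt_le_trans l0 ll.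
    by apply: lerXn2r; rewrite ?nnegrE ?invr_ge0 ?mulr_ge0 ?(ltW l0) ?(ltW l'0) // lef_pV2 ?posrE ?mulr_gt0 // ler_wpM2l.
  have Qz := QQ_and down1 down2 (convE_bnd wM wA M2 A2 HT Htr Ntr) (QQ_inv (ltr0n R 2) Qe).
  have [l l0 [[[C C0 HC] [C' C'0 HC']] [c b]]] := QQ_meet Qz ((GS_QQ beur A wM theta).1 ht).
  have c0 := bnd_ge0 wM l0 b.
  exists (C * c * C' * 2 ^+ d) => [|F uF]; first by rewrite !mulr_ge0 // exprn_ge0.
  apply: (@le_trans _ _ (\sum_(a <- F) C * c * C' * 2^-1 ^+ mabs a)); last first.
    by rewrite -mulr_sumr; apply: ler_wpM2l (mi_sum R uF); rewrite !mulr_ge0.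
  apply: ler_sum => a _.
  have bd : bnd0 l (c * (l ^+ mabs a * M (mabs a))) (check (dmult a theta)).
    by apply: bnd0_check; rewrite dmult_DD -size_mseq; exact: bnd0_DD.
  apply: le_trans (HC _ _ _ _ (GS_check wM wA (hd a)) bd (Hz a)) _.
  rewrite (_ : C * _ * _ = C * c * l ^+ mabs a * (nE (e a) * M (mabs a))); last by ring.
  apply: le_trans (ler_wpM2l _ (HC' a)) _; first by rewrite !mulr_ge0 // exprn_ge0 // ltW.
  rewrite invfM !exprMn !exprVn le_eqVlt; apply/orP; left; apply/eqP.
  have ln : l ^+ mabs a != 0 by rewrite expf_neq0 // gt_eqF.
  have n2 : 2 ^+ mabs a != 0 :> R by rewrite expf_neq0.
  by field; rewrite ln n2.
have [zg [Hzg _]] := hasSum_ex HN HX.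
have iotazg psi : S psi -> iota zg psi = g (conv psi theta).
  move=> hq; have := hasSum_iota hq Hzg => h.
  apply: (hasSum_uniq (cn_nspace R) h); have := Hg _ (GS_conv wM wA M2 A2 hq ht).
  by congr hasSum; apply: funext => a; rewrite Hz' // dmult_DD.
by exists z, zg.
Qed.

Lemma forward f : ultradist beur M A f -> (forall phi, S phi -> exists e : E, eqS beur M A (iota e) (convD f phi)) ->
  exists e : mi -> E, sum_cvgS beur M A (fun a phi => iota (e a) (dmult a phi)) f /\
   QQ beur (fun lam => exists2 C, 0 <= C & forall a, nE (e a) * M (mabs a) <= C * lam ^+ mabs a).
Proof.
move=> uf Hf.
have exT phi : exists e : E, S phi -> eqS beur M A (iota e) (convD f phi).
  by have [hp|nS] := pselect (S phi); [have [e He] := Hf _ hp; exists e|exists 0].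
have /boolp.choice[Tf HTf] := exT.
have [chi1 [chi2 [h1 h2 e12]]] := window_ex wM wA M1 M2 A2 nz.
pose zeta := conv chi1 chi2; have hz : GS true M A zeta by exact: GS_conv.
have hzS := GS_beur beur hz.
have [L [P [Pinv [L1 [PD PN] HPi Pinj Plim]]]] := parametrix wM wA A2 HT hz e12.
have L0 : 0 < L := lt_le_trans ltr01 L1.
have Ld1 : 1 <= L ^+ d by rewrite exprn_ege1.
have Ld0 : 0 < L ^+ d := lt_le_trans ltr01 Ld1.
have [u [Hu Qu]] := coeff_family wM wA M1 M2 A2 HT uf HTf h1 h2 L0.
have [W W0 HW] := @wt_sum R d.
have wt0 (k : zd) : 0 <= wt (zpt R k) by exact/ltW/wt_gt0.
have uabs : QQ beur (fun lam => exists2 C, 0 <= C & forall a F, uniq F -> \sum_(k <- F) nE (u a k) <= C * lam ^+ mabs a / M (mabs a)).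
  apply: QQ_imp Qu => lam lam0 [C C0 HC]; exists (C * W); first by rewrite mulr_ge0.
  move=> a F uF; apply: (@le_trans _ _ (\sum_(k <- F) C * lam ^+ mabs a / M (mabs a) * wt (zpt R k))).
    apply: ler_sum => k _; rewrite -(ler_pM2r (M_gt0 wM (mabs a))); apply: le_trans (HC a k) _.
    rewrite [leRHS](_ : _ = C * wt (zpt R k) * lam ^+ mabs a * (M (mabs a) / M (mabs a))); last by ring.
    by rewrite divff ?mulr1 // gt_eqF // M_gt0.
  rewrite -mulr_sumr (_ : C * W * _ / _ = C * lam ^+ mabs a / M (mabs a) * W); last by ring.
  apply: ler_wpM2l (HW _ uF); rewrite divr_ge0 ?mulr_ge0 ?exprn_ge0 ?(M_ge0 wM) //; exact: ltW.
have [lam1 lam10 [C1 C10 HC1]] := QQ_ex uabs.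
have /boolp.choice[G HGs] : forall a, exists z, hasSum nE (u a) z.
  by move=> a; have [z [hz' _]] := hasSum_ex HN (HC1 a); exists z.
(* With this choice L^d P (e a) is G a, the sum over all frequencies of the coefficients of order
   a. *)
pose e a := Pinv ((L ^+ d)^-1%:C *: G a).
have Pe a : P (e a) = (L ^+ d)^-1%:C *: G a := (HPi _).1.
have Qe : QQ beur (fun lam => exists2 C, 0 <= C & forall a, nE (e a) * M (mabs a) <= C * lam ^+ mabs a).
  apply: QQ_imp uabs => lam lam0 [C C0 HC]; exists (2 * C); first by rewrite mulr_ge0.
  move=> a; rewrite -ler_pdivlMr ?M_gt0 //; apply: le_trans (HPi _).2 _; rewrite -!mulrA; apply: ler_wpM2l => //.
  rewrite (nEZ HT) cnR ger0_norm ?invr_ge0 ?(ltW Ld0) // mulrA.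
  have nG : nE (G a) <= C * lam ^+ mabs a / M (mabs a).
    by apply: (hasSum_norm HN (HGs a)) => F uF; apply: le_trans (n_sum HN _ _ _) (HC a F uF).
  by apply: le_trans nG; rewrite ler_piMl ?(nE_ge0 HT) // invf_le1.
have [g [ug Hg]] := series_ex wM wA M1 M2 A2 HT nz HG Qe.
have claim phi theta : S phi -> S theta -> f (conv phi theta) = g (conv phi theta).
  (* The convolutions of [f] and [g] with [theta] lie in E, as [zf] and [zg]; the injective operator
     [P] identifies them after exchanging the sums over [a] and [k]. *)
  move=> hp ht; have hct := GS_check wM wA ht.
  pose zf := Tf (check theta).
  have Hzf psi : S psi -> iota zf psi = f (conv psi theta).
    by move=> hq; rewrite (HTf _ hct _ hq) /convD checkK.
  have [z [zg [Hz' Hzg iotazg]]] := conv_series Qe Hg ht.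
  have Pz : P zg = P zf.
    apply: (iota_inj HT) => psi hq.
    have hPsi : S (conv psi theta) by exact: GS_conv.
    set Psi := conv psi theta in hPsi *.
    have Qu' : QQ beur (fun lam => exists2 C, 0 <= C & forall k a, nE (u a k) * M (mabs a) <= C * wt (zpt R k) * lam ^+ mabs a).
      by apply: QQ_imp Qu => lam _ [C C0 HC]; exists C.
    have Qf := @family_bnd _ _ _ _ _ wM wA M1 M2 A2 _ _ _ HT nz HG zd (fun k => wt (zpt R k)) (fun k a => u a k) wt0 Qu'.
    pose v (q : mi * zd) := iota (u q.1 q.2) (dmult q.1 Psi).
    have [l l0 [[K K0 HK] [c b]]] := QQ_meet Qf ((GS_QQ beur A wM Psi).1 hPsi).
    have c0 := bnd_ge0 wM l0 b.
    pose xa (a : mi) : R := K * c * 4^-1 ^+ mabs a.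
    have xa0 a : 0 <= xa a by rewrite /xa !mulr_ge0 // exprn_ge0.
    have hv a k : cnorm (v (a, k)) <= xa a * wt (zpt R k) by exact: HK.
    have sx F : uniq F -> \sum_(a <- F) xa a <= K * c * 2 ^+ d.
      move=> uF; rewrite /xa -mulr_sumr; apply: ler_wpM2l; first exact: mulr_ge0.
      apply: le_trans (mi_sum R uF); apply: ler_sum => a _; apply: lerXn2r; rewrite ?nnegrE ?invr_ge0 //.
      by rewrite lef_pV2 ?posrE // ler_nat.
    have ck k : hasSum (@cnorm R) (fun a => v (a, k)) (Gk f L zeta Psi k).
      have [Fk HF] := Hu k => r r0; exists Fk => F uF sub.
      by rewrite (HF _ _ hPsi uF sub) subrr cn0 ltW.
    have ra a : hasSum (@cnorm R) (fun k => v (a, k)) (iota (G a) (dmult a Psi)).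
      exact: (hasSum_iota (GS_dmult wM wA M2 a hPsi) (HGs a)).
    have abG : abs_le (@cnorm R) (Gk f L zeta Psi) (K * c * 2 ^+ d * W).
      move=> F uF; apply: (@le_trans _ _ (\sum_(k <- F) K * c * 2 ^+ d * wt (zpt R k))).
        apply: ler_sum => k _; apply: (hasSum_norm (cn_nspace R) (ck k)) => F' uF'.
        apply: le_trans (cn_sum _ _ _) _; apply: (@le_trans _ _ (\sum_(a <- F') xa a * wt (zpt R k))).
          by apply: ler_sum => a _; exact: hv.
        by rewrite -mulr_suml; apply: ler_wpM2r; [exact: wt0|exact: sx].
      rewrite -mulr_sumr; apply: ler_wpM2l; [by rewrite !mulr_ge0 // exprn_ge0|exact: HW].
    have [t [Ht _]] := hasSum_ex (cn_nspace R) abG.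
    have PzE a : iota (P (z a)) psi = (L ^+ d)^-1%:C * iota (G a) (dmult a Psi).
      rewrite (P_comm L1 Plim ht (Hz' a) hq) Pe (iotaZ HT) -?dmult_DD //; exact: (GS_dmult wM wA M2).
    have hasP : hasSum nE (fun a => P (z a)) (P zg).
      apply: (hasSum_map (f := P) (ler0n R 2)) Hzg => // [|a b'].
        by have := PD 0 0; rewrite addr0 => /eqP; rewrite -subr_eq0 opprD addrA subrr sub0r oppr_eq0 => /eqP.
      by rewrite -(PB PD).
    have hs : hasSum (@cnorm R) (fun a => iota (G a) (dmult a Psi)) ((L ^+ d)%:C * iota (P zg) psi).
      have h := hasSum_iota hq hasP.
      have h3 : hasSum (@cnorm R) (fun a => (L ^+ d)%:C * iota (P (z a)) psi) ((L ^+ d)%:C * iota (P zg) psi).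
        apply: (hasSum_map (f := fun x : R[i] => (L ^+ d)%:C * x) (ltW Ld0)) h => [|a b'|a b'].
        - exact: mulr0.
        - exact: mulrDr.
        - by rewrite -mulrBr cnM cnR gtr0_norm.
      have Ea : (fun a : mi => iota (G a) (dmult a Psi)) = (fun a => (L ^+ d)%:C * iota (P (z a)) psi).
        apply: funext => a; rewrite PzE mulrA -rmorphM /= divff ?mul1r //.
        by rewrite gt_eqF.
      rewrite Ea; exact: h3.
    (* Summed over k first, the double family leads to L^d P zg; summed over a first, it gives f on
       the modulated windows, whose sum is L^d P zf by Poisson summation. *)
    have st := sum_swap (cn_nspace R) hv xa0 wt0 sx HW ra ck hs Ht.
    have Pf : (L ^+ d)%:C * iota (P zf) psi = t.
      apply: (P_uniq Plim hq (v := fun n => f (Pr L zeta n Psi))) => [n|r r0].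
        by rewrite Hzf ?(conv_Pr _ _ _ hq ht) //; exact: GS_Pr.
      exact: (Pr_cvg wM wA M1 M2 A2 uf L0 hzS hPsi abG Ht r0).
    have Ldn : (L ^+ d)%:C != 0.
      apply/negP => /eqP/(congr1 (@cnorm R)); rewrite cnR cn0 => /eqP; apply/negP.
      by rewrite normr_eq0 gt_eqF.
    by apply: (mulfI Ldn); rewrite Pf -st.
  have zz : zg = zf.
    by apply/eqP; rewrite -subr_eq0; apply/eqP; apply: Pinj; rewrite (PB PD) Pz subrr.
  by rewrite -Hzf // -zz iotazg.
(* So far f and g agree on convolutions only; [density] extends this to all of S. *)
have fg phi : S phi -> f phi = g phi.
  move=> hp; apply/eqP; rewrite -subr_eq0; apply/eqP.
  apply: (@density _ _ _ _ wM wA M1 M2 A2 beur (fun phi => f phi - g phi)) => //.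
    exact: ult_sub.
  by move=> p q Sp Sq; rewrite claim // subrr.
exists e; split; last exact: Qe.
by apply: (series_cvg wM wA M1 M2 A2 HT nz HG Qe) => phi hp; rewrite fg //; exact: Hg.
Qed.

Lemma backward f (e : mi -> E) : sum_cvgS beur M A (fun a phi => iota (e a) (dmult a phi)) f ->
  QQ beur (fun lam => exists2 C, 0 <= C & forall a, nE (e a) * M (mabs a) <= C * lam ^+ mabs a) ->
  forall phi, S phi -> exists y : E, eqS beur M A (iota y) (convD f phi).
Proof.
move=> Hf Qe phi hp.
have Hs psi : S psi -> hasSum (@cnorm R) (fun a => iota (e a) (dmult a psi)) (f psi).
  move=> hq r r0; have [F0 HF] := Hf _ (boundedS1 wM wA hq) r r0.
  by exists F0 => F uF sub; exact: HF.
have [z [zg [_ _ H]]] := conv_series Qe Hs (GS_check wM wA hp).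
by exists zg => psi hq; rewrite H.
Qed.

End Identify.

(** The two normalizations correspond through lam = 1 / l; [Num.max 0 C] supplies the sign that the
    second one does not impose. *)
Lemma QQ_coeff (R : realType) (I : Type) (b : bool) (n : I -> nat) (N : I -> R) : (forall i, 0 <= N i) ->
  QQ b (fun lam => exists2 C, 0 <= C & forall i, N i <= C * lam ^+ n i) <->
  if b then exists l C : R, 0 < l /\ forall i, l ^+ n i * N i <= C
  else forall l : R, 0 < l -> exists C : R, forall i, l ^+ n i * N i <= C.
Proof.
move=> N0.
have key l : 0 < l -> (exists2 C, 0 <= C & forall i, N i <= C * l ^+ n i) <-> exists C, forall i, l^-1 ^+ n i * N i <= C.
  move=> l0; have ln i : 0 < l ^+ n i by rewrite exprn_gt0.
  split=> [[C C0 HC]|[C HC]].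
    by exists C => i; rewrite exprVn ler_pdivrMl // mulrC.
  exists (Num.max 0 C) => [|i]; first by rewrite le_max lexx.
  have := HC i; rewrite exprVn ler_pdivrMl // mulrC => h; apply: (le_trans h).
  by apply: ler_wpM2r; [exact: ltW|rewrite le_max lexx orbT].
rewrite /QQ; case: b; split.
- by move=> [l [l0 /(key l l0)[C HC]]]; exists l^-1, C; rewrite invr_gt0.
- move=> [l [C [l0 HC]]]; have li : 0 < l^-1 by rewrite invr_gt0.
  by exists l^-1; split=> //; apply/(key _ li); exists C; rewrite invrK.
- move=> H l l0; have li : 0 < l^-1 by rewrite invr_gt0.
  by have /(key _ li) := H _ li; rewrite invrK.
- move=> H l l0; apply/(key l l0); apply: H; by rewrite invr_gt0.
Qed.

(* beur = true : Beurling case (M),(A);  beur = false : Roumieu case {M},{A}. *)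
Theorem theorem1p1 (R : realType) (d : nat) (beur : bool) (M A : nat -> R)
    (E : lmodType R[i]) (nE : E -> R) (iota : E -> functional R d) :
  weight_seq M -> weight_seq A ->
  cond_M1 M -> cond_M2' M -> cond_M1 A -> cond_M2' A ->
  (exists phi : testfun R d, GS true M A phi /\ exists x, phi x != 0) ->
  is_TMIB beur M A nE iota ->
  condG beur M A nE iota ->
  forall f : functional R d, ultradist beur M A f ->
  ((forall phi : testfun R d, GS beur M A phi ->
      exists e : E, eqS beur M A (iota e) (convD f phi)) <->
   (exists fa : mindex d -> E,
      sum_cvgS beur M A (fun a => dderiv a (iota (fa a))) f /\
      (if beur then exists l C : R, 0 < l /\
           forall a : mindex d, l ^+ mabs a * M (mabs a) * nE (fa a) <= C
       else forall l : R, 0 < l -> exists C : R,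
           forall a : mindex d, l ^+ mabs a * M (mabs a) * nE (fa a) <= C))).
Proof.
move=> wM wA M1 M2 _ A2 nz HT HG f uf.
(* The sign in [dderiv] is absorbed into the vectors by this norm preserving involution. *)
pose sg (fa : mindex d -> E) (a : mindex d) : E := (-1) ^+ mabs a *: fa a.
have nsg (fa : mindex d -> E) a : nE (sg fa a) = nE (fa a) by rewrite (nEZ HT) cnX cnN cn1 expr1n mul1r.
have sgK (fa : mindex d -> E) a : sg (sg fa) a = fa a by rewrite /sg scalerA -exprD addnn -mul2n exprM sqrrN expr1n expr1n scale1r.
have dsg (fa : mindex d -> E) a phi : GS beur M A phi -> dderiv a (iota (fa a)) phi = iota (sg fa a) (dmult a phi).
  by move=> hp; rewrite /dderiv (iotaZ HT) //; exact: GS_dmult.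
have N0 (fa : mindex d -> E) a : 0 <= nE (fa a) * M (mabs a) by rewrite mulr_ge0 ?(nE_ge0 HT) ?(M_ge0 wM).
have rearr (l : R) (fa : mindex d -> E) a : l ^+ mabs a * M (mabs a) * nE (fa a) = l ^+ mabs a * (nE (fa a) * M (mabs a)).
  by rewrite -mulrA [M _ * _]mulrC.
split=> [H|[fa [Hs Hb]]].
  have [e [He Qe]] := forward wM wA M1 M2 A2 HT nz HG uf H.
  exists (sg e); split.
    move=> B hB r r0; have [F0 HF] := He B hB r r0; exists F0 => F uF sub phi Bp.
    apply: le_trans (HF F uF sub phi Bp); rewrite le_eqVlt; apply/orP; left; apply/eqP; congr (cnorm (_ - _)).
    by apply: eq_bigr => a _; rewrite dsg ?sgK //; exact: hB.1.
  move/(QQ_coeff beur (@mabs d) (N0 e)): Qe; apply: if_imp1 => _.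
    by move=> [l [C [l0 HC]]]; exists l, C; split=> // a; rewrite rearr nsg.
  by move=> {}H l l0; have [C HC] := H l l0; exists C => a; rewrite rearr nsg.
apply: (backward wM wA M2 A2 HT (e := sg fa)).
  move=> B hB r r0; have [F0 HF] := Hs B hB r r0; exists F0 => F uF sub phi Bp.
  apply: le_trans (HF F uF sub phi Bp); rewrite le_eqVlt; apply/orP; left; apply/eqP; congr (cnorm (_ - _)).
  by apply: eq_bigr => a _; rewrite dsg //; exact: hB.1.
have Qf : QQ beur (fun lam => exists2 C, 0 <= C & forall a, nE (fa a) * M (mabs a) <= C * lam ^+ mabs a).
  apply/(QQ_coeff beur (@mabs d) (N0 fa)); move: Hb; apply: if_imp1 => _.
    by move=> [l [C [l0 HC]]]; exists l, C; split=> // a; rewrite -rearr.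
  by move=> H l l0; have [C HC] := H l l0; exists C => a; rewrite -rearr.
by apply: QQ_imp Qf => lam _ [C C0 HC]; exists C => // a; rewrite nsg.
Qed.
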